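(* Let $\Gamma$ be a finite index subgroup of $\mathrm{SL}_2(\mathbb{Z})$. Let $F:\Gamma\backslash\mathbb{H}\to\mathbb{C}$ be a bounded measurable function such that, for some fixed $\alpha>0$, $F(\tau z)\ll y^{-\alpha}$ for almost all $z=x+iy$ with $y\ge1$ and all $\tau\in\mathrm{SL}_2(\mathbb{Z})$. Let $\varepsilon>0$ and let $H$ be holomorphic on $\{s\in\mathbb{C}:-\varepsilon<\Re s<1+\varepsilon\}$ with $H(0)=0$, $H(1)=1$ and $H(s)\ll(1+|s|)^{O(1)}$. Then for every $\delta\in(0,\min(\alpha,\varepsilon))$, \[ \int_{\Gamma\backslash\mathbb{H}}F(z)\,\frac{dx\,dy}{y^2}=\int_{(1+\delta)}\bigl(H(s)-H(1-s)\bigr)\,2\xi(2s)\sum_{\tau\in\Gamma\backslash\mathrm{SL}_2(\mathbb{Z})}a_F(0,\cdot;\tau)^\wedge(1-s)\,\frac{ds}{2\pi i}. \]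
   Context: $\mathbb{H}$ is the upper half-plane. $\xi(s)=\pi^{-s/2}\Gamma(s/2)\zeta(s)$ is the completed Riemann zeta function. $\int_{(c)}$ denotes integration over the vertical line $\Re s=c$ upward. For $\tau\in\mathrm{SL}_2(\mathbb{Z})$, the function $z\mapsto F(\tau z)$ is periodic in $x$ with period the width $w$ of the cusp $\tau\infty$ of $\Gamma$, with Fourier expansion $F(\tau z)=\sum_{n\in\frac1w\mathbb{Z}}a_F(n,y;\tau)e^{2\pi i nx}$; $a_F(0,y;\tau)$ is its constant term (which depends only on the coset $\Gamma\tau$), and $a_F(0,\cdot;\tau)^\wedge(1-s)=\int_0^\infty a_F(0,y;\tau)\,y^{s-1}\,\frac{dy}{y}$.
   Formalization: The sum over τ is taken over {±1}Γ\SL₂(ℤ) instead of Γ\SL₂(ℤ); these agree if −1∈Γ, while if −1∉Γ (e.g. Γ=Γ(3), F≥0 with nonzero integral) the literal sum counts each term twice and the identity is off by a factor 2. *)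

(* Defs.v *)
From HB Require Import structures.
From mathcomp Require Import all_boot all_order all_algebra.
From mathcomp Require Import all_classical all_reals all_analysis.
From mathcomp Require Import measurable_realfun complex.

Set Implicit Arguments.
Unset Strict Implicit.
Unset Printing Implicit Defensive.

Import Order.TTheory GRing.Theory Num.Theory.
Import numFieldNormedType.Exports.

Local Open Scope classical_set_scope.
Local Open Scope ring_scope.
Local Open Scope complex_scope.

Section SL2Z.

Record SL2Z := SL2 { sl2_mx :> 'M[int]_2; _ : \det sl2_mx == 1 }.
HB.instance Definition _ := [isSub for sl2_mx].
HB.instance Definition _ := [Choice of SL2Z by <:].

Fact sl2_one_subproof : \det (1 : 'M[int]_2) == 1.
Proof. by rewrite det1. Qed.

Fact sl2_mul_subproof (g h : SL2Z) : \det (val g * val h) == 1.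
Proof. by rewrite det_mulmx (eqP (valP g)) (eqP (valP h)) mulr1. Qed.

Lemma sl2_unitmx (g : SL2Z) : val g \in unitmx.
Proof. by rewrite unitmxE (eqP (valP g)) unitr1. Qed.

Fact sl2_inv_subproof (g : SL2Z) : \det (invmx (val g)) == 1.
Proof. by rewrite det_inv (eqP (valP g)) invr1. Qed.

Fact sl2_opp_subproof (g : SL2Z) : \det (- val g) == 1.
Proof.
by rewrite -scaleN1r detZ (eqP (valP g)) mulr1 sqrrN expr1n.
Qed.

Fact sl2_trans_subproof :
  \det (\matrix_(i < 2, j < 2) ((i <= j)%N)%:R : 'M[int]_2) == 1.
Proof.
rewrite -det_tr det_trig; first by rewrite !big_ord_recl big_ord0 !mxE.
by apply/is_trig_mxP => i j ij; rewrite !mxE leqNgt ij.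
Qed.

Definition sl2_one : SL2Z := SL2 sl2_one_subproof.
Definition sl2_mul (g h : SL2Z) : SL2Z := SL2 (sl2_mul_subproof g h).
Definition sl2_inv (g : SL2Z) : SL2Z := SL2 (sl2_inv_subproof g).

Fact sl2_mulA : associative sl2_mul.
Proof. by move=> f g h; apply/val_inj => /=; rewrite mulrA. Qed.
Fact sl2_mul1 : left_id sl2_one sl2_mul.
Proof. by move=> g; apply/val_inj => /=; rewrite mul1r. Qed.
Fact sl2_1mul : right_id sl2_one sl2_mul.
Proof. by move=> g; apply/val_inj => /=; rewrite mulr1. Qed.
Fact sl2_mulV : left_inverse sl2_one sl2_inv sl2_mul.
Proof. by move=> g; apply/val_inj => /=; apply: mulVmx; exact: sl2_unitmx. Qed.
Fact sl2_Vmul : right_inverse sl2_one sl2_inv sl2_mul.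
Proof. by move=> g; apply/val_inj => /=; apply: mulmxV; exact: sl2_unitmx. Qed.

HB.instance Definition _ :=
  isGroup.Build SL2Z sl2_mulA sl2_mul1 sl2_1mul sl2_mulV sl2_Vmul.

Definition sl2_opp (g : SL2Z) : SL2Z := SL2 (sl2_opp_subproof g).

(* The matrix [[1, 1], [0, 1]]. *)
Definition translation : SL2Z := SL2 sl2_trans_subproof.

End SL2Z.

Section Subgroups.
Variable Gam : groupClosed SL2Z.

Definition finite_index :=
  finite_set (range (fun tau => [set (g * tau)%g | g in [set` Gam]])).

(* Membership in {1, -1} Gam, the group of matrices acting on the upper half-plane
   as elements of Gam do. *)
Definition pm_mem (g : SL2Z) : bool := (g \in Gam) || (sl2_opp g \in Gam).

(* Representatives of Gam \ SL_2(Z), where Gam and SL_2(Z) are seen as groups of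
   transformations of the upper half-plane, i.e. of {1, -1} Gam \ SL_2(Z). This is
   literally Gam \ SL_2(Z) if -1 is in Gam; otherwise each coset {1, -1} Gam tau
   consists of the two cosets Gam tau and Gam (- tau), which must not both be
   counted when integrating over the quotient Gam \ H. *)
Definition coset_transversal (T : seq SL2Z) :=
  [/\ uniq T,
      forall g, exists2 tau, tau \in T & pm_mem (g * tau^-1)%g &
      {in T &, forall s t, pm_mem (s * t^-1)%g -> s = t}].

Definition is_cusp_width (tau : SL2Z) (w : nat) :=
  let period v := (0 < v)%N && pm_mem (tau * translation ^+ v * tau^-1)%g in
  period w /\ forall v, period v -> (w <= v)%N.

Definition cusp_width (tau : SL2Z) : nat := xget 0 (is_cusp_width tau).

End Subgroups.

Notation area R := (@lebesgue_measure R \x @lebesgue_measure R)%E.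

Section Analysis.
Variable R : realType.
Local Notation C := R[i].
Local Notation leb := (@lebesgue_measure R).
Implicit Types (z s u : C) (F f : C -> C).

Definition of_coords (p : R * R) : C := p.1 +i* p.2.

Definition upper_half_plane : set C := [set z | 0 < complex.Im z].

Definition vertical_strip (a b : R) : set C := [set s | a < complex.Re s < b].

Definition mobius (g : SL2Z) z : C :=
  ((g 0 0)%:~R * z + (g 0 1)%:~R) / ((g 1 0)%:~R * z + (g 1 1)%:~R).

Definition holomorphic_on (U : set C) f :=
  forall s, U s -> derivable (f : C^o -> C^o) s 1.

Definition expc z : C :=
  (expR (complex.Re z))%:C * (cos (complex.Im z) +i* sin (complex.Im z)).

(* x ^ u for a positive real x. *)
Definition cpow (x : R) u : C := expc (u * (ln x)%:C).

Definition cintegral d (T : measurableType d) (mu : {measure set T -> \bar R})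
    (D : set T) (f : T -> C) : C :=
  (\int[mu]_(t in D) complex.Re (f t)) +i* (\int[mu]_(t in D) complex.Im (f t)).

(* The integral of f over the vertical line Re s = c, upward. *)
Definition vline_integral (c : R) f : C :=
  'i * cintegral leb setT (fun t => f (c +i* t)).

(* Euler's integral and the Dirichlet series below converge for Re s > 0 and
   Re s > 1 respectively; hence xi s is the completed zeta function for Re s > 1,
   the only region in which it is evaluated. *)
Definition Gammac s : C :=
  cintegral leb `]0, +oo[ (fun t => cpow t (s - 1) * (expR (- t))%:C).

Definition zeta s : C :=
  lim (series (fun n => cpow n.+1%:R (- s) : C^o) @ \oo).

Definition xi s : C := cpow pi (- (s / 2)) * Gammac (s / 2) * zeta s.

(* Measurability of f on the upper half-plane for the Lebesgue sigma-algebra,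
   i.e. the completion of the Borel one for the area. Such an f agrees with a
   Borel function off a null Borel set, and integrals, being defined from suprema
   over Borel simple functions, are the usual Lebesgue ones. *)
Definition lebesgue_measurable_on_H f :=
  forall B : set R, measurable B ->
    completed_algebra_gen (area R)
      (of_coords @^-1` (upper_half_plane `&` [set z | B (complex.Re (f z))])) /\
    completed_algebra_gen (area R)
      (of_coords @^-1` (upper_half_plane `&` [set z | B (complex.Im (f z))])).

Section Quotient.
Variable Gam : groupClosed SL2Z.

Definition invariant_on_H F :=
  forall g z, g \in Gam -> upper_half_plane z -> F (mobius g z) = F z.

Definition fundamental_domain (D : set C) :=
  [/\ D `<=` upper_half_plane,
      measurable (of_coords @^-1` D),
      {ae area R, forall p, upper_half_plane (of_coords p) ->
        exists2 g, g \in Gam & D (mobius g (of_coords p))} &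
      forall g, g \in Gam -> g != 1%g -> g != sl2_opp 1%g ->
        (area R).-negligible (of_coords @^-1` (D `&` mobius g @^-1` D))].

(* The integral of F against dx dy / y ^ 2; with D a fundamental domain and F
   invariant, this is the integral over the quotient. *)
Definition hyperbolic_integral (D : set C) F : C :=
  cintegral (area R) (of_coords @^-1` D)
    (fun p => F (of_coords p) * ((p.2 ^+ 2)^-1)%:C).

(* a_F(n, y; tau), for n in (1 / w) Z. *)
Definition fourier_coef F (tau : SL2Z) (n y : R) : C :=
  let w : R := (cusp_width Gam tau)%:R in
  (w^-1)%:C * cintegral leb `[0, w]
    (fun x => F (mobius tau (x +i* y)) * expc (0 +i* (- (2 * pi * n * x)))).

End Quotient.

(* The normalization is such that mellin_hat f (1 - s) is the integral of
   f(y) y ^ (s - 1) dy / y. *)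
Definition mellin_hat (f : R -> C) u : C :=
  cintegral leb `]0, +oo[ (fun y => f y * cpow y (- u) * (y^-1)%:C).

End Analysis.

Arguments upper_half_plane {R}.

(* Main.v *)
(* The theta function [theta z t], the sum of exp (- pi t |m z + n| ^ 2 / Im z) over
   all integers m and n, satisfies [theta z (1 / t) = t * theta z t]; this is Poisson
   summation, obtained here as a limit of the binomial theorem (Polya). The integral
   U(t) of F (theta - 1) over Gam \ H unfolds: the nonzero vectors (m, n) are the
   multiples of bottom rows of matrices in SL_2(Z), so that U is a multiplicative
   convolution of the Jacobi theta series with the sum of the constant terms of F at
   the cusps, and its Mellin transform on Re s = 1 + delta is 2 xi(2s) times the sum of
   their transforms. With M the integral of F and q(x) = U(exp x), the functional
   equation of theta reads q(-x) = exp(x) q(x) + M (exp(x) - 1). Since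
   Phi(s) = H(s) - H(1 - s) is odd about 1/2, its inverse Mellin transform p, which does
   not depend on the line of integration, satisfies p(-x) = - exp(-x) p(x). Hence
   p(x) q(x) + p(-x) q(-x) = - M (p(x) + p(-x)), and the integral of p q, which is
   the right-hand side, equals - M times the integral of p, that is - M Phi(0) = M.
   This needs Phi to decay: H is first multiplied by a factor that is 1 at 0 and 1 and
   tends to 1. As F is only defined up to null sets, it is first replaced by a
   Borel function, invariant everywhere, that vanishes on an invariant null set. *)

Require Import Defs.
From HB Require Import structures.
From mathcomp Require Import all_boot all_order all_algebra.
From mathcomp Require Import all_classical all_reals all_analysis.
From mathcomp Require Import complex measurable_realfun.
From mathcomp Require Import ring lra zify.

Set Implicit Arguments.
Unset Strict Implicit.
Unset Printing Implicit Defensive.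

Import Order.TTheory GRing.Theory Num.Theory.
Import numFieldNormedType.Exports.

Local Open Scope classical_set_scope.
Local Open Scope ring_scope.
Local Open Scope complex_scope.


(** * Change of variables and null sets *)

(** The obstacle is that no integrability is available at the outset: neither of [F] against the
    theta series nor even of [F] on the fundamental domain, whose shape is arbitrary. The positive
    parts of Re F, - Re F, Im F and - Im F are therefore treated separately, so that unfolding takes
    place among sums and integrals of nonnegative extended reals; that the mass M is finite then
    comes out of the functional equation of theta at t = 2. For the same reason Poisson summation is
    put in a form with 1 + cos in place of cos. Unfolding runs over the whole of SL_2(Z): a
    normalised window, whose integer translates sum to 1, stands for the quotient by translations,
    and its width is a common multiple of the cusp widths, so that it produces the constant terms at
    all cusps at once. As -1 acts trivially, an orbit meets the fundamental domain for two matrices,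
    a factor that cancels the 2 carried by the Jacobi theta series. The damping factor is raised to
    a power exceeding the growth of H; its removal rests on the decay of xi along vertical lines,
    obtained from Gamma(s + 1) = s Gamma(s). *)

Section IntegralOffNull.
Local Open Scope ereal_scope.
Context d (T : measurableType d) (R : realType) (mu : {measure set T -> \bar R}).
Import HBNNSimple.

Let integral_le_off_null (f g : T -> \bar R) (N : set T) :
  measurable N -> mu N = 0 -> (forall x, 0 <= g x) ->
  (forall x, ~ N x -> f x <= g x) ->
  (forall x, 0 <= f x) ->
  \int[mu]_x f x <= \int[mu]_x g x.
Proof.
move=> mN N0 g0 fg f0; rewrite !ge0_integralTE//.
apply: ge_ereal_sup => _ [h /= hf <-].
have -> : sintegral mu h = sintegral mu (proj_nnsfun h (measurableC mN)).
  rewrite -!integralT_nnsfun.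
  apply: ge0_ae_eq_integral => //.
  - exact/measurable_EFinP/measurable_funP.
  - exact/measurable_EFinP/measurable_funP.
  - by move=> x _; rewrite lee_fin.
  - by move=> x _; rewrite lee_fin.
  exists N; split=> // x /= => /not_implyP[_] hx.
  apply: contrapT => Nx; apply: hx.
  by rewrite /= mindicE mem_set// mulr1.
apply: ereal_sup_ubound; exists (proj_nnsfun h (measurableC mN)) => //= x.
have [Nx|Nx] := pselect (N x).
  by rewrite mindicE memNset ?mulr0//=; apply.
by rewrite mindicE mem_set// mulr1 (le_trans (hf x))// fg.
Qed.

(* No measurability of f and g is required: the integral is a supremum over
   simple functions, which can be truncated off N. *)
Lemma eq_integral_off_null (D N : set T) (f g : T -> \bar R) :
  measurable N -> mu N = 0 -> (forall x, D x -> ~ N x -> f x = g x) ->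
  \int[mu]_(x in D) f x = \int[mu]_(x in D) g x.
Proof.
move=> mN N0 fg.
have E x : ~ N x -> (f \_ D) x = (g \_ D) x.
  by move=> Nx; rewrite !patchE; case: ifPn => // /set_mem Dx; exact: fg.
rewrite [LHS]integral_mkcond [RHS]integral_mkcond integralE [RHS]integralE.
congr (_ - _); apply/eqP; rewrite eq_le; apply/andP; split.
all: apply: (integral_le_off_null mN N0) => x //.
all: by move=> Nx; rewrite ?funeposE ?funenegE E.
Qed.

End IntegralOffNull.

Section ChangeOfVariables.
Context (R : realType).
Local Notation leb := (@lebesgue_measure R).

Section weighted.
Variables (w : R -> R) (phi : R -> R).
Hypotheses (w0 : forall x, 0 <= w x) (mw : measurable_fun setT w)
  (mphi : measurable_fun setT phi).

(** The image under [phi] of the measure with density [w]. The phantom arguments carry the three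
    hypotheses in the term, so that the measure structure declared below can be found by
    inference. *)
Definition weighted_pushforward of phantom _ mw & phantom _ mphi &
    phantom _ w0 := fun A : set (measurableTypeR R) =>
  (\int[leb]_x (w x * \1_A (phi x))%:E)%E.
Local Notation wpf := (weighted_pushforward (Phantom _ mw) (Phantom _ mphi) (Phantom _ w0)).

Let mwA (A : set R) : measurable A ->
  measurable_fun setT (fun x => (w x * \1_A (phi x))%:E).
Proof.
move=> mA; apply/measurable_EFinP; apply: measurable_funM => //.
apply: measurableT_comp => //.
Qed.

Let wA0 (A : set R) x : (0 <= (w x * \1_A (phi x))%:E)%E.
Proof. by rewrite lee_fin mulr_ge0. Qed.

Let wpf0 : wpf set0 = 0%E.
Proof.
rewrite /weighted_pushforward integral0_eq// => x _.
by rewrite indic0 mulr0.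
Qed.

Let wpf_ge0 A : (0 <= wpf A)%E.
Proof. exact: integral_ge0. Qed.

Let wpf_sigma_additive : semi_sigma_additive wpf.
Proof.
move=> F mF tF mUF; rewrite /weighted_pushforward.
rewrite [X in _ --> X](_ : _ =
    (\sum_(n <oo) \int[leb]_x (w x * \1_(F n) (phi x))%:E)%E); last first.
  rewrite -integral_nneseries//; last by move=> n; exact: mwA (mF n).
  apply: eq_integral => x _; rewrite EFinM indic_bigcup//.
  by rewrite -nneseriesZl.
apply: is_cvg_nneseries => n _ _.
exact: integral_ge0.
Qed.

HB.instance Definition _ := isMeasure.Build _ _ _ wpf wpf0 wpf_ge0 wpf_sigma_additive.

Import HBNNSimple.
(** Lebesgue measure is determined by its values on the intervals ]a, b], so the hypothesis
    identifies it with the image measure; the formula then passes from indicators to simple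
    functions and, by monotone convergence, to [f]. *)
Lemma ge0_integral_change :
  (forall a b, a <= b ->
    (\int[leb]_x (w x * \1_`]a, b] (phi x))%:E = (b - a)%:E)%E) ->
  forall f : R -> \bar R, measurable_fun setT f -> (forall x, (0 <= f x)%E) ->
  (\int[leb]_x ((w x)%:E * f (phi x)) = \int[leb]_y f y)%E.
Proof.
move=> H f mf f0.
have wE (A : set R) : measurable A -> wpf A = leb A.
  move=> mA; apply/esym/lebesgue_measure_unique => // _ [[a b] /= ab <-].
  rewrite lebesgue_measure_itv/= lte_fin /weighted_pushforward.
  have [lab|ba] := ltP a b; first by rewrite H ?ltW.
  by rewrite set_itv_ge ?bnd_simp -?leNgt.
pose f_ := @nnsfun_approx _ (measurableTypeR R) R setT measurableT f mf.
have cvf x : (f_ n x)%:E @[n --> \oo] --> f x by exact: cvg_nnsfun_approx.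
have ndf x : {homo (fun n => (f_ n x)%:E) : m n / (m <= n)%N >-> (m <= n)%E}.
  by move=> m n mn; rewrite lee_fin; exact/lefP/nd_nnsfun_approx.
have mfn n : measurable_fun setT (f_ n : measurableTypeR R -> R).
  exact: measurable_funP.
have mf_ n : measurable_fun setT (fun x => (f_ n (phi x))%:E).
  by apply/measurable_EFinP; exact: (measurableT_comp (mfn n) mphi).
have mf0 n : measurable_fun setT (fun x => (f_ n x)%:E).
  by apply/measurable_EFinP; exact: mfn.
have mwE : measurable_fun setT (EFin \o w) by apply/measurable_EFinP; exact: mw.
transitivity (limn (fun n => \int[leb]_x ((w x)%:E * (f_ n (phi x))%:E)))%E.
  rewrite -monotone_convergence//.
  - apply: eq_integral => x _; apply/esym/cvg_lim => //.
    exact: cvgeZl.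
  - by move=> n; exact: (emeasurable_funM mwE (mf_ n)).
  - by move=> n x _; rewrite mule_ge0// lee_fin.
  - by move=> x _ m n mn; rewrite lee_wpmul2l ?lee_fin//; exact: ndf.
transitivity (limn (fun n => \int[leb]_x ((f_ n x)%:E)))%E; last first.
  rewrite -monotone_convergence//.
    by apply: eq_integral => x _; exact/cvg_lim.
  by move=> n x _; rewrite lee_fin.
congr (limn _); apply/funext => n.
transitivity (\sum_(k \in range (f_ n))
    \int[leb]_x (k%:E * (w x * \1_(f_ n @^-1` [set k]) (phi x))%:E))%E.
  have mk (k : R) : measurable_fun setT
      (fun x => k%:E * (w x * \1_(f_ n @^-1` [set k]) (phi x))%:E)%E.
    apply: emeasurable_funM; first exact: measurable_cst.
    by apply: mwA; exact: (measurable_funPTI (f_ n)).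
  rewrite -ge0_integral_fsum//; last first.
    move=> k x _; rewrite -EFinM mulrCA lee_fin mulr_ge0//.
    by have := nnfun_muleindic_ge0 (f_ n) k (phi x); rewrite -EFinM lee_fin.
  apply: eq_integral => x _; rewrite {1}fimfunE.
  rewrite -fsumEFin// ge0_mule_fsumr//; last first.
    by move=> k; exact: (nnfun_muleindic_ge0 (f_ n) k (phi x)).
  by apply: eq_fsbigr => k _; rewrite -!EFinM mulrCA.
transitivity (\sum_(k \in range (f_ n)) k%:E * leb (f_ n @^-1` [set k]))%E.
  apply: eq_fsbigr => k /set_mem[x _ <-].
  have mfx : measurable (f_ n @^-1` [set f_ n x]) by exact: (measurable_funPTI (f_ n)).
  rewrite ge0_integralZl_EFin ?lee_fin//; last exact: mwA.
  by congr (_ * _)%E; rewrite -(wE _ mfx).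
transitivity (sintegral leb (f_ n)); first by rewrite sintegralE.
by rewrite -(integralT_nnsfun leb (f_ n)).
Qed.

End weighted.

Let integral_ocitv (f : R -> R) (a b : R) : a <= b ->
  (forall x, f x = \1_`]a, b] x) -> (\int[leb]_x (f x)%:E = (b - a)%:E)%E.
Proof.
move=> ab fE; under eq_integral do rewrite fE.
rewrite integral_indic// setIT.
transitivity (lebesgue_measure `]a, b]%classic) => //.
rewrite lebesgue_measure_itv/= lte_fin; case: ltP => // ba.
by rewrite (@le_anti _ _ a b) ?ab// subrr.
Qed.

Lemma ge0_integral_shift (r : R) (f : R -> \bar R) : measurable_fun setT f ->
  (forall x, (0 <= f x)%E) ->
  (\int[leb]_x f (x + r)%R = \int[leb]_x f x)%E.
Proof.
move=> mf f0.
rewrite -[RHS](@ge0_integral_change (cst 1) (fun x => x + r)) //=.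
- by apply: eq_integral => x _; rewrite mul1e.
- exact: measurable_funD.
- move=> a b ab; rewrite (@integral_ocitv _ (a - r) (b - r)) ?lerB//.
    by congr EFin; ring.
  move=> x; rewrite mul1r !indicE; congr (_ %:R); congr nat_of_bool.
  by rewrite !mem_setE !in_itv/= ltrBlDr lerBrDr.
Qed.

Lemma ge0_integral_opp (f : R -> \bar R) : measurable_fun setT f ->
  (forall x, (0 <= f x)%E) ->
  (\int[leb]_x f (- x)%R = \int[leb]_x f x)%E.
Proof.
move=> mf f0.
rewrite -[RHS](@ge0_integral_change (cst 1) -%R) //=.
- by apply: eq_integral => x _; rewrite mul1e.
- move=> a b ab.
  rewrite -[RHS](_ : (- a - - b)%:E = _); last by congr EFin; ring.
  rewrite -(@integral_ocitv (\1_`]- b, - a]) (- b) (- a)) ?lerN2//.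
  (* The preimage of ]a, b] is [-b, -a[, which differs from ]-b, -a] at its two ends. *)
  apply: (@eq_integral_off_null _ _ R leb setT [set - a; - b]).
  - exact: measurableU.
  - by apply: countable_lebesgue_measure0; exact: finite_set_countable.
  move=> x _ /= /not_orP[xa xb]; rewrite mul1r !indicE; congr ((nat_of_bool _) %:R)%:E.
  apply/idP/idP => /set_mem /=; rewrite !in_itv/= => /andP[h1 h2]; apply/mem_set.
  - rewrite /= in_itv/= ltrNl lt_neqAle h2 andbT lerNr (ltW h1) andbT.
    by apply/eqP => h; apply: xb; rewrite -h opprK.
  - rewrite /= in_itv/= ltrNr lt_neqAle h2 andbT lerNl (ltW h1) andbT.
    by apply/eqP.
Qed.

Lemma ge0_integral_scale (r : R) (f : R -> \bar R) : 0 < r ->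
  measurable_fun setT f -> (forall x, (0 <= f x)%E) ->
  (\int[leb]_x (r%:E * f (r * x)%R) = \int[leb]_x f x)%E.
Proof.
move=> r0 mf f0.
rewrite -[RHS](@ge0_integral_change (cst r) (fun x => r * x)) //=.
- by move=> _; exact: ltW.
- exact: measurable_funM.
- move=> a b ab.
  transitivity (\int[leb]_x (r%:E * (\1_`]a / r, b / r] x)%:E))%E.
    apply: eq_integral => x _; rewrite -EFinM; congr (_ * _)%:E.
    rewrite !indicE; congr (_ %:R); congr nat_of_bool.
    by rewrite !mem_setE !in_itv/= ltr_pdivrMr ?ler_pdivlMr// ![_ * r]mulrC.
  rewrite ge0_integralZl_EFin ?ltW//; last exact/measurable_EFinP.
  rewrite (@integral_ocitv _ (a / r) (b / r)) ?ler_pM2r ?invr_gt0//.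
  by rewrite -EFinM; congr EFin; field; rewrite gt_eqF.
Qed.

(** The density is 1 / x on the positive half-line and the map is [ln]: the integral of 1 / x from
    exp a to exp b is b - a. *)
Lemma ge0_integral_expR (f : R -> \bar R) :
  measurable_fun setT f -> (forall x, (0 <= f x)%E) ->
  (\int[leb]_(x in `]0%R, +oo[) ((x^-1)%:E * f (ln x)) = \int[leb]_x f x)%E.
Proof.
move=> mf f0; rewrite integral_mkcond/=.
pose w (x : R) : R := if 0 < x then x^-1 else 0.
have w0 x : 0 <= w x by rewrite /w; case: ltP => // x0; rewrite invr_ge0 ltW.
have mw : measurable_fun setT w.
  rewrite (_ : w = (@GRing.inv R) \_ `]0, +oo[); last first.
    apply/funext => x; rewrite patchE /w; case: ifPn => x0.
      by rewrite mem_set//= in_itv/= x0.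
    by rewrite memNset//= in_itv/= andbT; exact/negP.
  apply/(measurable_restrictT _ _).1 => //.
  apply: open_continuous_measurable_fun; first exact: interval_open.
  move=> x /set_mem /=; rewrite in_itv/= andbT => x0.
  by apply: inv_continuous; rewrite gt_eqF.
rewrite -[RHS](@ge0_integral_change w (@ln R)) //=.
  apply: eq_integral => x _; rewrite patchE /w; case: ifPn => x0.
    by move: x0 => /set_mem; rewrite /= in_itv/= andbT => ->.
  case: ltP => [x1|]; last by rewrite mul0e.
  by rewrite notin_setE /= in_itv/= andbT x1 in x0.
move=> a b; rewrite le_eqVlt => /predU1P[->|ab].
  rewrite subrr integral0_eq// => x _.
  by rewrite set_itv_ge ?indic0 ?mulr0// bnd_simp ltxx.
have E : expR a < expR b by rewrite ltr_expR.
transitivity (\int[leb]_(x in `[expR a, expR b]) (x^-1)%:E)%E; last first.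
  rewrite (continuous_FTC2 (F := @ln R))//.
  - by rewrite !expRK.
  - apply: continuous_in_subspaceT => x /set_mem; rewrite /= in_itv/= => /andP[ax xb].
    by apply: inv_continuous; rewrite gt_eqF// (lt_le_trans _ ax)// expR_gt0.
  - split.
    + move=> x; rewrite in_itv/= => /andP[ax xb].
      by apply: ex_derive; apply: is_derive1_ln; rewrite (lt_trans _ ax)// expR_gt0.
    + by apply: cvg_at_right_filter; apply: continuous_ln; rewrite expR_gt0.
    + by apply: cvg_at_left_filter; apply: continuous_ln; rewrite expR_gt0.
  - move=> x; rewrite in_itv/= => /andP[ax xb].
    rewrite derive1E; apply: derive_val; apply: is_derive1_ln.
    by rewrite (lt_trans _ ax)// expR_gt0.
rewrite [RHS]integral_mkcond.
apply: (@eq_integral_off_null _ _ R leb setT [set expR a]) => //.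
  exact: lebesgue_measure_set1.
move=> x _ /= xa; rewrite patchE /w indicE.
case: (ltP 0 x) => x0; last first.
  rewrite mul0r memNset// => /=; rewrite in_itv/= => /andP[h _].
  by have := lt_le_trans (expR_gt0 a) (le_trans h x0); rewrite ltxx.
rewrite !mem_setE !in_itv/= -ltr_expR -ler_expR lnK//.
have -> : (expR a < x) = (expR a <= x).
  by rewrite lt_neqAle; case: eqVneq => // h; case: xa.
by case: ifP => _; rewrite ?mulr1 ?mulr0.
Qed.

End ChangeOfVariables.

(** * Poisson summation and the two-dimensional theta function *)

Section ThetaFunction.
Context (R : realType).
Implicit Types (x y a phi theta : R).

Lemma cosD_2pi_int (z : int) x : cos (x + 2 * pi * z%:~R) = cos x :> R.
Proof.
have P (n : nat) t : cos (t + 2 * pi * n%:R) = cos t :> R.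
  rewrite -(periodicn (@cosD2pi R) n t); congr cos; congr (_ + _).
  by rewrite -[RHS]mulr_natr -[pi *+ 2]mulr_natr; ring.
case: z => n; first by rewrite -pmulrn P.
rewrite -[LHS](P n.+1); congr cos.
by rewrite NegzE mulrNz -pmulrn; ring.
Qed.

Lemma sum_binS (f : nat -> R) n :
  \sum_(k < n.+2) 'C(n.+1, k)%:R * f k =
  \sum_(k < n.+1) 'C(n, k)%:R * f k + \sum_(k < n.+1) 'C(n, k)%:R * f k.+1.
Proof.
rewrite big_ord_recl bin0 /=.
under eq_bigr do rewrite /bump /= add1n binS natrD mulrDl.
rewrite big_split/= addrA; congr (_ + _).
rewrite [in RHS]big_ord_recl bin0; congr (_ + _).
rewrite big_ord_recr /= bin_small // mul0r addr0.
by apply: eq_bigr => i _; rewrite /bump /= add1n.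
Qed.

(** The real part of exp (i phi) (exp (i theta) + exp (- i theta)) ^ n, expanded by the binomial
    theorem. The free phase [phi] is what the induction shifts by theta in either direction. *)
Lemma sum_bin_cos n theta phi :
  \sum_(k < n.+1) 'C(n, k)%:R * cos ((2 * k%:R - n%:R) * theta + phi) =
  2 ^+ n * cos theta ^+ n * cos phi.
Proof.
elim: n phi => [|n IH] phi.
  by rewrite big_ord1 bin0 mulr0 subrr mul0r add0r !expr0 !mul1r.
rewrite (sum_binS (fun k => cos ((2 * k%:R - n.+1%:R) * theta + phi))).
have E0 k : (2 * k%:R - n.+1%:R) * theta + phi = (2 * k%:R - n%:R) * theta + (phi - theta) :> R.
  by rewrite -natr1; ring.
have E1 k : (2 * k.+1%:R - n.+1%:R) * theta + phi = (2 * k%:R - n%:R) * theta + (phi + theta) :> R.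
  by rewrite -!natr1; ring.
under eq_bigr do rewrite E0.
under [X in _ + X]eq_bigr do rewrite E1.
by rewrite !IH cosB [cos (phi + theta)]cosD !exprS; ring.
Qed.

(** Orthogonality of the characters of Z / L. Off the multiples of L, multiplication by 2 sin h
    makes the sum telescope, where 2 h is the increment of the angle. *)
Lemma sum_cos_roots (L r : nat) phi : (0 < L)%N ->
  \sum_(i < L) cos (phi + 2 * pi * r%:R * i%:R / L%:R) =
  if (L %| r)%N then L%:R * cos phi else 0.
Proof.
move=> L0; have L0' : L%:R != 0 :> R by rewrite pnatr_eq0 -lt0n.
pose h : R := pi * (r %% L)%:R / L%:R.
have E (i : 'I_L) : cos (phi + 2 * pi * r%:R * i%:R / L%:R) = cos (phi + 2 * h * i%:R).
  rewrite {1}(divn_eq r L) -[RHS](cosD_2pi_int (r %/ L * i)%:Z) -pmulrn.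
  by congr cos; rewrite natrD !natrM /h; field.
under eq_bigr do rewrite E.
case: ifPn => [Lr|nLr].
  rewrite /h (eqP Lr) mulr0 mul0r mulr0.
  under eq_bigr do rewrite mul0r addr0.
  by rewrite sumr_const card_ord -[LHS]mulr_natl.
have sh : 2 * sin h != 0.
  rewrite mulf_neq0 ?pnatr_eq0// gt_eqF// sin_gt0_pi// /h.
  rewrite divr_gt0 ?mulr_gt0 ?pi_gt0 ?ltr0n//=; last by rewrite lt0n.
  by rewrite ltr_pdivrMr ?ltr0n// ltr_pM2l ?pi_gt0// ltr_nat ltn_mod.
apply: (mulfI sh); rewrite mulr0 mulr_sumr.
pose f i := sin (phi + 2 * h * i%:R - h).
rewrite (eq_bigr (fun i : 'I_L => f i.+1 - f i)); last first.
  move=> i _; rewrite /f (_ : phi + 2 * h * i.+1%:R - h = phi + 2 * h * i%:R + h).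
    by rewrite sinD sinB; ring.
  by rewrite -natr1; ring.
rewrite -(big_mkord xpredT (fun i => f i.+1 - f i)) telescope_sumr//.
rewrite /f mulr0 addr0 (_ : _ - h = phi - h + 2 * pi * (r %% L)%:Z%:~R); last first.
  by rewrite -pmulrn /h; field.
rewrite -(cosBpihalf (phi - h + _)) -(cosBpihalf (phi - h)) addrAC cosD_2pi_int subrr//.
Qed.

(** Extending the left-hand sum by zero terms up to N L allows it to be cut into blocks of length L,
    each of which contains a single multiple of L, at its end. *)
Lemma sum_multiples (f : nat -> R) (L N : nat) : (0 < L)%N ->
  (forall j, (N < j)%N -> f j = 0) ->
  \sum_(r < N) (if (L %| r.+1)%N then f r.+1 else 0) = \sum_(n < N) f (n.+1 * L)%N.
Proof.
move=> L0 fN.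
pose g r := if (L %| r.+1)%N then f r.+1 else 0.
have -> : \sum_(n < N) f (n.+1 * L)%N = \sum_(r < N * L) g r.
  elim: {fN} N => [|N IH]; first by rewrite mul0n !big_ord0.
  rewrite big_ord_recr/= IH mulSnr big_split_ord/=; congr (_ + _).
  case: L L0 @g {IH} => // L _ g.
  rewrite big_ord_recr/= big1 ?add0r.
    by rewrite /g -addnS -mulSnr dvdn_mull.
  move=> i _; rewrite /g -addnS dvdn_addr ?dvdn_mull// gtnNdvd//.
  by rewrite ltnS ltn_ord.
rewrite -(big_mkord xpredT g) -(big_mkord xpredT (fun r => if (L %| r.+1)%N then f r.+1 else 0)).
rewrite [RHS](@big_cat_nat _ _ _ N)//=; last by rewrite leq_pmulr.
rewrite [X in _ + X]big_nat_cond [X in _ + X]big1 ?addr0// => i /andP[/andP[Ni _] _].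
by rewrite /g fN ?if_same.
Qed.

(* The binomial expansion of [cos ^+ 2N] sampled at L equally spaced points: the
   finite form of Poisson summation from which the theta identity arises as
   L goes to infinity with [N / L ^ 2] fixed (Polya). *)
Lemma polya_identity (L N : nat) y : (0 < L)%N ->
  \sum_(i < L) cos (pi * (y + i%:R) / L%:R) ^+ N.*2 =
  L%:R * 'C(N.*2, N)%:R / 4 ^+ N *
  (1 + 2 * \sum_(n < N) 'C(N.*2, N + n.+1 * L)%:R / 'C(N.*2, N)%:R *
     cos (2 * pi * n.+1%:R * y)).
Proof.
move=> L0; have L0' : L%:R != 0 :> R by rewrite pnatr_eq0 -lt0n.
have C0 : 'C(N.*2, N)%:R != 0 :> R by rewrite pnatr_eq0 -lt0n bin_gt0 -addnn leq_addr.
have p4 : 4 ^+ N != 0 :> R by rewrite expf_neq0.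
(* The terms of index N - r and N + r are paired around the central coefficient. *)
have sym theta : 4 ^+ N * cos theta ^+ N.*2 =
    'C(N.*2, N)%:R + 2 * \sum_(r < N) 'C(N.*2, N + r.+1)%:R * cos (2 * r.+1%:R * theta).
  have := sum_bin_cos N.*2 theta 0; rewrite cos0 mulr1.
  rewrite (_ : 2 ^+ N.*2 = 4 ^+ N); last by rewrite -mul2n exprM -natrX.
  move=> <-; rewrite -(big_mkord xpredT (fun k => 'C(N.*2, k)%:R *
    cos ((2 * k%:R - N.*2%:R) * theta + 0))).
  rewrite -addnn -addnS big_mkord big_split_ord/=.
  rewrite (reindex_inj rev_ord_inj)/= big_ord_recl/= addn0.
  rewrite (_ : (2 * N%:R - (N + N)%:R) * theta + 0 = 0); last by rewrite natrD; ring.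
  rewrite cos0 mulr1 addrCA; congr (_ + _).
  rewrite -big_split/= mulr_sumr; apply: eq_bigr => i _.
  rewrite /bump /= add1n.
  have iN : (i.+1 <= N)%N by [].
  rewrite (_ : 'C(N + N, N - i.+1) = 'C(N + N, N + i.+1)); last first.
    rewrite -bin_sub; first by congr 'C(_, _); lia.
    by lia.
  rewrite -mulrDr mulrCA; congr (_ * _).
  rewrite natrB// !natrD !addr0.
  rewrite (_ : (2 * (N%:R - i.+1%:R) - (N%:R + N%:R)) * theta = - (2 * i.+1%:R * theta)); last by ring.
  rewrite cosN (_ : (2 * (N%:R + i.+1%:R) - (N%:R + N%:R)) * theta = (2 * i.+1%:R * theta)); last by ring.
  by ring.
apply: (mulfI p4); rewrite mulr_sumr.
under eq_bigr do rewrite sym.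
rewrite big_split/= sumr_const card_ord -mulr_sumr exchange_big/=.
have F0 (r i : nat) : 2 * r.+1%:R * (pi * (y + i%:R) / L%:R) =
     2 * pi * r.+1%:R * y / L%:R + 2 * pi * r.+1%:R * i%:R / L%:R by field.
have F1 (r : nat) : \sum_(i < L) 'C(N.*2, N + r.+1)%:R *
     cos (2 * r.+1%:R * (pi * (y + i%:R) / L%:R)) = if (L %| r.+1)%N then
    'C(N.*2, N + r.+1)%:R * (L%:R * cos (2 * pi * r.+1%:R * y / L%:R)) else 0.
  rewrite -mulr_sumr; under eq_bigr do rewrite F0.
  by rewrite sum_cos_roots//; case: ifP => _ //; rewrite mulr0.
under eq_bigr do rewrite F1.
rewrite (sum_multiples (f := fun r =>
  'C(N.*2, N + r)%:R * (L%:R * cos (2 * pi * r%:R * y / L%:R))))//; last first.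
  by move=> j Nj; rewrite bin_small ?mul0r// -addnn ltn_add2l.
rewrite -[_ *+ L]mulr_natl.
set S := (X in 1 + 2 * X).
have -> : \sum_(n < N) 'C(N.*2, N + n.+1 * L)%:R *
   (L%:R * cos (2 * pi * (n.+1 * L)%:R * y / L%:R)) = L%:R * 'C(N.*2, N)%:R * S.
  rewrite /S mulr_sumr; apply: eq_bigr => n _.
  rewrite (_ : 2 * pi * (n.+1 * L)%:R * y / L%:R = 2 * pi * n.+1%:R * y).
    by field.
  by rewrite natrM; field.
by field.
Qed.

End ThetaFunction.

(** * Dominated convergence for series *)

Section Tannery.
Context (R : realType).

Lemma lim_series_fin (f : nat -> R) K : (forall k, (K <= k)%N -> f k = 0) ->
  limn (series f) = \sum_(k < K) f k.
Proof.
move=> f0; apply: lim_near_cst => //; exists K => // n /= Kn.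
rewrite seriesEord/= -!(big_mkord xpredT f) (@big_cat_nat _ _ _ K)//=.
rewrite [X in _ + X]big_nat_cond [X in _ + X]big1 ?addr0// => i /andP[/andP[Ki _] _].
exact: f0.
Qed.

Lemma lim_series_shift (f : nat -> R) : cvgn (series f) ->
  limn (series f) = f 0%N + limn (series (fun n => f n.+1)).
Proof.
move=> cf.
have E n : series f n.+1 = f 0%N + series (fun k => f k.+1) n.
  by rewrite !seriesEord/= big_ord_recl.
have cs : series (fun n => f n.+1) @ \oo --> limn (series f) - f 0%N.
  rewrite (_ : series _ = fun n => series f n.+1 - f 0%N).
    by apply: cvgB; [rewrite cvg_shiftS|exact: cvg_cst].
  by apply/funext => n; rewrite E addrC addKr.
by rewrite (cvg_lim _ cs)// addrC subrK.
Qed.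

Let abs_cvg (f b : nat -> R) : (forall k, `|f k| <= b k) -> cvgn (series b) ->
  cvgn (series f).
Proof.
move=> fb cb; apply: normed_cvg; apply: series_le_cvg cb => k /=; rewrite ?normr_ge0//.
exact: le_trans (normr_ge0 _) (fb k).
Qed.

Let tail_le (f b : nat -> R) K : (forall k, `|f k| <= b k) -> cvgn (series b) ->
  `|limn (series f) - series f K| <= limn (series b) - series b K.
Proof.
move=> fb cb; have cf := abs_cvg fb cb.
have h1 : `|series f n - series f K| @[n --> \oo] --> `|limn (series f) - series f K|.
  by apply: cvg_norm; apply: cvgB => //; exact: cvg_cst.
have h2 : series b n - series b K @[n --> \oo] --> limn (series b) - series b K.
  by apply: cvgB => //; exact: cvg_cst.
apply: ler_cvg_to h1 h2 _; exists K => // n /= Kn.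
rewrite !seriesEnat/= !(@big_cat_nat _ _ _ K 0 n)//= ![_ + _ - _]addrAC !subrr !add0r.
by apply: le_trans (ler_norm_sum _ _ _) _; apply: ler_sum.
Qed.

(** Beyond some rank K the tails are controlled by that of [b], uniformly in m; the first K terms
    converge one by one. *)
Lemma tannery (u : nat -> nat -> R) (v b : nat -> R) :
  (forall k, u ^~ k @ \oo --> v k) ->
  (\forall m \near \oo, forall k, `|u m k| <= b k) -> cvgn (series b) ->
  cvgn (series v) /\ limn (series (u m)) @[m --> \oo] --> limn (series v).
Proof.
move=> uv ub cb.
have vb k : `|v k| <= b k.
  apply: (ler_cvg_to (cvg_norm (uv k)) (cvg_cst (b k))).
  by apply: filterS ub => m; exact.
split; first exact: abs_cvg vb cb.
apply/cvgrPdist_lt => e e0.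
have e3 : 0 < e / 3 by rewrite divr_gt0.
have [K _ HK] : \forall K \near \oo, `|limn (series b) - series b K| < e / 3.
  by move/cvgrPdist_lt : cb; apply.
have /(_ K (leqnn K)) bK := HK.
have cK : series (u m) K @[m --> \oo] --> series v K.
  rewrite seriesEord/=; under eq_fun do rewrite seriesEord/=.
  elim: K {HK bK} => [|K IH].
    by rewrite big_ord0; under eq_fun do rewrite big_ord0; exact: cvg_cst.
  rewrite big_ord_recr/= (_ : (fun x => _) = (fun x => \sum_(k < K) u x k + u x K)).
    exact: cvgD.
  by apply/funext => x; rewrite big_ord_recr.
near=> m.
have um : forall k, `|u m k| <= b k by near: m.
have h1 := le_lt_trans (le_trans (tail_le K um cb) (ler_norm _)) bK.
have h2 := le_lt_trans (le_trans (tail_le K vb cb) (ler_norm _)) bK.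
have h3 : `|series v K - series (u m) K| < e / 3.
  by near: m; move/cvgrPdist_lt : cK; apply.
rewrite (_ : _ - _ = (limn (series v) - series v K) + (series v K - series (u m) K)
   - (limn (series (u m)) - series (u m) K)); last by ring.
rewrite (le_lt_trans (ler_normB _ _))//.
rewrite (le_lt_trans (lerD (ler_normD _ _) (lexx _)))//.
lra.
Unshelve. all: by end_near. Qed.

End Tannery.

(** * Poisson summation for the Gaussian, as a limit of the binomial identity *)

Section Poisson.
Context (R : realType).
Implicit Types (x y a s t theta : R).

(** The lower bound is 1 / (1 - t) = 1 + t / (1 - t) <= exp (t / (1 - t)), inverted. *)
Lemma expR_le_1B t : 0 <= t < 1 -> expR (- (t / (1 - t))) <= 1 - t <= expR (- t).
Proof.
move=> /andP[t0 t1]; have t1' : 0 < 1 - t by rewrite subr_gt0.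
rewrite expR_ge1Dx andbT expRN -[leRHS]invrK lef_pV2 ?posrE ?invr_gt0 ?expR_gt0//.
apply: le_trans (expR_ge1Dx _); rewrite le_eqVlt; apply/orP; left; apply/eqP.
by field; rewrite gt_eqF.
Qed.

Lemma expR_le_1BX t n : 0 <= t < 1 ->
  expR (- (n%:R * t / (1 - t))) <= (1 - t) ^+ n <= expR (- (n%:R * t)).
Proof.
move=> t01; have /andP[h1 h2] := expR_le_1B t01.
rewrite (_ : - (n%:R * t / (1 - t)) = n%:R * - (t / (1 - t))); last by ring.
rewrite -[- (n%:R * t)]mulrN !expRM_natl; have t1 : 0 <= 1 - t.
  by rewrite subr_ge0; case/andP: t01 => _ /ltW.
by rewrite !lerXn2r ?nnegrE ?expR_ge0.
Qed.

(** By the mean value theorem sin (u / 2) = (u / 2) cos c with cos c >= cos (u / 2). Hence sin u = 2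
    sin (u / 2) cos (u / 2) is at least u cos (u / 2) ^ 2, and cos (u / 2) ^ 2 >= 1 / 2. *)
Lemma half_le_sin (u : R) : 0 <= u <= pi / 2 -> u / 2 <= sin u.
Proof.
move=> /andP[u0 up].
have [c /[!in_itv]/= /andP[c0 c1]] : exists2 c, c \in `[0, u / 2] &
    sin (u / 2) - sin 0 = cos c * (u / 2 - 0).
  apply: MVT_segment; first by rewrite divr_ge0.
  apply: continuous_subspaceT; exact: continuous_sin.
rewrite sin0 !subr0 => E.
have pi4 : u / 2 <= pi / 4 by lra.
have p0 : 0 < pi :> R by exact: pi_gt0.
have cc : cos (u / 2) <= cos c.
  have [->//|cu] := eqVneq c (u / 2).
  rewrite ltW// ltr_cos ?in_itv/=; first by rewrite lt_neqAle cu.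
    by apply/andP; split; lra.
  by apply/andP; split; lra.
have c2 : 1 / 2 <= cos (u / 2) ^+ 2.
  have := @cos_mulr2n R (u / 2).
  rewrite (_ : u / 2 *+ 2 = u) => [h|]; last by rewrite -mulr_natr; field.
  have : 0 <= cos u by apply: cos_ge0_pihalf; apply/andP; split; lra.
  by rewrite h mulr2n; lra.
have c0' : 0 <= cos (u / 2) by apply: cos_ge0_pihalf; apply/andP; split; lra.
have := @sin_mulr2n R (u / 2).
rewrite (_ : u / 2 *+ 2 = u) => [->|]; last by rewrite -mulr_natr; field.
rewrite E -[leRHS]mulr_natr.
have : cos (u / 2) ^+ 2 <= cos (u / 2) * cos c by rewrite expr2 ler_wpM2l.
move: c2; set A := cos _ ^+ 2; set B := cos _ * cos c => AB1 AB2.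
rewrite (_ : cos (u / 2) * (cos c * (u / 2)) = B * (u / 2)); last by rewrite /B mulrA.
have : 1 / 2 <= B by lra.
nra.
Qed.

(** From 1 - sin ^ 2 <= exp (- sin ^ 2) and sin |theta| >= |theta| / 2: a Gaussian bound uniform in
    N, which will dominate the sampled sums. *)
Lemma cosX_le (N : nat) theta : `|theta| <= pi / 2 ->
  cos theta ^+ N.*2 <= expR (- (N%:R * theta ^+ 2 / 4)).
Proof.
move=> tp; rewrite -mul2n exprM.
have -> : cos theta ^+ 2 = 1 - sin `|theta| ^+ 2.
  by rewrite sin2cos2 opprB addrC subrK cos_norm.
have h : `|theta| / 2 <= sin `|theta| by apply: half_le_sin; rewrite normr_ge0.
have h0 : 0 <= `|theta| / 2 by rewrite divr_ge0.
have t2 : theta ^+ 2 / 4 <= sin `|theta| ^+ 2.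
  by rewrite -normrX [`|_|]ger0_norm ?sqr_ge0// ||
     (rewrite -[theta ^+ 2]real_normK ?num_real//; nra).
have s1 : 0 <= 1 - sin `|theta| ^+ 2 by rewrite -cos2sin2 sqr_ge0.
rewrite (_ : - (N%:R * theta ^+ 2 / 4) = N%:R * - (theta ^+ 2 / 4)); last by ring.
rewrite expRM_natl lerXn2r ?nnegrE ?expR_ge0//.
apply: le_trans (_ : expR (- sin `|theta| ^+ 2) <= _); first exact: expR_ge1Dx.
by rewrite ler_expR lerN2.
Qed.

Let rho N r : R := 'C(N.*2, N + r)%:R / 'C(N.*2, N)%:R.

Let C0 N : 0 < 'C(N.*2, N)%:R :> R.
Proof. by rewrite ltr0n bin_gt0 -addnn leq_addr. Qed.

Let rho0 N : rho N 0 = 1.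
Proof. by rewrite /rho addn0 divff// gt_eqF. Qed.

Let rhoS N r : rho N r.+1 = rho N r * ((N - r)%:R / (N + r).+1%:R).
Proof.
have := mul_bin_left N.*2 (N + r).
rewrite -addnn subnDl => /(congr1 (fun n => n%:R : R)); rewrite addnn !natrM => E.
rewrite /rho addnS; apply: (mulfI (_ : (N + r).+1%:R != 0)); first by rewrite pnatr_eq0.
rewrite mulrA E; field.
by rewrite (gt_eqF (C0 N)) andbT -natrD nat1r pnatr_eq0.
Qed.

Let rho_ge0 N r : 0 <= rho N r. Proof. by rewrite divr_ge0. Qed.

Let rho_gt N r : (N < r)%N -> rho N r = 0.
Proof. by move=> Nr; rewrite /rho bin_small ?mul0r// -addnn ltn_add2l. Qed.

(** The successive quotients are (N - r) / (N + r + 1) = 1 - (2 r + 1) / (N + r + 1), each at most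
    exp (- (2 r + 1) / (N + M)), and the first r odd numbers add up to r ^ 2. *)
Let rho_le N M r : (0 < N)%N -> (r <= M)%N -> rho N r <= expR (- (r%:R ^+ 2 / (N + M)%:R)).
Proof.
move=> N0; elim: r => [|r IH] rM; first by rewrite rho0 expr0n/= mul0r oppr0 expR0.
have NM : 0 < (N + M)%:R :> R by rewrite ltr0n addn_gt0 N0.
have [Nr|rN] := leqP N r; first by rewrite rho_gt ?expR_ge0// ltnS.
rewrite rhoS.
have -> : - (r.+1%:R ^+ 2 / (N + M)%:R) =
  - (r%:R ^+ 2 / (N + M)%:R) + - ((2 * r%:R + 1) / (N + M)%:R) :> R.
  by rewrite -natr1; field; rewrite -natrD gt_eqF.
rewrite expRD ler_pM ?divr_ge0 ?IH 1?ltnW//.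
have Nr0 : 0 < (N + r).+1%:R :> R by [].
apply: le_trans (_ : expR (- ((2 * r%:R + 1) / (N + r).+1%:R)) <= _).
  apply: le_trans (expR_ge1Dx _); rewrite le_eqVlt; apply/orP; left; apply/eqP.
  by rewrite natrB ?(ltnW rN)// -natr1 natrD; field; rewrite -natrD natr1 gt_eqF.
rewrite ler_expR lerN2 ler_pM2l; last by rewrite ltr_wpDl.
by rewrite lef_pV2 ?posrE// ler_nat -addnS leq_add2l.
Qed.

(** The same product, bounded below by [expR_le_1B]: with 1 - t = (N - r) / (N + r + 1) one has t /
    (1 - t) = (2 r + 1) / (N - r). *)
Let rho_ge N M r : (M < N)%N -> (r <= M)%N -> expR (- (r%:R ^+ 2 / (N - M)%:R)) <= rho N r.
Proof.
move=> MN; elim: r => [|r IH] rM; first by rewrite rho0 expr0n/= mul0r oppr0 expR0.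
have NM : 0 < (N - M)%:R :> R by rewrite ltr0n subn_gt0.
have rN : (r < N)%N by exact: leq_ltn_trans (ltnW rM) MN.
rewrite rhoS.
have -> : - (r.+1%:R ^+ 2 / (N - M)%:R) =
  - (r%:R ^+ 2 / (N - M)%:R) + - ((2 * r%:R + 1) / (N - M)%:R) :> R.
  by rewrite -natr1; field; rewrite gt_eqF.
rewrite expRD ler_pM ?expR_ge0 ?IH 1?ltnW//.
have Nr0 : 0 < (N + r).+1%:R :> R by [].
have Nr1 : 0 < (N - r)%:R :> R by rewrite ltr0n subn_gt0.
pose t : R := (2 * r%:R + 1) / (N + r).+1%:R.
have Et : 1 - t = (N - r)%:R / (N + r).+1%:R.
  rewrite /t natrB ?(ltnW rN)// -[(N + r).+1%:R]natr1 natrD; field.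
  by rewrite -natrD natr1 pnatr_eq0.
have t01 : 0 <= t < 1.
  by rewrite divr_ge0//= -subr_gt0 Et divr_gt0.
rewrite -Et; have /andP[+ _] := expR_le_1B t01; apply: le_trans.
rewrite ler_expR lerN2 Et (_ : t / _ = (2 * r%:R + 1) / (N - r)%:R); last first.
  by rewrite /t; field; rewrite !gt_eqF//= -natrD natr1.
rewrite ler_pM2l; last by rewrite ltr_wpDl.
by rewrite lef_pV2 ?posrE// ler_nat leq_sub2l// ltnW.
Qed.

(** The sequence decreases because (2 n + 1) (2 n + 3) <= (2 n + 2) ^ 2. Its limit is 1 / pi, a
    value that emerges from the case a = 1 in the proof of [poisson_gauss]. *)
Lemma wallis_cvg :
  cvgn (fun n : nat => (n%:R + 1 / 2) * ('C(n.*2, n)%:R / 4 ^+ n) ^+ 2 : R).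
Proof.
apply: nonincreasing_is_cvgn; last first.
  by exists 0 => _ [n _ <-]; rewrite mulr_ge0 ?sqr_ge0// addr_ge0.
apply/nonincreasing_seqP => n.
have E : 'C(n.+1.*2, n.+1)%:R = 'C(n.*2, n)%:R * ((2 * (2 * n%:R + 1)) / (n%:R + 1)) :> R.
  have e1 := mul_bin_diag n.+1.*2 n; have e2 := mul_bin_down n.*2.+1 n.
  have e3 : ((n.+1 * n.+1) * 'C(n.+1.*2, n.+1) = n.+1.*2 * n.*2.+1 * 'C(n.*2, n))%N.
    rewrite -mulnA -e1 mulnCA -mulnA; congr (_ * _)%N.
    by move: e2 => /= ->; congr (_ * _)%N; lia.
  have := congr1 (fun k => k%:R : R) e3; rewrite !natrM -[n.+1%:R]natr1.
  rewrite (_ : n.+1.*2%:R = 2 * (n%:R + 1)); last by rewrite -mul2n natrM natr1.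
  rewrite (_ : n.*2.+1%:R = 2 * n%:R + 1) => [e4|]; last by rewrite -natr1 -mul2n natrM.
  have n1 : n%:R + 1 != 0 :> R by rewrite natr1.
  apply: (mulfI (_ : (n%:R + 1) * (n%:R + 1) != 0)); first by rewrite mulf_neq0.
  by rewrite e4; field.
rewrite E.
set c := 'C(_, _)%:R / _.
rewrite (_ : _ / 4 ^+ n.+1 = 'C(n.*2, n)%:R / 4 ^+ n * ((2 * n%:R + 1) / (2 * (n%:R + 1)))); last first.
  by rewrite exprS; field; rewrite natr1 pnatr_eq0/= expf_neq0.
rewrite -[n.+1%:R]natr1.
have n0 : 0 <= n%:R :> R by [].
move: n0; rewrite -/c; set k := n%:R => k0.
have key : (k + 1 + 1 / 2) * ((2 * k + 1) / (2 * (k + 1))) ^+ 2 <= k + 1 / 2.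
  by rewrite expr_div_n mulrA ler_pdivrMr; nra.
rewrite (_ : _ * _ ^+ 2 = c ^+ 2 * ((k + 1 + 1 / 2) * ((2 * k + 1) / (2 * (k + 1))) ^+ 2)); last by ring.
by rewrite [leRHS]mulrC ler_wpM2l ?sqr_ge0.
Qed.

Let auxD (n l N : R) : l != 0 -> N + n * l != 0 ->
  n ^+ 2 / (N / l ^+ 2 + n * l^-1) = (n * l) ^+ 2 / (N + n * l).
Proof. by move=> l0 D; field; rewrite ?l0 ?D. Qed.

Let auxB (n l N : R) : l != 0 -> N - n * l != 0 ->
  (n * l) ^+ 2 / (N - n * l) = n ^+ 2 / (N / l ^+ 2 - n * l^-1).
Proof.
move=> l0 D; rewrite (_ : N / l ^+ 2 - n * l^-1 = (N - n * l) / l ^+ 2); last by field.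
by rewrite invf_div exprMn -mulrA.
Qed.

Let auxE (k b N : R) : b != 0 -> k * (1 / (2 * b)) * (N + N) = k / b * N.
Proof. by move=> b0; field. Qed.

Let auxF (k b L : R) : b != 0 -> k / b * (b * L) = k * L.
Proof. by move=> b0; field. Qed.

Let auxG (l N c p : R) : l != 0 -> N != 0 ->
  (l * c / p) ^+ 2 = N * (c / p) ^+ 2 * (N / l ^+ 2)^-1.
Proof. by move=> l0 N0; rewrite -mulrA; set x := c / p; field; rewrite l0. Qed.

Let auxH (k x : R) : 1 <= k -> - (1 / 2) <= x -> k ^+ 2 / 4 <= (x + k) ^+ 2.
Proof. nra. Qed.

Let auxI (k x : R) : 0 <= k -> x <= 1 / 2 -> k ^+ 2 / 4 <= (x - (k + 1)) ^+ 2.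
Proof. nra. Qed.

Section limit.
Variables (a : R) (a0 : 0 < a).
(** With L = 2 m + 1 sample points and N close to a L ^ 2 / pi, the power cos (pi s / L) ^ (2 N)
    tends to exp (- pi a s ^ 2), while the binomial quotient at distance n L from the centre behaves
    like exp (- n ^ 2 L ^ 2 / N) and tends to exp (- pi n ^ 2 / a): these are the two sides of
    Poisson summation. L is odd so that the samples can be centred. *)
Let be : R := a / pi.
Let Lm (m : nat) : R := m.*2.+1%:R.
Let Nm (m : nat) : nat := Num.truncn (be * Lm m ^+ 2).

Let be0 : 0 < be. Proof. by rewrite divr_gt0 ?pi_gt0. Qed.

Let L0 m : 0 < Lm m. Proof. by rewrite /Lm ltr0n. Qed.

Let L0' m : Lm m != 0. Proof. by rewrite gt_eqF. Qed.

Let Nm_itv m : (Nm m)%:R <= be * Lm m ^+ 2 < (Nm m)%:R + 1.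
Proof. by rewrite natr1; apply: truncn_itv; rewrite mulr_ge0 ?sqr_ge0 ?ltW. Qed.

Let cvgL : (Lm m)^-1 @[m --> \oo] --> (0 : R).
Proof.
apply: squeeze_cvgr; [|exact: cvg_cst|exact: cvg_harmonic].
near=> m; rewrite invr_ge0 ltW//= lef_pV2 ?posrE// ler_nat ltnS -addnn.
exact: leq_addr.
Unshelve. all: by end_near. Qed.

Let cvgNL : (Nm m)%:R / Lm m ^+ 2 @[m --> \oo] --> be.
Proof.
apply: (@squeeze_cvgr _ _ _ _ (fun m => be - (Lm m)^-1 * (Lm m)^-1) (cst be)); last 2 first.
- rewrite -[X in _ --> X]subr0 -(mulr0 0).
  by apply: cvgB; [exact: cvg_cst|apply: cvgM; exact: cvgL].
- exact: cvg_cst.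
near=> m; have /andP[h1 h2] := Nm_itv m.
have L2 : 0 < Lm m ^+ 2 by rewrite exprn_gt0.
rewrite /cst ler_pdivrMr// h1 andbT ler_pdivlMr// -expr2 exprVn mulrBl mulVf ?gt_eqF//.
by rewrite lerBlDr ltW.
Unshelve. all: by end_near. Qed.

Let N_large (X : R) : \forall m \near \oo, X <= (Nm m)%:R.
Proof.
near=> m; have /andP[_ h2] := Nm_itv m.
have h3 : (X + 1) / be <= m%:R by near: m; exact: nbhs_infty_ger.
have h4 : m%:R <= Lm m ^+ 2.
  by rewrite /Lm -natrX ler_nat; nia.
rewrite -(lerD2r 1); apply: le_trans (ltW h2).
by rewrite mulrC -ler_pdivrMr// (le_trans h3).
Unshelve. all: by end_near. Qed.

Let cvgNoo : Nm @ \oo --> \oo.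
Proof.
apply/cvgnyPge => K; apply: filterS (N_large K%:R) => m.
by rewrite ler_nat.
Qed.

Let cvg_rho n : rho (Nm m) (n * m.*2.+1) @[m --> \oo] --> expR (- (pi * n%:R ^+ 2 / a)).
Proof.
have p0 : pi != 0 :> R by rewrite gt_eqF// pi_gt0.
have E : pi * n%:R ^+ 2 / a = n%:R ^+ 2 / be.
  rewrite /be; move: p0 (gt_eqF a0); generalize (pi : R) => q q0 /negbT a1; field.
  by rewrite q0 a1.
have cn : n%:R * (Lm m)^-1 @[m --> \oo] --> (0 : R).
  by rewrite -[X in _ --> X](mulr0 n%:R); apply: cvgM; [exact: cvg_cst|exact: cvgL].
have cB : (Nm m)%:R / Lm m ^+ 2 - n%:R * (Lm m)^-1 @[m --> \oo] --> be.
  by rewrite -[X in _ --> X]subr0; exact: cvgB.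
have cD : (Nm m)%:R / Lm m ^+ 2 + n%:R * (Lm m)^-1 @[m --> \oo] --> be.
  by rewrite -[X in _ --> X]addr0; exact: cvgD.
have bn0 : be != 0 by rewrite gt_eqF.
rewrite E; apply: (@squeeze_cvgr _ _ _ _
  (fun m => expR (- (n%:R ^+ 2 / ((Nm m)%:R / Lm m ^+ 2 - n%:R * (Lm m)^-1))))
  (fun m => expR (- (n%:R ^+ 2 / ((Nm m)%:R / Lm m ^+ 2 + n%:R * (Lm m)^-1))))); last 2 first.
- apply: continuous_cvg; first exact: continuous_expR.
  by apply: cvgN; apply: cvgM; [exact: cvg_cst|exact: cvgV].
- apply: continuous_cvg; first exact: continuous_expR.
  by apply: cvgN; apply: cvgM; [exact: cvg_cst|exact: cvgV].
near=> m.
have B0 : 0 < (Nm m)%:R / Lm m ^+ 2 - n%:R * (Lm m)^-1.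
  by near: m; exact: (cvgr_gt _ cB).
have LE : (n * m.*2.+1)%:R = n%:R * Lm m by rewrite natrM.
have lN : (n * m.*2.+1 < Nm m)%N.
  rewrite -(ltr_nat R) LE -subr_gt0.
  rewrite (_ : _ - _ = Lm m ^+ 2 * ((Nm m)%:R / Lm m ^+ 2 - n%:R * (Lm m)^-1)).
    by rewrite mulr_gt0// exprn_gt0.
  by field.
have N0 : (0 < Nm m)%N by exact: leq_trans lN.
have Nr0 : 0 < (Nm m)%:R :> R by rewrite ltr0n.
have D1 : (Nm m)%:R - n%:R * Lm m != 0.
  by rewrite gt_eqF// subr_gt0 -LE ltr_nat.
have D2 : (Nm m)%:R + n%:R * Lm m != 0.
  by rewrite gt_eqF// ltr_pwDl// mulr_ge0// ltW.
rewrite (le_trans _ (rho_ge lN (leqnn _))) ?(le_trans (rho_le N0 (leqnn _)))//.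
- rewrite ler_expR lerN2 natrD LE le_eqVlt; apply/orP; left; apply/eqP.
  exact: auxD.
- rewrite ler_expR lerN2 natrB ?(ltnW lN)// LE le_eqVlt; apply/orP; left; apply/eqP.
  exact: auxB.
Unshelve. all: by end_near. Qed.

(** The derivative of sin (c u) at u = 0, taken along u = 1 / L. *)
Let cvgLsin (c : R) : Lm m * sin (c / Lm m) @[m --> \oo] --> c.
Proof.
have D : is_derive (0 : R) (1 : R) (fun u : R => sin (c * u)) c.
  apply: is_derive_eq.
  by rewrite mulr0 cos0 /GRing.scale/= !mulr1 ?mul1r.
have H : h^-1 *: (sin (c * (h *: 1 + 0)) - sin (c * 0)) @[h --> (0 : R)^'] --> c.
  by rewrite -[X in _ --> X](@derive_val _ _ _ _ _ _ _ D); exact: ex_derive.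
have L' : (Lm m)^-1 @[m --> \oo] --> (0 : R)^'.
  move=> A HA; have : \forall m \near \oo, (Lm m)^-1 != 0 -> A (Lm m)^-1 by exact: (cvgL HA).
  by apply: filterS => m; apply; rewrite invr_neq0.
rewrite (_ : (fun m => _) = (fun h : R => h^-1 *: (sin (c * (h *: 1 + 0)) - sin (c * 0))) \o
  (fun m => (Lm m)^-1)); first exact: (cvg_comp _ _ L' H).
apply/funext => m /=.
by rewrite invrK mulr0 sin0 subr0 addr0 /GRing.scale/= mulr1.
Qed.

Let CP m s := cos (pi * s / Lm m) ^+ (Nm m).*2.

(** [CP m s] is (1 - t) ^ N with t = sin (pi s / L) ^ 2, where t tends to 0 and N t tends to pi a s
    ^ 2. *)
Let cvgCP s : CP m s @[m --> \oo] --> expR (- (pi * a * s ^+ 2)).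
Proof.
pose t m := sin (pi * s / Lm m) ^+ 2.
have CPE m : CP m s = (1 - t m) ^+ (Nm m).
  by rewrite /CP /t -mul2n exprM cos2sin2.
have cNt : (Nm m)%:R * t m @[m --> \oo] --> pi * a * s ^+ 2.
  rewrite (_ : pi * a * s ^+ 2 = be * ((pi * s) * (pi * s))); last first.
    rewrite /be; have := @pi_gt0 R; generalize (pi : R) => q /lt0r_neq0 q0; by field.
  rewrite (_ : (fun m => _) = (fun m => ((Nm m)%:R / Lm m ^+ 2) *
    ((Lm m * sin (pi * s / Lm m)) * (Lm m * sin (pi * s / Lm m))))).
    by apply: cvgM; [exact: cvgNL|apply: cvgM; exact: cvgLsin].
  apply/funext => m; rewrite /t; move: (L0' m) (sin _).
  by generalize (Lm m) => l l0 x; field.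
have ct : t m @[m --> \oo] --> (0 : R).
  rewrite (_ : 0 = ((pi * s) * 0) * ((pi * s) * 0)); last by rewrite mulr0 mul0r.
  rewrite (_ : t = (fun m => (Lm m * sin (pi * s / Lm m) * (Lm m)^-1) *
      (Lm m * sin (pi * s / Lm m) * (Lm m)^-1))).
    by apply: cvgM; apply: cvgM; [exact: cvgLsin|exact: cvgL|exact: cvgLsin|exact: cvgL].
  apply/funext => m; rewrite /t; move: (L0' m) (sin _).
  by generalize (Lm m) => l l0 x; field.
rewrite (_ : CP ^~ s = (fun m => (1 - t m) ^+ (Nm m))); last exact/funext.
apply: (@squeeze_cvgr _ _ _ _ (fun m => expR (- ((Nm m)%:R * t m / (1 - t m))))
  (fun m => expR (- ((Nm m)%:R * t m)))).
- near=> m; apply: expR_le_1BX; rewrite sqr_ge0/=.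
  by near: m; exact: (cvgr_lt _ ct).
- apply: continuous_cvg; first exact: continuous_expR.
  rewrite -[X in _ --> - X]divr1 -[X in _ / X]subr0; apply: cvgN; apply: cvgM => //.
  by apply: cvgV; [rewrite subr0|apply: cvgB => //; exact: cvg_cst].
- apply: continuous_cvg; first exact: continuous_expR.
  exact: cvgN.
Unshelve. all: by end_near. Qed.

Let CP_ge0 m s : 0 <= CP m s.
Proof. by rewrite /CP -mul2n exprM exprn_ge0 ?sqr_ge0. Qed.

(** The Gaussian bound is weakened to a geometric one by means of N / L ^ 2 >= be / 2, which holds
    for large m, pi ^ 2 >= 4 and n ^ 2 >= n. *)
Let CP_le : \forall m \near \oo, forall (n : nat) s, `|s| <= Lm m / 2 ->
  n%:R ^+ 2 / 4 <= s ^+ 2 -> CP m s <= expR (- (be / 8)) ^+ n.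
Proof.
have h : \forall m \near \oo, be / 2 < (Nm m)%:R / Lm m ^+ 2.
  by apply: (cvgr_gt _ cvgNL); have := be0; lra.
apply: filterS h => m h n s sL ns.
have lp := L0 m; have pp := @pi_gt0 R.
apply: le_trans (cosX_le _ _) _.
  rewrite normrM normfV [`|Lm m|]gtr0_norm// normrM [`|pi|]gtr0_norm//.
  by rewrite ler_pdivrMr// -mulrA ler_pM2l//; move: sL; rewrite mulrC.
rewrite -expRM_natl ler_expR mulrN lerN2.
have n1 : n%:R <= n%:R ^+ 2 :> R by rewrite -natrX ler_nat; nia.
have s4 : n%:R / 4 <= s ^+ 2 by lra.
have p4 : 4 <= pi ^+ 2 :> R by have := @pi_ge2 R; nra.
rewrite (_ : _ / 4 = ((Nm m)%:R / Lm m ^+ 2) * (pi ^+ 2 * s ^+ 2 / 4)); last first.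
  by rewrite [in LHS]expr_div_n exprMn; ring.
move: h; set q := _ / _ ^+ 2 => h.
have b0 := be0.
apply: le_trans (_ : be / 2 * (pi ^+ 2 * s ^+ 2 / 4) <= _).
  have s0 := sqr_ge0 s; have h2 : n%:R <= pi ^+ 2 * s ^+ 2 by nra.
  rewrite (_ : be / 2 * _ = pi ^+ 2 * s ^+ 2 * (be / 8)); last by field.
  by rewrite ler_wpM2r// divr_ge0// ltW.
apply: ler_wpM2r (ltW h).
by rewrite divr_ge0// mulr_ge0 ?sqr_ge0.
Qed.

(** The centred samples lie at x + j for -m <= j <= m. Here x + n is paired with x - (n + 1), and
    the cut-offs n <= m and n < m select exactly 2 m + 1 of them, so that both sides become series
    indexed by n. *)
Let uP x m n := (if (n <= m)%N then CP m (x + n%:R) else 0) +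
  (if (n < m)%N then CP m (x - n.+1%:R) else 0).
Let G s := expR (- (pi * a * s ^+ 2)).
Let vP x n := G (x + n%:R) + G (x - n.+1%:R).
Let uQ x m n := rho (Nm m) (n.+1 * m.*2.+1) * cos (2 * pi * n.+1%:R * x).
Let vQ x n := expR (- (pi * n.+1%:R ^+ 2 / a)) * cos (2 * pi * n.+1%:R * x).
Let A m := Lm m * 'C((Nm m).*2, Nm m)%:R / 4 ^+ (Nm m).

Let polya m x : limn (series (uP x m)) = A m * (1 + 2 * limn (series (uQ x m))).
Proof.
rewrite (@lim_series_fin _ _ m.+1); last first.
  by move=> k mk; rewrite /uP leqNgt mk ltnNge (ltnW mk)/= addr0.
rewrite (@lim_series_fin _ (uQ x m) (Nm m)); last first.
  move=> k mk; rewrite /uQ rho_gt ?mul0r// -[X in (X < _)%N]muln1.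
  by rewrite (@leq_trans (k.+1 * 1)%N)// ?leq_mul// !muln1.
have := @polya_identity R m.*2.+1 (Nm m) (x - m%:R) isT.
rewrite -/(Lm m) -/(A m) => E.
transitivity (\sum_(i < m.*2.+1) cos (pi * (x - m%:R + i%:R) / Lm m) ^+ (Nm m).*2).
  rewrite -(big_mkord xpredT (fun i => cos (pi * (x - m%:R + i%:R) / Lm m) ^+ (Nm m).*2)).
  rewrite -addnn -addnS big_mkord big_split_ord/= big_split/= addrC; congr (_ + _).
    rewrite big_ord_recr/= ltnn addr0 (reindex_inj rev_ord_inj)/=.
    apply: eq_bigr => i _; rewrite ifT; last by case: i => i /= im; lia.
    by rewrite /CP subnSK// natrB ?(ltnW (ltn_ord i))//; congr (cos (_ / _) ^+ _); ring.
  apply: eq_bigr => i _; rewrite ifT; last by case: i => i /= im; lia.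
  by rewrite /CP natrD; congr (cos (_ / _) ^+ _); ring.
rewrite E; congr (_ * (1 + 2 * _)); apply: eq_bigr => k _.
rewrite /uQ /rho; congr (_ * _).
rewrite -[RHS](cosD_2pi_int (- (k.+1 * m)%:Z)).
by congr cos; rewrite mulrNz -pmulrn natrM; ring.
Qed.

Let bP n := 2 * expR (- (be / 8)) ^+ n.
Let bQ n := expR (- (1 / (2 * be))) ^+ n.

Let cvg_exp_geom (c r : R) : 0 < r -> cvgn (series (fun n => c * expR (- r) ^+ n)).
Proof.
move=> r0; apply: is_cvg_geometric_series.
by rewrite ger0_norm ?expR_ge0// expR_lt1 oppr_lt0.
Qed.

Let cvg_from (f g : nat -> R) (l : R) K : g @ \oo --> l ->
  (forall m, (K <= m)%N -> f m = g m) -> f @ \oo --> l.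
Proof.
move=> /cvgrPdist_lt gl fg; apply/cvgrPdist_lt => e e0.
near=> m; rewrite fg; last by near: m; exact: nbhs_infty_ge.
by near: m; exact: gl.
Unshelve. all: by end_near. Qed.

Let cvg_uP x : `|x| <= 1 / 2 ->
  cvgn (series (vP x)) /\ limn (series (uP x m)) @[m --> \oo] --> limn (series (vP x)).
Proof.
rewrite ler_norml => /andP[x1 x2]; apply: (@tannery _ _ _ bP).
- move=> k.
  have H1 : (fun m => if (k <= m)%N then CP m (x + k%:R) else 0) @ \oo --> G (x + k%:R).
    by apply: (@cvg_from _ (CP ^~ (x + k%:R)) _ k); [exact: cvgCP|move=> m ->].
  have H2 : (fun m => if (k < m)%N then CP m (x - k.+1%:R) else 0) @ \oo --> G (x - k.+1%:R).
    by apply: (@cvg_from _ (CP ^~ (x - k.+1%:R)) _ k.+1); [exact: cvgCP|move=> m ->].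
  exact: (cvgD H1 H2).
- apply: filterS CP_le => m h k.
  have e0 : 0 <= expR (- (be / 8)) ^+ k by rewrite exprn_ge0 ?expR_ge0.
  rewrite /uP /bP ger0_norm; last by apply: addr_ge0; case: ifP.
  rewrite mulr2n mulrDl !mul1r; apply: lerD; case: ifP => // km.
  + have km' : k%:R <= m%:R :> R by rewrite ler_nat.
    have k0 : 0 <= k%:R :> R by [].
    apply: h.
      rewrite /Lm -natr1 -muln2 natrM ler_norml; apply/andP; split; lra.
    have [->|kn0] := eqVneq k 0%N; first by rewrite expr0n mul0r sqr_ge0.
    have : 1 <= k%:R :> R by rewrite ler1n lt0n.
    by move=> h1; apply: auxH.
  + have km' : k.+1%:R <= m%:R :> R by rewrite ler_nat.
    have k0 : 0 <= k%:R :> R by [].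
    move: km'; rewrite -[k.+1%:R]natr1 => km'.
    apply: h.
      rewrite /Lm -[m.*2.+1%:R]natr1 -muln2 natrM ler_norml; apply/andP; split; lra.
    exact: auxI.
- by apply: cvg_exp_geom; rewrite divr_gt0.
Qed.

Let cvg_uQ x :
  cvgn (series (vQ x)) /\ limn (series (uQ x m)) @[m --> \oo] --> limn (series (vQ x)).
Proof.
apply: (@tannery _ _ _ bQ).
- by move=> k; apply: cvgM; [exact: cvg_rho|exact: cvg_cst].
- apply: filterS (N_large 1) => m; rewrite ler1n => N0 k.
  have e0 : 0 <= bQ k by rewrite exprn_ge0 ?expR_ge0.
  rewrite /uQ normrM ger0_norm; last exact: rho_ge0.
  apply: le_trans (ler_pM _ _ (lexx _) (cos_max _)) _ => //; rewrite mulr1.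
  have [Nk|kN] := ltnP (Nm m) (k.+1 * m.*2.+1); first by rewrite rho_gt.
  apply: le_trans (rho_le N0 kN) _.
  rewrite /bQ -expRM_natl ler_expR mulrN lerN2 natrM -/(Lm m).
  have /andP[h1 _] := Nm_itv m.
  have b0 := be0.
  have N0' : 0 < (Nm m)%:R :> R by rewrite ltr0n.
  rewrite natrD ler_pdivlMr ?addr_gt0// auxE ?gt_eqF//.
  apply: le_trans (ler_wpM2l _ h1) _; first by rewrite divr_ge0// ltW.
  rewrite auxF ?gt_eqF//.
  rewrite exprMn ler_wpM2r ?sqr_ge0// -natrX ler_nat; nia.
- have := @cvg_exp_geom 1 (1 / (2 * be)); under eq_fun do rewrite mul1r; apply.
  by rewrite divr_gt0// mulr_gt0.
Qed.

(** At x = 0 the factor multiplying [A m] is at least 1, so [A m] is a quotient of convergent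
    sequences and has a limit c. Its square is the Wallis sequence at N divided by (N + 1 / 2) / L ^
    2, and the divisor tends to a / pi. *)
Lemma poisson_const : exists c, [/\ 0 <= c,
    c ^+ 2 = limn (fun n : nat => (n%:R + 1 / 2) * ('C(n.*2, n)%:R / 4 ^+ n) ^+ 2 : R) * (pi / a) &
    forall x, `|x| <= 1 / 2 -> limn (series (vP x)) = c * (1 + 2 * limn (series (vQ x)))].
Proof.
have x0 : `|0 : R| <= 1 / 2 by rewrite normr0.
have Q_ge m : 1 <= 1 + 2 * limn (series (uQ 0 m)).
  rewrite lerDl mulr_ge0// (@lim_series_fin _ (uQ 0 m) (Nm m)); last first.
    move=> k mk; rewrite /uQ rho_gt ?mul0r// -[X in (X < _)%N]muln1.
    by rewrite (@leq_trans (k.+1 * 1)%N)// ?leq_mul// !muln1.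
  by apply: sumr_ge0 => i _; rewrite /uQ mulr0 cos0 mulr1 rho_ge0.
have cQ x : 1 + 2 * limn (series (uQ x m)) @[m --> \oo] --> 1 + 2 * limn (series (vQ x)).
  apply: cvgD; first exact: cvg_cst.
  by apply: cvgM; [exact: cvg_cst|exact: (cvg_uQ x).2].
have Q0 : 1 <= 1 + 2 * limn (series (vQ 0)).
  by apply: (cvgr_to_ge (cQ 0)); near=> m; exact: Q_ge.
have Q0' : 1 + 2 * limn (series (vQ 0)) != 0 by rewrite gt_eqF// (lt_le_trans _ Q0).
pose c := limn (series (vP 0)) / (1 + 2 * limn (series (vQ 0))).
have Ac : A m @[m --> \oo] --> c.
  rewrite (_ : A = (fun m => limn (series (uP 0 m)) / (1 + 2 * limn (series (uQ 0 m))))).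
    by apply: cvgM; [exact: (cvg_uP x0).2|apply: cvgV].
  apply/funext => m; rewrite polya mulfK// gt_eqF// (lt_le_trans _ (Q_ge m))//.
exists c; split.
- apply: (cvgr_to_ge Ac); near=> m.
  by rewrite /A divr_ge0// mulr_ge0// ltW.
- have A2 : A m ^+ 2 @[m --> \oo] --> c ^+ 2.
    by rewrite expr2; under eq_fun do rewrite expr2; exact: cvgM.
  set W := limn _.
  have cW : ((Nm m)%:R + 1 / 2) * ('C((Nm m).*2, Nm m)%:R / 4 ^+ Nm m) ^+ 2 @[m --> \oo] --> W.
    exact: (cvg_comp _ _ cvgNoo wallis_cvg).
  have cN : ((Nm m)%:R + 1 / 2) / Lm m ^+ 2 @[m --> \oo] --> be.
    rewrite (_ : (fun m => _) = (fun m => (Nm m)%:R / Lm m ^+ 2 + 1 / 2 * ((Lm m)^-1 * (Lm m)^-1))).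
      rewrite -[X in _ --> X]addr0 -(mulr0 (1 / 2)) -(mulr0 0).
      by apply: cvgD => //; apply: cvgM; [exact: cvg_cst|exact: cvgM].
    apply/funext => m; move: (L0' m); generalize (Lm m) => l l0.
    by rewrite mulrDl expr2 invfM.
  apply: cvg_unique A2 _ => //.
  rewrite (_ : pi / a = be^-1); last by rewrite /be invf_div.
  rewrite (_ : (fun m => A m ^+ 2) = (fun m => ((Nm m)%:R + 1 / 2) *
     ('C((Nm m).*2, Nm m)%:R / 4 ^+ Nm m) ^+ 2 * (((Nm m)%:R + 1 / 2) / Lm m ^+ 2)^-1)).
    by apply: cvgM => //; apply: cvgV; rewrite ?gt_eqF.
  apply/funext => m; rewrite /A.
  have N0 : (Nm m)%:R + 1 / 2 != 0 :> R by rewrite gt_eqF// ltr_wpDl.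
  exact: auxG.
- move=> x x12; have cP := (cvg_uP x12).2.
  apply: cvg_unique cP _ => //.
  rewrite (_ : (fun m => _) = (fun m => A m * (1 + 2 * limn (series (uQ x m))))).
    exact: cvgM.
  by apply/funext => m; exact: polya.
Unshelve. all: by end_near. Qed.

Lemma cvg_series_theta x : `|x| <= 1 / 2 -> cvgn (series (vP x)) /\ cvgn (series (vQ x)).
Proof. by move=> x12; split; [exact: (cvg_uP x12).1|exact: (cvg_uQ x).1]. Qed.

End limit.

(** For a = 1 and x = 0 the two Gaussian sums are the same, which forces the constant to be 1 there;
    this evaluates the Wallis limit, and with it the constant for every a. *)
Lemma poisson_gauss a x : 0 < a -> `|x| <= 1 / 2 ->
  limn (series (fun n => expR (- (pi * a * (x + n%:R) ^+ 2)) +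
                         expR (- (pi * a * (x - n.+1%:R) ^+ 2)))) =
  (Num.sqrt a)^-1 * (1 + 2 * limn (series (fun n =>
     expR (- (pi * n.+1%:R ^+ 2 / a)) * cos (2 * pi * n.+1%:R * x)))).
Proof.
move=> a0 x12; have [c [c0 c2 cE]] := poisson_const a0.
rewrite cE//; congr (_ * _).
have [d [d0 d2 dE]] := poisson_const (@ltr01 R).
have x0 : `|0 : R| <= 1 / 2 by rewrite normr0.
have [cP cQ] := cvg_series_theta (@ltr01 R) x0.
have d1 : d = 1.
  have := dE 0 x0.
  set f : nat -> R := (fun n => _ + _); set g : nat -> R := (fun n => _ * cos _).
  have -> : limn (series f) = 1 + 2 * limn (series g).
    have cg : cvgn (series g) by [].
    pose h n : R := expR (- (pi * n%:R ^+ 2)).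
    have gE : g = (fun n => h n.+1).
      by apply/funext => n; rewrite /g /h mulr0 cos0 mulr1 divr1.
    have ch : cvgn (series h).
      apply/cvg_ex; exists (h 0%N + limn (series g)).
      rewrite -cvg_shiftS /= (_ : (fun n => _) = (fun n => h 0%N + series g n)).
        by apply: cvgD => //; exact: cvg_cst.
      by apply/funext => n; rewrite gE !seriesEord/= big_ord_recl.
    have fE : f = (fun n => h n + g n).
      apply/funext => n; rewrite /f gE /h !mulr1 add0r; congr (_ + _).
      by rewrite sub0r sqrrN.
    rewrite fE (_ : series _ = series h + series g); last first.
      by apply/funext => n; rewrite !seriesEord/= big_split.
    rewrite limD// (lim_series_shift ch) -gE /h expr0n mulr0 oppr0 expR0; ring.
  move=> E; have Q1 : 1 <= 1 + 2 * limn (series g).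
    rewrite lerDl mulr_ge0//; apply: limr_ge => //; near=> n.
    by rewrite seriesEord/=; apply: sumr_ge0 => i _; rewrite /g mulr0 cos0 mulr1 expR_ge0.
  have Q0 : 1 + 2 * limn (series g) != 0 by rewrite gt_eqF// (lt_le_trans _ Q1).
  by apply: (mulIf Q0); rewrite -E mul1r.
move: d2; rewrite d1 expr1n divr1 => W.
have ca : c ^+ 2 = (Num.sqrt a)^-1 ^+ 2.
  by rewrite c2 mulrA -W mul1r exprVn sqr_sqrtr ?ltW.
by apply/eqP; rewrite -(eqrXn2 (n := 2))// ?ca// invr_ge0 sqrtr_ge0.
Unshelve. all: by end_near. Qed.

End Poisson.

(** * Sums over the integers in the extended reals *)

Section IntSums.
Context (R : realType).
Local Open Scope ereal_scope.

Lemma esum_intE (f : int -> \bar R) : (forall n, 0 <= f n) ->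
  \esum_(n in [set: int]) f n = \sum_(n <oo) (f n%:Z + f (- n.+1%:Z)%R).
Proof.
move=> f0; rewrite nneseriesD// (esumID [set n : int | (0 <= n)%R])// !setTI.
congr (_ + _); rewrite nneseries_esumT//; apply: reindex_esum; split => //.
- by move=> m n _ _ [].
- by move=> n /= n0; exists `|n|%N => //; rewrite gez0_abs.
- by move=> m n _ _ /oppr_inj[].
- move=> n /= /negP; rewrite -ltNge => n0; exists `|n|.-1%N => //.
  by rewrite prednK ?absz_gt0 ?lt_eqF// ltz0_abs// opprK.
Qed.

Lemma esum_intZl (c : R) (f : int -> \bar R) : (forall n, 0 <= f n) ->
  (0 <= c)%R ->
  \esum_(n in [set: int]) (c%:E * f n) = c%:E * \esum_(n in [set: int]) f n.
Proof.
move=> f0 c0; rewrite !esum_intE//; try by move=> n; rewrite mule_ge0.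
rewrite -nneseriesZl; try by move=> n _; rewrite adde_ge0.
by apply: eq_eseriesr => n _; rewrite ge0_muleDr.
Qed.

Lemma esum_int_shift (k : int) (f : int -> \bar R) :
  \esum_(n in [set: int]) f (n + k)%R = \esum_(n in [set: int]) f n.
Proof.
symmetry; apply: reindex_esum; split => //.
- by move=> m n _ _ /addIr.
- by move=> n _; exists (n - k)%R => //; rewrite subrK.
Qed.

Lemma esum_int2 (f : int -> int -> \bar R) : (forall m n, 0 <= f m n) ->
  \esum_(v in [set: int * int]) f v.1 v.2 =
  \esum_(m in [set: int]) \esum_(n in [set: int]) f m n.
Proof.
move=> f0; rewrite esum_esum//; congr esum.
by apply/seteqP; split => // -[].
Qed.

Lemma esum_int_swap (f : int -> int -> \bar R) : (forall m n, 0 <= f m n) ->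
  \esum_(m in [set: int]) \esum_(n in [set: int]) f m n =
  \esum_(n in [set: int]) \esum_(m in [set: int]) f m n.
Proof.
move=> f0; rewrite -esum_int2// -(esum_int2 (fun n m => f0 m n)).
apply: (@reindex_esum _ _ _ _ _ (fun v : int * int => (v.2, v.1))); split => //.
- by move=> [a b] [c d] _ _ [-> ->].
- by move=> [a b] _; exists (b, a).
Qed.

Lemma nneseries_EFin (u : nat -> R) : cvgn (series u) ->
  \sum_(n <oo) (u n)%:E = (limn (series u))%:E.
Proof.
move=> cu; rewrite -EFin_lim//; congr (limn _); apply/funext => n.
by rewrite /= sumEFin.
Qed.

Lemma gauss_sum_lty (c : R) : (0 < c)%R ->
  \esum_(n in [set: int]) (expR (- (c * n%:~R ^+ 2)))%:E < +oo.
Proof.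
move=> c0; rewrite esum_intE; try by move=> n; rewrite lee_fin expR_ge0.
apply: (@le_lt_trans _ _ (\sum_(n <oo) (2 * expR (- c) ^+ n)%:E)); last first.
  rewrite nneseries_EFin ?ltry//; apply: is_cvg_geometric_series.
  by rewrite ger0_norm ?expR_ge0// expR_lt1 oppr_lt0.
apply: lee_nneseries => n _; first by rewrite adde_ge0// lee_fin expR_ge0.
rewrite -EFinD lee_fin mulr2n mulrDl !mul1r -expRM_natl; apply: lerD; rewrite ler_expR.
  have n2 : (n%:R <= n%:R ^+ 2 :> R)%R by rewrite -natrX ler_nat; nia.
  by rewrite -pmulrn; nra.
have n2 : (n%:R <= n.+1%:R ^+ 2 :> R)%R by rewrite -natrX ler_nat; nia.
by rewrite mulrNz sqrrN -pmulrn; nra.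
Qed.

End IntSums.

Lemma lim_seriesD (R : realType) (f g : nat -> R) :
  cvgn (series f) -> cvgn (series g) ->
  cvgn (series (fun n => f n + g n)) /\
  limn (series (fun n => f n + g n)) = limn (series f) + limn (series g).
Proof.
move=> cf cg; have -> : series (fun n => f n + g n) = series f + series g.
  by apply/funext => n; rewrite !seriesEord/= big_split.
by split; [exact: is_cvgD|exact: limD].
Qed.

(** * The two-dimensional theta function and its inversion formula *)

Section Theta2.
Context (R : realType).
Implicit Types (a b x y t : R).

Let E a (n : nat) : R := expR (- (pi * n%:R ^+ 2 / a)).

Let cvgE a : 0 < a -> cvgn (series (E a)).
Proof.
move=> a0; apply: series_le_cvg (_ : cvgn (series (fun n => 1 * expR (- (pi / a)) ^+ n))).
- by move=> n; exact: expR_ge0.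
- by move=> n; rewrite mulr_ge0// exprn_ge0// expR_ge0.
- move=> n; rewrite mul1r -expRM_natl ler_expR mulrN lerN2 mulrAC mulrC.
  have n2 : n%:R <= n%:R ^+ 2 :> R by rewrite -natrX ler_nat; nia.
  by rewrite ler_wpM2l// divr_ge0 ?pi_ge0 ?ltW.
- apply: is_cvg_geometric_series.
  by rewrite ger0_norm ?expR_ge0// expR_lt1 oppr_lt0 divr_gt0// pi_gt0.
Qed.

(** Adding the Gaussian sum to both sides replaces cos by 1 + cos, so that every term is nonnegative
    and the identity holds among extended reals, where it can be summed over a further index and
    rearranged freely. *)
Let poisson_half a b : 0 < a -> `|b| <= 1 / 2 ->
  ((Num.sqrt a)%:E * (\esum_(n in [set: int]) (expR (- (pi * a * (b + n%:~R) ^+ 2)))%:E)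
   + (\esum_(n in [set: int]) (expR (- (pi * n%:~R ^+ 2 / a)))%:E)
   = \esum_(n in [set: int])
       (expR (- (pi * n%:~R ^+ 2 / a)) * (1 + cos (2 * pi * n%:~R * b)))%:E)%E.
Proof.
move=> a0 b12.
have [cP cQ] := cvg_series_theta a0 b12.
have cE := cvgE a0.
pose v n := E a n * cos (2 * pi * n%:R * b).
have cE1 : cvgn (series (fun n => E a n.+1)).
  have cE' : cvgn (fun n => series (E a) n.+1).
    by apply/cvg_ex; exists (limn (series (E a))); rewrite cvg_shiftS.
  rewrite (_ : series _ = (fun n => series (E a) n.+1 - E a 0)).
    by apply: is_cvgB => //; exact: is_cvg_cst.
  by apply/funext => n; rewrite !seriesEord/= big_ord_recl/= addrC addKr.
have cv1 : cvgn (series (fun n => v n.+1)) by exact: cQ.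
have cv : cvgn (series v).
  apply: normed_cvg; apply: series_le_cvg cE => n.
  - by rewrite /= normr_ge0.
  - exact: expR_ge0.
  - rewrite /= normrM ger0_norm ?expR_ge0//.
    by rewrite -[leRHS]mulr1 ler_wpM2l ?expR_ge0// cos_max.
rewrite !esum_intE; last 3 first.
- by move=> n; rewrite lee_fin mulr_ge0 ?expR_ge0.
- by move=> n; rewrite lee_fin expR_ge0.
- by move=> n; rewrite lee_fin expR_ge0.
pose vP n := expR (- (pi * a * (b + n%:R) ^+ 2)) + expR (- (pi * a * (b - n.+1%:R) ^+ 2)).
rewrite (eq_eseriesr (g := fun n => (vP n)%:E)); last first.
  by move=> n _; rewrite -EFinD /vP mulrNz -!pmulrn.
rewrite [X in (_ + X = _)%E](eq_eseriesr (g := fun n => (E a n + E a n.+1)%:E)); last first.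
  by move=> n _; rewrite -EFinD /E mulrNz -!pmulrn sqrrN.
rewrite [RHS](eq_eseriesr (g := fun n => ((E a n + v n) + (E a n.+1 + v n.+1))%:E)); last first.
  move=> n _; rewrite -EFinD /v /E mulrNz -!pmulrn sqrrN !mulrN mulNr cosN.
  by congr EFin; ring.
have [c1 e1] := lim_seriesD cE cE1.
have [c2 e2] := lim_seriesD cE cv.
have [c3 e3] := lim_seriesD cE1 cv1.
have [c4 e4] := lim_seriesD c2 c3.
rewrite (nneseries_EFin cP) (nneseries_EFin c1) (nneseries_EFin c4).
rewrite -EFinM -EFinD; congr EFin; rewrite e1 e4 e2 e3.
rewrite (poisson_gauss a0 b12) mulrA mulfV ?mul1r; last by rewrite gt_eqF// sqrtr_gt0.
have -> : limn (series v) = 1 + limn (series (fun n => v n.+1)).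
  rewrite (lim_series_shift cv); congr (_ + _).
  by rewrite /v /E expr0n mulr0 mul0r oppr0 expR0 mulr0 mul0r cos0 mulr1.
by ring.
Qed.

(** Both sides are unchanged when b is shifted by an integer, and subtracting the nearest integer
    [k] brings it to |b| <= 1 / 2. *)
Lemma poisson_esum a b : 0 < a ->
  ((Num.sqrt a)%:E * (\esum_(n in [set: int]) (expR (- (pi * a * (b + n%:~R) ^+ 2)))%:E)
   + (\esum_(n in [set: int]) (expR (- (pi * n%:~R ^+ 2 / a)))%:E)
   = \esum_(n in [set: int])
       (expR (- (pi * n%:~R ^+ 2 / a)) * (1 + cos (2 * pi * n%:~R * b)))%:E)%E.
Proof.
move=> a0; pose k := Num.floor (b + 1 / 2); pose b' := b - k%:~R.
have b'12 : `|b'| <= 1 / 2.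
  have := floor_itv (b + 1 / 2); rewrite -/k intrD => /andP[h1 h2].
  rewrite /b' ler_norml; apply/andP; split; lra.
rewrite -[in X in (_ * X + _ = _)%E](esum_int_shift (- k)).
have EE (n : int) : b + (n - k)%:~R = b' + n%:~R by rewrite intrD mulrNz /b'; ring.
under eq_esum do rewrite EE.
rewrite [LHS](poisson_half a0 b'12).
apply: eq_esum => n _; congr ((_ * (1 + _))%:E).
rewrite -(cosD_2pi_int (n * k) (2 * pi * n%:~R * b')); congr cos.
by rewrite intrM /b'; ring.
Qed.

Definition theta x y t : \bar R := \esum_(v in [set: int * int])
  (expR (- (pi * t * ((v.1%:~R * x + v.2%:~R) ^+ 2 + (v.1%:~R * y) ^+ 2) / y)))%:E.

(** Poisson summation in n, for each m, shows that sqrt (t / y) times [theta], plus [B], is [C].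
    Replacing t by 1 / t exchanges the roles of m and n in [B] and in [C], whence their symmetry. *)
Let B y t : \bar R := \esum_(m in [set: int]) \esum_(n in [set: int])
  (expR (- (pi * y * t * m%:~R ^+ 2)) * expR (- (pi * n%:~R ^+ 2 / (t / y))))%:E.

Let C x y t : \bar R := \esum_(m in [set: int]) \esum_(n in [set: int])
  (expR (- (pi * y * t * m%:~R ^+ 2)) * (expR (- (pi * n%:~R ^+ 2 / (t / y))) *
   (1 + cos (2 * pi * n%:~R * (m%:~R * x)))))%:E.

Let B_lty y t : 0 < y -> 0 < t -> (B y t < +oo)%E.
Proof.
move=> y0 t0; rewrite /B.
have h1 : 0 < pi * y * t by rewrite !mulr_gt0 ?pi_gt0.
have h2 : 0 < pi / (t / y) by rewrite !divr_gt0 ?pi_gt0.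
have Q0 := gauss_sum_lty h2.
set Q := \esum_(n in _) _ in Q0.
have Qge : (0 <= Q)%E by apply: esum_ge0 => n _; rewrite lee_fin expR_ge0.
have Qf : Q \is a fin_num by rewrite ge0_fin_numE.
rewrite (eq_esum (b := fun m : int => ((fine Q)%:E * (expR (- (pi * y * t * m%:~R ^+ 2)))%:E)%E)).
  rewrite esum_intZl ?fine_ge0//.
  by rewrite lte_mul_pinfty ?gauss_sum_lty// lee_fin fine_ge0.
move=> m _; rewrite fineK// muleC /Q -esum_intZl ?expR_ge0//.
by apply: eq_esum => n _; rewrite EFinM [pi / _ * _]mulrAC.
Qed.

Let thetaE x y t : 0 < y -> 0 < t ->
  ((Num.sqrt (t / y))%:E * theta x y t + B y t = C x y t)%E.
Proof.
move=> y0 t0; have a0 : 0 < t / y by rewrite divr_gt0.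
rewrite /theta (esum_int2 (f := fun m n => (expR (- (pi * t * ((m%:~R * x + n%:~R) ^+ 2 +
   (m%:~R * y) ^+ 2) / y)))%:E)); try by move=> m n; rewrite lee_fin expR_ge0.
rewrite -esum_intZl ?sqrtr_ge0//; last first.
  by move=> m; apply: esum_ge0 => n _; rewrite lee_fin expR_ge0.
rewrite -esumD; last 2 first.
- move=> m _; rewrite mule_ge0 ?lee_fin ?sqrtr_ge0//.
  by apply: esum_ge0 => n _; rewrite lee_fin expR_ge0.
- by move=> m _; apply: esum_ge0 => n _; rewrite lee_fin mulr_ge0 ?expR_ge0.
apply: eq_esum => m _.
pose g : R := expR (- (pi * y * t * m%:~R ^+ 2)).
have g0 : 0 <= g by exact: expR_ge0.
have -> : \esum_(n in [set: int]) (expR (- (pi * t * ((m%:~R * x + n%:~R) ^+ 2 +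
   (m%:~R * y) ^+ 2) / y)))%:E = (g%:E * \esum_(n in [set: int])
    (expR (- (pi * (t / y) * (m%:~R * x + n%:~R) ^+ 2)))%:E)%E.
  rewrite -esum_intZl//.
  apply: eq_esum => n _; rewrite -EFinM /g -expRD; congr ((expR _)%:E).
  by field; rewrite gt_eqF.
rewrite -/g; under [X in (_ + X)%E]eq_esum do rewrite EFinM.
under [RHS]eq_esum do rewrite EFinM.
rewrite !esum_intZl//.
rewrite -(poisson_esum (m%:~R * x) a0).
set P := \esum_(n in _) _; set Q := \esum_(n in _) _.
have P0 : (0 <= P)%E by apply: esum_ge0 => n _; rewrite lee_fin expR_ge0.
have Q0 : (0 <= Q)%E by apply: esum_ge0 => n _; rewrite lee_fin expR_ge0.
by rewrite ge0_muleDr ?mule_ge0 ?lee_fin ?sqrtr_ge0// muleCA.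
Qed.

Let B_sym y t : 0 < y -> 0 < t -> B y t^-1 = B y t.
Proof.
move=> y0 t0; rewrite /B esum_int_swap; last first.
  by move=> m n; rewrite lee_fin mulr_ge0 ?expR_ge0.
apply: eq_esum => m _; apply: eq_esum => n _; rewrite mulrC.
by congr ((expR _ * expR _)%:E); field; rewrite ?gt_eqF.
Qed.

Let C_sym x y t : 0 < y -> 0 < t -> C x y t^-1 = C x y t.
Proof.
move=> y0 t0; rewrite /C esum_int_swap; last first.
  by move=> m n; rewrite lee_fin !mulr_ge0 ?expR_ge0.
apply: eq_esum => m _; apply: eq_esum => n _; rewrite mulrCA.
rewrite [cos _](_ : _ = cos (2 * pi * n%:~R * (m%:~R * x))); last by congr cos; ring.
by congr ((expR _ * (expR _ * _))%:E); field; rewrite ?gt_eqF.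
Qed.

(** [C] is at most twice [B], since 1 + cos <= 2, and [B] is a product of two Gaussian sums. *)
Lemma theta_lty x y t : 0 < y -> 0 < t -> (theta x y t < +oo)%E.
Proof.
move=> y0 t0; have a0 : 0 < Num.sqrt (t / y) by rewrite sqrtr_gt0 divr_gt0.
have CB : (C x y t < +oo)%E.
  have := B_lty y0 t0; rewrite -(@lte_pmul2l _ 2%:E)// mulry gtr0_sg// mul1e => h.
  apply: le_lt_trans h; rewrite /B -esum_intZl//; last first.
    by move=> m; apply: esum_ge0 => n _; rewrite lee_fin mulr_ge0 ?expR_ge0.
  apply: le_esum => m _; rewrite -esum_intZl//.
  apply: le_esum => n _; rewrite -EFinM lee_fin mulrA [leRHS]mulrC ler_wpM2l ?mulr_ge0 ?expR_ge0//.
  by have := @cos_le1 R (2 * pi * n%:~R * (m%:~R * x)); lra.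
have th0 : (0 <= theta x y t)%E by apply: esum_ge0 => n _; rewrite lee_fin expR_ge0.
rewrite ltey; apply/eqP => thoo.
move: CB; rewrite -thetaE// thoo mulry gtr0_sg// mul1e addye// -ltNye.
apply: (@lt_le_trans _ _ 0%E) => //.
by apply: esum_ge0 => m _; apply: esum_ge0 => n _; rewrite lee_fin mulr_ge0 ?expR_ge0.
Qed.

(** The finite term [B] is cancelled from the relations for t and 1 / t, and sqrt (t / y) = t sqrt
    (1 / (t y)) supplies the weight. *)
Lemma theta_inv x y t : 0 < y -> 0 < t -> theta x y t^-1 = (t%:E * theta x y t)%E.
Proof.
move=> y0 t0; have ti0 : 0 < t^-1 by rewrite invr_gt0.
have Bf : B y t \is a fin_num.
  rewrite ge0_fin_numE ?B_lty//.
  by apply: esum_ge0 => m _; apply: esum_ge0 => n _; rewrite lee_fin mulr_ge0 ?expR_ge0.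
have := thetaE x y0 ti0; rewrite B_sym// C_sym// -thetaE// => /(congr1 (fun u => (u - B y t)%E)).
rewrite !addeK// => E1.
have f1 : theta x y t \is a fin_num.
  by rewrite ge0_fin_numE ?theta_lty//; apply: esum_ge0 => n _; rewrite lee_fin expR_ge0.
have f2 : theta x y t^-1 \is a fin_num.
  by rewrite ge0_fin_numE ?theta_lty//; apply: esum_ge0 => n _; rewrite lee_fin expR_ge0.
move: E1; rewrite -(fineK f1) -(fineK f2) -!EFinM => -[E1].
congr EFin; have s0 : Num.sqrt (t^-1 / y) != 0 by rewrite gt_eqF// sqrtr_gt0 divr_gt0.
apply: (mulfI s0); rewrite E1 mulrA; congr (_ * _).
rewrite (_ : t / y = t ^+ 2 * (t^-1 / y)); last by field; rewrite ?gt_eqF.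
by rewrite sqrtrM ?sqr_ge0// sqrtr_sqr gtr0_norm// mulrC.
Qed.

End Theta2.

(** * Complex-valued integrals *)

Section ComplexBasics.
Context (R : realType).
Local Notation C := R[i].
Local Notation Re := (@complex.Re R).
Local Notation Im := (@complex.Im R).
Local Notation normc := (@Normc.normc R).
Implicit Types (z w : C) (r : R).

Lemma ReD z w : Re (z + w) = Re z + Re w. Proof. by case: z w => [? ?] [? ?]. Qed.
Lemma ImD z w : Im (z + w) = Im z + Im w. Proof. by case: z w => [? ?] [? ?]. Qed.
Lemma ReN z : Re (- z) = - Re z. Proof. by case: z. Qed.
Lemma ImN z : Im (- z) = - Im z. Proof. by case: z. Qed.
Lemma ReM z w : Re (z * w) = Re z * Re w - Im z * Im w.
Proof. by case: z w => [? ?] [? ?]. Qed.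
Lemma ImM z w : Im (z * w) = Re z * Im w + Im z * Re w.
Proof. by case: z w => [? ?] [? ?]. Qed.

Lemma ReMr z r : Re (z * r%:C) = Re z * r.
Proof. by rewrite ReM/= mulr0 subr0. Qed.
Lemma ImMr z r : Im (z * r%:C) = Im z * r.
Proof. by rewrite ImM/= mulr0 add0r. Qed.

Lemma complex_eq z w : Re z = Re w -> Im z = Im w -> z = w.
Proof. by case: z w => [? ?] [? ?] /= -> ->. Qed.

Lemma normc_def z : normc z = Num.sqrt (Re z ^+ 2 + Im z ^+ 2).
Proof. by case: z. Qed.

Lemma normc_ge0 z : 0 <= normc z.
Proof. by rewrite normc_def sqrtr_ge0. Qed.

Lemma normc_sqr z : normc z ^+ 2 = Re z ^+ 2 + Im z ^+ 2.
Proof. by rewrite normc_def sqr_sqrtr// addr_ge0// sqr_ge0. Qed.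

Lemma normcE z : `|z| = (normc z)%:C. Proof. by []. Qed.

Lemma le_normcD z w : normc (z + w) <= normc z + normc w.
Proof. by have := ler_normD z w; rewrite !normcE -rmorphD lecR. Qed.

Lemma normcN z : normc (- z) = normc z.
Proof. by rewrite !normc_def ReN ImN !sqrrN. Qed.

Lemma le_normcB z w : normc (z - w) <= normc z + normc w.
Proof. by rewrite -(normcN w) le_normcD. Qed.

Lemma normcB z w : normc (z - w) = normc (w - z).
Proof. by rewrite -normcN opprB. Qed.

Lemma normc_real r : normc r%:C = `|r|.
Proof. by rewrite normc_def /= expr0n addr0 sqrtr_sqr. Qed.

Lemma normc_i : normc 'i = 1.
Proof. by rewrite normc_def /= expr0n add0r expr1n sqrtr1. Qed.

Lemma le_Re_normc z : `|Re z| <= normc z.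
Proof.
by rewrite -(@ler_pXn2r _ 2)// ?nnegrE ?normc_ge0// normc_sqr real_normK ?num_real// lerDl sqr_ge0.
Qed.

Lemma le_Im_normc z : `|Im z| <= normc z.
Proof.
by rewrite -(@ler_pXn2r _ 2)// ?nnegrE ?normc_ge0// normc_sqr real_normK ?num_real// lerDr sqr_ge0.
Qed.

Lemma normc_le_ReIm z : normc z <= `|Re z| + `|Im z|.
Proof.
rewrite -(@ler_pXn2r _ 2)// ?nnegrE ?normc_ge0 ?addr_ge0// normc_sqr sqrrD.
by rewrite !real_normK ?num_real// lerD2r lerDl mulrn_wge0// mulr_ge0.
Qed.

Lemma normcX z n : normc (z ^+ n) = normc z ^+ n.
Proof. by elim: n => [|n IH]; rewrite ?expr0 ?Normc.normc1// !exprS Normc.normcM IH. Qed.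

Lemma expcD z w : expc (z + w) = expc z * expc w.
Proof.
rewrite /expc ReD ImD; apply: complex_eq.
  by rewrite !ReM !ImM /= expRD cosD; ring.
by rewrite !(ReM, ImM) /= expRD sinD; ring.
Qed.

Lemma Re_expc z : Re (expc z) = expR (Re z) * cos (Im z).
Proof. by rewrite /expc ReM /= mul0r subr0. Qed.

Lemma Im_expc z : Im (expc z) = expR (Re z) * sin (Im z).
Proof. by rewrite /expc ImM /= mul0r addr0. Qed.

Lemma normc_expc z : normc (expc z) = expR (Re z).
Proof.
rewrite normc_def Re_expc Im_expc !exprMn -mulrDr cos2Dsin2 mulr1.
by rewrite sqrtr_sqr ger0_norm// expR_ge0.
Qed.

Lemma expc0 : expc (0 : C) = 1.
Proof. by apply: complex_eq; rewrite ?Re_expc ?Im_expc /= expR0 ?cos0 ?sin0 mul1r. Qed.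

Lemma expc_real r : expc r%:C = (expR r)%:C.
Proof. by apply: complex_eq; rewrite ?Re_expc ?Im_expc /= ?cos0 ?sin0 ?mulr1 ?mulr0. Qed.

End ComplexBasics.

#[local] Arguments Normc.normc : simpl never.

Section ComplexIntegral.
Context (R : realType).
Local Notation C := R[i].
Local Notation Re := (@complex.Re R).
Local Notation Im := (@complex.Im R).
Local Notation normc := (@Normc.normc R).

Section general.
Context d (T : measurableType d) (mu : {measure set T -> \bar R}) (D : set T)
  (mD : measurable D).
Implicit Types f g : T -> C.

Definition cmeasurable f :=
  measurable_fun D (fun t => Re (f t)) /\ measurable_fun D (fun t => Im (f t)).

Definition cintegrable f :=
  mu.-integrable D (EFin \o (fun t => Re (f t))) /\
  mu.-integrable D (EFin \o (fun t => Im (f t))).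

Lemma integrable_mull (c : R) (h : T -> R) : mu.-integrable D (EFin \o h) ->
  mu.-integrable D (EFin \o (fun t => c * h t)).
Proof.
move=> hi; rewrite (_ : _ \o _ = (fun t => c%:E * (h t)%:E)%E)//.
exact: (integrableZl mD c hi).
Qed.

Lemma cintegrable_measurable f : cintegrable f -> cmeasurable f.
Proof.
by move=> [/measurable_int/measurable_EFinP h1 /measurable_int/measurable_EFinP h2].
Qed.

Lemma cmeasurableD f g : cmeasurable f -> cmeasurable g -> cmeasurable (fun t => f t + g t).
Proof.
move=> [f1 f2] [g1 g2]; split.
  by under eq_fun do rewrite ReD; exact: measurable_funD.
by under eq_fun do rewrite ImD; exact: measurable_funD.
Qed.

Lemma cmeasurableM f g : cmeasurable f -> cmeasurable g -> cmeasurable (fun t => f t * g t).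
Proof.
move=> [f1 f2] [g1 g2]; split.
  under eq_fun do rewrite ReM.
  by apply: measurable_funB; exact: measurable_funM.
under eq_fun do rewrite ImM.
by apply: measurable_funD; exact: measurable_funM.
Qed.

Lemma cmeasurable_cst (c : C) : cmeasurable (fun=> c).
Proof. by split; exact: measurable_cst. Qed.

Lemma cmeasurable_real (f : T -> R) : measurable_fun D f -> cmeasurable (fun t => (f t)%:C).
Proof. by move=> mf; split => //; exact: measurable_cst. Qed.

Lemma cmeasurable_normc f : cmeasurable f -> measurable_fun D (fun t => normc (f t)).
Proof.
move=> [f1 f2]; under eq_fun do rewrite normc_def.
apply: measurableT_comp.
  by apply: continuous_measurable_fun; exact: sqrt_continuous.
by apply: measurable_funD; apply: measurable_funX.
Qed.

Lemma cintegrable_le f (g : T -> R) : cmeasurable f ->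
  mu.-integrable D (EFin \o g) -> (forall t, D t -> normc (f t) <= g t) -> cintegrable f.
Proof.
move=> [f1 f2] ig fg; split; apply: (le_integrable mD _ _ ig).
- exact/measurable_EFinP.
- move=> t Dt /=; rewrite lee_fin (le_trans (le_Re_normc _))//.
  by rewrite (le_trans (fg _ Dt))// ler_norm.
- exact/measurable_EFinP.
- move=> t Dt /=; rewrite lee_fin (le_trans (le_Im_normc _))//.
  by rewrite (le_trans (fg _ Dt))// ler_norm.
Qed.

Lemma cintegrable_normc f : cintegrable f ->
  mu.-integrable D (EFin \o (fun t => normc (f t))).
Proof.
move=> [f1 f2]; have [m1 m2] := cintegrable_measurable (conj f1 f2).
apply: (@le_integrable _ _ _ mu _ mD _
   (fun t => (`|Re (f t)|)%:E + (`|Im (f t)|)%:E)%E).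
- by apply/measurable_EFinP; apply: cmeasurable_normc; split.
- move=> t Dt /=; rewrite lee_fin ger0_norm ?normc_ge0//.
  by rewrite (le_trans (normc_le_ReIm _))// ler_norm.
- by apply: integrableD => //; exact: integrable_norm.
Qed.

Lemma cintegrableD f g : cintegrable f -> cintegrable g -> cintegrable (fun t => f t + g t).
Proof.
move=> [f1 f2] [g1 g2]; split.
  rewrite (_ : _ \o _ = (EFin \o (fun t => Re (f t))) \+ (EFin \o (fun t => Re (g t)))).
    exact: integrableD.
  by apply/funext => t /=; rewrite ReD.
rewrite (_ : _ \o _ = (EFin \o (fun t => Im (f t))) \+ (EFin \o (fun t => Im (g t)))).
  exact: integrableD.
by apply/funext => t /=; rewrite ImD.
Qed.

Lemma cintegralD f g : cintegrable f -> cintegrable g ->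
  cintegral mu D (fun t => f t + g t) = cintegral mu D f + cintegral mu D g.
Proof.
move=> [f1 f2] [g1 g2]; apply: complex_eq => /=.
  by under eq_Rintegral do rewrite ReD; exact: RintegralD.
by under eq_Rintegral do rewrite ImD; exact: RintegralD.
Qed.

Lemma cintegrableZ (c : C) f : cintegrable f -> cintegrable (fun t => c * f t).
Proof.
move=> fi; apply: (@cintegrable_le _ (fun t => normc c * normc (f t))).
- by apply: cmeasurableM; [exact: cmeasurable_cst|exact: cintegrable_measurable].
- rewrite (_ : _ \o _ = (fun t => (normc c)%:E * (normc (f t))%:E)%E)//.
  by apply: integrableZl => //; exact: (cintegrable_normc fi).
- by move=> t _; rewrite Normc.normcM.
Qed.

Lemma cintegralZ (c : C) f : cintegrable f ->
  cintegral mu D (fun t => c * f t) = c * cintegral mu D f.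
Proof.
move=> [f1 f2].
have ZI (r : R) (h : T -> R) : mu.-integrable D (EFin \o h) ->
    mu.-integrable D (EFin \o (fun t => r * h t)).
  move=> hi; rewrite (_ : _ \o _ = (fun t => r%:E * (h t)%:E)%E)//.
  exact: (integrableZl mD r hi).
apply: complex_eq => /=; rewrite ?ReM ?ImM/=.
  under eq_Rintegral do rewrite ReM.
  rewrite RintegralB ?RintegralZl//; exact: ZI.
under eq_Rintegral do rewrite ImM.
rewrite RintegralD ?RintegralZl//; exact: ZI.
Qed.

Lemma cintegralN f : cintegrable f ->
  cintegral mu D (fun t => - f t) = - cintegral mu D f.
Proof.
move=> fi; rewrite -mulN1r -cintegralZ//.
by congr (cintegral _ _ _); apply/funext => t; rewrite mulN1r.
Qed.

Lemma cintegrableN f : cintegrable f -> cintegrable (fun t => - f t).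
Proof.
move=> fi; rewrite (_ : (fun t => _) = (fun t => -1 * f t)); first exact: cintegrableZ.
by apply/funext => t; rewrite mulN1r.
Qed.

Lemma cintegralB f g : cintegrable f -> cintegrable g ->
  cintegral mu D (fun t => f t - g t) = cintegral mu D f - cintegral mu D g.
Proof.
move=> fi gi; rewrite -(cintegralN gi) -cintegralD//; exact: cintegrableN.
Qed.

Lemma cintegrableB f g : cintegrable f -> cintegrable g -> cintegrable (fun t => f t - g t).
Proof. by move=> fi gi; apply: cintegrableD => //; exact: cintegrableN. Qed.

Lemma eq_cintegral f g : (forall t, D t -> f t = g t) ->
  cintegral mu D f = cintegral mu D g.
Proof.
by move=> fg; apply: complex_eq => /=; apply: eq_Rintegral => t /set_mem Dt; rewrite fg.
Qed.

(** The factor 2 comes from bounding the real and imaginary parts separately. *)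
Lemma normc_cintegral_le f (g : T -> R) : cmeasurable f ->
  mu.-integrable D (EFin \o g) -> (forall t, D t -> normc (f t) <= g t) ->
  normc (cintegral mu D f) <= 2 * \int[mu]_(t in D) g t.
Proof.
move=> mf ig fg; have [f1 f2] := cintegrable_le mf ig fg.
apply: le_trans (normc_le_ReIm _) _ => /=.
rewrite mulr2n mulrDl mul1r; apply: lerD.
- apply: le_trans (le_normr_Rintegral mD f1) _.
  apply: le_Rintegral => //; first exact: integrable_norm.
  by move=> t Dt; rewrite (le_trans (le_Re_normc _))// fg.
- apply: le_trans (le_normr_Rintegral mD f2) _.
  apply: le_Rintegral => //; first exact: integrable_norm.
  by move=> t Dt; rewrite (le_trans (le_Im_normc _))// fg.
Qed.

Lemma cintegral_dominated (f_ : nat -> T -> C) f (g : T -> R) :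
  (forall n, cmeasurable (f_ n)) -> cmeasurable f ->
  (forall t, D t -> Re (f_ n t) @[n --> \oo] --> Re (f t)) ->
  (forall t, D t -> Im (f_ n t) @[n --> \oo] --> Im (f t)) ->
  mu.-integrable D (EFin \o g) -> (forall n t, D t -> normc (f_ n t) <= g t) ->
  Re (cintegral mu D (f_ n)) @[n --> \oo] --> Re (cintegral mu D f) /\
  Im (cintegral mu D (f_ n)) @[n --> \oo] --> Im (cintegral mu D f).
Proof.
move=> mf_ mf fRe fIm ig fg.
have real_dom (h_ : nat -> T -> R) (h : T -> R) :
    (forall n, measurable_fun D (h_ n)) -> measurable_fun D h ->
    (forall t, D t -> h_ n t @[n --> \oo] --> h t) ->
    (forall n t, D t -> `|h_ n t| <= g t) ->
    (\int[mu]_(t in D) h_ n t) @[n --> \oo] --> \int[mu]_(t in D) h t.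
  move=> mh_ mh hh hg.
  have [] := @dominated_convergence _ _ _ mu D mD (fun n t => (h_ n t)%:E)
    (fun t => (h t)%:E) (EFin \o g).
  - by move=> n; apply/measurable_EFinP.
  - exact/measurable_EFinP.
  - apply: aeW => t Dt; apply: cvg_EFin; last exact: hh.
    by apply: nearW => n.
  - exact: ig.
  - by apply: aeW => t n Dt /=; rewrite lee_fin hg.
  move=> ih _ hcv; apply: fine_cvg; rewrite fineK//.
  exact: integrable_fin_num.
split => /=; apply: real_dom.
- by move=> n; exact: (mf_ n).1.
- exact: mf.1.
- exact: fRe.
- by move=> n t Dt; rewrite (le_trans (le_Re_normc _))// fg.
- by move=> n; exact: (mf_ n).2.
- exact: mf.2.
- exact: fIm.
- by move=> n t Dt; rewrite (le_trans (le_Im_normc _))// fg.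
Qed.

End general.

Section fubini.
Context d1 d2 (T1 : measurableType d1) (T2 : measurableType d2).
Context (m1 : {sigma_finite_measure set T1 -> \bar R})
  (m2 : {sigma_finite_measure set T2 -> \bar R}).

(** The inner extended integral is known to be finite almost everywhere; passing to its [fine] value
    changes it on a null set at most. *)
Let rfubini1 (f : T1 * T2 -> R) : (m1 \x m2)%E.-integrable setT (EFin \o f) ->
  m1.-integrable setT (EFin \o (fun x => \int[m2]_y f (x, y))) /\
  \int[m1]_x (\int[m2]_y f (x, y)) = \int[(m1 \x m2)%E]_z f z.
Proof.
move=> fi.
have mF := measurable_fubini_F fi.
have iF := integrable_fubini_F fi.
have mR : measurable_fun setT (EFin \o (fun x => \int[m2]_y f (x, y))).
  by apply/measurable_EFinP; exact: measurableT_comp mF.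
have E : ae_eq m1 setT (fubini_F m2 (EFin \o f)) (EFin \o (fun x => \int[m2]_y f (x, y))).
  have := integrable_ae measurableT iF; apply: filterS => x /= h _.
  by rewrite fineK// h.
split.
  apply: (le_integrable measurableT mR _ iF) => x _ /=.
  rewrite /Rintegral /fubini_F /=; case: (integral _ _ _) => [r||]//=.
    by rewrite normr0 leey.
  by rewrite normr0 leey.
congr fine; rewrite -(integral12_prod_meas1 fi).
by apply/esym; apply: ae_eq_integral.
Qed.

Let rfubini2 (f : T1 * T2 -> R) : (m1 \x m2)%E.-integrable setT (EFin \o f) ->
  \int[m2]_y (\int[m1]_x f (x, y)) = \int[(m1 \x m2)%E]_z f z.
Proof.
move=> fi.
have mG := measurable_fubini_G fi.
have E : ae_eq m2 setT (fubini_G m1 (EFin \o f)) (EFin \o (fun y => \int[m1]_x f (x, y))).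
  have := ae_integrable2 fi; apply: filterS => y /= h _.
  by rewrite /fubini_G/= fineK//; exact: integrable_fin_num.
congr fine; rewrite -(integral21_prod_meas1 fi).
apply/esym; apply: ae_eq_integral => //.
by apply/measurable_EFinP; exact: measurableT_comp mG.
Qed.

Lemma cfubini (f : T1 * T2 -> C) : cintegrable (m1 \x m2)%E setT f ->
  cintegrable m1 setT (fun x => cintegral m2 setT (fun y => f (x, y))) /\
  cintegral m1 setT (fun x => cintegral m2 setT (fun y => f (x, y))) =
  cintegral m2 setT (fun y => cintegral m1 setT (fun x => f (x, y))).
Proof.
move=> [f1 f2]; have [i1 e1] := rfubini1 f1; have [i2 e2] := rfubini1 f2.
split; first by split.
by apply: complex_eq => /=; [rewrite e1 (rfubini2 f1)|rewrite e2 (rfubini2 f2)].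
Qed.

End fubini.
End ComplexIntegral.

(** * Changes of variables for signed and complex integrands *)

Section ChangeOfVariablesSigned.
Context (R : realType).
Local Notation leb := (@lebesgue_measure R).
Local Notation C := R[i].
Local Notation Re := (@complex.Re R).
Local Notation Im := (@complex.Im R).

Lemma integral_shift (r : R) (f : R -> \bar R) : measurable_fun setT f ->
  (\int[leb]_x f (x + r)%R = \int[leb]_x f x)%E.
Proof.
move=> mf; rewrite integralE [RHS]integralE; congr (_ - _)%E.
- rewrite -(ge0_integral_shift r (measurable_funepos mf))//.
  by apply: eq_integral => x _; rewrite !funeposE.
- rewrite -(ge0_integral_shift r (measurable_funeneg mf))//.
  by apply: eq_integral => x _; rewrite !funenegE.
Qed.

Lemma integral_opp (f : R -> \bar R) : measurable_fun setT f ->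
  (\int[leb]_x f (- x)%R = \int[leb]_x f x)%E.
Proof.
move=> mf; rewrite integralE [RHS]integralE; congr (_ - _)%E.
- rewrite -(ge0_integral_opp (measurable_funepos mf))//.
  by apply: eq_integral => x _; rewrite !funeposE.
- rewrite -(ge0_integral_opp (measurable_funeneg mf))//.
  by apply: eq_integral => x _; rewrite !funenegE.
Qed.

Lemma integral_scale (r : R) (f : R -> \bar R) : 0 < r -> measurable_fun setT f ->
  (\int[leb]_x (r%:E * f (r * x)%R) = \int[leb]_x f x)%E.
Proof.
move=> r0 mf; rewrite integralE [RHS]integralE; congr (_ - _)%E.
- rewrite -(ge0_integral_scale r0 (measurable_funepos mf))//.
  by apply: eq_integral => x _; rewrite !funeposE [RHS]maxeMr ?mule0// lee_fin ltW.
- rewrite -(ge0_integral_scale r0 (measurable_funeneg mf))//.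
  by apply: eq_integral => x _; rewrite !funenegE [RHS]maxeMr ?mule0 ?muleN// lee_fin ltW.
Qed.

Lemma integral_expR (f : R -> \bar R) : measurable_fun setT f ->
  (\int[leb]_(x in `]0%R, +oo[) ((x^-1)%:E * f (ln x)) = \int[leb]_x f x)%E.
Proof.
move=> mf; rewrite integralE [RHS]integralE; congr (_ - _)%E.
- rewrite -(ge0_integral_expR (measurable_funepos mf))//.
  apply: eq_integral => x /set_mem; rewrite /= in_itv/= andbT => x0.
  by rewrite !funeposE [RHS]maxeMr ?mule0// lee_fin invr_ge0 ltW.
- rewrite -(ge0_integral_expR (measurable_funeneg mf))//.
  apply: eq_integral => x /set_mem; rewrite /= in_itv/= andbT => x0.
  by rewrite !funenegE [RHS]maxeMr ?mule0 ?muleN// lee_fin invr_ge0 ltW.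
Qed.

Lemma cintegral_shift (r : R) (f : R -> C) : cmeasurable setT f ->
  cintegral leb setT (fun x => f (x + r)) = cintegral leb setT f.
Proof.
move=> [f1 f2]; apply: complex_eq => /=; congr fine.
  by apply: (integral_shift r (f := fun x => (Re (f x))%:E)); exact/measurable_EFinP.
by apply: (integral_shift r (f := fun x => (Im (f x))%:E)); exact/measurable_EFinP.
Qed.

Lemma cintegral_opp (f : R -> C) : cmeasurable setT f ->
  cintegral leb setT (fun x => f (- x)) = cintegral leb setT f.
Proof.
move=> [f1 f2]; apply: complex_eq => /=; congr fine.
  by apply: (integral_opp (f := fun x => (Re (f x))%:E)); exact/measurable_EFinP.
by apply: (integral_opp (f := fun x => (Im (f x))%:E)); exact/measurable_EFinP.
Qed.

Lemma cintegral_expR (f : R -> C) : cmeasurable setT f ->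
  cintegral leb `]0, +oo[ (fun y => f (ln y) * (y^-1)%:C) = cintegral leb setT f.
Proof.
move=> [f1 f2]; apply: complex_eq => /=; congr fine.
  rewrite -(integral_expR (f := fun x => (Re (f x))%:E)); last exact/measurable_EFinP.
  by apply: eq_integral => x _; rewrite -EFinM ReM /= mulr0 subr0 mulrC.
rewrite -(integral_expR (f := fun x => (Im (f x))%:E)); last exact/measurable_EFinP.
by apply: eq_integral => x _; rewrite -EFinM ImM /= mulr0 add0r mulrC.
Qed.

Lemma integrable_opp (f : R -> R) : leb.-integrable setT (EFin \o f) ->
  leb.-integrable setT (EFin \o (fun x => f (- x))).
Proof.
move=> /integrableP[mf fi]; apply/integrableP; split.
  by apply: (measurableT_comp mf); exact: measurable_funN.
rewrite (integral_opp (f := fun x => `|(f x)%:E|%E))//.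
exact: measurableT_comp.
Qed.

End ChangeOfVariablesSigned.


(** * The Cauchy kernel and the Laplace kernel *)

Section Kernels.
Context (R : realType).
Local Notation leb := (@lebesgue_measure R).

Definition cauchy_ker (v : R) : R := (1 + v ^+ 2)^-1.

Lemma cauchy_ker_gt0 v : 0 < cauchy_ker v.
Proof. by rewrite invr_gt0 ltr_pwDl// sqr_ge0. Qed.

Lemma continuous_cauchy_ker : continuous cauchy_ker.
Proof. exact: (@continuous_oneDsqrV R). Qed.

Lemma measurable_cauchy_ker : measurable_fun setT cauchy_ker.
Proof. by apply: continuous_measurable_fun; exact: continuous_cauchy_ker. Qed.

Lemma integral_cauchy_ker : (\int[leb]_v (cauchy_ker v)%:E = (pi)%:E)%E.
Proof.
rewrite ge0_symfun_integralT; last 3 first.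
- by move=> x; rewrite ltW// cauchy_ker_gt0.
- exact: continuous_cauchy_ker.
- by move=> x; rewrite /cauchy_ker/= sqrrN.
rewrite (_ : [set x | _] = `[0%R, +oo[%classic); last first.
  by apply/seteqP; split => x /=; rewrite in_itv/= andbT.
transitivity (2%:E * \int[leb]_(x in `[0%R, +oo[) ((@oneDsqr R x)^-1)%:E)%E => //.
rewrite integral0y_oneDsqr.
by rewrite -EFinM; congr EFin; field.
Qed.

Lemma Rintegral_cauchy_ker : \int[leb]_v cauchy_ker v = pi.
Proof. by rewrite /Rintegral integral_cauchy_ker. Qed.

Lemma integrable_cauchy_ker : leb.-integrable setT (EFin \o cauchy_ker).
Proof.
apply/integrableP; split; first by apply/measurable_EFinP; exact: measurable_cauchy_ker.
under eq_integral => x _ do rewrite /= ger0_norm ?(ltW (cauchy_ker_gt0 _))//.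
by rewrite integral_cauchy_ker ltry.
Qed.

(** In the applications [f] depends on |x|; [g] is the expression without absolute value with which
    it agrees for x >= 0, so that the primitive [F] is differentiable at 0 as well. *)
Let even_FTC (f g F : R -> R) (l : R) : (forall x, 0 <= f x) -> continuous f ->
  f =1 f \o -%R -> F x @[x --> +oo%R] --> l ->
  (forall x : R, is_derive x (1 : R) F (g x)) -> (forall x, 0 <= x -> f x = g x) ->
  (\int[leb]_x (f x)%:E = (2 * (l - F 0))%:E)%E.
Proof.
move=> f0 cf ef Fl dF fg.
rewrite ge0_symfun_integralT// (_ : [set x | _] = `[0%R, +oo[%classic); last first.
  by apply/seteqP; split => x /=; rewrite in_itv/= andbT.
rewrite (@ge0_continuous_FTC2y _ f F 0 l)//.
- exact: continuous_subspaceT.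
- apply: cvg_at_right_filter; apply: differentiable_continuous.
  by apply/derivable1_diffP; exact: ex_derive.
- move=> x; rewrite in_itv/= andbT => x0.
  by rewrite fg ?(ltW x0)// derive1E; exact: derive_val.
Qed.

Section laplace.
Variables (k : R) (k0 : 0 < k).

Let cvg_decay : expR (- (k * x)) @[x --> +oo%R] --> (0 : R).
Proof.
have H := @cvgr_expR R.
apply: (@cvg_comp _ _ _ (fun x => k * x) (fun x => expR (- x)) _ (pinfty_nbhs R)) => //.
exact: gt0_cvgMry.
Qed.

Let ker (x : R) := expR (- (k * `|x|)).

Let cker : continuous ker.
Proof.
move=> x; apply: continuous_comp; last exact: continuous_expR.
apply: continuousN; apply: continuousM; [exact: cst_continuous|exact: norm_continuous].
Qed.

Let integral_ker : (\int[leb]_x (ker x)%:E = (2 / k)%:E)%E.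
Proof.
have dF (x : R) : is_derive x (1 : R) (fun x => - (expR (- (k * x)) / k)) (expR (- (k * x))).
  rewrite ?/F; apply: is_derive_eq; rewrite ?scaler0 ?addr0 ?add0r ?mulr1 /GRing.scale/=.
  by field; rewrite gt_eqF.
rewrite (even_FTC (l := - (0 / k)) _ cker _ _ dF); last first.
- by move=> x x0; rewrite /ker ger0_norm.
- apply: cvgN; apply: cvgM cvg_decay _; exact: cvg_cst.
- by move=> x; rewrite /ker/= normrN.
- by move=> x; exact: expR_ge0.
by rewrite mulr0 oppr0 expR0; congr EFin; field; rewrite gt_eqF.
Qed.

Lemma integrable_laplace : leb.-integrable setT (EFin \o (fun x => expR (- (k * `|x|)))).
Proof.
apply/integrableP; split.
  by apply/measurable_EFinP; exact: continuous_measurable_fun.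
under eq_integral => x _ do rewrite /= ger0_norm//.
by rewrite integral_ker ltry.
Qed.

(** [F] is a primitive of exp (- k x) (1 + cos (v x)): the summand 1 makes the integrand
    nonnegative, as [even_FTC] demands, and its contribution 2 / k is subtracted at the end. *)
Lemma integral_laplace_cos v :
  \int[leb]_x (expR (- (k * `|x|)) * cos (v * x)) = 2 * k / (k ^+ 2 + v ^+ 2).
Proof.
have kv : k ^+ 2 + v ^+ 2 != 0 by rewrite gt_eqF// ltr_pwDl ?exprn_gt0// sqr_ge0.
pose F x := - (expR (- (k * x)) / k) +
  expR (- (k * x)) * (v * sin (v * x) - k * cos (v * x)) / (k ^+ 2 + v ^+ 2).
have dF (x : R) : is_derive x (1 : R) F (expR (- (k * x)) * (1 + cos (v * x))).
  rewrite ?/F; apply: is_derive_eq; rewrite ?scaler0 ?addr0 ?add0r ?mulr1 /GRing.scale/=.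
  by field; rewrite kv gt_eqF.
have F0 : F x @[x --> +oo%R] --> (0 : R).
  have F1 : - (expR (- (k * x)) / k) @[x --> +oo%R] --> (0 : R).
    rewrite -[X in _ --> X]oppr0 -[X in _ --> - X](mul0r k^-1).
    by apply: cvgN; apply: cvgM cvg_decay _; exact: cvg_cst.
  have F2 : expR (- (k * x)) * (v * sin (v * x) - k * cos (v * x)) @[x --> +oo%R] --> (0 : R).
    apply: norm_cvg0.
    apply: (@squeeze_cvgr _ _ _ _ (fun=> 0) (fun x => expR (- (k * x)) * (`|v| + k))).
    - apply: nearW => x; rewrite normr_ge0/= normrM ger0_norm ?expR_ge0// ler_pM2l ?expR_gt0//.
      rewrite (le_trans (ler_normB _ _))// !normrM (gtr0_norm k0); apply: lerD.
        by rewrite ler_piMr// ler_norml sin_geN1 sin_le1.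
      by rewrite ler_piMr ?(ltW k0)// ler_norml cos_geN1 cos_le1.
    - exact: cvg_cst.
    - rewrite -[X in _ --> X](mul0r (`|v| + k)).
      by apply: cvgM; [exact: cvg_decay|exact: cvg_cst].
  have F3 : expR (- (k * x)) * (v * sin (v * x) - k * cos (v * x)) / (k ^+ 2 + v ^+ 2)
      @[x --> +oo%R] --> (0 : R).
    rewrite -[X in _ --> X](mul0r (k ^+ 2 + v ^+ 2)^-1).
    by apply: cvgM F2 _; exact: cvg_cst.
  by rewrite -[X in _ --> X](addr0 (0 : R)); exact: (cvgD F1 F3).
have ck : continuous (fun x => ker x * cos (v * x)).
  move=> x; apply: continuousM; first exact: cker.
  apply: continuous_comp; last exact: continuous_cos.
  by apply: continuousM; [exact: cst_continuous|exact: cvg_id].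
have I1 : (\int[leb]_x (ker x * (1 + cos (v * x)))%:E = (2 * (0 - F 0))%:E)%E.
  apply: even_FTC F0 dF _.
  - by move=> x; rewrite mulr_ge0 ?expR_ge0// -lerBlDl sub0r cos_geN1.
  - under [X in continuous X]eq_fun do rewrite mulrDr mulr1.
    by move=> x; apply: continuousD; [exact: cker|exact: ck].
  - by move=> x; rewrite /ker/= normrN mulrN cosN.
  - by move=> x x0; rewrite /ker ger0_norm.
have iker := integrable_laplace.
have icos : leb.-integrable setT (EFin \o (fun x => ker x * cos (v * x))).
  apply: (le_integrable measurableT _ _ iker).
    by apply/measurable_EFinP; exact: continuous_measurable_fun.
  move=> x _ /=; rewrite lee_fin normrM ler_piMr// ler_norml cos_geN1 cos_le1//.
have : \int[leb]_x (ker x * (1 + cos (v * x))) = 2 * (0 - F 0) by rewrite /Rintegral I1.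
under eq_Rintegral do rewrite mulrDr mulr1.
rewrite RintegralD// {1}/Rintegral integral_ker /= => E.
rewrite -[LHS](addKr (2 / k)) E /F !mulr0 sin0 cos0 oppr0 expR0.
by field; rewrite kv gt_eqF.
Qed.

End laplace.
End Kernels.

(** * Shifting vertical line integrals *)

Section ComplexDerivative.
Context (R : realType).
Local Notation C := R[i].
Local Notation Re := (@complex.Re R).
Local Notation Im := (@complex.Im R).
Local Notation normc := (@Normc.normc R).
Local Notation leb := (@lebesgue_measure R).
Implicit Types (f : C -> C) (s d : C).

(** Differentiability as a first-order expansion with real radius and real error, the form in which
    Goursat's argument uses it. *)
Definition cderiv f s d := forall e : R, 0 < e -> exists2 r : R, 0 < r &
  forall h : C, normc h < r -> normc (f (s + h) - f s - d * h) <= e * normc h.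

Lemma gt0_complex (z : C) : 0 < z -> z = (Re z)%:C /\ 0 < Re z.
Proof.
by case: z => a b; rewrite ltcE/= => /andP[/eqP -> a0].
Qed.

Lemma derivable_cderiv f s : derivable (f : C^o -> C^o) s 1 -> exists d, cderiv f s d.
Proof.
move=> /cvg_ex[/= l fl]; exists l => e e0.
have e0' : 0 < e%:C :> C by rewrite ltcR.
have /cvgrPdist_le /(_ _ e0') := fl.
move=> /nbhs_ballP[/= d d0 dP].
have [dE d0'] := gt0_complex d0.
exists (Re d) => // h hd.
have [->|h0] := eqVneq h 0.
  by rewrite addr0 subrr mulr0 subr0 Normc.normc0 mulr0.
have : ball (0 : C^o) d h.
  by rewrite /ball/= sub0r normrN dE normcE ltcR.
move=> /dP /(_ h0); rewrite /= normcE lecR /GRing.scale/= mulr1 [h + s]addrC => le.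
have -> : f (s + h) - f s - l * h = - (l - h^-1 * (f (s + h) - f s)) * h.
  by rewrite mulNr mulrBl opprB mulrAC mulVf// mul1r.
by rewrite Normc.normcM normcN ler_wpM2r// normc_ge0.
Qed.

Lemma cderiv_continuous f s d : cderiv f s d -> forall e : R, 0 < e ->
  exists2 r : R, 0 < r & forall h : C, normc h < r -> normc (f (s + h) - f s) <= e.
Proof.
move=> fd e e0; have [r r0 rP] := fd 1 ltr01.
have d0 : 0 < 1 + normc d by rewrite ltr_pwDl// normc_ge0.
exists (Num.min r (e / (1 + normc d))); first by rewrite lt_min r0 divr_gt0.
move=> h; rewrite lt_min => /andP[hr he].
rewrite -[_ - _](subrK (d * h)) (le_trans (le_normcD _ _))//.
rewrite (le_trans (lerD (rP _ hr) (lexx _)))// Normc.normcM -mulrDl mulrC.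
by rewrite -ler_pdivlMr// ltW.
Qed.

Definition ccontinuous_at (g : R -> C) (x : R) :=
  {for x, continuous (fun x => Re (g x))} /\ {for x, continuous (fun x => Im (g x))}.

Lemma ccontinuous_atP (g : R -> C) x :
  (forall e : R, 0 < e -> exists2 r : R, 0 < r &
    forall h : R, `|h| < r -> normc (g (x + h) - g x) <= e) -> ccontinuous_at g x.
Proof.
move=> gP; split; apply/cvgrPdist_le => e e0; have [r r0 rP] := gP _ e0;
  apply/nbhs_ballP; exists r => //= y; rewrite /ball/= => xy.
- have := rP (y - x); rewrite distrC xy => /(_ isT).
  rewrite addrCA subrr addr0 => /(le_trans (le_Re_normc _)).
  by rewrite ReD ReN distrC.
- have := rP (y - x); rewrite distrC xy => /(_ isT).
  rewrite addrCA subrr addr0 => /(le_trans (le_Im_normc _)).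
  by rewrite ImD ImN distrC.
Qed.

Lemma ccontinuous_vertical f (c : R) (t : R) d : cderiv f (c +i* t) d ->
  ccontinuous_at (fun t => f (c +i* t)) t.
Proof.
move=> /cderiv_continuous fc; apply: ccontinuous_atP => e /fc[r r0 rP].
exists r => // h hr; have := rP (0 +i* h).
by rewrite normc_def/= expr0n add0r sqrtr_sqr => /(_ hr); rewrite /GRing.add/= addr0.
Qed.

Lemma ccontinuous_horizontal f (c : R) (t : R) d : cderiv f (t +i* c) d ->
  ccontinuous_at (fun t => f (t +i* c)) t.
Proof.
move=> /cderiv_continuous fc; apply: ccontinuous_atP => e /fc[r r0 rP].
exists r => // h hr; have := rP (h +i* 0).
by rewrite normc_def/= expr0n addr0 sqrtr_sqr => /(_ hr); rewrite /GRing.add/= addr0.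
Qed.

Lemma ccontinuous_cintegrable (g : R -> C) (a b : R) :
  (forall x, a <= x <= b -> ccontinuous_at g x) -> cintegrable leb `[a, b] g.
Proof.
move=> gc; split; apply: continuous_compact_integrable; try exact: segment_compact;
  by apply: continuous_in_subspaceT => x /set_mem/=; rewrite in_itv/= => /gc[].
Qed.

Lemma cintegral_itv_split (g : R -> C) (a m b : R) : a <= m <= b ->
  cintegrable leb `[a, b] g ->
  cintegral leb `[a, b] g = cintegral leb `[a, m] g + cintegral leb `[m, b] g.
Proof.
move=> /andP[am mb] [g1 g2].
have split_real (h : R -> R) : leb.-integrable `[a, b] (EFin \o h) ->
    \int[leb]_(x in `[a, b]) h x = \int[leb]_(x in `[a, m]) h x + \int[leb]_(x in `[m, b]) h x.
  move=> hi.
  have U : `[a, b]%classic = (`[a, m]%classic `|` `]m, b]%classic)%classic :> set R.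
    by rewrite -itv_bndbnd_setU// bnd_simp.
  rewrite {1}U Rintegral_setU// -?U//; last first.
    apply/disj_setPRL => x/=; rewrite !in_itv/= => /andP[mx _]; apply/negP.
    by rewrite negb_and -!ltNge mx orbT.
  congr (_ + _); rewrite Rintegral_itv_obnd_cbnd//.
  apply: (integrableS _ _ _ hi) => //.
  by apply: subset_itvr; rewrite bnd_simp.
by apply: complex_eq => /=; rewrite split_real.
Qed.

Lemma fine_lebesgue_itvcc (a b : R) : a <= b -> fine (leb `[a, b]%classic) = b - a.
Proof.
move=> ab; rewrite lebesgue_measure_itv/= lte_fin; case: ltP => //= ba.
by rewrite (@le_anti _ _ a b) ?ab// subrr.
Qed.

Lemma cintegral_itv_cst (c : C) (a b : R) : a <= b ->
  cintegral leb `[a, b] (fun=> c) = (b - a)%:C * c.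
Proof.
move=> ab; apply: complex_eq => /=; rewrite Rintegral_cst// fine_lebesgue_itvcc//.
  by rewrite ReM/= mul0r subr0 mulrC.
by rewrite ImM/= mul0r addr0 mulrC.
Qed.

Lemma normc_cintegral_itv_le (g : R -> C) (a b e : R) : a <= b ->
  cintegrable leb `[a, b] g -> (forall x, a <= x <= b -> normc (g x) <= e) ->
  normc (cintegral leb `[a, b] g) <= 2 * (e * (b - a)).
Proof.
move=> ab gi ge; have := @normc_cintegral_le R _ _ leb `[a, b] (measurable_itv _) g (fun=> e).
rewrite Rintegral_cst// fine_lebesgue_itvcc//; apply.
- exact: cintegrable_measurable gi.
- apply: continuous_compact_integrable; first exact: segment_compact.
  by apply: continuous_subspaceT => x; exact: cvg_cst.
- by move=> x /=; rewrite in_itv/=; exact: ge.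
Qed.

End ComplexDerivative.

(** * Goursat's theorem for rectangles *)

Section Goursat.
Context (R : realType).
Local Notation C := R[i].
Local Notation normc := (@Normc.normc R).
Local Notation leb := (@lebesgue_measure R).
Variables (f : C -> C) (A B : R).
Hypothesis df : forall s, A <= complex.Re s <= B -> exists d, cderiv f s d.

(** The contour integral along the boundary of [a, b] x [c, d], traversed counterclockwise. *)
Definition rect_integral (g : C -> C) (a b c d : R) : C :=
  cintegral leb `[a, b] (fun x => g (x +i* c) - g (x +i* d)) +
  'i * cintegral leb `[c, d] (fun y => g (b +i* y) - g (a +i* y)).

Lemma hol_cintegrable_vertical c a b : A <= c <= B ->
  cintegrable leb `[a, b] (fun y => f (c +i* y)).
Proof.
move=> cAB; apply: ccontinuous_cintegrable => y _.
by have [d fd] := df (s := c +i* y) cAB; exact: ccontinuous_vertical fd.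
Qed.

Lemma hol_cintegrable_horizontal c a b : A <= a -> b <= B ->
  cintegrable leb `[a, b] (fun x => f (x +i* c)).
Proof.
move=> Aa bB; apply: ccontinuous_cintegrable => x /andP[ax xb].
have xAB : A <= complex.Re (x +i* c) <= B by rewrite /= (le_trans Aa ax) (le_trans xb bB).
by have [d fd] := df xAB; exact: ccontinuous_horizontal fd.
Qed.

Let rectE a b c d : A <= a -> a <= b -> b <= B ->
  rect_integral f a b c d =
  cintegral leb `[a, b] (fun x => f (x +i* c)) - cintegral leb `[a, b] (fun x => f (x +i* d)) +
  'i * (cintegral leb `[c, d] (fun y => f (b +i* y)) -
        cintegral leb `[c, d] (fun y => f (a +i* y))).
Proof.
move=> Aa ab bB; rewrite /rect_integral !cintegralB//.
- by apply: hol_cintegrable_vertical; rewrite (le_trans Aa ab).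
- by apply: hol_cintegrable_vertical; rewrite Aa (le_trans ab bB).
- exact: hol_cintegrable_horizontal.
- exact: hol_cintegrable_horizontal.
Qed.

Let rect_hsplit a m b c d : A <= a -> a <= m <= b -> b <= B ->
  rect_integral f a b c d = rect_integral f a m c d + rect_integral f m b c d.
Proof.
move=> Aa /andP[am mb] bB.
rewrite !rectE// ?(le_trans am)// ?(le_trans Aa)// ?(le_trans mb)//.
rewrite (@cintegral_itv_split _ (fun x => f (x +i* c)) a m b) ?am//; last first.
  exact: hol_cintegrable_horizontal.
rewrite (@cintegral_itv_split _ (fun x => f (x +i* d)) a m b) ?am//; last first.
  exact: hol_cintegrable_horizontal.
by ring.
Qed.

Let rect_vsplit a b c m d : A <= a -> a <= b -> b <= B -> c <= m <= d ->
  rect_integral f a b c d = rect_integral f a b c m + rect_integral f a b m d.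
Proof.
move=> Aa ab bB /andP[cm md].
rewrite !rectE//.
rewrite (@cintegral_itv_split _ (fun y => f (b +i* y)) c m d) ?cm//; last first.
  by apply: hol_cintegrable_vertical; rewrite (le_trans Aa ab).
rewrite (@cintegral_itv_split _ (fun y => f (a +i* y)) c m d) ?cm//; last first.
  by apply: hol_cintegrable_vertical; rewrite Aa (le_trans ab bB).
by ring.
Qed.

(** If each of the four quarters carried less than a quarter of the modulus, the triangle inequality
    would fail. *)
Let quarter a b l h : A <= a -> a + l <= B -> 0 <= l -> 0 <= h ->
  exists q : R * R, [/\ a <= q.1 <= a + l / 2, b <= q.2 <= b + h / 2 &
    normc (rect_integral f a (a + l) b (b + h)) <=
    4 * normc (rect_integral f q.1 (q.1 + l / 2) q.2 (q.2 + h / 2))].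
Proof.
move=> Aa alB l0 h0; apply/not_existsP => noq.
have la : l / 2 + l / 2 = l by rewrite -splitr.
have ha : h / 2 + h / 2 = h by rewrite -splitr.
have l2 : 0 <= l / 2 by rewrite divr_ge0.
have h2 : 0 <= h / 2 by rewrite divr_ge0.
set I := rect_integral f.
have E : I a (a + l) b (b + h) =
  (I a (a + l / 2) b (b + h / 2) + I a (a + l / 2) (b + h / 2) (b + h / 2 + h / 2)) +
  (I (a + l / 2) (a + l / 2 + l / 2) b (b + h / 2) +
   I (a + l / 2) (a + l / 2 + l / 2) (b + h / 2) (b + h / 2 + h / 2)).
  rewrite -(addrA a) -(addrA b) la ha /I (@rect_hsplit a (a + l / 2) (a + l))//; last lra.
  by congr (_ + _)%R; apply: rect_vsplit => //; lra.
have lt q : a <= q.1 <= a + l / 2 -> b <= q.2 <= b + h / 2 ->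
    4 * normc (I q.1 (q.1 + l / 2) q.2 (q.2 + h / 2)) < normc (I a (a + l) b (b + h)).
  by move=> h1 h3; rewrite ltNge; apply/negP => le; apply: (noq q).
have := lt (a, b); have := lt (a, b + h / 2).
have := lt (a + l / 2, b); have := lt (a + l / 2, b + h / 2); cbn [fst snd].
have N : normc (I a (a + l) b (b + h)) <=
  (normc (I a (a + l / 2) b (b + h / 2)) + normc (I a (a + l / 2) (b + h / 2) (b + h / 2 + h / 2))) +
  (normc (I (a + l / 2) (a + l / 2 + l / 2) b (b + h / 2)) +
   normc (I (a + l / 2) (a + l / 2 + l / 2) (b + h / 2) (b + h / 2 + h / 2))).
  by rewrite E (le_trans (le_normcD _ _))// lerD// le_normcD.
clear - l2 h2 N; move: N.
move: (normc _) (normc _) (normc _) (normc _) (normc _) => n0 n1 n2 n3 n4.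
by lra.
Qed.

(** The common point is the supremum of the left ends. *)
Let nested (u : nat -> R) (l : R) : 0 <= l ->
  (forall n, u n <= u n.+1 <= u n + l / 2 ^+ n / 2) ->
  exists x, forall n, u n <= x <= u n + l / 2 ^+ n.
Proof.
move=> l0 uP.
have um m n : (m <= n)%N -> u m <= u n.
  move: m n; apply: (homo_leq (f := u) (r := fun x y : R => x <= y)) => [?|? ? ?|k]; [exact: lexx|exact: le_trans|by case/andP: (uP k)].
have ud m n : (m <= n)%N -> u n + l / 2 ^+ n <= u m + l / 2 ^+ m.
  move: m n; apply: (homo_leq (f := fun k => u k + l / 2 ^+ k) (r := fun x y : R => y <= x)) => [?|? ? ? /[swap]|k]; [exact: lexx|exact: le_trans|].
  have /andP[_] := uP k; rewrite exprSr invfM mulrA.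
  have := splitr (l / 2 ^+ k); lra.
have ub m n : u m <= u n + l / 2 ^+ n.
  have l2 k : 0 <= l / 2 ^+ k by rewrite divr_ge0// exprn_ge0.
  case: (leqP m n) => mn.
    by rewrite (le_trans (um _ _ mn))// lerDl.
  by rewrite (le_trans _ (ud _ _ (ltnW mn)))// lerDl.
exists (sup (range u)) => n; apply/andP; split.
  apply: ub_le_sup; last by exists n.
  by exists (u 0%N + l / 2 ^+ 0) => _ [m _ <-]; exact: ub.
apply: ge_sup; first by exists (u n), n.
by move=> _ [m _ <-]; exact: ub.
Qed.

(** For the linear part d s of an expansion, the horizontal and vertical contributions to the
    boundary integral cancel. *)
Let aux_affine (d : C) (a b c e : R) :
  (b - a)%:C * (d * (0 +i* (c - e))) + 'i * ((e - c)%:C * (d * (b - a)%:C)) = 0.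
Proof.
by case: d => d1 d2; apply: complex_eq; rewrite !(ReD, ImD, ReM, ImM)/=; ring.
Qed.

(** The affine part of [f] at s0 integrates to zero, so that only the error [g] counts, with |g| <=
    e (l + h). In the constant 4 one factor 2 is for the difference between opposite sides, the
    other comes from [normc_cintegral_itv_le]. *)
Let rect_small s0 d (e r : R) a b l h : A <= a -> a + l <= B -> 0 <= l -> 0 <= h ->
  a <= complex.Re s0 <= a + l -> b <= complex.Im s0 <= b + h -> l + h < r ->
  (forall z, normc z < r -> normc (f (s0 + z) - f s0 - d * z) <= e * normc z) ->
  0 < e -> normc (rect_integral f a (a + l) b (b + h)) <= 4 * (e * (l + h) ^+ 2).
Proof.
move=> Aa alB l0 h0 sa sb lhr fe e0.
pose g s := f s - f s0 - d * (s - s0).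
have gb x y : a <= x <= a + l -> b <= y <= b + h -> normc (g (x +i* y)) <= e * (l + h).
  move=> xa yb; have n1 : normc (x +i* y - s0) <= l + h.
    rewrite (le_trans (normc_le_ReIm _))// ReD ImD ReN ImN/=.
    by apply: lerD; rewrite ler_norml; lra.
  have := fe (x +i* y - s0) (le_lt_trans n1 lhr).
  rewrite addrCA subrr addr0 => /le_trans; apply.
  by rewrite ler_pM2l.
have gE s t : f s - f t = d * (s - t) + (g s - g t).
  by rewrite /g; ring.
have al : a <= a + l by rewrite lerDl.
have bh : b <= b + h by rewrite lerDl.
have E1 : cintegral leb `[a, a + l] (fun x => f (x +i* b) - f (x +i* (b + h))) =
    (a + l - a)%:C * (d * (0 +i* (b - (b + h)))) +
    cintegral leb `[a, a + l] (fun x => g (x +i* b) - g (x +i* (b + h))) /\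
    cintegrable leb `[a, a + l] (fun x => g (x +i* b) - g (x +i* (b + h))).
  have ic : cintegrable leb `[a, a + l] (fun=> d * (0 +i* (b - (b + h)))).
    by apply: ccontinuous_cintegrable => x _; split; exact: cvg_cst.
  have fE x : f (x +i* b) - f (x +i* (b + h)) = d * (0 +i* (b - (b + h))) +
      (g (x +i* b) - g (x +i* (b + h))).
    by rewrite gE; congr (_ * _ + _); apply: complex_eq; rewrite ?ReD ?ImD ?ReN ?ImN/= ?subrr.
  have ig : cintegrable leb `[a, a + l] (fun x => g (x +i* b) - g (x +i* (b + h))).
    rewrite (_ : (fun x => _) = fun x => (f (x +i* b) - f (x +i* (b + h))) -
      d * (0 +i* (b - (b + h)))); last first.
      by apply/funext => x; rewrite fE [RHS]addrC addKr.
    apply: cintegrableB => //; apply: cintegrableB => //; exact: hol_cintegrable_horizontal.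
  split => //; rewrite -cintegral_itv_cst// -cintegralD//.
  by apply: eq_cintegral => x _.
have E2 : cintegral leb `[b, b + h] (fun y => f ((a + l) +i* y) - f (a +i* y)) =
    (b + h - b)%:C * (d * (a + l - a)%:C) +
    cintegral leb `[b, b + h] (fun y => g ((a + l) +i* y) - g (a +i* y)) /\
    cintegrable leb `[b, b + h] (fun y => g ((a + l) +i* y) - g (a +i* y)).
  have ic : cintegrable leb `[b, b + h] (fun=> d * (a + l - a)%:C).
    by apply: ccontinuous_cintegrable => x _; split; exact: cvg_cst.
  have fE y : f ((a + l) +i* y) - f (a +i* y) = d * (a + l - a)%:C +
      (g ((a + l) +i* y) - g (a +i* y)).
    by rewrite gE; congr (_ * _ + _); apply: complex_eq; rewrite ?ReD ?ImD ?ReN ?ImN/= ?subrr.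
  have ig : cintegrable leb `[b, b + h] (fun y => g ((a + l) +i* y) - g (a +i* y)).
    rewrite (_ : (fun x => _) = fun y => (f ((a + l) +i* y) - f (a +i* y)) -
      d * (a + l - a)%:C); last first.
      by apply/funext => x; rewrite fE [RHS]addrC addKr.
    by apply: cintegrableB => //; apply: cintegrableB => //; apply: hol_cintegrable_vertical; lra.
  split => //; rewrite -cintegral_itv_cst// -cintegralD//.
  by apply: eq_cintegral => x _.
rewrite /rect_integral E1.1 E2.1 mulrDr addrACA aux_affine add0r.
rewrite (le_trans (le_normcD _ _))// Normc.normcM normc_i mul1r.
have N1 := normc_cintegral_itv_le al E1.2 (e := 2 * (e * (l + h))).
have N2 := normc_cintegral_itv_le bh E2.2 (e := 2 * (e * (l + h))).
have -> : 4 * (e * (l + h) ^+ 2) = 2 * (2 * (e * (l + h)) * (a + l - a)) +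
  2 * (2 * (e * (l + h)) * (b + h - b)) by ring.
apply: lerD.
- apply: N1 => x xa; rewrite (le_trans (le_normcB _ _))// mulr2n mulrDl mul1r.
  by apply: lerD; apply: gb => //; lra.
- apply: N2 => y yb; rewrite (le_trans (le_normcB _ _))// mulr2n mulrDl mul1r.
  by apply: lerD; apply: gb => //; lra.
Qed.

(** After n quarterings the modulus is at most 4 ^ n times that for a rectangle of sides l / 2 ^ n
    and h / 2 ^ n. The expansion of [f] at the point common to all the rectangles bounds the latter
    by a multiple of e / 4 ^ n, for every e. *)
Lemma goursat a b l h : A <= a -> a + l <= B -> 0 <= l -> 0 <= h ->
  rect_integral f a (a + l) b (b + h) = 0.
Proof.
move=> Aa alB l0 h0.
pose lev n (p : R * R) := rect_integral f p.1 (p.1 + l / 2 ^+ n) p.2 (p.2 + h / 2 ^+ n).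
have ln n : 0 <= l / 2 ^+ n by rewrite divr_ge0// exprn_ge0.
have hn n : 0 <= h / 2 ^+ n by rewrite divr_ge0// exprn_ge0.
(* The conditions on the rectangle stand inside the existential, so that choice yields a function
   defined everywhere. *)
have step (np : nat * (R * R)) : exists q : R * R,
    (a <= np.2.1 -> np.2.1 + l / 2 ^+ np.1 <= B ->
    [/\ np.2.1 <= q.1 <= np.2.1 + l / 2 ^+ np.1 / 2,
        np.2.2 <= q.2 <= np.2.2 + h / 2 ^+ np.1 / 2 &
        normc (lev np.1 np.2) <= 4 * normc (lev np.1.+1 q)]).
  case: np => n p /=.
  have [/andP[p1 p2]|np] := boolP ((a <= p.1) && (p.1 + l / 2 ^+ n <= B)); last first.
    by exists p => p1 p2; rewrite p1 p2 in np.
  have [q qP] := quarter p.2 (le_trans Aa p1) p2 (ln n) (hn n).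
  exists q => _ _; move: qP; rewrite /lev exprSr [in X in _ -> X]invfM !mulrA; exact.
have [g gP] := choice step.
pose fix u n := if n is m.+1 then g (m, u m) else (a, b).
have uB n : a <= (u n).1 /\ (u n).1 + l / 2 ^+ n <= a + l.
  elim: n => [|n [IH1 IH2]]; first by rewrite /= expr0 divr1.
  have [/= h1 _ _] := gP (n, u n) IH1 (le_trans IH2 alB).
  rewrite exprSr invfM mulrA; have := splitr (l / 2 ^+ n); split; lra.
have uP n := gP (n, u n) (uB n).1 (le_trans (uB n).2 alB).
have [x0 xP] : exists x, forall n, (u n).1 <= x <= (u n).1 + l / 2 ^+ n.
  by apply: nested => // n; have [] := uP n.
have [y0 yP] : exists x, forall n, (u n).2 <= x <= (u n).2 + h / 2 ^+ n.
  by apply: nested => // n; have [] := uP n.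
have big n : normc (lev 0%N (a, b)) <= 4 ^+ n * normc (lev n (u n)).
  elim: n => [|n IH]; first by rewrite expr0 mul1r.
  rewrite (le_trans IH)// exprSr -mulrA ler_pM2l ?exprn_gt0//.
  by have [] := uP n.
have lev0 : lev 0%N (a, b) = rect_integral f a (a + l) b (b + h).
  by rewrite /lev/= expr0 !divr1.
have xAB : A <= complex.Re (x0 +i* y0) <= B.
  by have := xP 0%N; rewrite /= expr0 divr1; lra.
have [d fd] := df xAB.
have small e : 0 < e -> normc (rect_integral f a (a + l) b (b + h)) <= 4 * (e * (l + h) ^+ 2).
  move=> e0; have [r r0 rP] := fd e e0.
  have [n nP] : exists n, l / 2 ^+ n + h / 2 ^+ n < r.
    have := @cvg_geometric R (l + h) 2^-1; rewrite ger0_norm ?invr_ge0// invf_lt1// ltr1n.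
    move=> /(_ isT) /cvgrPdist_lt/(_ r r0)[N _ /(_ N (leqnn N))].
    rewrite /= sub0r normrN => lt; exists N.
    by rewrite -mulrDl; rewrite exprVn in lt; exact: le_lt_trans (ler_norm _) lt.
  rewrite -lev0 (le_trans (big n))//.
  have -> : 4 * (e * (l + h) ^+ 2) =
      4 ^+ n * (4 * (e * (l / 2 ^+ n + h / 2 ^+ n) ^+ 2)).
    rewrite -mulrDl exprMn exprVn -exprM mulnC exprM.
    have -> : 2 ^+ 2 = 4 :> R by ring.
    by field; rewrite expf_neq0.
  rewrite ler_pM2l ?exprn_gt0//.
  apply: (rect_small (s0 := x0 +i* y0) (d := d) (r := r)) => //.
  - exact: le_trans (uB n).1.
  - exact: le_trans (uB n).2 _.
apply: Normc.eq0_normc; apply/eqP; rewrite eq_le normc_ge0 andbT; apply/ler_addgt0Pl => e e0.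
rewrite addr0; have lh : 0 < 1 + 4 * (l + h) ^+ 2.
  by rewrite ltr_pwDl// mulr_ge0// sqr_ge0.
rewrite (le_trans (small (e / (1 + 4 * (l + h) ^+ 2)) _)) ?divr_gt0//.
rewrite mulrCA mulrAC -mulrA ler_piMr ?(ltW e0)// ler_pdivrMr// mul1r lerDr//.
Qed.

End Goursat.

Section LineIntegrals.
Context (R : realType).
Local Notation C := R[i].
Local Notation Re := (@complex.Re R).
Local Notation Im := (@complex.Im R).
Local Notation normc := (@Normc.normc R).
Local Notation leb := (@lebesgue_measure R).

Lemma is_derive_eps (f : R -> R) (x d : R) : is_derive x (1 : R) f d ->
  forall e : R, 0 < e -> exists2 r : R, 0 < r &
    forall h : R, `|h| < r -> `|f (x + h) - f x - d * h| <= e * `|h|.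
Proof.
move=> [/cvg_ex[/= l fl] ld] e e0.
have {ld} E : l = d by rewrite -ld; apply/esym; apply: cvg_lim.
move/cvgrPdist_le : fl => /(_ _ e0) /nbhs_ballP[/= r r0 rP].
exists r => // h hr; have [->|h0] := eqVneq h 0.
  by rewrite addr0 subrr mulr0 subr0 normr0 mulr0.
have : ball (0 : R) r h by rewrite /ball/= sub0r normrN.
move=> /rP /(_ h0); rewrite /= /GRing.scale/= mulr1 [h + x]addrC E => le.
have -> : f (x + h) - f x - d * h = - (d - h^-1 * (f (x + h) - f x)) * h.
  by rewrite mulNr mulrBl opprB mulrAC mulVf// mul1r.
by rewrite normrM normrN ler_wpM2r.
Qed.

Lemma cderiv_derivable (f : C -> C) s d : cderiv f s d -> derivable (f : C^o -> C^o) s 1.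
Proof.
move=> fd; apply/cvg_ex; exists (d : C^o); apply/cvgrPdist_le => e /gt0_complex[eE e0]; rewrite eE.
have [r r0 rP] := fd _ e0.
apply/nbhs_ballP; exists r%:C => /=; first by rewrite ltcR.
move=> h; rewrite /ball/= sub0r normrN normcE ltcR => hr h0.
rewrite normcE lecR /GRing.scale/= mulr1 [h + s]addrC.
have nh : 0 < normc h by rewrite lt_neqAle normc_ge0 andbT eq_sym; apply: contra h0 => /eqP/Normc.eq0_normc->.
rewrite -(ler_pM2r nh) -Normc.normcM mulrBl -mulrA mulrCA mulVf// mulr1 normcB.
exact: rP.
Qed.

Let expc_small (e : R) : 0 < e -> exists2 r : R, 0 < r &
  forall h : C, normc h < r -> normc (expc h - 1 - h) <= e * normc h.
Proof.
(* Nine terms of size at most k n, with n = |h|, are collected below, which k <= e / 16 keeps under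
   e n. *)
move=> e0; have [k k0 [k1 ke]] : exists2 k, 0 < k & k <= 1 /\ k <= e / 16.
  exists (Num.min 1 (e / 16)); first by rewrite lt_min ltr01 divr_gt0.
  by split; rewrite ge_min lexx ?orbT.
have [r1 r10 P1] := is_derive_eps (is_derive_expR 0) k0.
have [r2 r20 P2] := is_derive_eps (is_derive_cos 0) k0.
have [r3 r30 P3] := is_derive_eps (is_derive_sin 0) k0.
pose r := Num.min (Num.min r1 r2) (Num.min r3 k).
exists r; first by rewrite !lt_min r10 r20 r30 k0.
move=> h; rewrite !lt_min => /andP[/andP[h1 h2] /andP[h3 h4]].
have ha := le_Re_normc h; have hb := le_Im_normc h.
have := P1 _ (le_lt_trans ha h1); rewrite add0r expR0 mul1r => E.
have := P2 _ (le_lt_trans hb h2); rewrite add0r cos0 sin0 oppr0 mul0r subr0 => K.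
have := P3 _ (le_lt_trans hb h3); rewrite add0r sin0 cos0 mul1r subr0 => S.
rewrite (le_trans (normc_le_ReIm _))// !(ReD, ImD, ReN, ImN) Re_expc Im_expc/= subr0.
move: ha hb h4 S K E; move: (normc_ge0 h); clear -k0 k1 ke.
move: (Re h) (Im h) (normc h) => a b n n0 ha hb h4 S K E.
have E2 : expR a <= 3.
  have := le_trans E (_ : _ <= 1); rewrite ler_norml => /(_ _)/andP[].
    by rewrite (@le_trans _ _ (k * n))// ?ler_pM2l//; nra.
  by have := le_trans ha (ltW h4); rewrite ler_norml; lra.
have e2 := expR_ge0 a.
have en : k * `|a| <= k * n by rewrite ler_pM2l.
have en' : k * `|b| <= k * n by rewrite ler_pM2l.
have -> : expR a * cos b - 1 - a = expR a * (cos b - 1) + (expR a - 1 - a) by ring.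
have -> : expR a * sin b - b = expR a * (sin b - b) + (expR a - 1) * b by ring.
have X1 : `|expR a * (cos b - 1)| <= 3 * (k * n).
  by rewrite normrM ger0_norm//; apply: ler_pM => //; exact: le_trans K en'.
have X2 : `|expR a * (sin b - b)| <= 3 * (k * n).
  by rewrite normrM ger0_norm//; apply: ler_pM => //; exact: le_trans S en'.
have X3 : `|(expR a - 1) * b| <= (k * n + n) * n.
  rewrite normrM; apply: ler_pM => //.
  rewrite -[expR a - 1](subrK a) (le_trans (ler_normD _ _))//.
  by apply: lerD => //; exact: le_trans E en.
rewrite (le_trans (lerD (ler_normD _ _) (ler_normD _ _)))//.
have X4 : (k * n + n) * n <= k * n + k * n.
  rewrite mulrDl lerD//; last by rewrite ler_wpM2r// ltW.
  by rewrite ler_piMr ?(le_trans (ltW h4))// mulr_ge0// ltW.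
have X5 := le_trans E en.
have X7 : 0 <= k * n by rewrite mulr_ge0// ltW.
have X6 : k * n <= e / 16 * n by rewrite ler_wpM2r.
by lra.
Qed.

Lemma cderiv_expc (x : R) s : exists d, cderiv (fun s => expc (s * x%:C)) s d.
Proof.
exists (x%:C * expc (s * x%:C)) => e e0.
have N0 : 0 < 1 + `|x| by rewrite ltr_pwDl.
have n0 : 0 < normc (expc (s * x%:C)) by rewrite normc_expc expR_gt0.
have [r r0 rP] := expc_small (divr_gt0 e0 (mulr_gt0 n0 N0)).
exists (r / (1 + `|x|)); first by rewrite divr_gt0.
move=> h; rewrite ltr_pdivlMr// => hr.
have hx : normc (h * x%:C) <= normc h * (1 + `|x|).
  by rewrite Normc.normcM normc_real ler_wpM2l ?normc_ge0// lerDr.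
have := rP _ (le_lt_trans hx hr).
rewrite mulrDl expcD.
have -> : expc (s * x%:C) * expc (h * x%:C) - expc (s * x%:C) - x%:C * expc (s * x%:C) * h =
  expc (s * x%:C) * (expc (h * x%:C) - 1 - h * x%:C) by ring.
rewrite [X in _ -> X <= _]Normc.normcM.
move=> H; apply: le_trans (ler_wpM2l (ltW n0) H) _.
rewrite (le_trans (ler_wpM2l (ltW n0) (ler_wpM2l _ hx)))//.
  by rewrite ltW// divr_gt0// mulr_gt0.
by rewrite le_eqVlt; apply/orP; left; apply/eqP; field; rewrite !gt_eqF.
Qed.

Lemma ccontinuous_cmeasurable (g : R -> C) : (forall x, ccontinuous_at g x) ->
  cmeasurable setT g.
Proof. by move=> gc; split; apply: continuous_measurable_fun => x; have [] := gc x. Qed.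

Lemma cmeasurable_expc d (T : measurableType d) (D : set T) (f : T -> C) :
  cmeasurable D f -> cmeasurable D (fun t => expc (f t)).
Proof.
move=> [f1 f2]; split.
  under eq_fun do rewrite Re_expc.
  apply: measurable_funM; first exact: measurableT_comp.
  by apply: measurableT_comp => //; apply: continuous_measurable_fun; exact: continuous_cos.
under eq_fun do rewrite Im_expc.
apply: measurable_funM; first exact: measurableT_comp.
by apply: measurableT_comp => //; apply: continuous_measurable_fun; exact: continuous_sin.
Qed.

Lemma cvg_ball_integral (g : R -> C) : cintegrable leb setT g ->
  Re (cintegral leb `[- n%:R, n%:R] g) @[n --> \oo] --> Re (cintegral leb setT g) /\
  Im (cintegral leb `[- n%:R, n%:R] g) @[n --> \oo] --> Im (cintegral leb setT g).
Proof.
move=> gi; pose D n : set R := `[- n%:R, n%:R]%classic.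
have mD n : measurable (D n) by exact: measurable_itv.
pose g_ n t : C := (\1_(D n) t : R)%:C * g t.
have E n : cintegral leb `[- n%:R, n%:R] g = cintegral leb setT (g_ n).
  apply: complex_eq => /=; rewrite Rintegral_mkcond; apply: eq_Rintegral => t _;
    by rewrite /g_ patchE ?(ReM, ImM)/= mul0r ?subr0 ?addr0 indicE /D;
    case: ifPn => _; rewrite ?mul1r ?mul0r.
have D1 t : \forall n \near \oo, t \in D n.
  exists (Num.truncn `|t|).+1 => // n /= tn; rewrite inE /D/= in_itv/= -ler_norml.
  by rewrite (le_trans (ltW (truncnS_gt _)))// ler_nat.
under eq_fun do rewrite E; under [X in _ /\ (X @ _ --> _)]eq_fun do rewrite E.
apply: (@cintegral_dominated _ _ _ leb setT measurableT g_ g (fun t => normc (g t))).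
- move=> n; apply: cmeasurableM; last exact: cintegrable_measurable gi.
  by apply: cmeasurable_real; exact: (@measurable_indic _ (measurableTypeR R) R setT (D n) (mD n)).
- exact: cintegrable_measurable gi.
- move=> t _; apply: cvg_near_cst; apply: filterS (D1 t) => n tn.
  by rewrite /g_ indicE tn mul1r.
- move=> t _; apply: cvg_near_cst; apply: filterS (D1 t) => n tn.
  by rewrite /g_ indicE tn mul1r.
- exact: cintegrable_normc.
- move=> n t _; rewrite /g_ Normc.normcM normc_real ler_piMl ?normc_ge0//.
  by rewrite indicE; case: (_ \in _); rewrite ?normr1 ?normr0.
Qed.

End LineIntegrals.

Section LineShift.
Context (R : realType).
Local Notation C := R[i].
Local Notation Re := (@complex.Re R).
Local Notation Im := (@complex.Im R).
Local Notation normc := (@Normc.normc R).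
Local Notation leb := (@lebesgue_measure R).
Variables (f : C -> C) (A B K : R).
Hypothesis df : forall s, A <= Re s <= B -> exists d, cderiv f s d.
Hypothesis bf : forall s, A <= Re s <= B -> normc (f s) <= K * cauchy_ker (Im s).

Lemma cmeasurable_line c : A <= c <= B -> cmeasurable setT (fun v => f (c +i* v)).
Proof.
move=> cAB; apply: ccontinuous_cmeasurable => y.
by have [d fd] := df (s := c +i* y) cAB; exact: ccontinuous_vertical fd.
Qed.

Lemma cintegrable_line c : A <= c <= B -> cintegrable leb setT (fun v => f (c +i* v)).
Proof.
move=> cAB; apply: (@cintegrable_le R _ _ leb setT measurableT (fun v => f (c +i* v)) (fun v => K * cauchy_ker v)).
- exact: cmeasurable_line.
- rewrite (_ : _ \o _ = (fun t => K%:E * (cauchy_ker t)%:E)%E)//.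
  by apply: integrableZl => //; exact: integrable_cauchy_ker.
- by move=> v _; exact: bf.
Qed.

Let K_ge0 c : A <= c <= B -> 0 <= K.
Proof.
move=> cAB; have := bf (s := c%:C) cAB; rewrite /cauchy_ker/= expr0n addr0 invr1 mulr1.
exact/le_trans/normc_ge0.
Qed.

(** For the rectangle between the heights -n and n the horizontal sides contribute at most a
    constant times 1 / (1 + n ^ 2), so the difference of the truncated vertical integrals tends to
    0. *)
Lemma line_shift a b : A <= a <= B -> A <= b <= B ->
  cintegral leb setT (fun v => f (a +i* v)) = cintegral leb setT (fun v => f (b +i* v)).
Proof.
wlog ab : a b / a <= b.
  by move=> W aAB bAB; have [/W|/ltW/W] := leP a b; [exact|move=> ->].
move=> aAB bAB; have [/andP[Aa aB] /andP[Ab bB]] := (aAB, bAB).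
have K0 := K_ge0 aAB.
pose g v := f (b +i* v) - f (a +i* v).
have ig : cintegrable leb setT g by apply: cintegrableB => //; exact: cintegrable_line.
have small n : normc (cintegral leb `[- n%:R, n%:R] g) <= 4 * K * (b - a) * cauchy_ker n%:R.
  have l0 : 0 <= b - a by rewrite subr_ge0.
  have h0 : 0 <= n%:R + n%:R :> R by rewrite addr_ge0.
  have E1 : a + (b - a) = b by rewrite addrC subrK.
  have E2 : - n%:R + (n%:R + n%:R) = n%:R :> R by rewrite addrA addNr add0r.
  have := goursat df (- n%:R) Aa _ l0 h0; rewrite E1 E2 => /(_ bB).
  rewrite /rect_integral => /eqP; rewrite addrC addr_eq0 => /eqP/(congr1 normc).
  rewrite Normc.normcM normc_i mul1r normcN => ->.
  rewrite (_ : _ * _ = 2 * (2 * K * cauchy_ker n%:R * (b - a))); last ring.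
  apply: normc_cintegral_itv_le => //.
    by apply: cintegrableB => //; exact: (hol_cintegrable_horizontal df).
  move=> x /andP[ax xb]; have xAB : A <= x <= B by rewrite (le_trans Aa)// (le_trans xb).
  rewrite (le_trans (le_normcB _ _))// -mulrA mulr2n mulrDl mul1r lerD//.
    by have := bf (s := x +i* - n%:R) xAB; rewrite /cauchy_ker/= sqrrN.
  exact: (bf (s := x +i* n%:R)).
have ck0 : cauchy_ker n%:R @[n --> \oo] --> (0 : R).
  apply: (@squeeze_cvgr _ _ _ _ (fun=> 0) harmonic).
  - apply: nearW => n; rewrite (ltW (cauchy_ker_gt0 _))/= /harmonic lef_pV2 ?posrE ?ltr_pwDl ?sqr_ge0//.
    by rewrite -natr1 addrC lerD2l -natrX ler_nat; case: n => // n; rewrite expnS expn1 leq_pmulr.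
  - exact: cvg_cst.
  - exact: cvg_harmonic.
have z0 (u : nat -> R) : (forall n, `|u n| <= 4 * K * (b - a) * cauchy_ker n%:R) ->
    u n @[n --> \oo] --> (0 : R).
  move=> un; apply: norm_cvg0.
  apply: (@squeeze_cvgr _ _ _ _ (fun=> 0) (fun n => 4 * K * (b - a) * cauchy_ker n%:R)).
  - by apply: nearW => n; rewrite normr_ge0 un.
  - exact: cvg_cst.
  - rewrite -[X in _ --> X](mulr0 (4 * K * (b - a))).
    by apply: cvgM => //; exact: cvg_cst.
have [h1 h2] := cvg_ball_integral ig.
have g0 : cintegral leb setT g = 0.
  apply: complex_eq.
    rewrite -(cvg_lim _ h1)//; apply: cvg_lim => //; apply: z0 => n.
    exact: le_trans (le_Re_normc _) (small n).
  rewrite -(cvg_lim _ h2)//; apply: cvg_lim => //; apply: z0 => n.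
  exact: le_trans (le_Im_normc _) (small n).
by apply/esym/eqP; rewrite -subr_eq0 -cintegralB ?[X in X == _]g0//; exact: cintegrable_line.
Qed.

End LineShift.

(** * Mellin inversion and the functional equation *)

Section ProductIntegrable.
Context d1 d2 (T1 : measurableType d1) (T2 : measurableType d2) (R : realType).
Context (m1 : {sigma_finite_measure set T1 -> \bar R})
  (m2 : {sigma_finite_measure set T2 -> \bar R}).

Lemma integrable_prodM (f : T1 -> R) (g : T2 -> R) :
  m1.-integrable setT (EFin \o f) -> m2.-integrable setT (EFin \o g) ->
  (m1 \x m2)%E.-integrable setT (EFin \o (fun z => f z.1 * g z.2)).
Proof.
move=> fi gi.
have mf : measurable_fun setT f by apply/measurable_EFinP; exact: measurable_int fi.
have mg : measurable_fun setT g by apply/measurable_EFinP; exact: measurable_int gi.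
apply/fubini1a.
  apply/measurable_EFinP; apply: measurable_funM; exact: measurableT_comp.
have gi' := integrable_norm gi.
rewrite (eq_integral (fun x => `|(f x)%:E| * \int[m2]_y `|(g y)%:E|)%E); last first.
  move=> x _; rewrite -ge0_integralZl//; last by apply: measurableT_comp => //; exact/measurable_EFinP.
  by apply: eq_integral => y _; rewrite /= -EFinM -normrM.
have gfin : (\int[m2]_y `|(g y)%:E|)%E \is a fin_num by exact: integrable_fin_num.
rewrite -(fineK gfin) ge0_integralZr//.
- by rewrite lte_mul_pinfty ?integral_ge0 ?lee_fin ?fine_ge0 ?integral_ge0//;
  [exact: integrable_fin_num (integrable_norm fi)|rewrite ltry].
- by apply: measurableT_comp => //; exact/measurable_EFinP.
- by rewrite lee_fin fine_ge0// integral_ge0.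
Qed.

Lemma cmeasurable_fst (f : T1 -> R[i]) : cmeasurable setT f ->
  cmeasurable setT (fun z : T1 * T2 => f z.1).
Proof. by move=> [f1 f2]; split; [apply: (measurableT_comp f1)|apply: (measurableT_comp f2)]. Qed.

Lemma cmeasurable_snd (f : T2 -> R[i]) : cmeasurable setT f ->
  cmeasurable setT (fun z : T1 * T2 => f z.2).
Proof. by move=> [f1 f2]; split; [apply: (measurableT_comp f1)|apply: (measurableT_comp f2)]. Qed.

End ProductIntegrable.

Section FourierInversion.
Context (R : realType).
Local Notation C := R[i].
Local Notation Re := (@complex.Re R).
Local Notation Im := (@complex.Im R).
Local Notation normc := (@Normc.normc R).
Local Notation leb := (@lebesgue_measure R).
Variables (Phi : C -> C) (A B K : R).
Hypotheses (A0 : A < 0) (B0 : 0 < B).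
Hypothesis dPhi : forall s, A <= Re s <= B -> exists d, cderiv Phi s d.
Hypothesis bPhi : forall s, A <= Re s <= B -> normc (Phi s) <= K * cauchy_ker (Im s).

Let mPhi c : A <= c <= B -> cmeasurable setT (fun v => Phi (c +i* v)).
Proof. exact: cmeasurable_line. Qed.

Let AB0 : A <= 0 <= B. Proof. by rewrite !ltW. Qed.

Let K0 : 0 <= K.
Proof.
have := bPhi (s := 0) AB0; rewrite /cauchy_ker/= expr0n addr0 invr1 mulr1.
exact/le_trans/normc_ge0.
Qed.

Let iKck : leb.-integrable setT (EFin \o (fun v => K * cauchy_ker v)).
Proof.
by apply: integrable_mull; [exact: measurableT|exact: integrable_cauchy_ker].
Qed.

(** Up to the factor 1 / (2 pi), the inverse Mellin transform of [Phi] along Re s = c, with kernel y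
    ^ s at y = exp x. *)
Definition mellin_inv c (x : R) : C :=
  cintegral leb setT (fun v => Phi (c +i* v) * expc ((c +i* v) * x%:C)).

Let mkern c (g : R -> C) : A <= c <= B -> cmeasurable setT g ->
  cmeasurable setT (fun z : R * R => Phi (c +i* z.2) * expc ((c +i* z.2) * z.1%:C) * g z.1).
Proof.
move=> cAB mg; apply: cmeasurableM; last exact: (@cmeasurable_fst _ _ _ _ R _ mg).
apply: cmeasurableM; first exact: (@cmeasurable_snd _ _ _ _ R _ (mPhi cAB)).
apply: cmeasurable_expc; apply: cmeasurableM.
  by split => /=; [exact: measurable_cst|exact: measurable_snd].
by apply: cmeasurable_real; exact: measurable_fst.
Qed.

Let normc_kern c (v x : R) : A <= c <= B ->
  normc (Phi (c +i* v) * expc ((c +i* v) * x%:C)) <= expR (c * x) * (K * cauchy_ker v).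
Proof.
move=> cAB; rewrite Normc.normcM normc_expc ReM/= mulr0 subr0 mulrC.
by rewrite ler_wpM2l ?expR_ge0//; exact: (bPhi (s := c +i* v)).
Qed.

Let ikern c (g : R -> C) : A <= c <= B -> cmeasurable setT g ->
  leb.-integrable setT (EFin \o (fun x => expR (c * x) * normc (g x))) ->
  cintegrable (leb \x leb)%E setT
    (fun z : R * R => Phi (c +i* z.2) * expc ((c +i* z.2) * z.1%:C) * g z.1).
Proof.
move=> cAB mg gi.
apply: (@cintegrable_le R _ _ (leb \x leb)%E setT measurableT _
  (fun z => (expR (c * z.1) * normc (g z.1)) * (K * cauchy_ker z.2))).
- exact: mkern.
- exact: (integrable_prodM gi iKck).
- move=> z _; rewrite Normc.normcM [leRHS]mulrAC ler_wpM2r ?normc_ge0//; exact: normc_kern.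
Qed.

Let mellin_inv_fubini c (g : R -> C) : A <= c <= B -> cmeasurable setT g ->
  leb.-integrable setT (EFin \o (fun x => expR (c * x) * normc (g x))) ->
  cintegrable leb setT (fun x => mellin_inv c x * g x) /\
  cintegral leb setT (fun v => Phi (c +i* v) *
    cintegral leb setT (fun x => expc ((c +i* v) * x%:C) * g x)) =
  cintegral leb setT (fun x => mellin_inv c x * g x).
Proof.
move=> cAB mg gi; have [I E] := cfubini (ikern cAB mg gi).
have gi' v : cintegrable leb setT (fun x => expc ((c +i* v) * x%:C) * g x).
  apply: (@cintegrable_le R _ _ leb setT measurableT _ (fun x => expR (c * x) * normc (g x))); [|exact: gi|].
    apply: cmeasurableM; last exact: mg.
    apply: cmeasurable_expc; apply: cmeasurableM; first exact: cmeasurable_cst.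
    by apply: cmeasurable_real; exact: measurable_id.
  by move=> x _; rewrite Normc.normcM normc_expc ReM/= mulr0 subr0.
have pi' x : cintegrable leb setT (fun v => Phi (c +i* v) * expc ((c +i* v) * x%:C)).
  apply: (@cintegrable_le R _ _ leb setT measurableT _ (fun v => expR (c * x) * (K * cauchy_ker v))).
  - apply: cmeasurableM; first exact: mPhi.
    apply: cmeasurable_expc; apply: cmeasurableM; last exact: cmeasurable_cst.
    by split => /=; [exact: measurable_cst|exact: measurable_id].
  - by apply: integrable_mull; [exact: measurableT|exact: iKck].
  - by move=> v _; exact: normc_kern.
have E1 : (fun x => cintegral leb setT (fun v =>
    Phi (c +i* v) * expc ((c +i* v) * x%:C) * g x)) = (fun x => mellin_inv c x * g x).
  apply/funext => x; have /esym := @cintegralZ R _ _ leb setT measurableT (g x) _ (pi' x).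
  by rewrite [X in X = _]mulrC => ->; apply: eq_cintegral => v _; exact: mulrC.
split; first by rewrite -E1.
transitivity (cintegral leb setT (fun v => cintegral leb setT (fun x =>
    Phi (c +i* v) * expc ((c +i* v) * x%:C) * g x))).
  apply: eq_cintegral => v _.
  have <- := @cintegralZ R _ _ leb setT measurableT (Phi (c +i* v)) _ (gi' v).
  by apply: eq_cintegral => x _; rewrite mulrA.
by rewrite -E1; exact/esym.
Qed.

Let ik k : 0 < k -> leb.-integrable setT (EFin \o (fun x => expR (- (k * `|x|)))).
Proof. exact: integrable_laplace. Qed.

Lemma mellin_inv_shift a b x : A <= a <= B -> A <= b <= B ->
  mellin_inv a x = mellin_inv b x.
Proof.
move=> aAB bAB.
apply: (@line_shift R (fun s => Phi s * expc (s * x%:C)) A B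
   (K * expR (Num.max (A * x) (B * x)))) => //.
- move=> s sAB; apply: derivable_cderiv.
  have [d1 D1] := dPhi sAB; have [d2 D2] := cderiv_expc x s.
  exact: (derivableM (cderiv_derivable D1) (cderiv_derivable D2)).
- move=> s sAB; rewrite mulrAC Normc.normcM normc_expc ReM/= mulr0 subr0.
  apply: ler_pM; [exact: normc_ge0|exact: expR_ge0|exact: bPhi|].
  rewrite ler_expR le_max; have /andP[As sB] := sAB.
  have [x0|x0] := leP 0 x; first by rewrite (ler_wpM2r x0 sB) orbT.
  by rewrite ler_nM2r// As.
Qed.

(** The line may be moved to any abscissa c of the strip. Taking c = A < 0 for x > 0 and c = B > 0
    for x < 0 will give exponential decay in both directions. *)
Lemma normc_mellin_inv_le c x : A <= c <= B -> normc (mellin_inv 0 x) <= 2 * (pi * K) * expR (c * x).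
Proof.
move=> cAB; rewrite (mellin_inv_shift x AB0 cAB).
have := @normc_cintegral_le R _ _ leb setT measurableT
  (fun v => Phi (c +i* v) * expc ((c +i* v) * x%:C)) (fun v => (expR (c * x) * K) * cauchy_ker v).
rewrite RintegralZl ?Rintegral_cauchy_ker//; last exact: integrable_cauchy_ker.
rewrite (_ : 2 * (expR (c * x) * K * pi) = 2 * (pi * K) * expR (c * x)); last by ring.
apply.
- apply: cmeasurableM; first exact: mPhi.
  apply: cmeasurable_expc; apply: cmeasurableM; last exact: cmeasurable_cst.
  by split => /=; [exact: measurable_cst|exact: measurable_id].
- by apply: integrable_mull; [exact: measurableT|exact: integrable_cauchy_ker].
- by move=> v _; rewrite -mulrA; exact: normc_kern.
Qed.

(** On the line Re s = 0 the weight exp (- k |x|) makes the double integral absolutely convergent,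
    and the Fourier transform of this weight is a Poisson kernel. *)
Let mellin_inv_damped k : 0 < k ->
  cintegrable leb setT (fun x => mellin_inv 0 x * (expR (- (k * `|x|)))%:C) /\
  cintegral leb setT (fun x => mellin_inv 0 x * (expR (- (k * `|x|)))%:C) =
  cintegral leb setT (fun v => Phi (0 +i* v) * (2 * k / (k ^+ 2 + v ^+ 2))%:C).
Proof.
move=> k0; pose g (x : R) : C := (expR (- (k * `|x|)))%:C.
have mg0 : measurable_fun setT (fun x : R => expR (- (k * `|x|))).
  by apply/measurable_EFinP; exact: measurable_int (ik k0).
have mg : cmeasurable setT g by exact: cmeasurable_real.
have gi : leb.-integrable setT (EFin \o (fun x => expR (0 * x) * normc (g x))).
  rewrite (_ : (fun x => _) = (fun x => expR (- (k * `|x|)))); first exact: ik.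
  by apply/funext => x; rewrite mul0r expR0 mul1r normc_real ger0_norm ?expR_ge0.
have [I <-] := mellin_inv_fubini AB0 mg gi; split => //.
apply: eq_cintegral => v _; congr (_ * _).
transitivity (cintegral leb setT (fun x =>
    (expR (- (k * `|x|)) * cos (v * x)) +i* (expR (- (k * `|x|)) * sin (v * x)))).
  apply: eq_cintegral => x _; apply: complex_eq.
    rewrite ReM Re_expc !(ReM, ImM)/= !mul0r !mulr0 subrr expR0 mul1r add0r subr0.
    exact: mulrC.
  rewrite ImM Im_expc !(ReM, ImM)/= !mul0r !mulr0 subrr expR0 mul1r add0r add0r.
  exact: mulrC.
apply: complex_eq => /=; first exact: integral_laplace_cos.
have ms : measurable_fun setT (fun x : R => expR (- (k * `|x|)) * sin (v * x)).
  apply: measurable_funM => //; apply: measurableT_comp; last exact: measurable_funM.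
  by apply: continuous_measurable_fun; exact: continuous_sin.
have si : leb.-integrable setT (EFin \o (fun x => expR (- (k * `|x|)) * sin (v * x))).
  apply: (le_integrable measurableT _ _ (ik k0)).
    by apply/measurable_EFinP.
  move=> x _ /=; rewrite lee_fin normrM ler_piMr// ler_norml sin_geN1 sin_le1//.
(* The sine part is odd, so its integral vanishes. *)
have O : \int[leb]_x (expR (- (k * `|x|)) * sin (v * x)) = - \int[leb]_x (expR (- (k * `|x|)) * sin (v * x)).
  rewrite -mulN1r -RintegralZl// /Rintegral; congr fine.
  rewrite -(integral_opp (f := fun x => (expR (- (k * `|x|)) * sin (v * x))%:E)); last exact/measurable_EFinP.
  by apply: eq_integral => x _; rewrite mulN1r normrN !mulrN sinN mulrN.
move: O; rewrite /Rintegral; move: (fine _) => r; lra.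
Qed.

(** Fubini gives measurability after damping; the damping factor is then divided out. *)
Lemma cmeasurable_mellin_inv : cmeasurable setT (mellin_inv 0).
Proof.
have [/cintegrable_measurable I _] := mellin_inv_damped ltr01.
rewrite (_ : mellin_inv 0 = fun x => mellin_inv 0 x * (expR (- (1 * `|x|)))%:C * (expR (1 * `|x|))%:C).
  apply: cmeasurableM => //; apply: cmeasurable_real; apply: measurableT_comp => //.
  by apply: measurable_funM.
apply/funext => x; rewrite -mulrA -rmorphM/= -expRD addNr expR0.
by rewrite mulr1.
Qed.

Let kappa := Num.min (- A) B.
Let kappa0 : 0 < kappa. Proof. by rewrite lt_min oppr_gt0 A0 B0. Qed.

Let normc_mellin_inv_decay x : normc (mellin_inv 0 x) <= 2 * (pi * K) * expR (- (kappa * `|x|)).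
Proof.
have P0 : 0 <= 2 * (pi * K) by rewrite !mulr_ge0// pi_ge0.
have [kA kB] : kappa <= - A /\ kappa <= B by split; rewrite ge_min lexx ?orbT.
have [x0|/ltW x0] := leP 0 x.
  apply: le_trans (normc_mellin_inv_le x (c := A) _) _; first by rewrite lexx (le_trans (ltW A0))// ltW.
  by rewrite ler_wpM2l// ler_expR ger0_norm// lerNr -mulNr ler_wpM2r.
apply: le_trans (normc_mellin_inv_le x (c := B) _) _; first by rewrite lexx (le_trans (ltW A0))// ltW.
by rewrite ler_wpM2l// ler_expR ler0_norm// mulrN opprK; exact: ler_wnM2r.
Qed.

Let idecay : leb.-integrable setT (EFin \o (fun x => 2 * (pi * K) * expR (- (kappa * `|x|)))).
Proof.
by apply: integrable_mull; [exact: measurableT|exact: ik].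
Qed.

Lemma cintegrable_mellin_inv : cintegrable leb setT (mellin_inv 0).
Proof.
apply: (@cintegrable_le R _ _ leb setT measurableT _ (fun x => 2 * (pi * K) * expR (- (kappa * `|x|)))).
- exact: cmeasurable_mellin_inv.
- exact: idecay.
- by move=> x _; exact: normc_mellin_inv_decay.
Qed.

Let cvg_unique_C (u : nat -> C) (l1 l2 : C) :
  Re (u n) @[n --> \oo] --> Re l1 /\ Im (u n) @[n --> \oo] --> Im l1 ->
  Re (u n) @[n --> \oo] --> Re l2 /\ Im (u n) @[n --> \oo] --> Im l2 -> l1 = l2.
Proof.
move=> [a1 a2] [b1 b2]; apply: complex_eq.
  by rewrite -(cvg_lim _ a1)//; exact: cvg_lim.
by rewrite -(cvg_lim _ a2)//; exact: cvg_lim.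
Qed.

Let rescale k : 0 < k ->
  cintegral leb setT (fun v => Phi (0 +i* v) * (2 * k / (k ^+ 2 + v ^+ 2))%:C) =
  cintegral leb setT (fun v => Phi (0 +i* (k * v)) * (2 * cauchy_ker v)%:C).
Proof.
move=> k0.
have [m1 m2] : cmeasurable setT (fun v : R => Phi (0 +i* v) * (2 * k / (k ^+ 2 + v ^+ 2))%:C).
  apply: cmeasurableM; first exact: mPhi.
  apply: cmeasurable_real; apply: measurable_funM => //.
  apply: continuous_measurable_fun => v; apply: cvgV.
    by rewrite gt_eqF// ltr_pwDl ?exprn_gt0// sqr_ge0.
  by apply: cvgD; [exact: cvg_cst|exact: exprn_continuous].
have E v : k * (2 * k / (k ^+ 2 + (k * v) ^+ 2)) = 2 * cauchy_ker v.
  by rewrite /cauchy_ker; field; rewrite !gt_eqF//= ?ltr_pwDl ?sqr_ge0 ?exprn_gt0.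
apply: complex_eq => /=; congr fine.
  rewrite -(integral_scale k0 (f := fun v => (Re (Phi (0 +i* v) * (2 * k / (k ^+ 2 + v ^+ 2))%:C))%:E)); last exact/measurable_EFinP.
  by apply: eq_integral => v _; rewrite -EFinM !ReM/= !mulr0 !subr0 mulrCA E.
rewrite -(integral_scale k0 (f := fun v => (Im (Phi (0 +i* v) * (2 * k / (k ^+ 2 + v ^+ 2))%:C))%:E)); last exact/measurable_EFinP.
by apply: eq_integral => v _; rewrite -EFinM !ImM/= !mulr0 !add0r mulrCA E.
Qed.

(** Fourier inversion at 0 by Abel summation, the damping k tending to 0. On the side of [Phi] the
    Poisson kernel is rescaled to 2 / (1 + v ^ 2), of mass 2 pi, and [Phi] is evaluated at i k v,
    which tends to 0. Dominated convergence applies on both sides. *)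
Lemma integral_mellin_inv : cintegral leb setT (mellin_inv 0) = (2 * pi)%:C * Phi 0.
Proof.
pose k (n : nat) : R := n.+1%:R^-1.
have k0 n : 0 < k n by rewrite invr_gt0 ltr0n.
have kcvg : k n @[n --> \oo] --> (0 : R) by exact: cvg_harmonic.
have D (c x : R) : c * expR (- (k n * `|x|)) @[n --> \oo] --> c.
  rewrite -[X in _ --> X]mulr1 -expR0; apply: cvgM; first exact: cvg_cst.
  have L : - (k n * `|x|) @[n --> \oo] --> (0 : R).
    rewrite -[X in _ --> X]oppr0 -(mul0r `|x|).
    by apply: cvgN; apply: cvgM kcvg _; exact: cvg_cst.
  by apply: continuous_cvg; [exact: continuous_expR|exact: L].
apply: (cvg_unique_C (u := fun n => cintegral leb setT
    (fun x => mellin_inv 0 x * (expR (- (k n * `|x|)))%:C))).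
  apply: (@cintegral_dominated _ _ _ leb setT measurableT _ _ _ _ _ _ _ idecay).
  - by move=> n; have [/cintegrable_measurable] := mellin_inv_damped (k0 n).
  - exact: cmeasurable_mellin_inv.
  - move=> x _; under eq_fun do rewrite ReMr; exact: D.
  - move=> x _; under eq_fun do rewrite ImMr; exact: D.
  - move=> n x _; rewrite Normc.normcM normc_real ger0_norm ?expR_ge0//.
    rewrite (le_trans _ (normc_mellin_inv_decay x))// ler_piMr ?normc_ge0//.
    by rewrite -expR0 ler_expR oppr_le0 mulr_ge0// ltW.
have E n : cintegral leb setT (fun x => mellin_inv 0 x * (expR (- (k n * `|x|)))%:C) =
    cintegral leb setT (fun v => Phi (0 +i* (k n * v)) * (2 * cauchy_ker v)%:C).
  by have [_ ->] := mellin_inv_damped (k0 n); exact: rescale.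
under eq_fun do rewrite E; under [X in _ /\ (X @ _ --> _)]eq_fun do rewrite E.
have i2 : leb.-integrable setT (EFin \o (fun v => 2 * cauchy_ker v)).
  by apply: integrable_mull; [exact: measurableT|exact: integrable_cauchy_ker].
have ic2 : cintegrable leb setT (fun v => (2 * cauchy_ker v)%:C : C).
  by split => //; exact: (integrable0 leb setT).
have -> : (2 * pi)%:C * Phi 0 = cintegral leb setT (fun v => Phi 0 * (2 * cauchy_ker v)%:C).
  rewrite (@cintegralZ R _ _ leb setT measurableT _ _ ic2) mulrC; congr (_ * _).
  apply: complex_eq => /=; last by rewrite Rintegral_cst// mul0r.
  by rewrite RintegralZl ?Rintegral_cauchy_ker//; exact: integrable_cauchy_ker.
have [d Phi0] := dPhi (s := 0) AB0.
have [c1 c2] := ccontinuous_vertical (c := 0) (t := 0) Phi0.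
have i3 : leb.-integrable setT (EFin \o (fun v => K * (2 * cauchy_ker v))).
  by apply: integrable_mull; [exact: measurableT|exact: i2].
have kv v : k n * v @[n --> \oo] --> (0 : R).
  by rewrite -[X in _ --> X](mul0r v); apply: cvgM kcvg _; exact: cvg_cst.
apply: (@cintegral_dominated _ _ _ leb setT measurableT _ _ _ _ _ _ _ i3).
- move=> n; apply: cmeasurableM; last first.
    by apply: cmeasurable_real; apply/measurable_EFinP; exact: measurable_int i2.
  have [m1 m2] := mPhi AB0; split.
    by apply: (measurableT_comp m1); exact: measurable_funM.
  by apply: (measurableT_comp m2); exact: measurable_funM.
- apply: cmeasurableM; first exact: cmeasurable_cst.
  by apply: cmeasurable_real; apply/measurable_EFinP; exact: measurable_int i2.
- move=> v _; under eq_fun do rewrite ReMr; rewrite ReMr.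
  by apply: cvgM; [exact: (cvg_comp _ _ (kv v) c1)|exact: cvg_cst].
- move=> v _; under eq_fun do rewrite ImMr; rewrite ImMr.
  by apply: cvgM; [exact: (cvg_comp _ _ (kv v) c2)|exact: cvg_cst].
- move=> n v _; rewrite Normc.normcM normc_real ger0_norm; last first.
    by rewrite mulr_ge0// ltW// cauchy_ker_gt0.
  apply: ler_wpM2r; first by rewrite mulr_ge0// ltW// cauchy_ker_gt0.
  apply: le_trans (bPhi (s := 0 +i* (k n * v)) AB0) _.
  by rewrite ler_piMr// invf_le1 ?lerDl ?sqr_ge0// ltr_pwDl// sqr_ge0.
Qed.

(* The functional equations of [Phi] and of [q] make [mellin_inv 0 x * q x] and its
   reflection add up to a multiple of [mellin_inv 0]. *)
Lemma mellin_functional (q : R -> C) (M : C) :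
  A + B = 1 -> (forall s, Phi (1 - s) = - Phi s) -> Phi 0 = -1 ->
  cmeasurable setT q ->
  leb.-integrable setT (EFin \o (fun x => expR (B * x) * normc (q x))) ->
  (forall x, q (- x) = (expR x)%:C * q x + M * ((expR x)%:C - 1)) ->
  cintegral leb setT (fun v => Phi (B +i* v) *
    cintegral leb setT (fun x => expc ((B +i* v) * x%:C) * q x)) = (2 * pi)%:C * M.
Proof.
move=> AB1 Phi1 Phi0 mq qi qE.
have BAB : A <= B <= B by rewrite lexx (le_trans (ltW A0))// ltW.
have AAB : A <= A <= B by rewrite lexx (le_trans (ltW A0))// ltW.
have [I ->] := mellin_inv_fubini BAB mq qi.
have pE : mellin_inv B = mellin_inv 0.
  by apply/funext => x; exact: mellin_inv_shift.
rewrite pE in I *; set p := mellin_inv 0 in I *.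
have mp : cmeasurable setT p by exact: cmeasurable_mellin_inv.
have ip : cintegrable leb setT p by exact: cintegrable_mellin_inv.
(* As A = 1 - B, the map s -> 1 - s exchanges the two edges of the strip, and the integral does not
   depend on the edge. *)
have pN x : p (- x) = - (expR (- x))%:C * p x.
  have -> : p (- x) = mellin_inv B (- x) by rewrite pE.
  have -> : p x = mellin_inv A x by exact: mellin_inv_shift.
  rewrite /mellin_inv.
  have mA : cmeasurable setT (fun v => Phi (A +i* v) * expc ((A +i* v) * x%:C)).
    apply: cmeasurableM; first exact: mPhi.
    apply: cmeasurable_expc; apply: cmeasurableM; last exact: cmeasurable_cst.
    by split => /=; [exact: measurable_cst|exact: measurable_id].
  have iA : cintegrable leb setT (fun v => Phi (A +i* v) * expc ((A +i* v) * x%:C)).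
    apply: (@cintegrable_le R _ _ leb setT measurableT _ (fun v => expR (A * x) * (K * cauchy_ker v))).
    - exact: mA.
    - by apply: integrable_mull; [exact: measurableT|exact: iKck].
    - by move=> v _; exact: normc_kern.
  rewrite -(cintegral_opp mA) -(@cintegralZ R _ _ leb setT measurableT); last first.
    case: iA => i1 i2; split.
      exact: (integrable_opp (f := fun v => Re (Phi (A +i* v) * expc ((A +i* v) * x%:C)))).
    exact: (integrable_opp (f := fun v => Im (Phi (A +i* v) * expc ((A +i* v) * x%:C)))).
  apply: eq_cintegral => v _.
  have -> : B +i* v = 1 - (A +i* - v).
    by apply: complex_eq; rewrite ?ReD ?ImD ?ReN ?ImN/= ?opprK ?add0r// -AB1 addrC addKr.
  have -> : expc ((1 - (A +i* - v)) * (- x)%:C) = (expR (- x))%:C * expc ((A +i* - v) * x%:C).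
    by rewrite -expc_real -expcD; congr expc; rewrite !rmorphN/=; ring.
  by rewrite Phi1; ring.
have ipN : cintegrable leb setT (fun x => p (- x)).
  by case: ip => i1 i2; split; [exact: (integrable_opp (f := fun v => Re (p v)))|
    exact: (integrable_opp (f := fun v => Im (p v)))].
have SN : cintegral leb setT (fun x => p (- x)) = cintegral leb setT p.
  by apply: cintegral_opp; exact: mp.
have S1 : cintegral leb setT (fun x => p x * q x) =
    cintegral leb setT (fun x => - (p x * q x) + M * (- p x - p (- x))).
  rewrite -[LHS](@cintegral_opp R (fun x => p x * q x)); last exact: cmeasurableM.
  apply: eq_cintegral => x _; rewrite qE pN.
  have E : (expR (- x))%:C * (expR x)%:C = 1 :> C.
    by rewrite -rmorphM/= -expRD addNr expR0.
  by move: (expR x)%:C (expR (- x))%:C E => a b E; ring: E.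
have iN := cintegrableN measurableT I.
have i1 : cintegrable leb setT (fun x => - p x - p (- x)).
  exact: (cintegrableB measurableT (cintegrableN measurableT ip) ipN).
have := S1; rewrite (@cintegralD R _ _ leb setT measurableT _ _ iN); last exact: (cintegrableZ measurableT M i1).
rewrite (@cintegralN R _ _ leb setT measurableT _ I).
rewrite (@cintegralZ R _ _ leb setT measurableT _ _ i1).
rewrite (@cintegralB R _ _ leb setT measurableT _ _ (cintegrableN measurableT ip) ipN).
rewrite (@cintegralN R _ _ leb setT measurableT _ ip) SN integral_mellin_inv Phi0.
move: (cintegral _ _ _) => S SE.
(* The relation reached is S = - S - 2 M P, where P is the integral of [p], equal to 2 pi Phi(0) = -
   2 pi. *)
apply: (mulfI (x := 2)); first by rewrite pnatr_eq0.
rewrite mulr2n mulrDl mul1r {1}SE; ring.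
Qed.

End FourierInversion.

(** * Decay of the gamma function *)

Section GammaDecay.
Context (R : realType).
Local Notation C := R[i].
Local Notation Re := (@complex.Re R).
Local Notation Im := (@complex.Im R).
Local Notation normc := (@Normc.normc R).
Local Notation leb := (@lebesgue_measure R).

Lemma integral_derive_eq0 (F f : R -> R) : (forall x : R, is_derive x (1 : R) F (f x)) ->
  continuous f -> leb.-integrable setT (EFin \o f) ->
  F n%:R @[n --> \oo] --> (0 : R) -> F (- n%:R) @[n --> \oo] --> (0 : R) ->
  \int[leb]_x f x = 0.
Proof.
move=> dF cf fi Fp Fn.
have ci : cintegrable leb setT (fun x => (f x)%:C : C).
  by split; [exact: fi|exact: integrable0].
have [h _] := cvg_ball_integral ci.
have E n : complex.Re (cintegral leb `[- n%:R, n%:R] (fun x => (f x)%:C)) = F n%:R - F (- n%:R).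
  case: n => [|n].
    rewrite /cintegral/= oppr0 subrr set_itv1 /Rintegral integral_set1//.
  rewrite /cintegral/= /Rintegral (continuous_FTC2 (F := F))//.
  - by rewrite -subr_gt0 opprK addr_gt0 ?ltr0n.
  - exact: continuous_subspaceT.
  - have cF : continuous F.
      move=> x; apply: differentiable_continuous; apply/derivable1_diffP; exact: ex_derive.
    split => [x _||]; first exact: ex_derive.
      by apply: cvg_at_right_filter; exact: cF.
    by apply: cvg_at_left_filter; exact: cF.
  - by move=> x _; rewrite derive1E; exact: derive_val.
have h0 : complex.Re (cintegral leb `[- n%:R, n%:R] (fun x => (f x)%:C)) @[n --> \oo] --> (0 : R).
  have h1 : F n%:R - F (- n%:R) @[n --> \oo] --> (0 : R).
    by rewrite -[X in _ --> X](subr0 (0 : R)); exact: cvgB.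
  by under eq_fun do rewrite E.
by rewrite -(cvg_lim _ h0)//; apply/esym; exact: cvg_lim.
Qed.

(** The factor exp (- t) of Euler's integral at t = exp x; in this variable the integral extends
    over the whole line, against exp (s x). *)
Definition dexp (x : R) := expR (- expR x).

Lemma dexp_ge0 x : 0 <= dexp x. Proof. exact: expR_ge0. Qed.

Lemma continuous_dexp : continuous dexp.
Proof.
move=> x; apply: continuous_comp; last exact: continuous_expR.
by apply: continuousN; exact: continuous_expR.
Qed.

Lemma measurable_dexp : measurable_fun setT dexp.
Proof. apply: continuous_measurable_fun; exact: continuous_dexp. Qed.

(** For x <= 0 the factor [dexp] is at most 1. For x > 0 the term of degree N in the series of exp
    (exp x) bounds it by N! exp (- N x), where N >= c + 1. *)
Lemma dexp_decay (c : R) : 0 < c -> exists K k : R, [/\ 0 <= K, 0 < k &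
  forall x, expR (c * x) * dexp x <= K * expR (- (k * `|x|))].
Proof.
move=> c0; pose N := (Num.truncn c).+2; exists (N`!)%:R, (Num.min c 1); split => //.
  by rewrite lt_min c0 ltr01.
move=> x; have [kc k1] : Num.min c 1 <= c /\ Num.min c 1 <= 1 by split; rewrite ge_min lexx ?orbT.
have N1 : 1 <= N`!%:R :> R by rewrite ler1n fact_gt0.
have [x0|/ltW x0] := leP x 0.
  rewrite ler0_norm// mulrN opprK (@le_trans _ _ (expR (c * x)))//.
    by rewrite ler_piMr ?expR_ge0// -expR0 ler_expR oppr_le0 expR_ge0.
  rewrite (@le_trans _ _ (expR (Num.min c 1 * x)))//; last by rewrite ler_peMl// expR_ge0.
  by rewrite ler_expR ler_wnM2r.
rewrite ger0_norm//.
have e := expR_ge1Dxn (Num.truncn c).+1 (expR_ge0 x).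
have eN : expR (N%:R * x) / N`!%:R <= expR (expR x).
  by rewrite expRM_natl (le_trans _ e)// lerDr.
have cN : c + 1 <= N%:R.
  by rewrite /N -natr1 lerD2r ltW// truncnS_gt.
rewrite /dexp expRN ler_pdivrMr ?expR_gt0//.
apply: le_trans (ler_wpM2l _ eN); last by rewrite mulr_ge0 ?expR_ge0// ler0n.
have -> : N`!%:R * expR (- (Num.min c 1 * x)) * (expR (N%:R * x) / N`!%:R) =
    expR (- (Num.min c 1 * x)) * expR (N%:R * x).
  by field; rewrite pnatr_eq0 -lt0n fact_gt0.
rewrite -expRD ler_expR.
have : (c + 1) * x <= N%:R * x by rewrite ler_wpM2r.
have : Num.min c 1 * x <= 1 * x by rewrite ler_wpM2r.
by lra.
Qed.

Lemma integrable_dexp (c : R) : 0 < c ->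
  leb.-integrable setT (EFin \o (fun x => expR (c * x) * dexp x)).
Proof.
move=> c0; have [K [k [K0 k0 b]]] := dexp_decay c0.
have ik : leb.-integrable setT (EFin \o (fun x => K * expR (- (k * `|x|)))).
  by apply: integrable_mull; [exact: measurableT|exact: integrable_laplace].
apply: (le_integrable measurableT _ _ ik).
  apply/measurable_EFinP; apply: measurable_funM; last exact: measurable_dexp.
  by apply: measurableT_comp => //; exact: measurable_funM.
move=> x _ /=; rewrite lee_fin ger0_norm; first exact: le_trans (b x) (ler_norm _).
by rewrite mulr_ge0 ?expR_ge0.
Qed.

Definition gamma_line (s : C) : C := cintegral leb setT (fun x => expc (s * x%:C) * (dexp x)%:C).

Lemma cintegrable_gamma s : 0 < Re s ->
  cintegrable leb setT (fun x => expc (s * x%:C) * (dexp x)%:C).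
Proof.
move=> s0; apply: (@cintegrable_le R _ _ leb setT measurableT _ (fun x => expR (Re s * x) * dexp x)).
- apply: cmeasurableM.
    apply: cmeasurable_expc; apply: cmeasurableM; first exact: cmeasurable_cst.
    by apply: cmeasurable_real; exact: measurable_id.
  by apply: cmeasurable_real; exact: measurable_dexp.
- exact: integrable_dexp.
- move=> x _; rewrite Normc.normcM normc_expc ReMr normc_real ger0_norm//; exact: dexp_ge0.
Qed.

Lemma normc_gamma_le s : 0 < Re s -> normc (gamma_line s) <= 2 * \int[leb]_x (expR (Re s * x) * dexp x).
Proof.
move=> s0; apply: normc_cintegral_le => //.
- exact: cintegrable_measurable (cintegrable_gamma s0).
- exact: integrable_dexp.
- move=> x _; rewrite Normc.normcM normc_expc ReMr normc_real ger0_norm//; exact: dexp_ge0.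
Qed.

Let cvg_decay (K k : R) : 0 < k -> K * expR (- (k * `|n%:R|)) @[n --> \oo] --> (0 : R).
Proof.
move=> k0; rewrite -[X in _ --> X](mulr0 K); apply: cvgM; first exact: cvg_cst.
have -> : (fun n : nat => expR (- (k * `|n%:R|)) : R) = (fun n => expR (- k) ^+ n).
  by apply/funext => n; rewrite normr_nat -mulNr mulrC expRM_natl.
by apply: cvg_expr; rewrite ger0_norm ?expR_ge0// expR_lt1 oppr_lt0.
Qed.

(** Integration by parts: the derivative of exp (s x) [dexp x] is s times that function minus the
    integrand for s + 1, and the function vanishes at both ends of the line. The real and imaginary
    parts use the primitives with cos and with sin. *)
Lemma gamma_lineS s : 0 < Re s -> gamma_line (s + 1) = s * gamma_line s.
Proof.
move=> s0; set c := Re s; set v := Im s.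
have s10 : 0 < Re (s + 1) by rewrite ReD/= addr_gt0.
have [K [k [K0 k0 b]]] := dexp_decay s0.
have [I1 I2] := cintegrable_gamma s0; have [J1 J2] := cintegrable_gamma s10.
have sc x : Re (s * x%:C) = c * x by rewrite ReMr.
have sv x : Im (s * x%:C) = v * x by rewrite ImMr.
have s1c x : Re ((s + 1) * x%:C) = c * x + x by rewrite ReMr ReD/= mulrDl mul1r.
have s1v x : Im ((s + 1) * x%:C) = v * x by rewrite ImMr ImD/= addr0.
have F0 (u : nat -> R) (F : R -> R) : (forall x, `|F x| <= expR (c * x) * dexp x) ->
    (forall n, `|u n| = `|n%:R|) -> F (u n) @[n --> \oo] --> (0 : R).
  move=> Fb un; apply: norm_cvg0.
  apply: (@squeeze_cvgr _ _ _ _ (fun=> 0) (fun n => K * expR (- (k * `|n%:R|)))).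
  - apply: nearW => n; rewrite normr_ge0/= -un.
    exact: le_trans (Fb _) (b _).
  - exact: cvg_cst.
  - exact: cvg_decay.
have nN n : `|- n%:R| = `|n%:R : R| by rewrite normrN.
have cM (f : R -> R) (a : R) : continuous f -> continuous (fun x => f (a * x)).
  move=> cf x; apply: continuous_comp; last exact: cf.
  by apply: continuousM; [exact: cst_continuous|exact: cvg_id].
have cE := @continuous_expR R.
have cd := continuous_dexp.
apply: complex_eq; rewrite /= ?ReM ?ImM /=.
- pose F x := expR (c * x) * dexp x * cos (v * x).
  pose f x := c * Re (expc (s * x%:C) * (dexp x)%:C) - v * Im (expc (s * x%:C) * (dexp x)%:C) -
    Re (expc ((s + 1) * x%:C) * (dexp x)%:C).
  have fE x : f x = c * (expR (c * x) * cos (v * x) * dexp x)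
     - v * (expR (c * x) * sin (v * x) * dexp x) - expR (c * x) * expR x * cos (v * x) * dexp x.
    by rewrite /f !(ReMr, ImMr, Re_expc, Im_expc) !ReD !ImD/= mulrDl mul1r expRD addr0.
  have f0 : \int[leb]_x f x = 0.
    apply: (@integral_derive_eq0 F).
    + move=> x; rewrite fE /F /dexp; apply: is_derive_eq.
      by rewrite /GRing.scale/=; ring.
    + rewrite (_ : f = fun x => c * (expR (c * x) * cos (v * x) * dexp x)
        - v * (expR (c * x) * sin (v * x) * dexp x) - expR (c * x) * expR x * cos (v * x) * dexp x).
        move=> x; apply: cvgB; first apply: cvgB.
        * apply: cvgM; first exact: cvg_cst.
          apply: cvgM; last exact: cd.
          by apply: cvgM; apply: cM => //; exact: continuous_cos.
        * apply: cvgM; first exact: cvg_cst.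
          apply: cvgM; last exact: cd.
          by apply: cvgM; apply: cM => //; exact: continuous_sin.
        * apply: cvgM; last exact: cd.
          apply: cvgM; last by apply: cM; exact: continuous_cos.
          by apply: cvgM; [exact: cM|exact: cE].
      by apply/funext => x; exact: fE.
    + have i1 := integrable_mull measurableT c I1.
      have i2 := integrable_mull measurableT v I2.
      exact: (integrableB measurableT (integrableB measurableT i1 i2) J1).
    + by apply: F0 => // x; rewrite /F normrM ger0_norm ?mulr_ge0 ?expR_ge0//
        ler_piMr ?mulr_ge0 ?expR_ge0// ler_norml cos_geN1 cos_le1.
    + by apply: F0 => // x; rewrite /F normrM ger0_norm ?mulr_ge0 ?expR_ge0//
        ler_piMr ?mulr_ge0 ?expR_ge0// ler_norml cos_geN1 cos_le1.
  move: f0; rewrite /f RintegralB//; last first.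
    exact: (integrableB measurableT (integrable_mull measurableT c I1) (integrable_mull measurableT v I2)).
  rewrite RintegralB//; try exact: integrable_mull.
  by rewrite !RintegralZl// => /eqP; rewrite subr_eq0 => /eqP <-.
- pose F x := expR (c * x) * dexp x * sin (v * x).
  pose f x := c * Im (expc (s * x%:C) * (dexp x)%:C) + v * Re (expc (s * x%:C) * (dexp x)%:C) -
    Im (expc ((s + 1) * x%:C) * (dexp x)%:C).
  have fE x : f x = c * (expR (c * x) * sin (v * x) * dexp x)
     + v * (expR (c * x) * cos (v * x) * dexp x) - expR (c * x) * expR x * sin (v * x) * dexp x.
    by rewrite /f !(ReMr, ImMr, Re_expc, Im_expc) !ReD !ImD/= mulrDl mul1r expRD addr0.
  have f0 : \int[leb]_x f x = 0.
    apply: (@integral_derive_eq0 F).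
    + move=> x; rewrite fE /F /dexp; apply: is_derive_eq.
      by rewrite /GRing.scale/=; ring.
    + rewrite (_ : f = fun x => c * (expR (c * x) * sin (v * x) * dexp x)
        + v * (expR (c * x) * cos (v * x) * dexp x) - expR (c * x) * expR x * sin (v * x) * dexp x).
        move=> x; apply: cvgB; first apply: cvgD.
        * apply: cvgM; first exact: cvg_cst.
          apply: cvgM; last exact: cd.
          by apply: cvgM; apply: cM => //; exact: continuous_sin.
        * apply: cvgM; first exact: cvg_cst.
          apply: cvgM; last exact: cd.
          by apply: cvgM; apply: cM => //; exact: continuous_cos.
        * apply: cvgM; last exact: cd.
          apply: cvgM; last by apply: cM; exact: continuous_sin.
          by apply: cvgM; [exact: cM|exact: cE].
      by apply/funext => x; exact: fE.
    + have i1 := integrable_mull measurableT c I2.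
      have i2 := integrable_mull measurableT v I1.
      exact: (integrableB measurableT (integrableD measurableT i1 i2) J2).
    + by apply: F0 => // x; rewrite /F normrM ger0_norm ?mulr_ge0 ?expR_ge0//
        ler_piMr ?mulr_ge0 ?expR_ge0// ler_norml sin_geN1 sin_le1.
    + by apply: F0 => // x; rewrite /F normrM ger0_norm ?mulr_ge0 ?expR_ge0//
        ler_piMr ?mulr_ge0 ?expR_ge0// ler_norml sin_geN1 sin_le1.
  move: f0; rewrite /f RintegralB//; last first.
    exact: (integrableD measurableT (integrable_mull measurableT c I2) (integrable_mull measurableT v I1)).
  rewrite RintegralD//; try exact: integrable_mull.
  by rewrite !RintegralZl// => /eqP; rewrite subr_eq0 => /eqP <-.
Qed.

(** Two steps of the functional equation give |Gamma(s + 2)| >= v ^ 2 |Gamma(s)|. A bound of order m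
    at the abscissa c + 2, added to one of order m at c, thus yields order m + 1 at c. *)
Lemma gamma_line_decay (m : nat) (c : R) : 0 < c ->
  exists K : R, forall v, normc (gamma_line (c +i* v)) <= K * cauchy_ker v ^+ m.
Proof.
elim: m c => [|m IH] c c0.
  exists (2 * \int[leb]_x (expR (c * x) * dexp x)) => v.
  by rewrite expr0 mulr1; exact: (normc_gamma_le (s := c +i* v)).
have [K1 P1] := IH _ c0.
have [K2 P2] := IH _ (ltr_wpDr (ler0n R 2) c0).
exists (K1 + K2) => v.
have E : gamma_line ((c + 2) +i* v) = (c +i* v + 1) * ((c +i* v) * gamma_line (c +i* v)).
  have -> : (c + 2) +i* v = (c +i* v + 1) + 1.
    by apply: complex_eq; rewrite !(ReD, ImD)/= ?addr0//; ring.
  by rewrite gamma_lineS ?gamma_lineS// ReD/= addr_gt0.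
have := P2 v; rewrite E !Normc.normcM => Q2.
have n1 : `|v| <= normc (c +i* v + 1).
  by have := le_Im_normc (c +i* v + 1); rewrite ImD/= addr0.
have n2 := le_Im_normc (c +i* v).
have G0 := normc_ge0 (gamma_line (c +i* v)).
have Q : v ^+ 2 * normc (gamma_line (c +i* v)) <= K2 * cauchy_ker v ^+ m.
  rewrite -real_normK ?num_real// expr2 -mulrA; apply: le_trans Q2.
  by apply: ler_pM => //; [rewrite mulr_ge0|rewrite ler_wpM2r].
have v1 : 0 < 1 + v ^+ 2 by rewrite ltr_pwDl// sqr_ge0.
rewrite exprSr mulrA {2}/cauchy_ker ler_pdivlMr// mulrDr mulr1 mulrDl.
by rewrite [_ * v ^+ 2]mulrC; exact: lerD.
Qed.

End GammaDecay.

(** * The completed zeta function as a Mellin transform *)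

Section Zeta.
Context (R : realType).
Local Notation C := R[i].
Local Notation Re := (@complex.Re R).
Local Notation Im := (@complex.Im R).
Local Notation normc := (@Normc.normc R).
Local Notation leb := (@lebesgue_measure R).

Lemma cvg_complex (u : nat -> C) (l : C) :
  Re (u n) @[n --> \oo] --> Re l -> Im (u n) @[n --> \oo] --> Im l ->
  (u n : C^o) @[n --> \oo] --> (l : C^o).
Proof.
move=> u1 u2; apply/cvgrPdist_le => e /gt0_complex[eE e0].
have e2 : 0 < Re e / 2 by rewrite divr_gt0.
have /cvgrPdist_le/(_ _ e2) h1 := u1; have /cvgrPdist_le/(_ _ e2) h2 := u2.
near=> n; rewrite normcE eE lecR (le_trans (normc_le_ReIm _))// ReD ImD ReN ImN.
by rewrite (splitr (Re e)); apply: lerD; near: n.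
Unshelve. all: by end_near. Qed.

Let inv_sqr_le (m : R) : 0 < m -> ((m + 1) ^+ 2)^-1 <= m^-1 - (m + 1)^-1.
Proof.
move=> m0; have m1 : 0 < m + 1 by rewrite addr_gt0.
have -> : m^-1 - (m + 1)^-1 = (m * (m + 1))^-1 by field; rewrite !gt_eqF.
by rewrite lef_pV2 ?posrE ?exprn_gt0 ?mulr_gt0// expr2 ler_pM2r// lerDl.
Qed.

Lemma sum_inv_sqr_le n : \sum_(k < n) (k.+1%:R ^+ 2)^-1 <= 2 :> R.
Proof.
suff H m : \sum_(k < m.+1) (k.+1%:R ^+ 2)^-1 <= 2 - m.+1%:R^-1 :> R.
  case: n => [|n]; first by rewrite big_ord0.
  by rewrite (le_trans (H n))// lerBlDr lerDl invr_ge0.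
elim: m => [|m IH]; first by rewrite big_ord_recr big_ord0/= expr1n invr1 add0r; lra.
rewrite big_ord_recr/=; apply: le_trans (lerD IH (lexx _)) _.
have := inv_sqr_le (ltr0Sn R m); rewrite (natr1 m.+1 : m.+1%:R + 1 = m.+2%:R :> R).
by move=> h; rewrite -addrA lerD2l addrC lerBlDr [leRHS]addrC.
Qed.

(** The dilation of t by pi (k + 1) ^ 2 becomes the translation by [L k] in the variable x = ln
    t. *)
Let L (k : nat) : R := ln (pi * k.+1%:R ^+ 2).

Let expR_L k x : expR (x + L k) = pi * k.+1%:R ^+ 2 * expR x.
Proof.
by rewrite expRD lnK ?posrE ?mulr_gt0 ?pi_gt0 ?exprn_gt0 ?ltr0n// mulrC.
Qed.

Let LE k : L k = ln pi + 2 * ln k.+1%:R.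
Proof.
by rewrite /L lnM ?posrE ?pi_gt0 ?exprn_gt0 ?ltr0n// lnXn ?ltr0n// mulr_natl.
Qed.

Let expR_NL (c : R) k : 1 <= c -> expR (- (2 * c * ln k.+1%:R)) <= (k.+1%:R ^+ 2)^-1.
Proof.
move=> c1; have k0 : 0 < k.+1%:R ^+ 2 :> R by rewrite exprn_gt0// ltr0n.
rewrite expRN lef_pV2 ?posrE ?expR_gt0//.
rewrite -[leLHS]lnK ?posrE// ler_expR lnXn ?ltr0n// mulr2n.
have : ln k.+1%:R <= c * ln k.+1%:R by rewrite ler_peMl// ln_ge0// ler1n.
by move: (ln _) => l; lra.
Qed.

(* The Jacobi theta series without its constant term. *)
Definition omega (u : R) : \bar R :=
  (\sum_(k <oo) (2 * expR (- (pi * k.+1%:R ^+ 2 * u)))%:E)%E.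

Lemma omega_ge0 u : (0 <= omega u)%E.
Proof. by apply: nneseries_ge0 => k _ _; rewrite lee_fin mulr_ge0// expR_ge0. Qed.

Lemma omega_lty u : 0 < u -> (omega u < +oo)%E.
Proof.
move=> u0; have c0 : 0 < pi * u by rewrite mulr_gt0// pi_gt0.
have := gauss_sum_lty c0; rewrite -(@lte_pmul2l _ 2%:E)//.
rewrite esum_intE; last by move=> n; rewrite lee_fin expR_ge0.
rewrite mulry gtr0_sg// mul1e; apply: le_lt_trans.
rewrite -nneseriesZl//; last by move=> k _; rewrite adde_ge0// lee_fin expR_ge0.
apply: lee_nneseries => k _; first by rewrite lee_fin mulr_ge0// expR_ge0.
rewrite -EFinD -EFinM lee_fin ler_pM2l// mulrNz sqrrN.
rewrite (_ : (k.+1%:Z)%:~R = k.+1%:R)//.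
by rewrite mulrAC lerDr expR_ge0.
Qed.

Lemma measurable_omega : measurable_fun setT omega.
Proof.
apply: (@ge0_emeasurable_sum _ _ _ setT (fun k u => (2 * expR (- (pi * k.+1%:R ^+ 2 * u)))%:E) xpredT).
  by move=> k u _ _; rewrite lee_fin mulr_ge0// expR_ge0.
move=> k _; apply/measurable_EFinP; apply: measurable_funM => //.
by apply: measurableT_comp => //; apply: measurable_funN; exact: measurable_funM.
Qed.

Definition theta_log (x : R) : R := fine (omega (expR x)).
Let w := theta_log.

Lemma theta_logE x : (theta_log x)%:E = omega (expR x).
Proof. by rewrite fineK// ge0_fin_numE ?omega_ge0// omega_lty// expR_gt0. Qed.

Lemma theta_log_ge0 x : 0 <= theta_log x.
Proof. by rewrite -lee_fin theta_logE omega_ge0. Qed.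

Lemma measurable_theta_log : measurable_fun setT theta_log.
Proof.
apply/measurable_EFinP; rewrite (_ : _ \o _ = omega \o expR).
  by apply: measurableT_comp; [exact: measurable_omega|].
by apply/funext => x; rewrite /= theta_logE.
Qed.

Let wE x : (w x)%:E = (\sum_(k <oo) (2 * dexp (x + L k))%:E)%E.
Proof.
rewrite theta_logE /omega; apply: eq_eseriesr => k _; congr (2 * _)%:E.
by rewrite /dexp expR_L.
Qed.

Let cvg_w x : \sum_(k < n) (2 * dexp (x + L k)) @[n --> \oo] --> w x.
Proof.
have d0 k : (0 <= k)%N -> xpredT k -> (0 <= (2 * dexp (x + L k))%:E)%E.
  by move=> _ _; rewrite lee_fin mulr_ge0// dexp_ge0.
have h : (\sum_(0 <= k < n) (2 * dexp (x + L k))%:E)%E @[n --> \oo] --> (w x)%:E.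
  by rewrite wE; exact: (@is_cvg_nneseries R (fun k => (2 * dexp (x + L k))%:E) xpredT 0%N d0).
have E : (fun n : nat => \sum_(k < n) (2 * dexp (x + L k))) =
    fine \o (fun n : nat => (\sum_(0 <= k < n) (2 * dexp (x + L k))%:E)%E).
  by apply/funext => n; rewrite /= sumEFin big_mkord.
by rewrite E; exact: fine_cvg.
Qed.

Let partial_w_le x n : 0 <= \sum_(k < n) (2 * dexp (x + L k)) <= w x.
Proof.
have d0 k : 0 <= 2 * dexp (x + L k) by rewrite mulr_ge0// dexp_ge0.
rewrite sumr_ge0//=.
have nd : {homo (fun n : nat => \sum_(k < n) (2 * dexp (x + L k))) : n m / (n <= m)%N >-> n <= m}.
  by apply/nondecreasing_seqP => m; rewrite big_ord_recr/= lerDl.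
have cw : cvgn (fun n : nat => \sum_(k < n) (2 * dexp (x + L k))).
  by apply/cvg_ex; exists (w x); exact: cvg_w.
have := nondecreasing_cvgn_le nd cw n.
have wl : limn (fun n : nat => \sum_(k < n) (2 * dexp (x + L k))) = w x.
  by apply: cvg_lim => //; exact: cvg_w.
by rewrite wl.
Qed.

Lemma cvg_inv_sqr : cvgn (series (fun k => (k.+1%:R ^+ 2)^-1 : R)).
Proof.
apply: nondecreasing_is_cvgn.
  by apply/nondecreasing_seqP => m; rewrite !seriesEord/= big_ord_recr/= lerDl invr_ge0 sqr_ge0.
by exists 2 => _ [n _ <-]; rewrite seriesEord/=; exact: sum_inv_sqr_le.
Qed.

Let mterm (c : R) k : measurable_fun setT (fun x : R => expR (c * x) * (2 * dexp (x + L k))).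
Proof.
apply: measurable_funM.
  by apply: measurableT_comp => //; exact: measurable_funM.
apply: measurable_funM => //; apply: measurableT_comp; first exact: measurable_dexp.
exact: measurable_funD.
Qed.

(** Integrated term by term: the translation by [L k] multiplies the integral of exp (c x) [dexp x]
    by exp (- c L k), which is at most a constant times 1 / (k + 1) ^ 2 because c >= 1. *)
Lemma integrable_theta_log (c : R) : 1 <= c ->
  leb.-integrable setT (EFin \o (fun x => expR (c * x) * theta_log x)).
Proof.
move=> c1; have c0 : 0 < c by rewrite (lt_le_trans ltr01).
apply/integrableP; split.
  apply/measurable_EFinP; apply: measurable_funM; last exact: measurable_theta_log.
  by apply: measurableT_comp => //; exact: measurable_funM.
pose G : R := \int[leb]_x (expR (c * x) * dexp x).
have GE : (\int[leb]_x (expR (c * x) * dexp x)%:E = G%:E)%E.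
  rewrite /G /Rintegral fineK//; apply: integrable_fin_num => //; exact: integrable_dexp.
have G0 : 0 <= G.
  by rewrite -lee_fin -GE; apply: integral_ge0 => x _; rewrite lee_fin mulr_ge0 ?expR_ge0.
have E x : (`|(EFin \o (fun x => expR (c * x) * w x)%R) x| =
    \sum_(k <oo) (expR (c * x) * (2 * dexp (x + L k)))%:E)%E.
  rewrite /= ger0_norm; last by rewrite mulr_ge0 ?expR_ge0// theta_log_ge0.
  rewrite EFinM wE -nneseriesZl//; last by move=> k _; rewrite lee_fin mulr_ge0// dexp_ge0.
under eq_integral do rewrite E.
rewrite integral_nneseries//; last 2 first.
- by move=> k; apply/measurable_EFinP; exact: mterm.
- by move=> k x _; rewrite lee_fin !mulr_ge0 ?expR_ge0.
have I k : (\int[leb]_x (expR (c * x) * (2 * dexp (x + L k)))%:E)%E = (2 * expR (- (c * L k)) * G)%:E.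
  transitivity (\int[leb]_x ((2 * expR (- (c * L k)))%:E * (expR (c * (x + L k)) * dexp (x + L k))%:E))%E.
    apply: eq_integral => x _; rewrite -EFinM mulrDr expRD expRN; congr EFin.
    by field; rewrite gt_eqF// expR_gt0.
  rewrite ge0_integralZl//; last 2 first.
  - apply/measurable_EFinP; apply: (@measurableT_comp _ _ _ _ _ _ (fun x => expR (c * x) * dexp x)).
      by apply: measurable_funM; [apply: measurableT_comp => //; exact: measurable_funM|exact: measurable_dexp].
    exact: measurable_funD.
  - by move=> x _; rewrite lee_fin mulr_ge0 ?expR_ge0.
  rewrite (ge0_integral_shift (L k) (f := fun x => (expR (c * x) * dexp x)%:E)).
  - by rewrite GE.
  - apply/measurable_EFinP; apply: measurable_funM; last exact: measurable_dexp.
    by apply: measurableT_comp => //; exact: measurable_funM.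
  - by move=> x; rewrite lee_fin mulr_ge0 ?expR_ge0.
under eq_eseriesr do rewrite I.
apply: (@le_lt_trans _ _ (\sum_(k <oo) (2 * G * expR (- (c * ln pi)) * (k.+1%:R ^+ 2)^-1)%:E)%E).
  apply: lee_nneseries => k _; first by rewrite lee_fin !mulr_ge0 ?expR_ge0.
  rewrite lee_fin LE (_ : 2 * _ * G = 2 * G * expR (- (c * ln pi)) * expR (- (2 * c * ln k.+1%:R))); last first.
    rewrite (_ : - _ = - (c * ln pi) + - (2 * c * ln k.+1%:R)) ?expRD; ring.
  by rewrite ler_wpM2l ?mulr_ge0 ?expR_ge0//; exact: expR_NL.
rewrite nneseries_EFin ?ltry//.
exact: (@is_cvg_seriesZ R _ (2 * G * expR (- (c * ln pi))) cvg_inv_sqr).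
Qed.

Let Gammac_line (s : C) : 0 < Re s -> Gammac s = gamma_line s.
Proof.
move=> s0; rewrite /Gammac /gamma_line.
rewrite -(cintegral_expR (cintegrable_measurable (cintegrable_gamma s0))).
apply: eq_cintegral => t; rewrite /= in_itv/= andbT => t0.
rewrite /cpow /dexp lnK ?posrE// mulrBl mul1r expcD -[- (ln t)%:C]rmorphN/= expc_real (expRN (ln t)) lnK ?posrE//.
by rewrite mulrAC.
Qed.

Lemma normc_cpow_nat (c v : R) k : normc (cpow k.+1%:R (- (2 * (c +i* v)))) = expR (- (2 * c * ln k.+1%:R)).
Proof. by rewrite /cpow normc_expc !(ReMr, ReN, ReM)/=; congr expR; ring. Qed.

Let zsum (s : C) (n : nat) : C := \sum_(k < n) cpow k.+1%:R (- (2 * s)).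

Lemma Re_sum (I : Type) (r : seq I) (f : I -> C) : Re (\sum_(i <- r) f i) = \sum_(i <- r) Re (f i).
Proof. by apply: (big_morph Re) => // x y; rewrite ReD. Qed.

Lemma Im_sum (I : Type) (r : seq I) (f : I -> C) : Im (\sum_(i <- r) f i) = \sum_(i <- r) Im (f i).
Proof. by apply: (big_morph Im) => // x y; rewrite ImD. Qed.

(** The argument has real part 2 c >= 2, so the terms are bounded by 1 / (k + 1) ^ 2, whose sums are
    at most 2. The constant 4 adds the bounds for the real and imaginary parts. *)
Let zeta_cvg (c v : R) : 1 <= c ->
  [/\ Re (zsum (c +i* v) n) @[n --> \oo] --> Re (zeta (2 * (c +i* v))),
      Im (zsum (c +i* v) n) @[n --> \oo] --> Im (zeta (2 * (c +i* v))) &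
      normc (zeta (2 * (c +i* v))) <= 4].
Proof.
move=> c1; set s := c +i* v.
have le k : normc (cpow k.+1%:R (- (2 * s))) <= (k.+1%:R ^+ 2)^-1.
  by rewrite normc_cpow_nat; exact: expR_NL.
have real_cvg (f : nat -> R) : (forall k, `|f k| <= (k.+1%:R ^+ 2)^-1) ->
    cvgn (series f) /\ `|limn (series f)| <= 2.
  move=> fle; have cf : cvgn (series f).
    apply: normed_cvg; apply: (series_le_cvg _ _ _ cvg_inv_sqr) => k /=.
    - exact: normr_ge0.
    - by rewrite invr_ge0 sqr_ge0.
    - exact: fle.
  have b n : `|series f n| <= 2.
    rewrite seriesEord/= (le_trans (ler_norm_sum _ _ _))// (le_trans _ (sum_inv_sqr_le n))//.
    by apply: ler_sum => k _; exact: fle.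
  split => //; rewrite ler_norml; apply/andP; split.
    by apply: limr_ge => //; apply: nearW => n; have := b n; rewrite ler_norml => /andP[].
  by apply: limr_le => //; apply: nearW => n; have := b n; rewrite ler_norml => /andP[].
have [c1' b1] := real_cvg _ (fun k => le_trans (le_Re_normc _) (le k)).
have [c2' b2] := real_cvg _ (fun k => le_trans (le_Im_normc _) (le k)).
have E1 : (fun n => Re (zsum s n)) = series (fun k => Re (cpow k.+1%:R (- (2 * s)))).
  by apply/funext => n; rewrite seriesEord/= Re_sum.
have E2 : (fun n => Im (zsum s n)) = series (fun k => Im (cpow k.+1%:R (- (2 * s)))).
  by apply/funext => n; rewrite seriesEord/= Im_sum.
rewrite -E1 in c1' b1; rewrite -E2 in c2' b2.
have Z : zeta (2 * s) = limn (fun n => Re (zsum s n)) +i* limn (fun n => Im (zsum s n)).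
  rewrite /zeta (_ : series _ = (zsum s : nat -> C^o)); last first.
    by apply/funext => n; rewrite seriesEord.
  have h := @cvg_complex (zsum s) (limn (fun n => Re (zsum s n)) +i* limn (fun n => Im (zsum s n))) c1' c2'.
  exact: (cvg_lim (@norm_hausdorff _ C^o) h).
rewrite Z; split => //; rewrite (le_trans (normc_le_ReIm _))//=.
by move: b1 b2; lra.
Qed.

Section mellin.
Variables (c v : R).
Hypothesis c1 : 1 <= c.
Let s := c +i* v.
Let c0 : 0 < c. Proof. by rewrite (lt_le_trans ltr01). Qed.

Let mexp : cmeasurable setT (fun x : R => expc (s * x%:C)).
Proof.
apply: cmeasurable_expc; apply: cmeasurableM; first exact: cmeasurable_cst.
by apply: cmeasurable_real; exact: measurable_id.
Qed.

Let normc_exp (x a : R) : 0 <= a -> normc (expc (s * x%:C) * a%:C) = expR (c * x) * a.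
Proof. by move=> a0; rewrite Normc.normcM normc_expc ReMr normc_real ger0_norm. Qed.

(** The translation by [L k] brings out exp (- s L k) = pi ^ (- s) (k + 1) ^ (- 2 s). *)
Let iterm k : cintegrable leb setT (fun x => expc (s * x%:C) * (2 * dexp (x + L k))%:C) /\
  cintegral leb setT (fun x => expc (s * x%:C) * (2 * dexp (x + L k))%:C) =
  2 * cpow pi (- s) * gamma_line s * cpow k.+1%:R (- (2 * s)).
Proof.
have md : measurable_fun setT (fun x : R => 2 * dexp (x + L k)).
  apply: measurable_funM => //; apply: measurableT_comp; first exact: measurable_dexp.
  exact: measurable_funD.
split.
  apply: (@cintegrable_le R _ _ leb setT measurableT _ (fun x => expR (c * x) * theta_log x)).
  - by apply: cmeasurableM => //; exact: cmeasurable_real.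
  - exact: integrable_theta_log.
  - move=> x _; rewrite normc_exp ?mulr_ge0 ?dexp_ge0// ler_wpM2l ?expR_ge0//.
    have /andP[_] := partial_w_le x k.+1; apply: le_trans.
    by rewrite big_ord_recr/= lerDr sumr_ge0// => i _; rewrite mulr_ge0 ?dexp_ge0.
have ig := cintegrable_gamma (s := s) c0.
transitivity (cintegral leb setT (fun x => (2 * expc (- (s * (L k)%:C))) *
    (expc (s * (x + L k)%:C) * (dexp (x + L k))%:C))).
  apply: eq_cintegral => x _.
  have -> : s * x%:C = - (s * (L k)%:C) + s * (x + L k)%:C by rewrite rmorphD/=; ring.
  by rewrite expcD rmorphM/=; ring.
rewrite (cintegral_shift (L k) (f := fun x => (2 * expc (- (s * (L k)%:C))) *
    (expc (s * x%:C) * (dexp x)%:C))); last first.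
  by apply: cmeasurableM; [exact: cmeasurable_cst|exact: cintegrable_measurable ig].
rewrite (@cintegralZ R _ _ leb setT measurableT _ _ ig) -/(gamma_line s).
have -> : expc (- (s * (L k)%:C)) = cpow pi (- s) * cpow k.+1%:R (- (2 * s)).
  rewrite -expcD; congr expc; rewrite LE rmorphD rmorphM/=.
  by rewrite (rmorph_nat (@real_complex R) 2); ring.
by rewrite mulrA mulrAC.
Qed.

Let W n (x : R) := \sum_(k < n) (2 * dexp (x + L k)).

Let ipart n : cintegrable leb setT (fun x => expc (s * x%:C) * (W n x)%:C) /\
  cintegral leb setT (fun x => expc (s * x%:C) * (W n x)%:C) =
  2 * cpow pi (- s) * gamma_line s * zsum s n.
Proof.
elim: n => [|n [IH1 IH2]].
  have E : (fun x : R => expc (s * x%:C) * (W 0 x)%:C) = fun=> 0.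
    by apply/funext => x; rewrite /W big_ord0 mulr0.
  rewrite E /zsum big_ord0 mulr0; split; first by split; exact: integrable0.
  by apply: complex_eq => /=; rewrite Rintegral_cst// mul0r.
have [it1 it2] := iterm n.
have E : (fun x : R => expc (s * x%:C) * (W n.+1 x)%:C) =
    fun x => expc (s * x%:C) * (W n x)%:C + expc (s * x%:C) * (2 * dexp (x + L n))%:C.
  by apply/funext => x; rewrite /W big_ord_recr/= rmorphD/= mulrDr.
rewrite E; split; first exact: (cintegrableD measurableT IH1 it1).
rewrite (@cintegralD R _ _ leb setT measurableT _ _ IH1 it1) IH2 it2.
by rewrite /zsum big_ord_recr/= mulrDr.
Qed.

Lemma cintegrable_theta_log : cintegrable leb setT (fun x => expc (s * x%:C) * (theta_log x)%:C).
Proof.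
apply: (@cintegrable_le R _ _ leb setT measurableT _ (fun x => expR (c * x) * theta_log x)).
- by apply: cmeasurableM => //; apply: cmeasurable_real; exact: measurable_theta_log.
- exact: integrable_theta_log.
- by move=> x _; rewrite normc_exp// theta_log_ge0.
Qed.

Let xiE : 2 * xi (2 * s) = 2 * cpow pi (- s) * gamma_line s * zeta (2 * s).
Proof.
have s2 : 2 * s / 2 = s by rewrite mulrAC divff ?mul1r// pnatr_eq0.
by rewrite /xi s2 Gammac_line// !mulrA.
Qed.

(** Riemann's formula: the theta series is integrated term by term, its partial sums being dominated
    by its sum. *)
Lemma xi_mellin : 2 * xi (2 * s) = cintegral leb setT (fun x => expc (s * x%:C) * (theta_log x)%:C).
Proof.
have [z1 z2 _] := zeta_cvg v c1; rewrite -/s in z1 z2.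
have [d1 d2] : Re (cintegral leb setT (fun x => expc (s * x%:C) * (W n x)%:C)) @[n --> \oo] -->
    Re (cintegral leb setT (fun x => expc (s * x%:C) * (theta_log x)%:C)) /\
  Im (cintegral leb setT (fun x => expc (s * x%:C) * (W n x)%:C)) @[n --> \oo] -->
    Im (cintegral leb setT (fun x => expc (s * x%:C) * (theta_log x)%:C)).
  apply: (@cintegral_dominated _ _ _ leb setT measurableT _ _ _ _ _ _ _ (integrable_theta_log c1)).
  - by move=> n; have [/cintegrable_measurable] := ipart n.
  - exact: cintegrable_measurable cintegrable_theta_log.
  - move=> x _; under eq_fun do rewrite ReMr; rewrite ReMr.
    by apply: cvgM; [exact: cvg_cst|exact: cvg_w].
  - move=> x _; under eq_fun do rewrite ImMr; rewrite ImMr.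
    by apply: cvgM; [exact: cvg_cst|exact: cvg_w].
  - move=> n x _; have /andP[w0 wl] := partial_w_le x n.
    by rewrite normc_exp// ler_wpM2l ?expR_ge0.
have E n := (ipart n).2.
rewrite xiE; set P := 2 * cpow pi (- s) * gamma_line s in E *.
apply: complex_eq.
- rewrite -(cvg_lim _ d1)//; apply/esym/cvg_lim => //.
  under eq_fun do rewrite E ReM; rewrite ReM.
  by apply: cvgB; apply: cvgM => //; exact: cvg_cst.
- rewrite -(cvg_lim _ d2)//; apply/esym/cvg_lim => //.
  under eq_fun do rewrite E ImM; rewrite ImM.
  by apply: cvgD; apply: cvgM => //; exact: cvg_cst.
Qed.

Lemma normc_xi_le K m : normc (gamma_line s) <= K * cauchy_ker v ^+ m ->
  normc (2 * xi (2 * s)) <= 8 * expR (- (c * ln pi)) * K * cauchy_ker v ^+ m.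
Proof.
move=> gK; have [_ _ z4] := zeta_cvg v c1; rewrite -/s in z4.
rewrite xiE (Normc.normcM (2 * cpow pi (- s) * gamma_line s)) (Normc.normcM (2 * cpow pi (- s))).
rewrite (Normc.normcM 2) (_ : normc 2 = 2); last first.
  by have := normc_real (2 : R); rewrite rmorph_nat ger0_norm.
rewrite (_ : normc (cpow pi (- s)) = expR (- (c * ln pi))); last first.
  by rewrite /cpow normc_expc ReMr ReN mulNr.
have -> : 8 * expR (- (c * ln pi)) * K * cauchy_ker v ^+ m =
  2 * expR (- (c * ln pi)) * (K * cauchy_ker v ^+ m) * 4 by ring.
apply: ler_pM => //; rewrite ?mulr_ge0 ?expR_ge0 ?normc_ge0//.
by rewrite ler_wpM2l// mulr_ge0 ?expR_ge0.
Qed.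

End mellin.

Lemma xi_decay (c : R) m : 1 <= c ->
  exists K, forall v, normc (2 * xi (2 * (c +i* v))) <= K * cauchy_ker v ^+ m.
Proof.
move=> c1; have [K KP] := gamma_line_decay m (lt_le_trans ltr01 c1).
by exists (8 * expR (- (c * ln pi)) * K) => v; exact: normc_xi_le.
Qed.

(** The pointwise counterpart of [integrable_theta_log], which makes the convolution below converge
    absolutely at every x. *)
Lemma theta_log_bound (c : R) : 1 <= c -> exists K, forall x, expR (c * x) * theta_log x <= K.
Proof.
move=> c1; have c0 : 0 < c by rewrite (lt_le_trans ltr01).
have [K [k [K0 k0 dK]]] := dexp_decay c0.
have dK' x : expR (c * x) * dexp x <= K.
  by apply: le_trans (dK x) _; rewrite ler_piMr// -expR0 ler_expR oppr_le0 mulr_ge0// ltW.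
have P0 : 0 <= 2 * K * expR (- (c * ln pi)) by rewrite !mulr_ge0 ?expR_ge0.
exists (2 * K * expR (- (c * ln pi)) * 2) => x.
have h : expR (c * x) * \sum_(k < n) (2 * dexp (x + L k)) @[n --> \oo] --> expR (c * x) * theta_log x.
  by apply: cvgM; [exact: cvg_cst|exact: cvg_w].
apply: (cvgr_to_le h); apply: nearW => n.
apply: le_trans (_ : _ <= 2 * K * expR (- (c * ln pi)) * \sum_(k < n) (k.+1%:R ^+ 2)^-1) _; last first.
  by rewrite ler_wpM2l// sum_inv_sqr_le.
rewrite !mulr_sumr; apply: ler_sum => i _.
have -> : expR (c * x) * (2 * dexp (x + L i)) =
    2 * (expR (c * (x + L i)) * dexp (x + L i)) * expR (- (c * L i)).
  by rewrite mulrDr expRD expRN; field; rewrite gt_eqF// expR_gt0.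
apply: (@le_trans _ _ (2 * K * expR (- (c * L i)))).
  by rewrite ler_wpM2r ?expR_ge0// ler_wpM2l.
rewrite -[leRHS]mulrA ler_wpM2l ?mulr_ge0// LE.
rewrite (_ : - (c * _) = - (c * ln pi) + - (2 * c * ln i.+1%:R)); last by ring.
by rewrite expRD ler_wpM2l ?expR_ge0//; exact: expR_NL.
Qed.

Section convolution.
Variables (c : R) (b : R -> C).
Hypotheses (c1 : 1 <= c) (mb : cmeasurable setT b).
Hypothesis ib : leb.-integrable setT (EFin \o (fun r => expR ((c - 1) * r) * normc (b r))).

(** With y = exp r this is the integral of omega (exp x / y) b dy / y ^ 2, the shape taken by the
    integral of the theta series once it is unfolded. *)
Definition theta_conv (x : R) : C :=
  cintegral leb setT (fun r => (theta_log (x - r) * expR (- r))%:C * b r).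

Let kern (s : C) (z : R * R) : C := expc (s * z.1%:C) * ((theta_log (z.1 - z.2) * expR (- z.2))%:C * b z.2).

Let mkern s : cmeasurable setT (kern s).
Proof.
apply: cmeasurableM.
  apply: cmeasurable_expc; apply: cmeasurableM; first exact: cmeasurable_cst.
  by apply: cmeasurable_real; exact: measurable_fst.
apply: cmeasurableM; last exact: (@cmeasurable_snd _ _ _ _ R _ mb).
apply: cmeasurable_real; apply: measurable_funM.
  apply: measurableT_comp; first exact: measurable_theta_log.
  by apply: measurable_funB; [exact: measurable_fst|exact: measurable_snd].
by apply: measurableT_comp => //; apply: measurable_funN; exact: measurable_snd.
Qed.

Let g (x : R) := expR (c * x) * theta_log x.
Let h (r : R) := expR ((c - 1) * r) * normc (b r).

Let ikern v : cintegrable (leb \x leb)%E setT (kern (c +i* v)).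
Proof.
have gi := integrable_theta_log c1.
have mg : measurable_fun setT g by apply/measurable_EFinP; exact: measurable_int gi.
have mh : measurable_fun setT h by apply/measurable_EFinP; exact: measurable_int ib.
have g0 x : 0 <= g x by rewrite mulr_ge0 ?expR_ge0 ?theta_log_ge0.
have h0 x : 0 <= h x by rewrite mulr_ge0 ?expR_ge0 ?normc_ge0.
have I : (leb \x leb)%E.-integrable setT (EFin \o (fun z => h z.2 * g (z.1 - z.2))).
  apply/integrable21ltyP.
    apply/measurable_EFinP; apply: measurable_funM.
      by apply: (measurableT_comp mh); exact: measurable_snd.
    by apply: (measurableT_comp mg); apply: measurable_funB; [exact: measurable_fst|exact: measurable_snd].
  pose G : R := \int[leb]_x g x.
  have GE : (\int[leb]_x (g x)%:E = G%:E)%E.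
    by rewrite /G /Rintegral fineK//; apply: integrable_fin_num.
  apply: (@le_lt_trans _ _ (\int[leb]_r (G%:E * (h r)%:E))%E).
    rewrite le_eqVlt; apply/orP; left; apply/eqP; apply: eq_integral => r _.
    transitivity (\int[leb]_x ((h r)%:E * (g (x - r))%:E))%E.
      by apply: eq_integral => x _; rewrite /= -EFinM ger0_norm// mulr_ge0.
    rewrite ge0_integralZl//; last 3 first.
    - apply/measurable_EFinP; apply: (measurableT_comp mg); exact: measurable_funB.
    - by move=> x _; rewrite lee_fin.
    - by rewrite lee_fin.
    rewrite (ge0_integral_shift (- r) (f := fun x => (g x)%:E)).
    - by rewrite GE muleC.
    - exact/measurable_EFinP.
    - by move=> x; rewrite lee_fin.
  have := integrable_mull measurableT G ib => /integrableP[_].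
  apply: le_lt_trans; apply: ge0_le_integral => //.
  - by move=> r _; rewrite -EFinM lee_fin mulr_ge0// -lee_fin -GE; apply: integral_ge0 => x _; rewrite lee_fin.
  - by apply/measurable_EFinP; apply: measurable_funM.
  - by apply: measurableT_comp => //; apply/measurable_EFinP; apply: measurable_funM.
  - by move=> r _; rewrite /= lee_fin ler_norm.
apply: (@cintegrable_le R _ _ (leb \x leb)%E setT measurableT _ _ (mkern _) I) => z _.
rewrite /kern (Normc.normcM (expc _)) normc_expc ReMr (Normc.normcM _%:C) normc_real ger0_norm; last first.
  by rewrite mulr_ge0 ?expR_ge0 ?theta_log_ge0.
rewrite /h /g mulrBr le_eqVlt; apply/orP; left; apply/eqP.
rewrite (_ : expR (c * z.1 - c * z.2) = expR (c * z.1) * expR (- (c * z.2))) ?expRD//.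
have -> : (c - 1) * z.2 = c * z.2 - z.2 by ring.
rewrite expRD expRN [expR (- (c * z.2))]expRN; field; rewrite !gt_eqF ?expR_gt0//.
Qed.

Lemma cintegrable_theta_conv x : cintegrable leb setT (fun r => (theta_log (x - r) * expR (- r))%:C * b r).
Proof.
have [K KP] := theta_log_bound c1.
apply: (@cintegrable_le R _ _ leb setT measurableT _ (fun r => K * expR (- (c * x)) * h r)).
- apply: cmeasurableM => //; apply: cmeasurable_real; apply: measurable_funM.
    apply: measurableT_comp; first exact: measurable_theta_log.
    exact: measurable_funB.
  by apply: measurableT_comp => //; exact: measurable_funN.
- by apply: integrable_mull; [exact: measurableT|exact: ib].
- move=> r _; rewrite Normc.normcM normc_real ger0_norm ?mulr_ge0 ?expR_ge0 ?theta_log_ge0//.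
  rewrite /h mulrA ler_wpM2r ?normc_ge0//.
  have := KP (x - r); rewrite -(ler_pM2r (expR_gt0 (- (c * x) + (c - 1) * r))) => H.
  rewrite (_ : K * _ * _ = K * expR (- (c * x) + (c - 1) * r)); last by rewrite expRD mulrA.
  apply: le_trans H; rewrite mulrAC -expRD [leRHS]mulrC.
  by rewrite (_ : c * (x - r) + (- (c * x) + (c - 1) * r) = - r)//; ring.
Qed.

Let inner_r (s : C) x : cintegral leb setT (fun r => kern s (x, r)) = expc (s * x%:C) * theta_conv x.
Proof. by rewrite /kern/= (@cintegralZ R _ _ leb setT measurableT _ _ (cintegrable_theta_conv x)). Qed.

(** Both facts are read off from Fubini's theorem for the kernel at the real point s = c. *)
Lemma theta_conv_integrable : cmeasurable setT theta_conv /\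
  leb.-integrable setT (EFin \o (fun x => expR (c * x) * normc (theta_conv x))).
Proof.
have [I _] := cfubini (ikern 0).
have {}I : cintegrable leb setT (fun x => expc ((c +i* 0) * x%:C) * theta_conv x).
  rewrite (_ : (fun x => _) = (fun x => cintegral leb setT (fun r => kern (c +i* 0) (x, r))))//.
  by apply/funext => x; rewrite inner_r.
split.
  have E : theta_conv = fun x => expc (- ((c +i* 0) * x%:C)) * (expc ((c +i* 0) * x%:C) * theta_conv x).
    by apply/funext => x; rewrite mulrA -expcD addNr expc0 mul1r.
  rewrite E; apply: cmeasurableM; last exact: cintegrable_measurable I.
  apply: cmeasurable_expc; split => /=.
    apply: measurable_funN; apply: measurable_funB; exact: measurable_funM.
  by apply: measurable_funN; apply: measurable_funD; exact: measurable_funM.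
have := cintegrable_normc measurableT I.
rewrite (_ : (fun x => normc _) = (fun x => expR (c * x) * normc (theta_conv x)))//.
by apply/funext => x; rewrite Normc.normcM normc_expc ReMr.
Qed.

(** The Mellin transform of a convolution: substituting x + r for x separates the variables, and exp
    (- r) turns the transform of [b] at s into the one at s - 1. *)
Lemma mellin_theta_conv v :
  cintegral leb setT (fun x => expc ((c +i* v) * x%:C) * theta_conv x) =
  2 * xi (2 * (c +i* v)) * cintegral leb setT (fun r => b r * expc ((c +i* v - 1) * r%:C)).
Proof.
set s := c +i* v; have [_] := cfubini (ikern v).
have E1 : (fun x => cintegral leb setT (fun r => kern s (x, r))) = (fun x => expc (s * x%:C) * theta_conv x).
  by apply/funext => x; exact: inner_r.
rewrite [X in cintegral _ _ X = _ -> _]E1 => ->.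
have ibs : cintegrable leb setT (fun r => b r * expc ((s - 1) * r%:C)).
  apply: (@cintegrable_le R _ _ leb setT measurableT _ _ _ ib).
    apply: cmeasurableM => //; apply: cmeasurable_expc; apply: cmeasurableM; first exact: cmeasurable_cst.
    by apply: cmeasurable_real; exact: measurable_id.
  by move=> r _; rewrite Normc.normcM normc_expc ReMr ReD ReN/= mulrC.
rewrite -(@cintegralZ R _ _ leb setT measurableT _ _ ibs); apply: eq_cintegral => r _.
have it := cintegrable_theta_log v c1.
transitivity (cintegral leb setT (fun x => (b r * expc ((s - 1) * r%:C)) *
    (expc (s * (x + - r)%:C) * (theta_log (x + - r))%:C))).
  apply: eq_cintegral => x _; rewrite /kern/=.
  have -> : s * (x + - r)%:C = s * x%:C - s * r%:C by rewrite rmorphD rmorphN/=; ring.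
  have -> : (s - 1) * r%:C = s * r%:C + (- r)%:C by rewrite rmorphN/=; ring.
  rewrite !expcD expc_real rmorphM/=.
  have E : expc (s * r%:C) * expc (- (s * r%:C)) = 1 by rewrite -expcD subrr expc0.
  move: (expc (s * r%:C)) (expc (- (s * r%:C))) E => p q E.
  by ring: E.
rewrite (cintegral_shift (- r) (f := fun x => (b r * expc ((s - 1) * r%:C)) *
    (expc (s * x%:C) * (theta_log x)%:C))); last first.
  by apply: cmeasurableM; [exact: cmeasurable_cst|exact: cintegrable_measurable it].
by rewrite (@cintegralZ R _ _ leb setT measurableT _ _ it) -xi_mellin// mulrC.
Qed.

End convolution.

End Zeta.

(** * The action of SL_2(Z) on the upper half-plane *)

Section SL2ZAlgebra.

HB.instance Definition _ := [Countable of SL2Z by <:].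

Implicit Types g h : SL2Z.

Lemma ord2P (i : 'I_2) : i = 0 \/ i = 1.
Proof. by case: i => [[|[|//]] ?]; [left|right]; exact/val_inj. Qed.

Lemma sl2_det g : g 0 0 * g 1 1 - g 0 1 * g 1 0 = 1.
Proof.
have /eqP := valP g; rewrite (expand_det_row _ 0) !big_ord_recl big_ord0 addr0.
rewrite /cofactor !det_mx11 !mxE /= expr0 expr1 mul1r.
rewrite (_ : lift 0 0 = 1 :> 'I_2); last exact/val_inj.
rewrite (_ : lift 1 0 = 0 :> 'I_2); last exact/val_inj.
by move=> <-; rewrite mulN1r mulrN.
Qed.

Lemma sl2_eq g h : g 0 0 = h 0 0 -> g 0 1 = h 0 1 -> g 1 0 = h 1 0 -> g 1 1 = h 1 1 -> g = h.
Proof.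
move=> e1 e2 e3 e4; apply/val_inj/matrixP => i j.
by have [->|->] := ord2P i; have [->|->] := ord2P j.
Qed.

Lemma sl2_ex (a b c d : int) : a * d - b * c = 1 ->
  exists g : SL2Z, [/\ g 0 0 = a, g 0 1 = b, g 1 0 = c & g 1 1 = d].
Proof.
move=> abcd; pose A : 'M[int]_2 := \matrix_(i < 2, j < 2)
  (if i == 0 then (if j == 0 then a else b) else (if j == 0 then c else d)).
have dA : \det A == 1.
  rewrite (expand_det_row _ 0) !big_ord_recl big_ord0 addr0.
  rewrite /cofactor !det_mx11 !mxE /= expr0 expr1 mul1r.
  by rewrite mulN1r mulrN abcd.
by exists (SL2 dA); rewrite /= !mxE.
Qed.

Lemma sl2_mulE g h i j : (g * h)%g i j = g i 0 * h 0 j + g i 1 * h 1 j.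
Proof.
rewrite [LHS]mxE !big_ord_recl big_ord0 addr0.
by rewrite (_ : lift 0 0 = 1 :> 'I_2)//; exact/val_inj.
Qed.

Lemma sl2_oneE i j : (1%g : SL2Z) i j = (i == j)%:R.
Proof. by rewrite [LHS]mxE. Qed.

Lemma sl2_oppE g i j : sl2_opp g i j = - g i j.
Proof. by rewrite [LHS]mxE. Qed.

Lemma sl2_oppM g h : (sl2_opp g * h)%g = sl2_opp (g * h)%g.
Proof. by apply/val_inj; rewrite /= mulNr. Qed.

Lemma sl2_mulN g h : (g * sl2_opp h)%g = sl2_opp (g * h)%g.
Proof. by apply/val_inj; rewrite /= mulrN. Qed.

Lemma sl2_oppK : involutive sl2_opp.
Proof. by move=> g; apply/val_inj; rewrite /= opprK. Qed.

Lemma sl2_opp_neq g : sl2_opp g != g.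
Proof.
apply/eqP => /(congr1 (fun h : SL2Z => (h 0 0, h 1 1, h 0 1))) []; rewrite !sl2_oppE => e1 e2 e3.
have := sl2_det g; have {e1} -> : g 0 0 = 0 by lia.
have -> : g 0 1 = 0 by lia.
by rewrite !mul0r subr0.
Qed.

Fact transl_subproof (m : int) : exists g : SL2Z, [/\ g 0 0 = 1, g 0 1 = m, g 1 0 = 0 & g 1 1 = 1].
Proof. by apply: sl2_ex; rewrite mulr1 mulr0 subr0. Qed.

Definition transl (m : int) : SL2Z := sval (cid (transl_subproof m)).

Lemma translE m : [/\ transl m 0 0 = 1, transl m 0 1 = m, transl m 1 0 = 0 & transl m 1 1 = 1].
Proof. exact: svalP (cid (transl_subproof m)). Qed.

Lemma translD m n : transl (m + n) = (transl m * transl n)%g.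
Proof.
have [a1 a2 a3 a4] := translE m; have [b1 b2 b3 b4] := translE n; have [c1 c2 c3 c4] := translE (m + n).
by apply: sl2_eq; rewrite !sl2_mulE ?(a1, a2, a3, a4, b1, b2, b3, b4, c1, c2, c3, c4); ring.
Qed.

Lemma transl0 : transl 0 = 1%g.
Proof. by have [a1 a2 a3 a4] := translE 0; apply: sl2_eq; rewrite !sl2_oneE. Qed.

Lemma translX v : (translation ^+ v)%g = transl v%:Z.
Proof.
elim: v => [|v IH]; first by rewrite expg0 transl0.
rewrite expgS IH -addn1 PoszD addrC translD; congr (_ * _)%g.
by have [a1 a2 a3 a4] := translE 1; apply: sl2_eq; rewrite ?(a1, a2, a3, a4) mxE.
Qed.

Lemma transl_inj m n : transl m = transl n -> m = n.
Proof.
by move=> /(congr1 (fun g : SL2Z => g 0 1)); have [_ -> _ _] := translE m; have [_ -> _ _] := translE n.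
Qed.

Lemma same_bottom g h : g 1 0 = h 1 0 -> g 1 1 = h 1 1 -> exists m, g = (transl m * h)%g.
Proof.
(* The upper right entry of g h^-1, a matrix whose bottom row is (0, 1). *)
move=> e1 e2; exists (g 0 1 * h 0 0 - g 0 0 * h 0 1).
set m := _ - _; have [a1 a2 a3 a4] := translE m.
have dg := sl2_det g; have dh := sl2_det h; rewrite e1 e2 in dg.
apply: sl2_eq; rewrite !sl2_mulE ?(a1, a2, a3, a4) ?e1 ?e2 /m; rewrite ?mul0r ?mul1r ?add0r//.
- have -> : h 0 0 + (g 0 1 * h 0 0 - g 0 0 * h 0 1) * h 1 0 =
      h 0 0 * (1 + g 0 1 * h 1 0) - g 0 0 * (h 0 1 * h 1 0) by ring.
  rewrite -{1}dg subrK.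
  have -> : h 0 0 * (g 0 0 * h 1 1) - g 0 0 * (h 0 1 * h 1 0) =
      g 0 0 * (h 0 0 * h 1 1 - h 0 1 * h 1 0) by ring.
  by rewrite dh mulr1.
- have -> : h 0 1 + (g 0 1 * h 0 0 - g 0 0 * h 0 1) * h 1 1 =
      h 0 1 * (1 - g 0 0 * h 1 1) + g 0 1 * h 0 0 * h 1 1 by ring.
  rewrite -{1}dg addrAC subrr add0r.
  have -> : h 0 1 * - (g 0 1 * h 1 0) + g 0 1 * h 0 0 * h 1 1 =
      g 0 1 * (h 0 0 * h 1 1 - h 0 1 * h 1 0) by ring.
  by rewrite dh mulr1.
Qed.

End SL2ZAlgebra.

Section Mobius.
Context (R : realType).
Local Notation C := R[i].
Local Notation Re := (@complex.Re R).
Local Notation Im := (@complex.Im R).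
Implicit Types (g h : SL2Z) (z : C) (p : R * R).

(** This is |c z + d| ^ 2, where (c, d) is the bottom row of [g]. *)
Definition norm_den g p : R :=
  ((g 1 0)%:~R * p.1 + (g 1 1)%:~R) ^+ 2 + ((g 1 0)%:~R * p.2) ^+ 2.

Definition mob g p : R * R := (Re (mobius g (of_coords p)), Im (mobius g (of_coords p))).

Lemma of_coordsK p : (Re (of_coords p), Im (of_coords p)) = p.
Proof. by case: p. Qed.

Lemma of_coords_mob g p : of_coords (mob g p) = mobius g (of_coords p).
Proof. by rewrite /mob /of_coords/=; case: (mobius _ _). Qed.

Lemma det_real g : (g 0 0)%:~R * (g 1 1)%:~R - (g 0 1)%:~R * (g 1 0)%:~R = 1 :> R.
Proof. by rewrite -!intrM -intrB sl2_det. Qed.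

Lemma norm_den_gt0 g p : 0 < p.2 -> 0 < norm_den g p.
Proof.
move=> y0; rewrite /norm_den lt_neqAle addr_ge0 ?sqr_ge0// andbT eq_sym.
rewrite paddr_eq0 ?sqr_ge0// !sqrf_eq0 mulf_eq0 (gt_eqF y0) orbF.
apply/negP => /andP[/eqP h1 /eqP h2]; rewrite h2 mul0r add0r in h1.
by have := det_real g; rewrite h1 h2 !mulr0 subrr => /eqP; rewrite eq_sym oner_eq0.
Qed.

Definition den g z : C := (g 1 0)%:~R * z + (g 1 1)%:~R.

Let ReZ (m : int) : Re m%:~R = m%:~R.
Proof. by rewrite -(rmorph_int (@real_complex R)). Qed.
Let ImZ (m : int) : Im m%:~R = 0.
Proof. by rewrite -(rmorph_int (@real_complex R)). Qed.

Lemma den_neq0 g z : 0 < Im z -> den g z != 0.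
Proof.
move=> z0; have /lt0r_neq0 := norm_den_gt0 g (p := (Re z, Im z)) z0.
apply: contra => /eqP/(congr1 (fun w => (Re w, Im w))) []; rewrite !(ReD, ImD, ReM, ImM) !ReZ !ImZ.
by rewrite !mul0r !subr0 !addr0 /norm_den /= => -> ->; rewrite expr0n addr0.
Qed.

Let aux_re (a b c d x y : R) : 0 < (c * x + d) ^+ 2 + (c * y) ^+ 2 ->
  a * d - b * c = 1 ->
  a * x + b = ((a * x + b) * (c * x + d) + a * c * y ^+ 2) / ((c * x + d) ^+ 2 + (c * y) ^+ 2) * (c * x + d)
    - y / ((c * x + d) ^+ 2 + (c * y) ^+ 2) * (c * y).
Proof.
move=> N0 D; apply/eqP; rewrite -subr_eq0; apply/eqP.
transitivity (c * y ^+ 2 * ((1 - (a * d - b * c)) / ((c * x + d) ^+ 2 + (c * y) ^+ 2))).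
  by field; rewrite gt_eqF.
by rewrite D subrr mul0r mulr0.
Qed.

Let aux_im (a b c d x y : R) : 0 < (c * x + d) ^+ 2 + (c * y) ^+ 2 ->
  a * d - b * c = 1 ->
  a * y = ((a * x + b) * (c * x + d) + a * c * y ^+ 2) / ((c * x + d) ^+ 2 + (c * y) ^+ 2) * (c * y)
    + y / ((c * x + d) ^+ 2 + (c * y) ^+ 2) * (c * x + d).
Proof.
move=> N0 D; apply/eqP; rewrite -subr_eq0; apply/eqP.
transitivity ((c * x + d) * y * (((a * d - b * c) - 1) / ((c * x + d) ^+ 2 + (c * y) ^+ 2))).
  by field; rewrite gt_eqF.
by rewrite D subrr mul0r mulr0.
Qed.

Lemma mobE g p : 0 < p.2 -> mob g p =
  ((((g 0 0)%:~R * p.1 + (g 0 1)%:~R) * ((g 1 0)%:~R * p.1 + (g 1 1)%:~R) +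
     (g 0 0)%:~R * (g 1 0)%:~R * p.2 ^+ 2) / norm_den g p, p.2 / norm_den g p).
Proof.
case: p => x y /= y0; have N0 := norm_den_gt0 g (p := (x, y)) y0.
have d0 := den_neq0 g (z := x +i* y) y0.
set X := _ / _; set Y := y / _.
suff E : mobius g (x +i* y) = X +i* Y by rewrite /mob /of_coords/= E.
apply: (mulIf d0); rewrite [LHS]divfK//.
have D := det_real g; rewrite /X /Y; move: N0 D; rewrite /norm_den /den/=.
pose a : R := (g 0 0)%:~R; pose b : R := (g 0 1)%:~R; pose c : R := (g 1 0)%:~R; pose d : R := (g 1 1)%:~R.
rewrite -/a -/b -/c -/d => N0 D.
apply: complex_eq; rewrite !(ReD, ImD, ReM, ImM) !ReZ !ImZ /= !mul0r ?addr0 !subr0.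
  exact: aux_re.
exact: aux_im.
Qed.

Lemma mob_snd g p : 0 < p.2 -> (mob g p).2 = p.2 / norm_den g p.
Proof. by move=> /mobE ->. Qed.

Lemma mob_gt0 g p : 0 < p.2 -> 0 < (mob g p).2.
Proof. by move=> p0; rewrite mob_snd// divr_gt0// norm_den_gt0. Qed.

Lemma mobius_gt0 g z : 0 < Im z -> 0 < Im (mobius g z).
Proof.
by case: z => x y /= y0; have := mob_gt0 g (p := (x, y)) y0.
Qed.

Let int_complex (m : int) : (m%:~R : C) = (m%:~R : R)%:C.
Proof. by rewrite rmorph_int. Qed.

Lemma mobiusM g h z : 0 < Im z -> mobius (g * h)%g z = mobius g (mobius h z).
Proof.
move=> z0; have d1 := den_neq0 h z0; have d2 := den_neq0 (g * h)%g z0.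
have d3 := den_neq0 g (mobius_gt0 h z0).
rewrite /mobius; move: d1 d2 d3; rewrite /den /mobius !sl2_mulE !intrD !intrM.
move: (g 0 0)%:~R (g 0 1)%:~R (g 1 0)%:~R (g 1 1)%:~R => a b c d.
move: (h 0 0)%:~R (h 0 1)%:~R (h 1 0)%:~R (h 1 1)%:~R => a' b' c' d' d1 d2 d3.
have d4 : c * (a' * z + b') + d * (c' * z + d') != 0.
  by apply: contra d2 => /eqP e; apply/eqP; rewrite -[RHS]e; ring.
by field; rewrite d1 ?d4 ?d2.
Qed.

Lemma mob_mul g h p : 0 < p.2 -> mob (g * h)%g p = mob g (mob h p).
Proof. by move=> p0; rewrite /mob of_coords_mob mobiusM. Qed.

Lemma mobius1 z : mobius 1%g z = z.
Proof. by rewrite /mobius !sl2_oneE /= mul1r addr0 mul0r add0r divr1. Qed.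

Lemma mob1 p : mob 1%g p = p.
Proof. by rewrite /mob mobius1 of_coordsK. Qed.

Lemma mobius_opp g z : mobius (sl2_opp g) z = mobius g z.
Proof.
by rewrite /mobius !sl2_oppE !intrN !mulNr -!opprD invrN mulrNN.
Qed.

Lemma mob_opp g p : mob (sl2_opp g) p = mob g p.
Proof. by rewrite /mob mobius_opp. Qed.

Lemma mobV g p : 0 < p.2 -> mob g^-1%g (mob g p) = p.
Proof. by move=> p0; rewrite -mob_mul// mulVg mob1. Qed.

Lemma mobius_transl m z : mobius (transl m) z = z + m%:~R.
Proof.
have [a1 a2 a3 a4] := translE m.
by rewrite /mobius ?(a1, a2, a3, a4) mul1r mul0r add0r divr1.
Qed.

Lemma mob_transl m p : mob (transl m) p = (p.1 + m%:~R, p.2).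
Proof.
rewrite /mob mobius_transl int_complex; case: p => x y /=.
by rewrite addr0.
Qed.

End Mobius.

(** * The hyperbolic measure *)

Section HyperbolicMeasure.
Context (R : realType).
Local Notation leb := (@lebesgue_measure R).
Implicit Types (f : R * R -> \bar R) (g : SL2Z).

Section tonelli.
Variables (f : R * R -> \bar R) (mf : measurable_fun setT f) (f0 : forall p, (0 <= f p)%E).

Lemma tonelli_snd : (\int[area R]_z f z = \int[leb]_y \int[leb]_x f (x, y))%E.
Proof. exact: (@fubini_tonelli2 _ _ _ _ R leb leb f mf f0). Qed.

Lemma tonelli_fst : (\int[area R]_z f z = \int[leb]_x \int[leb]_y f (x, y))%E.
Proof. exact: (@fubini_tonelli1 _ _ _ _ R leb leb f mf f0). Qed.

Lemma measurable_tonelli_snd : measurable_fun setT (fun y => \int[leb]_x f (x, y))%E.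
Proof. exact: (@measurable_fun_fubini_tonelli_G _ _ _ _ R leb f mf f0). Qed.

Lemma measurable_tonelli_fst : measurable_fun setT (fun x => \int[leb]_y f (x, y))%E.
Proof. exact: (@measurable_fun_fubini_tonelli_F _ _ _ _ R leb f mf f0). Qed.

End tonelli.

Definition half_plane : set (R * R) := [set p | 0 < p.2].

Lemma measurable_half_plane : measurable half_plane.
Proof.
have -> : half_plane = snd @^-1` `]0, +oo[%classic.
  by apply/seteqP; split => p /=; rewrite in_itv/= andbT.
rewrite -[X in measurable X]setTI; apply: measurable_snd => //; exact: measurable_itv.
Qed.

Definition hyp_int f := (\int[area R]_(p in half_plane) (f p * ((p.2 ^+ 2)^-1)%:E))%E.

Lemma measurable_invp : measurable_fun setT (fun x : R => if 0 < x then x^-1 else 0).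
Proof.
rewrite (_ : (fun x : R => _) = (@GRing.inv R) \_ `]0, +oo[); last first.
  by apply/funext => x; rewrite patchE mem_setE in_itv/= andbT.
apply/(measurable_restrictT _ (measurable_itv _)).
apply: open_continuous_measurable_fun; first exact: interval_open.
by move=> x /set_mem/=; rewrite in_itv/= andbT => x0; apply: inv_continuous; rewrite gt_eqF.
Qed.

Lemma measurable_inv_ge0 d (T : measurableType d) (h : T -> R) : (forall t, 0 <= h t) ->
  measurable_fun setT h -> measurable_fun setT (fun t => (h t)^-1).
Proof.
move=> h0 mh; rewrite (_ : (fun t => _) = (fun x : R => if 0 < x then x^-1 else 0) \o h).
  exact: (measurableT_comp measurable_invp).
apply/funext => t /=; case: ifPn => //; rewrite -leNgt => t0.
by rewrite (_ : h t = 0) ?invr0//; apply/eqP; rewrite eq_le t0 h0.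
Qed.

Let Xf : R * R -> R := fst.
Let Yf : R * R -> R := snd.
Let mX : measurable_fun setT Xf. Proof. exact: measurable_fst. Qed.
Let mY : measurable_fun setT Yf. Proof. exact: measurable_snd. Qed.

Section coordinates.
Variables (f : R * R -> \bar R) (mf : measurable_fun setT f) (f0 : forall p, (0 <= f p)%E).

Lemma hyp_int_exp : hyp_int f = (\int[leb]_r \int[leb]_x (f (x, expR r) * (expR (- r))%:E))%E.
Proof.
pose G p : \bar R := (f p * ((Yf p ^+ 2)^-1)%:E)%E.
have mG : measurable_fun setT G.
  apply: emeasurable_funM => //; apply/measurable_EFinP; apply: measurable_inv_ge0.
    by move=> t; exact: sqr_ge0.
  exact: measurable_funX.
have G0 p : (0 <= G p)%E by rewrite mule_ge0// lee_fin invr_ge0 sqr_ge0.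
have mGH : measurable_fun setT (G \_ half_plane).
  by apply/(measurable_restrictT G measurable_half_plane); exact: measurable_funTS.
have GH0 p : (0 <= (G \_ half_plane) p)%E by rewrite patchE; case: ifP.
rewrite /hyp_int integral_mkcond -/G (tonelli_snd mGH GH0).
pose K r : \bar R := (\int[leb]_x (f (x, expR r) * (expR (- r))%:E))%E.
have K0 r : (0 <= K r)%E by apply: integral_ge0 => x _; rewrite mule_ge0// lee_fin expR_ge0.
have mk : measurable_fun setT (fun z : R * R => (f (z.1, expR z.2) * (expR (- z.2))%:E)%E).
  apply: emeasurable_funM.
    apply: (measurableT_comp mf); apply: measurable_fun_pair => //.
    by apply: measurableT_comp.
  by apply/measurable_EFinP; apply: measurableT_comp => //; exact: measurable_funN.
have mK : measurable_fun setT K.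
  by apply: (measurable_tonelli_snd mk) => z; rewrite mule_ge0// lee_fin expR_ge0.
rewrite -/K -(ge0_integral_expR mK K0) [RHS]integral_mkcond/=; apply: eq_integral => y _.
rewrite patchE; case: ifPn => [/set_mem/=|]; last first.
  move=> /negP yn; apply: integral0_eq => x _.
  rewrite patchE; case: ifPn => // /set_mem/= y0; exfalso; apply: yn.
  by rewrite inE/= in_itv/= y0.
rewrite in_itv/= andbT => y0.
rewrite /K -ge0_integralZl//.
- apply: eq_integral => x _; rewrite patchE mem_set// lnK ?posrE//.
  rewrite /G/= expRN lnK ?posrE// muleCA -EFinM; congr (_ * _%:E)%E.
  by rewrite -invfM -expr2.
- apply: emeasurable_funM => //; apply: (measurableT_comp mf).
  exact: measurable_fun_pair.
- by move=> x _; rewrite mule_ge0// lee_fin expR_ge0.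
- by rewrite lee_fin invr_ge0 ltW.
Qed.

(** In the coordinates u = x / y and r = ln y the hyperbolic measure is du dr. *)
Lemma hyp_int_shear : hyp_int f = (\int[leb]_u \int[leb]_r f (u * expR r, expR r)%R)%E.
Proof.
rewrite hyp_int_exp.
have mk : measurable_fun setT (fun z : R * R => f (z.1 * expR z.2, expR z.2)%R).
  apply: (measurableT_comp mf); apply: measurable_fun_pair.
    by apply: measurable_funM => //; exact: measurableT_comp.
  exact: measurableT_comp.
rewrite -(tonelli_fst mk (fun z => f0 _)) (tonelli_snd mk (fun z => f0 _)); apply: eq_integral => r _.
rewrite -(ge0_integral_scale (expR_gt0 r)); last 2 first.
- apply: emeasurable_funM => //; apply: (measurableT_comp mf).
  exact: measurable_fun_pair.
- by move=> x; rewrite mule_ge0// lee_fin expR_ge0.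
apply: eq_integral => u _; rewrite muleCA -EFinM -expRD subrr expR0 mule1.
by rewrite mulrC.
Qed.

End coordinates.

Lemma hyp_int_transl (a : R) f : measurable_fun setT f -> (forall p, (0 <= f p)%E) ->
  hyp_int (fun p => f (p.1 + a, p.2)%R) = hyp_int f.
Proof.
move=> mf f0; rewrite (hyp_int_exp mf f0) hyp_int_exp; last 2 first.
- apply: (measurableT_comp mf); apply: measurable_fun_pair => //.
  exact: measurable_funD.
- by move=> p; exact: f0.
apply: eq_integral => r _.
rewrite -(ge0_integral_shift a (f := fun x => (f (x, expR r) * (expR (- r))%:E)%E))//.
- apply: emeasurable_funM => //; apply: (measurableT_comp mf).
  exact: measurable_fun_pair.
- by move=> x; rewrite mule_ge0// lee_fin expR_ge0.
Qed.

(* The action of [z |-> - 1 / (m z)]. *)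
Definition inversion (m : R) (p : R * R) : R * R :=
  (- p.1 / (m * (p.1 ^+ 2 + p.2 ^+ 2)), p.2 / (m * (p.1 ^+ 2 + p.2 ^+ 2))).

Lemma measurable_inversion m : 0 <= m -> measurable_fun setT (inversion m).
Proof.
move=> m0.
have mN : measurable_fun setT (fun p : R * R => (m * (Xf p ^+ 2 + Yf p ^+ 2))^-1).
  apply: measurable_inv_ge0 => [t|]; first by rewrite mulr_ge0// addr_ge0 ?sqr_ge0.
  by apply: measurable_funM => //; apply: measurable_funD; exact: measurable_funX.
by apply: measurable_fun_pair; apply: measurable_funM => //; exact: measurable_funN.
Qed.

Let inversion_shear (m u r : R) : 0 < m ->
  inversion m (u * expR r, expR r) =
  (- u * expR (- (r + ln (m * (1 + u ^+ 2)))), expR (- (r + ln (m * (1 + u ^+ 2))))).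
Proof.
move=> m0; have u1 : 0 < 1 + u ^+ 2 by rewrite ltr_pwDl// sqr_ge0.
have e0 := expR_gt0 r; rewrite /inversion/= expRN expRD lnK ?posrE ?mulr_gt0//.
move: (expR r) e0 => e e0.
have N : e ^+ 2 * (u ^+ 2 + 1) != 0 by rewrite gt_eqF// mulr_gt0 ?exprn_gt0// addrC.
have N' : (u * e) ^+ 2 + e ^+ 2 != 0 by rewrite -[X in _ + X]mul1r exprMn -mulrDl mulrC.
by congr (_, _); field; rewrite N' ?(gt_eqF m0) ?(gt_eqF e0) ?(gt_eqF u1).
Qed.

(** In the coordinates (u, r) the inversion sends u to - u and r to - r - ln (m (1 + u ^ 2)): a
    reflection in u and, for fixed u, a reflection and a translation in r, all of which preserve du
    dr. *)
Lemma hyp_int_inversion (m : R) f : 0 < m -> measurable_fun setT f -> (forall p, (0 <= f p)%E) ->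
  hyp_int (fun p => f (inversion m p)) = hyp_int f.
Proof.
move=> m0 mf f0; have mi := measurable_inversion (ltW m0).
rewrite (hyp_int_shear mf f0) (hyp_int_shear (measurableT_comp mf mi) (fun p => f0 _)).
pose h u : \bar R := (\int[leb]_r f (u * expR r, expR r)%R)%E.
have mk : measurable_fun setT (fun z : R * R => f (z.1 * expR z.2, expR z.2)%R).
  apply: (measurableT_comp mf); apply: measurable_fun_pair.
    by apply: measurable_funM => //; exact: measurableT_comp.
  exact: measurableT_comp.
have mh : measurable_fun setT h by exact: (measurable_tonelli_fst mk).
have h0 u : (0 <= h u)%E by exact: integral_ge0.
rewrite -/h -(ge0_integral_opp mh h0); apply: eq_integral => u _.
pose L := ln (m * (1 + u ^+ 2)).
have mfu : measurable_fun setT (fun r : R => f (- u * expR r, expR r)).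
  apply: (measurableT_comp mf); apply: measurable_fun_pair => //.
  exact: measurable_funM.
transitivity (\int[leb]_r f (- u * expR (- (r + L)), expR (- (r + L)))%R)%E.
  by apply: eq_integral => r _; rewrite /= inversion_shear.
rewrite (ge0_integral_shift L (f := fun r => f (- u * expR (- r), expR (- r))%R)).
- exact: (ge0_integral_opp (f := fun r => f (- u * expR r, expR r))).
- by apply: (measurableT_comp mfu); exact: measurable_funN.
- by [].
Qed.

(** The rational formula for the action, visibly measurable on the whole plane; it agrees with [mob]
    where y > 0. *)
Definition mob_total g (p : R * R) : R * R :=
  ((((g 0 0)%:~R * p.1 + (g 0 1)%:~R) * ((g 1 0)%:~R * p.1 + (g 1 1)%:~R) +
     (g 0 0)%:~R * (g 1 0)%:~R * p.2 ^+ 2) / norm_den g p, p.2 / norm_den g p).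

Lemma mob_totalE g p : 0 < p.2 -> mob g p = mob_total g p.
Proof. exact: mobE. Qed.

Lemma measurable_mob_total g : measurable_fun setT (mob_total g).
Proof.
have ml (a b : R) : measurable_fun setT (fun p : R * R => a * p.1 + b).
  by apply: measurable_funD => //; exact: measurable_funM.
have mN : measurable_fun setT (fun p : R * R => (norm_den g p)^-1).
  apply: measurable_inv_ge0 => [t|]; first by rewrite addr_ge0 ?sqr_ge0.
  apply: measurable_funD; apply: measurable_funX => //; exact: measurable_funM.
apply: measurable_fun_pair; apply: measurable_funM => //.
apply: measurable_funD; first exact: measurable_funM.
by apply: measurable_funM => //; exact: measurable_funX.
Qed.

Let aux_mob1 (a b c d x y : R) : c != 0 -> a * d - b * c = 1 -> (c * x + d) ^+ 2 + (c * y) ^+ 2 != 0 ->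
  ((a * x + b) * (c * x + d) + a * c * y ^+ 2) / ((c * x + d) ^+ 2 + (c * y) ^+ 2) =
  - (x + d / c) / (c ^+ 2 * ((x + d / c) ^+ 2 + y ^+ 2)) + a / c.
Proof.
move=> c0 D N0.
have E : c ^+ 2 * ((x + d / c) ^+ 2 + y ^+ 2) = (c * x + d) ^+ 2 + (c * y) ^+ 2 by field.
rewrite E; apply/eqP; rewrite -subr_eq0; apply/eqP.
transitivity ((c * x + d) / c * (((1 - (a * d - b * c))) / ((c * x + d) ^+ 2 + (c * y) ^+ 2))).
  by field; rewrite c0 N0.
by rewrite D subrr mul0r mulr0.
Qed.

Let aux_mob2 (c d x y : R) : c != 0 -> (c * x + d) ^+ 2 + (c * y) ^+ 2 != 0 ->
  y / ((c * x + d) ^+ 2 + (c * y) ^+ 2) = y / (c ^+ 2 * ((x + d / c) ^+ 2 + y ^+ 2)).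
Proof.
move=> c0 N0.
have E : c ^+ 2 * ((x + d / c) ^+ 2 + y ^+ 2) = (c * x + d) ^+ 2 + (c * y) ^+ 2 by field.
by rewrite E.
Qed.

(** Bruhat decomposition: for c = 0 the matrix acts as a translation, and otherwise g z = a / c - 1
    / (c ^ 2 (z + d / c)) is an inversion between two translations. *)
Lemma hyp_int_mob g f : measurable_fun setT f -> (forall p, (0 <= f p)%E) ->
  hyp_int (fun p => f (mob g p)) = hyp_int f.
Proof.
move=> mf f0; have D := det_real R g.
have [c0|c0] := eqVneq ((g 1 0)%:~R : R) 0.
  rewrite c0 mulr0 subr0 in D.
  have d0 : (g 1 1)%:~R != 0 :> R.
    by apply/eqP => d0; move: D; rewrite d0 mulr0 => /eqP; rewrite eq_sym oner_eq0.
  have dd : (g 1 1)%:~R ^+ 2 = 1 :> R.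
    have : (g 0 0 * g 1 1)%R = 1 by have := sl2_det g; move/intr_inj: (c0 : (g 1 0)%:~R = 0%:~R) => ->; rewrite mulr0 subr0.
    move=> /(congr1 (fun n => `|n|%N)); rewrite abszM => /eqP; rewrite muln_eq1 => /andP[_ /eqP d1].
    by rewrite -rmorphXn/= -[g 1 1 ^+ 2]real_normK ?num_real// -abszE d1 expr1n.
  rewrite -(hyp_int_transl ((g 0 1)%:~R / (g 1 1)%:~R) mf f0).
  apply: eq_integral => p /set_mem p0; congr (f _ * _)%E; rewrite mobE// /norm_den c0 !mul0r !add0r.
  rewrite expr0n/= addr0 mulr0 mul0r addr0 dd !divr1; congr (_, _).
  rewrite mulrDl mulrAC D mul1r; congr (_ + _).
  by apply: (mulIf d0); rewrite divfK// -mulrA -expr2 dd mulr1.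
rewrite -(hyp_int_transl ((g 0 0)%:~R / (g 1 0)%:~R) mf f0).
have m0 : 0 < (g 1 0)%:~R ^+ 2 :> R by rewrite exprn_even_gt0.
have mt (a : R) : measurable_fun setT (fun p : R * R => (p.1 + a, p.2)).
  by apply: measurable_fun_pair => //; exact: measurable_funD.
rewrite -(hyp_int_inversion m0 (measurableT_comp mf (mt _)) (fun p => f0 _)).
rewrite -(hyp_int_transl ((g 1 1)%:~R / (g 1 0)%:~R)
  (measurableT_comp (measurableT_comp mf (mt _)) (measurable_inversion (ltW m0))) (fun p => f0 _)).
apply: eq_integral => p /set_mem p0; congr (f _ * _)%E.
have N0 := lt0r_neq0 (norm_den_gt0 g p0).
rewrite mobE// /inversion/=; congr (_, _).
  exact: aux_mob1.
exact: aux_mob2.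
Qed.

End HyperbolicMeasure.

(** * Unfolding *)

Section CountableSums.
Context (R : realType).

Lemma esum_countE (I : countType) (a : I -> \bar R) : (forall i, (0 <= a i)%E) ->
  (\esum_(i in [set: I]) a i = \sum_(n <oo) oapp a 0 (pickle_inv n))%E.
Proof.
move=> a0; pose b n := oapp a 0%E (pickle_inv n).
have b0 n : (0 <= b n)%E by rewrite /b; case: (pickle_inv n).
rewrite nneseries_esumT// -/b.
have -> : (\esum_(n in [set: nat]) b n = \esum_(n in range (@pickle I)) b n)%E.
  rewrite [RHS]esum_mkcond; apply: eq_esum => n _; case: ifPn => // nI.
  rewrite /b; case E : (pickle_inv n) => [i|]//=; exfalso; move/negP: nI; apply.
  rewrite inE; exists i => //; have := @pickle_invK I n; rewrite /ocancel E/= => <-//.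
rewrite (@reindex_esum _ _ _ setT _ (@pickle I)).
  by apply: eq_esum => i _; rewrite /b pickleK_inv.
by split => // i j _ _; exact: (pcan_inj pickleK).
Qed.

Section integral.
Context d (T : measurableType d) (mu : {measure set T -> \bar R}) (D : set T)
  (mD : measurable D) (I : countType) (f : I -> T -> \bar R).
Hypotheses (f0 : forall i t, (0 <= f i t)%E) (mf : forall i, measurable_fun D (f i)).

Let E t : (\esum_(i in [set: I]) f i t = \sum_(n <oo) oapp (f ^~ t) 0 (pickle_inv n))%E.
Proof. by rewrite esum_countE. Qed.

Lemma measurable_esum_count : measurable_fun D (fun t => \esum_(i in [set: I]) f i t)%E.
Proof.
under eq_fun do rewrite E.
apply: (@ge0_emeasurable_sum _ _ _ D (fun n t => oapp (f ^~ t) 0%E (pickle_inv n)) xpredT).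
  by move=> n t _ _; case: (pickle_inv n) => //=.
by move=> n _; case: (pickle_inv n) => [i|]//=; exact: measurable_cst.
Qed.

Lemma integral_esum_count :
  (\int[mu]_(t in D) (\esum_(i in [set: I]) f i t) = \esum_(i in [set: I]) (\int[mu]_(t in D) f i t))%E.
Proof.
under eq_integral do rewrite E.
rewrite integral_nneseries//; last 2 first.
- by move=> n; case: (pickle_inv n) => [i|]//=; exact: measurable_cst.
- by move=> n t _; case: (pickle_inv n) => //=.
rewrite esum_countE; last by move=> i; exact: integral_ge0.
apply: eq_eseriesr => n _; case: (pickle_inv n) => [i|]//=.
by rewrite integral0.
Qed.

End integral.

Lemma esum_countZl (I : countType) (c : R) (a : I -> \bar R) : (forall i, (0 <= a i)%E) -> 0 <= c ->
  (\esum_(i in [set: I]) (c%:E * a i) = c%:E * (\esum_(i in [set: I]) a i))%E.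
Proof.
move=> a0 c0; rewrite !esum_countE//; last by move=> i; rewrite mule_ge0.
rewrite -nneseriesZl; last by move=> n _; case: (pickle_inv n) => /=.
by apply: eq_eseriesr => n _; case: (pickle_inv n) => [i|]//=; rewrite mule0.
Qed.

Lemma esum_int_window (x : R) (W : nat) :
  (\esum_(m in [set: int]) (if (0 <= x + m%:~R < W%:R)%R then 1 else 0) = W%:R%:E :> \bar R)%E.
Proof.
(* The shift by [k] brings x into [0, 1[, where the integers counted are 0, ..., W - 1. *)
pose k : int := - Num.floor x.
rewrite -(esum_int_shift k).
have /andP[x0 x1] : 0 <= x + k%:~R < 1.
  have /andP[h1 h2] := floor_itv x; rewrite intrD in h2.
  by rewrite intrN; apply/andP; split; lra.
have E (m : int) : (0 <= x + (m + k)%:~R < W%:R) = (0 <= m < W%:Z).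
  rewrite intrD addrCA; apply/idP/idP => /andP[h1 h2]; apply/andP; split.
  - have : (-1)%:~R < m%:~R :> R by rewrite mulrN1z; lra.
    by rewrite ltr_int; lia.
  - have : m%:~R < (W%:Z)%:~R :> R by apply: le_lt_trans h2; rewrite lerDl.
    by rewrite ltr_int.
  - by rewrite addr_ge0// ler0z.
  - have : (m + 1)%:~R <= (W%:Z)%:~R :> R by rewrite ler_int; lia.
    rewrite intrD; apply: lt_le_trans; rewrite ltrD2l//.
under eq_esum do rewrite E.
transitivity (\esum_(m in Posz @` `I_W) (1 : \bar R))%E.
  rewrite [RHS]esum_mkcond; apply: eq_esum => m _.
  congr (if _ then _ else _); apply/idP/idP => [/andP[m0 mW]|/set_mem[i /= iW <-]]; last by lia.
  by rewrite inE; exists `|m|%N; rewrite /=; lia.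
rewrite (@reindex_esum _ _ _ `I_W _ Posz); last first.
  by split => //; move=> i j _ _ [].
rewrite esum_fset//.
rewrite -fsbig_ord sumEFin.
by rewrite sumr_const card_ord.
Qed.

End CountableSums.

(** * The theta function as a sum over SL_2(Z) *)

Section ThetaUnfolding.
Context (R : realType).
Implicit Types (g h : SL2Z) (p : R * R) (v : int * int).

(** Division by the gcd, completed to a matrix by Bezout's identity. The condition on [v] stands
    inside the existential, so that choice yields a total function; the multiplier is a successor,
    hence positive. *)
Lemma bottom_multiple v : exists gk : SL2Z * nat, v != 0 ->
  v.1 = gk.2.+1%:Z * gk.1 1 0 /\ v.2 = gk.2.+1%:Z * gk.1 1 1.
Proof.
case: v => m n; have [mn0|mn0] := boolP ((m == 0) && (n == 0)).
  by exists (1%g, 0%N) => /negP; case; move: mn0 => /andP[/eqP -> /eqP ->].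
have d0 : gcdz m n != 0 by rewrite gcdz_eq0.
have [u [w uw]] := Bezoutz m n.
have /dvdzP[m' mE] := dvdz_gcdl m n; have /dvdzP[n' nE] := dvdz_gcdr m n.
have [|g [_ _ g1 g2]] := @sl2_ex w (- u) m' n'.
  apply: (mulIf d0); rewrite mul1r -[RHS]uw.
  transitivity (u * (m' * gcdz m n) + w * (n' * gcdz m n)); first by ring.
  by rewrite -mE -nE.
have [k kE] : exists k : nat, gcdz m n = k.+1%:Z.
  have : (0 < gcdn `|m| `|n|)%N by rewrite gcdn_gt0 !absz_gt0 -negb_and.
  by case E : (gcdn _ _) => [//|k] _; exists k; rewrite /gcdz E.
by exists (g, k) => _ /=; rewrite g1 g2 -kE; split; rewrite mulrC.
Qed.

Let base := projT1 (choice bottom_multiple).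

Let baseP v : v != 0 ->
  v.1 = (base v).2.+1%:Z * (base v).1 1 0 /\ v.2 = (base v).2.+1%:Z * (base v).1 1 1.
Proof. exact: (projT2 (choice bottom_multiple) v). Qed.

(** Bottom rows are primitive: expanding the determinant of either matrix shows that each multiplier
    divides the other. *)
Let scale_unique g h (j k : nat) :
  j.+1%:Z * g 1 0 = k.+1%:Z * h 1 0 -> j.+1%:Z * g 1 1 = k.+1%:Z * h 1 1 -> j = k.
Proof.
suff dvd g' h' (j' k' : nat) : j'.+1%:Z * g' 1 0 = k'.+1%:Z * h' 1 0 ->
    j'.+1%:Z * g' 1 1 = k'.+1%:Z * h' 1 1 -> (k'.+1 %| j'.+1)%N.
  move=> e1 e2; have d1 := dvd _ _ _ _ e1 e2; have d2 := dvd _ _ _ _ (esym e1) (esym e2).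
  by have /eqP := (eqn_dvd j.+1 k.+1); rewrite d1 d2 /= => /eqP/eqP; case.
move=> e1 e2; have : (k'.+1%:Z %| j'.+1%:Z)%Z.
  apply/dvdzP; exists (g' 0 0 * h' 1 1 - g' 0 1 * h' 1 0).
  rewrite mulrBl -!mulrA ![h' _ _ * _]mulrC -e1 -e2.
  transitivity (j'.+1%:Z * (g' 0 0 * g' 1 1 - g' 0 1 * g' 1 0)); last by ring.
  by rewrite sl2_det mulr1.
by [].
Qed.

(** The matrices with a given bottom row form one orbit under integer translations. Hence a nonzero
    vector and an integer correspond to a matrix and a multiplier, the vector being the multiple of
    the bottom row. *)
Let unfold (vm : (int * int) * int) : SL2Z * nat := ((transl vm.2 * (base vm.1).1)%g, (base vm.1).2).

Let transl_bottom m g : (transl m * g)%g 1 0 = g 1 0 /\ (transl m * g)%g 1 1 = g 1 1.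
Proof.
have [_ _ a3 a4] := translE m.
by rewrite !sl2_mulE a3 a4 !mul0r !add0r !mul1r.
Qed.

Let unfold_bij : set_bij ([set v | v != 0] `*` [set: int]) [set: SL2Z * nat] unfold.
Proof.
split => //.
- move=> [v m] [v' m'] /set_mem[/= v0 _] /set_mem[/= v0' _] e.
  have e1 : (transl m * (base v).1)%g = (transl m' * (base v').1)%g := congr1 fst e.
  have e2 : (base v).2 = (base v').2 := congr1 snd e.
  have [b1 b2] := transl_bottom m (base v).1; have [b1' b2'] := transl_bottom m' (base v').1.
  have vv : v = v'.
    have [h1 h2] := baseP v0; have [h1' h2'] := baseP v0'.
    have E1 : v.1 = v'.1 by rewrite h1 h1' -b1 -b1' e1 e2.
    have E2 : v.2 = v'.2 by rewrite h2 h2' -b2 -b2' e1 e2.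
    by rewrite [LHS]surjective_pairing E1 E2 -surjective_pairing.
  by move: e1; rewrite vv => /(congr1 (fun g => (g * (base v').1^-1)%g)); rewrite !mulgK => /transl_inj ->.
- move=> [g k] _; pose v := (k.+1%:Z * g 1 0, k.+1%:Z * g 1 1).
  have v0 : v != 0.
    apply/eqP => -[] /eqP h1 /eqP h2.
    move: h1 h2; rewrite !mulf_eq0 /= => /eqP h1 /eqP h2.
    by have := sl2_det g; rewrite h1 h2 !mulr0 subrr.
  have [h1 h2] := baseP v0.
  have kE := scale_unique h1 h2.
  have k0 : k.+1%:Z != 0 by [].
  rewrite /= -kE in h1 h2.
  have [m gE] := same_bottom (mulfI k0 h1) (mulfI k0 h2).
  by exists (v, m) => //=; rewrite /unfold/= -gE -kE.
Qed.

(** The integer translates of this function sum to 1, so that inserting it replaces a sum over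
    matrices modulo integer translations by a sum over all matrices. *)
Definition window (W : nat) (x : R) : R := if 0 <= x < W%:R then W%:R^-1 else 0.

Lemma window_ge0 W x : 0 <= window W x.
Proof. by rewrite /window; case: ifP => // _; rewrite invr_ge0. Qed.

Definition strip_kernel (W : nat) (t : R) p : \bar R := ((window W p.1)%:E * omega (t / p.2))%E.

Let gauss (t : R) p v : R :=
  expR (- (pi * t * ((v.1%:~R * p.1 + v.2%:~R) ^+ 2 + (v.1%:~R * p.2) ^+ 2) / p.2)).

Let esum_window (W : nat) (x : R) : (0 < W)%N ->
  (\esum_(m in [set: int]) (window W (x + m%:~R))%:E = 1 :> \bar R)%E.
Proof.
move=> W0; have Wn0 : W%:R != 0 :> R by rewrite pnatr_eq0 -lt0n.
have E (m : int) : ((window W (x + m%:~R))%:E = (W%:R^-1)%:E * (if (0 <= x + m%:~R < W%:R)%R then 1 else 0))%E.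
  by rewrite /window; case: ifP => _; rewrite ?mule1 ?mule0.
under eq_esum do rewrite E.
rewrite esum_intZl ?invr_ge0//; last by move=> m; case: ifP.
by rewrite esum_int_window -EFinM mulVf.
Qed.

(** When (m, n) is k + 1 times the bottom row of g, the quantity |m z + n| ^ 2 / Im z is (k + 1) ^ 2
    / Im (g z). The matrices sharing a bottom row differ by translations, over which the window sums
    to 1. The zero vector accounts for the summand 2. *)
Lemma theta_unfold (W : nat) (t : R) p : (0 < W)%N -> 0 < t -> 0 < p.2 ->
  (2%:E * theta p.1 p.2 t = 2%:E + \esum_(g in [set: SL2Z]) strip_kernel W t (mob g p))%E.
Proof.
move=> W0 t0 y0.
pose h (gk : SL2Z * nat) : \bar R := ((window W (mob gk.1 p).1)%:E *
  (2 * expR (- (pi * gk.2.+1%:R ^+ 2 * (t / (mob gk.1 p).2))))%:E)%E.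
have h0 gk : (0 <= h gk)%E by rewrite mule_ge0// lee_fin ?window_ge0// mulr_ge0// expR_ge0.
have -> : (\esum_(g in [set: SL2Z]) strip_kernel W t (mob g p) =
    \esum_(gk in [set: SL2Z * nat]) h gk)%E.
  have -> : [set: SL2Z * nat] = ([set: SL2Z] `*`` (fun=> [set: nat])) by apply/seteqP; split.
  rewrite -(esum_esum (a := fun g k => h (g, k)))//.
  apply: eq_esum => g _; rewrite /strip_kernel /omega -nneseriesZl//.
  exact: (@nneseries_esumT R (fun k => h (g, k)) (fun k => h0 _)).
rewrite (@reindex_esum R _ _ _ _ unfold h unfold_bij).
have -> : [set v : int * int | v != 0] `*` [set: int] =
    ([set v : int * int | v != 0] `*`` (fun=> [set: int])) by [].
rewrite -(esum_esum (a := fun v m => h (unfold (v, m))))//.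
have -> : ((\esum_(v in [set v : int * int | v != 0%R]) (\esum_(m in [set: int]) h (unfold (v, m)))) =
    \esum_(v in [set v : int * int | v != 0%R]) (2 * gauss t p v)%:E)%E.
  apply: eq_esum => v /= v0; have [h1 h2] := baseP v0.
  set g := (base v).1 in h1 h2 *; set k := (base v).2 in h1 h2 *.
  have hE m : (h (unfold (v, m)) = (2 * gauss t p v)%:E * (window W ((mob g p).1 + m%:~R))%:E)%E.
    have M : mob (unfold (v, m)).1 p = ((mob g p).1 + m%:~R, (mob g p).2).
      by rewrite -mob_transl -mob_mul.
    rewrite /h M -/k muleC; congr (_ * _)%E.
    congr (2 * expR (- _))%:E; rewrite [X in t / X]mob_snd//.
    have N0 := norm_den_gt0 g y0; rewrite h1 h2 !intrM /norm_den.
    rewrite (_ : (k.+1%:Z)%:~R = k.+1%:R :> R)//.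
    move: N0; rewrite /norm_den.
    move: (g 1 0)%:~R (g 1 1)%:~R (k.+1%:R) => c d n N0.
    by field; rewrite !gt_eqF.
  under eq_esum do rewrite hE.
  rewrite esum_intZl ?esum_window ?mule1//.
  - by move=> m; rewrite lee_fin window_ge0.
  - by rewrite mulr_ge0// expR_ge0.
rewrite /theta -esum_countZl//.
rewrite [LHS](esumID [set (0 : int * int)])//.
rewrite !setTI esum_set1//.
congr (_ + _)%E.
  by rewrite /= !mul0r add0r expr0n addr0 mulr0 mul0r oppr0 expR0 mule1.
have -> : ~` [set (0 : int * int)] = [set v | v != 0].
  by apply/seteqP; split => v /=; [move=> h'; exact/eqP|move=> /eqP].
by apply: eq_esum => v _; rewrite EFinM.
Qed.

End ThetaUnfolding.

(** * Unfolding for a nonnegative invariant function *)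

Section Unfolding.
Context (R : realType).
Local Notation leb := (@lebesgue_measure R).
Variables (Gam : groupClosed SL2Z) (T : seq SL2Z) (T_trans : coset_transversal Gam T).
Variables (phi : R * R -> R) (D : set (R * R)) (B : R).
Hypotheses (mphi : measurable_fun setT phi) (phi0 : forall p, 0 <= phi p)
  (phiB : forall p, phi p <= B).
Hypothesis phi_inv : forall g p, g \in Gam -> 0 < p.2 -> phi (mob g p) = phi p.
Hypothesis mD : measurable D.
(** The value 2 counts a matrix g and its opposite. The condition bears on the points where [phi]
    does not vanish, which leaves room for a null set on which the fundamental domain misbehaves. *)
Hypothesis countD : forall p, 0 < p.2 -> phi p != 0 ->
  (\esum_(g in [set g | pm_mem Gam g]) (\1_D (mob g p) : R)%:E = 2%:E)%E.
Variables (W : nat) (W0 : (0 < W)%N).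
Implicit Types (p : R * R) (g h : SL2Z).

Lemma pm_mem_inv g p : pm_mem Gam g -> 0 < p.2 -> phi (mob g p) = phi p.
Proof. by case/orP => gG p0; [exact: phi_inv|rewrite -(mob_opp g) phi_inv]. Qed.

Lemma pm_memM g h : pm_mem Gam g -> pm_mem Gam h -> pm_mem Gam (g * h)%g.
Proof.
move=> /orP[gG|gG] /orP[hG|hG]; apply/orP.
- by left; rewrite gpredMr.
- by right; rewrite -sl2_mulN gpredMr.
- by right; rewrite -sl2_oppM gpredMr.
- by left; rewrite -[(g * h)%g]sl2_oppK -sl2_oppM -sl2_mulN gpredMr.
Qed.

Lemma pm_memV g : pm_mem Gam g -> pm_mem Gam g^-1%g.
Proof.
have VN k : (sl2_opp k)^-1%g = sl2_opp k^-1%g.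
  apply: (mulgI (sl2_opp k)); rewrite mulgV sl2_mulN sl2_oppM mulgV.
  by rewrite sl2_oppK.
move=> /orP[gG|gG]; apply/orP; first by left; rewrite gpredV.
by right; rewrite -VN gpredV.
Qed.

Let ind p : R := \1_D p * phi p.

Let ind0 p : 0 <= ind p.
Proof. by rewrite mulr_ge0// indicE. Qed.

Let mind : measurable_fun setT ind.
Proof. by apply: measurable_funM => //; exact: measurable_indic. Qed.

Lemma coset_bij : set_bij ([set` T] `*` [set g | pm_mem Gam g]) [set: SL2Z]
  (fun th => (th.2 * th.1)%g).
Proof.
have [_ Tex Tun] := T_trans; split => //.
- move=> [t g] [t' g'] /set_mem[/= tT gG] /set_mem[/= tT' gG'] e.
  have tt : t = t'.
    apply: Tun => //; have -> : (t * t'^-1 = g^-1 * g')%g.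
      by apply: (mulgI g); rewrite mulVKg mulgA e mulgK.
    by apply: pm_memM => //; exact: pm_memV.
  by move: e; rewrite tt => /(congr1 (fun k => (k * t'^-1)%g)); rewrite !mulgK => ->.
- move=> g _; have [t tT tG] := Tex g.
  by exists (t, (g * t^-1)%g); rewrite //= mulgVK.
Qed.

Let tsum p : R := \sum_(t <- T) phi (mob t p).

(** SL_2(Z) is cut into the cosets {1, -1} Gam t; on each of them [phi] is constant along the orbit
    by invariance, and [countD] evaluates the sum of the indicators. *)
Let esum_orbit p : 0 < p.2 ->
  (\esum_(g in [set: SL2Z]) (ind (mob g p))%:E = (2 * tsum p)%:E)%E.
Proof.
move=> p0; have i0 g : (0 <= (ind (mob g p))%:E)%E by rewrite lee_fin.
rewrite (@reindex_esum R _ _ _ _ _ (fun g => (ind (mob g p))%:E) coset_bij).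
have -> : [set` T] `*` [set g | pm_mem Gam g] = [set` T] `*`` (fun=> [set g | pm_mem Gam g]) by [].
rewrite -(esum_esum (a := fun t h => (ind (mob (h * t)%g p))%:E))//.
have E t : (\esum_(h in [set h | pm_mem Gam h]) (ind (mob (h * t)%g p))%:E = (2 * phi (mob t p))%:E)%E.
  have q0 := mob_gt0 t p0; set q := mob t p in q0 *.
  transitivity (\esum_(h in [set: SL2Z]) ((phi q)%:E *
      (if h \in [set h | pm_mem Gam h] then (\1_D (mob h q) : R)%:E else 0)))%E.
    rewrite esum_mkcond; apply: eq_esum => h _; case: ifPn => [/set_mem/= hG|]; last by rewrite mule0.
    by rewrite mob_mul// -/q /ind pm_mem_inv// EFinM muleC.
  rewrite esum_countZl//; last by move=> h; case: ifP => // _; rewrite lee_fin indicE.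
  rewrite -esum_mkcond; have [->|q1] := eqVneq (phi q) 0; first by rewrite mul0e mulr0.
  by rewrite countD// -EFinM mulrC.
under eq_esum do rewrite E.
rewrite (esum_fset (finite_seq T)); last by move=> t _; rewrite lee_fin mulr_ge0.
rewrite -fsbig_seq; last by case: T_trans.
by rewrite sumEFin -mulr_sumr.
Qed.

(** [strip_kernel] with 1 / y replaced by 0 for y <= 0, a form that is measurable on the whole
    plane. *)
Let skern (t : R) p : \bar R :=
  ((window W p.1)%:E * omega (t * (if 0 < p.2 then p.2^-1 else 0))%R)%E.

Let skernE t p : 0 < p.2 -> skern t p = strip_kernel W t p.
Proof. by move=> p0; rewrite /skern p0. Qed.

Let skern0 t p : (0 <= skern t p)%E.
Proof. by rewrite mule_ge0 ?omega_ge0// lee_fin window_ge0. Qed.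

Lemma measurable_window : measurable_fun setT (window W : R -> R).
Proof.
rewrite (_ : window W = fun x : R => W%:R^-1 * \1_(`[0, W%:R[%classic) x); last first.
  apply/funext => x; rewrite /window indicE mem_setE in_itv/=.
  by case: (_ && _); rewrite ?mulr1 ?mulr0.
by apply: measurable_funM => //; exact: measurable_indic.
Qed.

Let mskern t : measurable_fun setT (skern t).
Proof.
apply: emeasurable_funM.
  by apply/measurable_EFinP; apply: (measurableT_comp measurable_window); exact: measurable_fst.
apply: (measurableT_comp (@measurable_omega R)); apply: measurable_funM => //.
by apply: (measurableT_comp (@measurable_invp R)); exact: measurable_snd.
Qed.

Let mmob g : measurable_fun setT (@mob_total R g).
Proof. exact: measurable_mob_total. Qed.

Let eq_hyp_int (f f' : R * R -> \bar R) : (forall p, 0 < p.2 -> f p = f' p) -> hyp_int f = hyp_int f'.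
Proof. by move=> ff; apply: eq_integral => p /set_mem/= p0; rewrite ff. Qed.

Let mtsum : measurable_fun setT (fun p => \sum_(t <- T) phi (mob_total t p)).
Proof. by apply: measurable_sum => t; exact: (measurableT_comp mphi). Qed.

Lemma tsumE p : 0 < p.2 -> tsum p = \sum_(t <- T) phi (mob_total t p).
Proof. by move=> p0; apply: eq_bigr => t _; rewrite mob_totalE. Qed.

Let myinv : measurable_fun setT (fun p : R * R => ((p.2 ^+ 2)^-1)%:E).
Proof.
apply/measurable_EFinP; apply: measurable_inv_ge0; first by move=> p; exact: sqr_ge0.
by apply: measurable_funX; exact: measurable_snd.
Qed.

Let yinv0 p : (0 <= ((p.2 ^+ 2)^-1)%:E :> \bar R)%E.
Proof. by rewrite lee_fin invr_ge0 sqr_ge0. Qed.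

(** The sum over g is exchanged with the integral by Tonelli, each term is transported by the
    invariance of the measure, and g is renamed into its inverse: the kernel then stays fixed while
    [ind] runs along the orbit. *)
Lemma hyp_int_unfold (t : R) : 0 < t ->
  hyp_int (fun p => ((ind p)%:E * \esum_(g in [set: SL2Z]) strip_kernel W t (mob g p))%E) =
  hyp_int (fun p => (strip_kernel W t p * (2 * tsum p)%:E)%E).
Proof.
move=> t0.
pose f1 g p : \bar R := ((ind p)%:E * skern t (mob_total g p))%E.
pose f2 g p : \bar R := ((ind (mob_total g p))%:E * skern t p)%E.
have mf1 g : measurable_fun setT (f1 g).
  by apply: emeasurable_funM; [exact/measurable_EFinP|exact: (measurableT_comp (mskern t))].
have mf2 g : measurable_fun setT (f2 g).
  apply: emeasurable_funM => //; apply/measurable_EFinP; exact: (measurableT_comp mind).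
have f10 g p : (0 <= f1 g p)%E by rewrite mule_ge0 ?lee_fin.
have f20 g p : (0 <= f2 g p)%E by rewrite mule_ge0 ?lee_fin.
have mH := @measurable_half_plane R.
have swap (f : SL2Z -> R * R -> \bar R) : (forall g, measurable_fun setT (f g)) ->
    (forall g p, (0 <= f g p)%E) ->
    hyp_int (fun p => \esum_(g in [set: SL2Z]) f g p)%E = (\esum_(g in [set: SL2Z]) hyp_int (f g))%E.
  move=> mf f0; rewrite /hyp_int -integral_esum_count//; last 2 first.
  - by move=> g p; rewrite mule_ge0.
  - by move=> g; apply: measurable_funTS; exact: (emeasurable_funM (mf g) myinv).
  apply: eq_integral => p _; rewrite muleC -esum_countZl//; last by rewrite invr_ge0 sqr_ge0.
  by apply: eq_esum => g _; rewrite muleC.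
transitivity (hyp_int (fun p => \esum_(g in [set: SL2Z]) f1 g p)%E).
  apply: eq_hyp_int => p p0; rewrite -(@esum_countZl R _ (ind p)); [|by move=> g; rewrite mule_ge0 ?omega_ge0// lee_fin window_ge0|exact: ind0].
  by apply: eq_esum => g _; rewrite /f1 -mob_totalE// skernE// mob_gt0.
rewrite swap//.
have E g : hyp_int (f1 g) = hyp_int (f2 g^-1%g).
  rewrite -(hyp_int_mob g (mf2 _) (f20 _)); apply: eq_hyp_int => p p0.
  by rewrite /f1 /f2 -!mob_totalE ?mob_gt0// mobV.
under eq_esum do rewrite E.
rewrite -(@reindex_esum R _ _ setT setT (fun g : SL2Z => g^-1%g) (fun g => hyp_int (f2 g))); last first.
  split => //; first by move=> g h _ _; exact: invg_inj.
  by move=> g _; exists g^-1%g; rewrite //= invgK.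
rewrite -swap//; apply: eq_hyp_int => p p0.
rewrite -esum_orbit// muleC -(skernE _ p0) /f2.
have sf : skern t p \is a fin_num.
  rewrite skernE// fin_numM// ge0_fin_numE ?omega_ge0// omega_lty// divr_gt0//.
rewrite -(fineK sf); under eq_esum do rewrite muleC -mob_totalE//.
rewrite esum_countZl ?fine_ge0 ?skern0//; first by rewrite muleC.
by move=> g; rewrite lee_fin.
Qed.

Let stripE (t r x : R) : strip_kernel W t (x, expR r) =
  ((window W x)%:E * omega (t * expR (- r)))%E.
Proof. by rewrite /strip_kernel/= expRN. Qed.

(** When W is a common multiple of the cusp widths, this is the sum over T of the constant terms of
    [phi] at height exp r. *)
Definition orbit_mean (r : R) : R :=
  \int[leb]_x (window W x * \sum_(t <- T) phi (mob t (x, expR r))).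

Let mtsum_exp : measurable_fun setT (fun z : R * R => tsum (z.1, expR z.2)).
Proof.
rewrite (_ : (fun z => _) = (fun p => \sum_(t <- T) phi (mob_total t p)) \o (fun z : R * R => (z.1, expR z.2))).
  apply: (measurableT_comp mtsum); apply: measurable_fun_pair; first exact: measurable_fst.
  by apply: measurableT_comp; [|exact: measurable_snd].
by apply/funext => z; rewrite /= tsumE//= expR_gt0.
Qed.

Let tsum0 p : 0 <= tsum p. Proof. exact: sumr_ge0. Qed.

Let tsum_le p : tsum p <= (size T)%:R * B.
Proof.
rewrite /tsum; elim: T => [|t s IH]; first by rewrite big_nil mul0r.
by rewrite big_cons /= -natr1 mulrDl mul1r addrC; apply: lerD.
Qed.

Let orbit_meanE r :
  ((orbit_mean r)%:E = \int[leb]_x (window W x * tsum (x, expR r))%:E)%E.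
Proof.
rewrite /orbit_mean /Rintegral fineK//.
have mr : measurable_fun setT (fun x : R => tsum (x, expR r)).
  by apply: (measurableT_comp mtsum_exp (g := fun x : R => (x, r))); exact: measurable_fun_pair.
rewrite ge0_fin_numE; last by apply: integral_ge0 => x _; rewrite lee_fin mulr_ge0 ?window_ge0 ?sumr_ge0.
have wi : (\int[leb]_(x in `[0%R, W%:R]) ((W%:R^-1 * ((size T)%:R * B))%:E) < +oo)%E.
  have wl : (leb `[0%R, W%:R]%classic < +oo)%E.
    by rewrite lebesgue_measure_itv/=; case: ifP => _; rewrite -?EFinB ltry.
  rewrite integral_cst//; apply: lte_mul_pinfty => //.
  by rewrite lee_fin mulr_ge0 ?invr_ge0//; exact: le_trans (tsum0 (0, 0)) (tsum_le _).
apply: le_lt_trans wi; rewrite [leRHS]integral_mkcond; apply: ge0_le_integral => //.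
- by move=> x _; rewrite lee_fin mulr_ge0 ?window_ge0 ?sumr_ge0.
- by apply/measurable_EFinP; apply: measurable_funM => //; exact: measurable_window.
- by apply/(measurable_restrictT _ (measurable_itv _)); exact: measurable_cst.
- move=> x _; rewrite patchE mem_setE in_itv/= /window.
  case: ifPn => [/andP[x0 xW]|_].
    rewrite x0 (ltW xW)/= lee_fin; apply: ler_wpM2l; first by rewrite invr_ge0.
    exact: tsum_le.
  rewrite mul0r; case: ifP => // _; rewrite lee_fin mulr_ge0 ?invr_ge0//.
  exact: le_trans (tsum0 _) (tsum_le (0, 0)).
Qed.

Lemma measurable_orbit_mean : measurable_fun setT orbit_mean.
Proof.
apply/measurable_EFinP; rewrite (_ : _ \o _ = fun r => (\int[leb]_x (window W x * tsum (x, expR r))%:E)%E); last first.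
  by apply/funext => r; rewrite /= orbit_meanE.
apply: (@measurable_tonelli_snd R (fun z => (window W z.1 * tsum (z.1, expR z.2))%:E)) => [|z].
  apply/measurable_EFinP; apply: measurable_funM => //.
  by apply: (measurableT_comp measurable_window); exact: measurable_fst.
by rewrite lee_fin mulr_ge0 ?window_ge0.
Qed.

Lemma orbit_mean_ge0 r : 0 <= orbit_mean r.
Proof. by apply: Rintegral_ge0 => // x _; rewrite mulr_ge0 ?window_ge0 ?sumr_ge0. Qed.

Let hyp_int_strip (t : R) : 0 < t ->
  hyp_int (fun p => (strip_kernel W t p * (2 * tsum p)%:E)%E) =
  (2%:E * \int[leb]_r (omega (t * expR (- r)) * (expR (- r) * orbit_mean r)%:E))%E.
Proof.
move=> t0; pose f p : \bar R := (skern t p * (2 * \sum_(s <- T) phi (mob_total s p))%:E)%E.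
have f0 p : (0 <= f p)%E by rewrite mule_ge0// lee_fin mulr_ge0// sumr_ge0.
have mf : measurable_fun setT f.
  by apply: emeasurable_funM => //; apply/measurable_EFinP; apply: measurable_funM.
rewrite (@eq_hyp_int _ f) => [|p p0]; last by rewrite /f skernE// -tsumE.
rewrite (hyp_int_exp mf f0).
have mo : measurable_fun setT (fun r : R => omega (t * expR (- r))).
  apply: (measurableT_comp (@measurable_omega R)); apply: measurable_funM => //.
  by apply: measurableT_comp => //; exact: measurable_funN.
rewrite -ge0_integralZl//; last 2 first.
- apply: emeasurable_funM => //; apply/measurable_EFinP; apply: measurable_funM; last exact: measurable_orbit_mean.
  by apply: measurableT_comp => //; exact: measurable_funN.
- by move=> r _; rewrite mule_ge0 ?omega_ge0// lee_fin mulr_ge0 ?expR_ge0// orbit_mean_ge0.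
apply: eq_integral => r _.
have of_ : omega (t * expR (- r)) \is a fin_num.
  by rewrite ge0_fin_numE ?omega_ge0// omega_lty// mulr_gt0// expR_gt0.
transitivity (\int[leb]_x ((2 * fine (omega (t * expR (- r))) * expR (- r))%:E *
    (window W x * tsum (x, expR r))%:E))%E.
  apply: eq_integral => x _; rewrite /f skernE/= ?expR_gt0// stripE -{1}(fineK of_).
  rewrite -tsumE/= ?expR_gt0// -!EFinM; congr EFin; ring.
rewrite ge0_integralZl//; last 3 first.
- apply/measurable_EFinP; apply: measurable_funM; first exact: measurable_window.
  by apply: (measurableT_comp mtsum_exp (g := fun x : R => (x, r))); exact: measurable_fun_pair.
- by move=> x _; rewrite lee_fin mulr_ge0 ?window_ge0.
- by rewrite lee_fin !mulr_ge0 ?expR_ge0 ?fine_ge0 ?omega_ge0.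
rewrite -orbit_meanE -{2}(fineK of_) -!EFinM; congr EFin; ring.
Qed.

(* By unfolding, [2 * q x] is the integral over [D] of [phi] times the orbit sum
   of [strip_kernel W (expR x)], that is of [phi * (2 * theta - 2)]. *)
Lemma theta_orbit (q : R -> R) :
  (forall x, ((q x)%:E = \int[leb]_r (theta_log (x - r) * expR (- r) * orbit_mean r)%:E)%E) ->
  exists M : R, hyp_int (fun p => (ind p)%:E) = M%:E /\
  forall x, q (- x) = expR x * q x + M * (expR x - 1).
Proof.
move=> qE; have mH := @measurable_half_plane R.
pose K t p : \bar R := (\esum_(g in [set: SL2Z]) strip_kernel W t (mob g p))%E.
have K0 t p : (0 <= K t p)%E.
  by apply: esum_ge0 => g _; rewrite mule_ge0 ?omega_ge0// lee_fin window_ge0.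
pose KT t p : \bar R := (\esum_(g in [set: SL2Z]) skern t (mob_total g p))%E.
have KTE t p : 0 < p.2 -> KT t p = K t p.
  by move=> p0; apply: eq_esum => g _; rewrite -mob_totalE// skernE// mob_gt0.
have mKT t : measurable_fun setT (KT t).
  apply: measurable_esum_count => // g; exact: (measurableT_comp (mskern t)).
have KT0 t p : (0 <= KT t p)%E by exact: esum_ge0.
have UE x : hyp_int (fun p => ((ind p)%:E * K (expR x) p)%E) = (2 * q x)%:E.
  rewrite hyp_int_unfold ?expR_gt0// hyp_int_strip ?expR_gt0// EFinM qE; congr (_ * _)%E.
  by apply: eq_integral => r _; rewrite -expRD -theta_logE -EFinM mulrA.
(* As 2 + K is twice theta by unfolding, this is the inversion formula for theta. *)
have ThK t p : 0 < t -> 0 < p.2 -> (2%:E + K t^-1%R p = t%:E * (2%:E + K t p))%E.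
  move=> t0 p0; have ti0 : 0 < t^-1 by rewrite invr_gt0.
  rewrite -(theta_unfold W0 ti0 p0) -(theta_unfold W0 t0 p0) theta_inv//.
  by rewrite muleCA.
pose M' := hyp_int (fun p => (ind p)%:E).
have mindy : measurable_fun setT (fun p => ((ind p)%:E * ((p.2 ^+ 2)^-1)%:E)%E).
  by apply: emeasurable_funM => //; exact/measurable_EFinP.
have i0 p : (0 <= (ind p)%:E * ((p.2 ^+ 2)^-1)%:E)%E by rewrite mule_ge0// lee_fin.
have M0 : (0 <= M')%E by apply: integral_ge0 => p _.
have add t : hyp_int (fun p => ((ind p)%:E * (2%:E + K t p))%E) =
    (2%:E * M' + hyp_int (fun p => ((ind p)%:E * K t p)%E))%E.
  rewrite (@eq_hyp_int (fun p => ((ind p)%:E * (2%:E + K t p))%E) (fun p => ((ind p)%:E * (2%:E + KT t p))%E)); last first.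
    by move=> p p0; rewrite KTE.
  rewrite (@eq_hyp_int (fun p => ((ind p)%:E * K t p)%E) (fun p => ((ind p)%:E * KT t p)%E)); last first.
    by move=> p p0; rewrite KTE.
  rewrite /M' /hyp_int -ge0_integralZl//; last exact: measurable_funTS.
  rewrite -ge0_integralD//.
  - apply: eq_integral => p _; rewrite ge0_muleDr// ge0_muleDl ?mule_ge0 ?lee_fin//.
    by congr (_ + _)%E; rewrite -muleA muleCA.
  - by move=> p _; rewrite mule_ge0.
  - by apply: measurable_funTS; apply: emeasurable_funM.
  - by move=> p _; apply: mule_ge0 => //; apply: mule_ge0 => //; rewrite lee_fin.
  - apply: measurable_funTS; apply: emeasurable_funM; last exact: myinv.
    by apply: emeasurable_funM; [exact/measurable_EFinP|exact: mKT].
have scal t : 0 < t -> hyp_int (fun p => ((ind p)%:E * (2%:E + K t^-1%R p))%E) =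
    (t%:E * hyp_int (fun p => ((ind p)%:E * (2%:E + K t p))%E))%E.
  move=> t0.
  rewrite [in RHS](@eq_hyp_int _ (fun p => ((ind p)%:E * (2%:E + KT t p))%E)); last first.
    by move=> p p0; rewrite KTE.
  rewrite /hyp_int -ge0_integralZl//.
  - by apply: eq_integral => p /set_mem/= p0; rewrite ThK// KTE// (muleCA (ind p)%:E) -!muleA.
  - apply: measurable_funTS; apply: emeasurable_funM; last exact: myinv.
    apply: emeasurable_funM; first exact/measurable_EFinP.
    by apply: emeasurable_funD; [exact: measurable_cst|exact: mKT].
  - by move=> p _; apply: mule_ge0 => //; apply: mule_ge0; [rewrite lee_fin|exact: adde_ge0].
  - by rewrite lee_fin ltW.
(* At t = 2 the functional equation reads K(1/2) = 2 + 2 K(2), so K(1/2) >= 1 and the mass is at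
   most the integral against K(1/2), which is 2 q(- ln 2) and hence finite. *)
have Mfin : M' \is a fin_num.
  rewrite ge0_fin_numE//; have := UE (- ln 2); rewrite expRN lnK ?posrE// => U2.
  apply: (@le_lt_trans _ _ (2 * q (- ln 2))%:E); last exact: ltry.
  rewrite -U2; apply: ge0_le_integral => //.
  - exact: measurable_funTS.
  - have mKH : measurable_fun (@half_plane R) (K 2^-1).
      apply: (@eq_measurable_fun _ _ _ _ _ (KT 2^-1)); last exact: measurable_funTS.
      by move=> p /set_mem/= p0; rewrite KTE.
    apply: emeasurable_funM; last exact: measurable_funTS.
    by apply: emeasurable_funM => //; apply: measurable_funTS; exact/measurable_EFinP.
  - move=> p /= p0; apply: lee_wpmul2r => //; rewrite -[leLHS]mule1.
    apply: lee_wpmul2l; first by rewrite lee_fin.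
    have := ThK 2 p (ltr0n _ 2) p0; have := K0 2 p; have := K0 2^-1 p.
    case: (K 2^-1 p) => [a a0||]; [|by move=> *; rewrite leey|by []].
    case: (K 2 p) => [b||]//; last by rewrite addey// gt0_muley// lte_fin.
    by rewrite !lee_fin => b0 [] h; move: b0 h a0 => /= b0 h a0; rewrite lee_fin in a0; lra.
exists (fine M'); split; first by rewrite fineK.
move=> x; have A y : hyp_int (fun p => ((ind p)%:E * (2%:E + K (expR y) p))%E) =
    (2 * fine M' + 2 * q y)%:E.
  by apply: etrans (add (expR y)) _; rewrite [X in (_ + X)%E]UE -{1}(fineK Mfin) -EFinM -EFinD.
have S := scal _ (expR_gt0 x).
have E1 : hyp_int (fun p => ((ind p)%:E * (2%:E + K (expR x)^-1%R p))%E) =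
    (2 * fine M' + 2 * q (- x))%:E by rewrite -[(expR x)^-1%R]expRN; exact: (A (- x)).
have := etrans (esym E1) (etrans S (congr1 (fun y => (_ * y)%E) (A x))).
move=> [] h; lra.
Qed.

End Unfolding.

(** * Null sets and cusps *)

Section NullSets.
Context (R : realType).
Implicit Types (p : R * R) (g h : SL2Z) (N A : set (R * R)).

Lemma negligible_countable_union (I : countType) (A : I -> set (R * R)) :
  (forall i, (area R).-negligible (A i)) -> (area R).-negligible (\bigcup_i A i).
Proof.
move=> A0; pose B n := oapp A set0 (unpickle n).
apply: (@negligibleS _ _ _ (area R) (\bigcup_n B n)).
  by move=> p [i _ Ap]; exists (pickle i) => //; rewrite /B pickleK.
apply: negligible_bigcup => n; rewrite /B; case: (unpickle n) => [i|]/=; first exact: A0.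
exact: negligible_set0.
Qed.

(** The hyperbolic measure is invariant, and its density is positive, so that in the half-plane it
    has the same null sets as the area. *)
Lemma null_mob N g : measurable N -> area R N = 0%E ->
  area R (@half_plane R `&` mob_total g @^-1` N) = 0%E.
Proof.
move=> mN N0; have mH := @measurable_half_plane R.
have mgN : measurable (mob_total g @^-1` N).
  by rewrite -[X in measurable X]setTI; exact: measurable_mob_total.
pose f p : \bar R := (\1_N p)%:E.
have mf : measurable_fun setT f by apply/measurable_EFinP; exact: measurable_indic.
have f0 p : (0 <= f p)%E by rewrite lee_fin indicE.
have my : measurable_fun setT (fun p : R * R => ((p.2 ^+ 2)^-1)%:E).
  apply/measurable_EFinP; apply: measurable_inv_ge0; first by move=> t; exact: sqr_ge0.
  by apply: measurable_funX; exact: measurable_snd.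
have h0 : hyp_int (fun p => f (mob g p)) = 0%E.
  rewrite hyp_int_mob// /hyp_int (@eq_integral_off_null _ _ _ (area R) _ N _ (cst 0%E))//.
    by rewrite integral0.
  by move=> p _ pN; rewrite /f indicE memNset// mul0e.
pose k p : \bar R := (f (mob_total g p) * ((p.2 ^+ 2)^-1)%:E)%E.
have mk : measurable_fun (@half_plane R) k.
  apply: measurable_funTS; apply: emeasurable_funM => //.
  exact: (measurableT_comp mf (@measurable_mob_total R g)).
have : (\int[area R]_(p in @half_plane R) `|k p| = 0)%E.
  rewrite -h0; apply: eq_integral => p /set_mem p0.
  by rewrite /k gee0_abs ?mule_ge0 ?lee_fin ?invr_ge0 ?sqr_ge0// mob_totalE.
move/(ae_eq_integral_abs (area R) mH mk) => [B [mB B0 sB]].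
apply: (@subset_measure0 _ _ _ (area R) _ B) => //; first exact: measurableI.
move=> p [/= p0 Np]; apply: sB => /= /(_ p0); rewrite /k /f indicE mem_set// mul1e.
by move=> -[] /eqP; rewrite invr_eq0 expf_eq0/= gt_eqF.
Qed.

(** The set is the union of the translates of a null Borel cover of [A]; the group being countable,
    it is still null. *)
Lemma negligible_invariant A : (area R).-negligible A ->
  exists N, [/\ measurable N, area R N = 0%E, N `<=` @half_plane R,
    forall g p, 0 < p.2 -> N (mob g p) <-> N p & @half_plane R `&` A `<=` N].
Proof.
move=> [B [mB B0 AB]]; have mH := @measurable_half_plane R.
pose G n : set (R * R) := oapp (fun g => @half_plane R `&` mob_total g @^-1` B) set0 (unpickle n).
have NE p : (\bigcup_n G n) p <-> 0 < p.2 /\ exists g, B (mob g p).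
  split=> [[n _]|[p0 [g Bg]]].
    rewrite /G; case: (unpickle n) => [g|]//= [p0 Bg]; split => //.
    by exists g; rewrite mob_totalE.
  by exists (pickle g) => //; rewrite /G pickleK/=; split=> //=; rewrite -mob_totalE.
have mG n : measurable (G n).
  rewrite /G; case: (unpickle n) => [g|]//=; apply: measurableI => //.
  by rewrite -[X in measurable X]setTI; exact: measurable_mob_total.
have mU : measurable (\bigcup_n G n) by exact: bigcup_measurable.
exists (\bigcup_n G n); split => //.
- apply: (proj1 (@negligibleP _ _ _ (area R) _ mU)).
  apply: negligible_bigcup => n; apply: (proj2 (@negligibleP _ _ _ (area R) _ (mG n))).
  by rewrite /G; case: (unpickle n) => [g|]/=; [exact: null_mob|exact: measure0].
- by move=> p /NE[].
- move=> g p p0; rewrite !NE; split=> -[q0 [h Bh]]; split => //; try exact: mob_gt0.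
    by exists (h * g)%g; rewrite mob_mul.
  by exists (h * g^-1)%g; rewrite mob_mul ?mob_gt0// mobV.
- by move=> p [p0 /AB Bp]; apply/NE; split => //; exists 1%g; rewrite mob1.
Qed.

(* A function measurable for the completed sigma-algebra is measurable once
   restricted to the complement of a suitable null set: one removes the
   negligible parts of the countably many sets [f > q], [q] rational. *)
Lemma completed_measurable_restrict (f : R * R -> R) :
  (forall q : rat, completed_algebra_gen (area R) (@half_plane R `&` [set p | ratr q < f p])) ->
  exists A, (area R).-negligible A /\
  forall N, measurable N -> @half_plane R `&` A `<=` N ->
    measurable_fun setT (fun p => if p \in @half_plane R `\` N then f p else 0).
Proof.
move=> fq; have mH := @measurable_half_plane R.
have /choice[B Bq] (q : rat) : exists B : set (R * R) * set (R * R),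
    [/\ measurable B.1, (area R).-negligible B.2 &
        B.1 `|` B.2 = @half_plane R `&` [set p | ratr q < f p]].
  by have [B1 mB1 [B2 nB2 e]] := fq q; exists (B1, B2).
exists (\bigcup_q (B q).2); split.
  by apply: negligible_countable_union => q; have [] := Bq q.
move=> N mN AN; rewrite [X in measurable_fun _ X](_ : _ = f \_ (@half_plane R `\` N)); last first.
  by apply/funext => p; rewrite patchE.
have mHN := measurableD mH mN.
apply/(measurable_restrictT _ mHN) => _.
apply: (measurability _ (RGenOInfty.measurableE R)) => //.
move=> /= _ [_ [x ->] <-]; rewrite preimage_itvoy.
rewrite [X in measurable X](_ : _ = \bigcup_(q : rat)
    (if x <= ratr q then ((B q).1 `\` N) `&` @half_plane R else set0)); last first.
  apply/seteqP; split=> p.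
    move=> [[/= p0 Np] xf]; have [q] := rat_in_itvoo xf.
    rewrite in_itv/= => /andP[xq qf]; exists q => //=; rewrite (ltW xq); split => //; split => //.
    have [_ _ E] := Bq q; have : (@half_plane R `&` [set p | ratr q < f p]) p by [].
    rewrite -E => -[//|B2]; exfalso; apply: Np; apply: AN; split => //.
    by exists q.
  move=> [q _]; case: ifPn => // xq [[B1 Np] p0]; split => //=.
  have [_ _ E] := Bq q; have : ((B q).1 `|` (B q).2) p by left.
  by rewrite E => -[_ /=]; exact: le_lt_trans.
apply: bigcupT_measurable_rat => q; case: ifP => // _.
by apply: measurableI => //; apply: measurableD => //; have [] := Bq q.
Qed.

End NullSets.

(** * Cusp widths *)

Section Cusps.
Variable (Gam : groupClosed SL2Z).
Hypothesis Gam_fin : finite_index Gam.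
Implicit Types (g h t : SL2Z).

(* Pigeonhole on the cosets [Gam t translation ^ n]. *)
Lemma cusp_period_ex t : exists v, (0 < v)%N && pm_mem Gam (t * translation ^+ v * t^-1)%g.
Proof.
apply: contrapT => np; apply: infinite_nat.
pose f (n : nat) : set SL2Z := [set (g * (t * translation ^+ n))%g | g in [set` Gam]].
have fP (m n : nat) : (m < n)%N -> f m = f n -> False.
  move=> mn e; have : f n (t * translation ^+ n)%g.
    by exists 1%g; rewrite ?mul1g//=; exact: gpred1.
  rewrite -e => -[g /= gG E]; apply: np; exists (n - m)%N; rewrite subn_gt0 mn/=.
  apply/orP; left.
  have -> : (t * translation ^+ (n - m) * t^-1 = g)%g => //.
  apply: (mulIg (t * translation ^+ m)%g); rewrite E !mulgA mulgVK -mulgA -expgnDr.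
  by rewrite subnK// ltnW.
have finj : injective f.
  by move=> m n e; case: (ltngtP m n) => // mn; exfalso; apply: (fP _ _ mn).
have := @finite_preimage _ _ (range (fun tau => [set (g * tau)%g | g in [set` Gam]])) f
  (in2W finj) Gam_fin.
by rewrite (_ : f @^-1` _ = setT)//; apply/seteqP; split => // n _ /=; exists (t * translation ^+ n)%g.
Qed.

Lemma cusp_widthP t : is_cusp_width Gam t (cusp_width Gam t).
Proof.
rewrite /cusp_width; case: xgetP => [w _ //|/(_ (ex_minn (cusp_period_ex t)))]; case.
by case: ex_minnP => m Pm minm; split.
Qed.

Lemma cusp_width_gt0 t : (0 < cusp_width Gam t)%N.
Proof. by have [/andP[]] := cusp_widthP t. Qed.

Lemma mob_cusp_width (R : realType) (A : Type) (h : R * R -> A) t (p : R * R) :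
  (forall g p, g \in Gam -> 0 < p.2 -> h (mob g p) = h p) -> 0 < p.2 ->
  h (mob t (p.1 + (cusp_width Gam t)%:R, p.2)) = h (mob t p).
Proof.
move=> h_inv p0; have [/andP[_ kG] _] := cusp_widthP t.
set w := cusp_width Gam t in kG *; set k := (t * translation ^+ w * t^-1)%g in kG.
have -> : (p.1 + w%:R, p.2) = mob (translation ^+ w)%g p by rewrite translX mob_transl.
rewrite -mob_mul// -(mulgVK t (t * translation ^+ w)%g) -/k mob_mul//.
have q0 := mob_gt0 t p0.
by case/orP: kG => kG; [rewrite h_inv|rewrite -(mob_opp k) h_inv].
Qed.

End Cusps.

Section PeriodicIntegral.
Context (R : realType).
Local Notation leb := (@lebesgue_measure R).

(** The interval [0, W[ consists of W / w translates of the period [0, w[, and the window has height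
    1 / W. *)
Lemma window_integral (w W : nat) (h : R -> R) : (0 < w)%N -> (0 < W)%N -> (w %| W)%N ->
  measurable_fun setT h -> (forall x, 0 <= h x) -> (forall x, h (x + w%:R) = h x) ->
  (\int[leb]_x (window W x * h x)%:E = \int[leb]_(x in `[0%R, w%:R]) (w%:R^-1 * h x)%:E)%E.
Proof.
move=> w0 W0 /dvdnP[k Wk] mh h0 hper.
pose I (a b : R) : \bar R := (\int[leb]_x ((if a <= x < b then 1 else 0) * h x)%:E)%E.
have mi (a b : R) : measurable_fun setT (fun x => ((if a <= x < b then 1 else 0) * h x)%:E).
  apply/measurable_EFinP; apply: measurable_funM => //.
  rewrite (_ : (fun x : R => _) = \1_(`[a, b[%classic)); last first.
    by apply/funext => x; rewrite indicE mem_setE in_itv/=; case: ifP.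
  exact: measurable_indic.
have i0 (a b : R) x : (0 <= ((if a <= x < b then 1 else 0) * h x)%:E)%E.
  by rewrite lee_fin; case: ifP => _; rewrite ?mul1r ?mul0r.
have hperk j x : h (x + (j * w)%:R) = h x.
  by elim: j => [|j IH]; rewrite ?mul0n ?addr0// mulSn natrD (addrC w%:R) addrA hper.
have Ishift j : I (j * w)%:R (j.+1 * w)%:R = I 0%R w%:R.
  rewrite /I -(ge0_integral_shift (j * w)%:R (mi _ _) (i0 _ _)); apply: eq_integral => x _.
  by rewrite hperk lerDr mulSn natrD ltrD2r.
have IE j : I 0%R (j * w)%:R = ((j%:R : R)%:E * I 0%R w%:R)%E.
  elim: j => [|j IH].
    rewrite mul0n mul0e; apply: integral0_eq => x _.
    by rewrite ltNge andbN mul0r.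
  rewrite -natr1 EFinD ge0_muleDl// -IH mul1e -(Ishift j) /I -ge0_integralD//; [|exact: mi|exact: mi].
  apply: eq_integral => x _; rewrite -EFinD -mulrDl; congr (_ * _)%:E.
  have jw0 : 0 <= (j * w)%:R :> R by [].
  have jw1 : (j * w)%:R <= (j.+1 * w)%:R :> R by rewrite ler_nat leq_mul2r leqnSn orbT.
  have [x1|x1] := ltP x (j * w)%:R.
    by rewrite andbT (lt_le_trans x1 jw1)/= andbT addr0.
  by rewrite andbF add0r (le_trans jw0 x1).
have k0 : (0 < k)%N by move: W0; rewrite Wk muln_gt0 => /andP[].
transitivity ((W%:R^-1)%:E * I 0%R W%:R)%E.
  rewrite /I -ge0_integralZl ?lee_fin ?invr_ge0//; last exact: mi.
  apply: eq_integral => x _.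
  by rewrite -EFinM /window mulrA; congr (_ * _)%:E; case: ifP; rewrite ?mulr1 ?mulr0.
rewrite {2}Wk IE muleA -EFinM Wk natrM invfM mulrAC mulVf ?pnatr_eq0 -?lt0n// mul1r.
rewrite -integral_itv_bndo_bndc; last first.
  by apply: measurable_funTS; apply/measurable_EFinP; exact: measurable_funM.
rewrite /I -ge0_integralZl ?lee_fin ?invr_ge0//; last exact: mi.
rewrite [RHS]integral_mkcond; apply: eq_integral => x _.
rewrite patchE mem_setE in_itv/=; case: ifP => _; first by rewrite mul1r.
by rewrite mul0r mule0.
Qed.

End PeriodicIntegral.

(** * The functional equation for nonnegative invariant functions *)

Section PositiveMean.
Context (R : realType).
Local Notation leb := (@lebesgue_measure R).
Local Notation C := R[i].
Variables (Gam : groupClosed SL2Z) (Gam_fin : finite_index Gam).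
Variables (T : seq SL2Z) (T_trans : coset_transversal Gam T).
Variables (phi : R * R -> R) (D : set (R * R)) (B K alpha delta : R).
Hypotheses (mphi : measurable_fun setT phi) (phi0 : forall p, 0 <= phi p)
  (phiB : forall p, phi p <= B).
Hypothesis phi_inv : forall g p, g \in Gam -> 0 < p.2 -> phi (mob g p) = phi p.
Hypotheses (mD : measurable D) (DH : D `<=` @half_plane R).
Hypothesis countD : forall p, 0 < p.2 -> phi p != 0 ->
  (\esum_(g in [set g | pm_mem Gam g]) (\1_D (mob g p) : R)%:E = 2%:E)%E.
Hypothesis phi_decay : forall t p, 1 <= p.2 -> phi (mob t p) <= K * expR (- (alpha * ln p.2)).
Hypotheses (delta0 : 0 < delta) (delta_alpha : delta < alpha).

Let w t := cusp_width Gam t.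
(** A common multiple of the cusp widths, which lets a single window serve all cusps. *)
Let W := (\prod_(t <- T) w t)%N.

Let W0 : (0 < W)%N.
Proof. by apply: prodn_gt0 => t; exact: cusp_width_gt0. Qed.

Let b := orbit_mean T phi W.

Let B0 : 0 <= B. Proof. exact: le_trans (phi0 (0, 0)) (phiB (0, 0)). Qed.

Let mphi_line t r : measurable_fun setT (fun x : R => phi (mob t (x, expR r))).
Proof.
rewrite (_ : (fun x : R => _) = phi \o (mob_total t) \o (fun x => (x, expR r))).
  apply: (measurableT_comp (measurableT_comp mphi (@measurable_mob_total R t))).
  exact: measurable_fun_pair.
by apply/funext => x /=; rewrite mob_totalE//= expR_gt0.
Qed.

Lemma integrable_cusp_line t r : leb.-integrable `[0, (w t)%:R]
  (EFin \o (fun x => phi (mob t (x, expR r)))).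
Proof.
apply: measurable_bounded_integrable => //.
- by rewrite /= lebesgue_measure_itv/=; case: ifP => _; rewrite ?sube0 ltry.
- exact: (measurable_funTS (mphi_line t r)).
- exists B; split; first exact: num_real.
  by move=> x Bx y _ /=; rewrite ger0_norm// (le_trans (phiB _))// ltW.
Qed.

Lemma orbit_mean_sum r :
  b r = \sum_(t <- T) (w t)%:R^-1 * \int[leb]_(x in `[0, (w t)%:R]) phi (mob t (x, expR r)).
Proof.
rewrite /b /orbit_mean /Rintegral.
transitivity (fine (\sum_(t <- T) \int[leb]_x (window W x * phi (mob t (x, expR r)))%:E)%E).
  congr fine; rewrite -ge0_integral_sum//.
  - by apply: eq_integral => x _; rewrite mulr_sumr -sumEFin.
  - by move=> t; apply/measurable_EFinP; exact: (measurable_funM (measurable_window W) (mphi_line t r)).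
  - by move=> t x _; rewrite lee_fin mulr_ge0 ?window_ge0.
have E t : t \in T -> (\int[leb]_x (window W x * phi (mob t (x, expR r)))%:E)%E =
    ((w t)%:R^-1 * \int[leb]_(x in `[0, (w t)%:R]) phi (mob t (x, expR r)))%:E.
  move=> tT; have wW : (w t %| W)%N by rewrite /W (big_rem _ tT)/= dvdn_mulr.
  rewrite (window_integral (cusp_width_gt0 Gam_fin t) W0 wW (mphi_line t r))//; last first.
    move=> x; exact: (mob_cusp_width Gam_fin t (p := (x, expR r)) phi_inv (expR_gt0 r)).
  have I := integrable_cusp_line t r.
  have If := @integrable_fin_num _ _ R leb _ (measurable_itv _) _ I.
  rewrite EFinM /Rintegral (fineK If).
  by rewrite -(@integralZl _ _ R leb _ (measurable_itv _) _ I).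
rewrite (eq_big_seq _ E) sumEFin//.
Qed.

Lemma orbit_mean_le r c : (forall t x, phi (mob t (x, expR r)) <= c) -> b r <= (size T)%:R * c.
Proof.
move=> pc; rewrite orbit_mean_sum.
have -> : (size T)%:R * c = \sum_(t <- T) c by rewrite big_const_seq count_predT iter_addr addr0 mulr_natl.
apply: ler_sum => t _; rewrite mulrC ler_pdivrMr ?ltr0n ?cusp_width_gt0//.
have I := integrable_cusp_line t r.
have ic : leb.-integrable `[0, (w t)%:R] (EFin \o cst c).
  apply: measurable_bounded_integrable => //.
  - by rewrite /= lebesgue_measure_itv/=; case: ifP => _; rewrite ?sube0 ltry.
  - exists `|c|; split; first exact: num_real.
    by move=> x Bx y _ /=; rewrite ltW.
apply: (@le_trans _ _ (\int[leb]_(x in `[0, (w t)%:R]) (cst c x))).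
  by apply: (@le_Rintegral _ _ R leb _ _ _ (measurable_itv _) I ic) => x _; exact: pc.
rewrite Rintegral_cst//= lebesgue_measure_itv/= lte_fin ltr0n cusp_width_gt0//=.
by rewrite subr0 lexx.
Qed.

(** As r tends to plus infinity the decay at the cusps beats exp (delta r), because delta < alpha;
    as r tends to minus infinity the mean stays bounded and exp (delta r) itself decays. [eta] is
    the slower of the two rates. *)
Lemma integrable_orbit_mean : leb.-integrable setT (EFin \o (fun r => expR (delta * r) * b r)).
Proof.
pose eta := Num.min delta (alpha - delta).
have eta0 : 0 < eta by rewrite lt_min delta0 subr_gt0.
have mb := measurable_orbit_mean T mphi phi0 phiB W.
have b0 r : 0 <= b r by exact: orbit_mean_ge0.
pose C0 := (size T)%:R * (B + `|K|).
apply: (le_integrable measurableT _ _ (integrable_mull measurableT C0 (integrable_laplace eta0))).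
  apply/measurable_EFinP; apply: measurable_funM => //.
  by apply: measurableT_comp => //; exact: measurable_funM.
move=> r _ /=; rewrite lee_fin ger0_norm ?mulr_ge0 ?expR_ge0//.
rewrite [leRHS]ger0_norm ?mulr_ge0 ?expR_ge0 ?addr_ge0//.
have [r0|r0] := leP 0 r.
  apply: (@le_trans _ _ (expR (delta * r) * ((size T)%:R * (`|K| * expR (- (alpha * r)))))).
    rewrite ler_wpM2l ?expR_ge0//; apply: orbit_mean_le => t x.
    apply: le_trans (phi_decay _ _) _ => /=; first by rewrite -expR0 ler_expR.
    by rewrite expRK ler_wpM2r ?expR_ge0// ler_norm.
  rewrite /C0 (_ : expR _ * _ = (size T)%:R * `|K| * expR (- ((alpha - delta) * r))); last first.
    rewrite (_ : - ((alpha - delta) * r) = delta * r + - (alpha * r)); last by ring.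
    by rewrite expRD; ring.
  apply: ler_pM; rewrite ?mulr_ge0 ?expR_ge0//.
    by rewrite ler_wpM2l// lerDr.
  by rewrite ler_expR lerN2 ger0_norm// ler_wpM2r// ge_min lexx orbT.
apply: (@le_trans _ _ (expR (delta * r) * ((size T)%:R * B))).
  by rewrite ler_wpM2l ?expR_ge0//; exact: orbit_mean_le.
rewrite mulrC; apply: ler_pM; rewrite ?mulr_ge0 ?expR_ge0//.
  by rewrite ler_wpM2l// lerDl.
rewrite ler_expR ltr0_norm// mulrN opprK; apply: ler_wnM2r; first exact: ltW.
by rewrite ge_min lexx.
Qed.

Lemma theta_conv_functional :
  exists M : R, hyp_int (fun p => (\1_D p * phi p)%:E) = M%:E /\
  forall x, theta_conv (fun r => (b r)%:C) (- x) =
    (expR x)%:C * theta_conv (fun r => (b r)%:C) x + M%:C * ((expR x)%:C - 1).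
Proof.
have c1 : 1 <= 1 + delta by rewrite lerDl ltW.
have mb : cmeasurable setT (fun r => (b r)%:C).
  apply: cmeasurable_real; exact: (measurable_orbit_mean T mphi phi0 phiB W).
have b0 r : 0 <= b r by exact: orbit_mean_ge0.
have ib : leb.-integrable setT (EFin \o (fun r => expR ((1 + delta - 1) * r) * Normc.normc (b r)%:C)).
  rewrite (_ : (fun r => _) = fun r => expR (delta * r) * b r); first exact: integrable_orbit_mean.
  by apply/funext => r; rewrite normc_real ger0_norm// (addrC 1) addrK.
pose q x := \int[leb]_r (theta_log (x - r) * expR (- r) * b r).
have qE x : theta_conv (fun r => (b r)%:C) x = (q x)%:C.
  apply: complex_eq; rewrite /theta_conv /q /=.
    by apply: eq_Rintegral => r _; rewrite !mul0r subr0.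
  rewrite (_ : 0 = fine (0%E : \bar R))//; congr fine.
  by apply: integral0_eq => r _; rewrite mulr0 mul0r addr0.
have [|M [HM qf]] := @theta_orbit R Gam T T_trans phi D B mphi phi0 phiB phi_inv mD countD W W0 q.
  move=> x; rewrite /q /Rintegral fineK//.
  have [ir _] := cintegrable_theta_conv c1 mb ib x.
  rewrite (_ : (fun r => _) = EFin \o (fun r => complex.Re ((theta_log (x - r) * expR (- r))%:C * (b r)%:C))).
    exact: (integrable_fin_num measurableT ir).
  by apply/funext => r /=; rewrite mulr0 subr0.
exists M; split => // x; rewrite !qE qf rmorphD !rmorphM rmorphB//.
Qed.

(** The functional equation already supplies a finite mass; for a nonnegative function this is
    integrability on D, and the mass becomes an ordinary real integral. *)
Lemma positive_hyp_int : exists M : R, hyp_int (fun p => (\1_D p * phi p)%:E) = M%:E /\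
  (area R).-integrable D (EFin \o (fun p => phi p * (p.2 ^+ 2)^-1)) /\
  M = \int[area R]_(p in D) (phi p * (p.2 ^+ 2)^-1).
Proof.
have [M [HM _]] := theta_conv_functional; exists M; split => //.
have E : hyp_int (fun p => (\1_D p * phi p)%:E) =
    (\int[area R]_(p in D) (phi p * (p.2 ^+ 2)^-1)%:E)%E.
  rewrite /hyp_int integral_mkcond [RHS]integral_mkcond; apply: eq_integral => p _.
  rewrite !patchE indicE; case: (boolP (p \in D)) => [/set_mem pD|_].
    by rewrite mem_set ?mul1r ?EFinM//; exact: DH.
  by rewrite mul0r mul0e; case: ifP.
rewrite E in HM; have my : measurable_fun setT (fun p : R * R => (p.2 ^+ 2)^-1).
  apply: measurable_inv_ge0; first by move=> t; exact: sqr_ge0.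
  by apply: measurable_funX; exact: measurable_snd.
split; last by rewrite /Rintegral HM.
apply/integrableP; split.
  by apply: measurable_funTS; apply/measurable_EFinP; exact: measurable_funM.
under eq_integral => p _ do rewrite /= ger0_norm ?mulr_ge0 ?invr_ge0 ?sqr_ge0//.
by rewrite HM ltry.
Qed.

End PositiveMean.

(** * Constant terms at the cusps *)

Section CuspMean.
Context (R : realType).
Local Notation leb := (@lebesgue_measure R).
Local Notation C := R[i].
Local Notation Re := complex.Re.
Local Notation Im := complex.Im.
Local Notation normc := Normc.normc.
Variables (Gam : groupClosed SL2Z) (Gam_fin : finite_index Gam).
Variables (T : seq SL2Z) (T_trans : coset_transversal Gam T).
Variables (f : R * R -> C) (D : set (R * R)) (B K alpha delta : R).
Hypotheses (mf : cmeasurable setT f) (fB : forall p, normc (f p) <= B).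
Hypothesis f_inv : forall g p, g \in Gam -> 0 < p.2 -> f (mob g p) = f p.
Hypotheses (mD : measurable D) (DH : D `<=` @half_plane R).
Hypothesis countD : forall p, 0 < p.2 -> f p != 0 ->
  (\esum_(g in [set g | pm_mem Gam g]) (\1_D (mob g p) : R)%:E = 2%:E)%E.
Hypothesis f_decay : forall t p, 1 <= p.2 -> normc (f (mob t p)) <= K * expR (- (alpha * ln p.2)).
Hypotheses (delta0 : 0 < delta) (delta_alpha : delta < alpha).

Let w t := cusp_width Gam t.
Let W := (\prod_(t <- T) w t)%N.

Definition cusp_mean (r : R) : C :=
  \sum_(t <- T) ((w t)%:R^-1)%:C * cintegral leb `[0, (w t)%:R] (fun x => f (mob t (x, expR r))).

Section part.
Variable u : C -> R.
Hypotheses (mu_f : measurable_fun setT (fun p => u (f p))) (u_le : forall z, u z <= normc z).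

(** With [u] equal to Re, - Re, Im and - Im these are four nonnegative invariant functions of which
    [f] is a linear combination; the positive case applies to each of them. *)
Definition pos_part (p : R * R) : R := Num.max (u (f p)) 0.

Let mpos : measurable_fun setT pos_part.
Proof. by apply: measurable_maxr => //; exact: measurable_cst. Qed.

Let pos0 p : 0 <= pos_part p.
Proof. by rewrite le_max lexx orbT. Qed.

Let pos_le p : pos_part p <= normc (f p).
Proof. by rewrite ge_max u_le normc_ge0. Qed.

Let posB p : pos_part p <= B.
Proof. exact: le_trans (pos_le p) (fB p). Qed.

Let pos_inv g p : g \in Gam -> 0 < p.2 -> pos_part (mob g p) = pos_part p.
Proof. by move=> gG p0; rewrite /pos_part f_inv. Qed.

Let pos_count p : 0 < p.2 -> pos_part p != 0 ->
  (\esum_(g in [set g | pm_mem Gam g]) (\1_D (mob g p) : R)%:E = 2%:E)%E.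
Proof.
move=> p0 pn; apply: countD => //; apply: contra pn => /eqP f0.
by have := pos_le p; rewrite f0 Normc.normc0 => h; rewrite eq_le h pos0.
Qed.

Let pos_decay t p : 1 <= p.2 -> pos_part (mob t p) <= K * expR (- (alpha * ln p.2)).
Proof. by move=> p1; apply: le_trans (pos_le _) (f_decay _ p1). Qed.

Definition pos_mean r := orbit_mean T pos_part W r.

Lemma pos_meanE r : pos_mean r = \sum_(t <- T) (w t)%:R^-1 *
  \int[leb]_(x in `[0, (w t)%:R]) pos_part (mob t (x, expR r)).
Proof. exact: (orbit_mean_sum Gam_fin T mpos pos0 posB pos_inv). Qed.

Lemma integrable_pos_line t r : leb.-integrable `[0, (w t)%:R]
  (EFin \o (fun x => pos_part (mob t (x, expR r)))).
Proof. exact: (integrable_cusp_line Gam mpos pos0 posB). Qed.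

Lemma pos_mean_ge0 r : 0 <= pos_mean r.
Proof. exact: orbit_mean_ge0. Qed.

Lemma measurable_pos_mean : measurable_fun setT pos_mean.
Proof. exact: (measurable_orbit_mean T mpos pos0 posB W). Qed.

Lemma integrable_pos_mean : leb.-integrable setT (EFin \o (fun r => expR (delta * r) * pos_mean r)).
Proof.
exact: (integrable_orbit_mean Gam_fin T mpos pos0 posB pos_inv pos_decay delta0 delta_alpha).
Qed.

Lemma cintegrable_pos_conv x :
  cintegrable leb setT (fun r => (theta_log (x - r) * expR (- r))%:C * (pos_mean r)%:C).
Proof.
have c1 : 1 <= 1 + delta by rewrite lerDl ltW.
apply: (cintegrable_theta_conv c1); first exact: cmeasurable_real measurable_pos_mean.
rewrite (_ : (fun r => _) = fun r => expR (delta * r) * pos_mean r); first exact: integrable_pos_mean.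
by apply/funext => r; rewrite normc_real ger0_norm ?pos_mean_ge0// (addrC 1) addrK.
Qed.

Definition pos_mass : R := \int[area R]_(p in D) (pos_part p * (p.2 ^+ 2)^-1).

Lemma integrable_pos_mass : (area R).-integrable D (EFin \o (fun p => pos_part p * (p.2 ^+ 2)^-1)).
Proof.
by have [M [_ []]] := positive_hyp_int Gam_fin T_trans mpos pos0 posB pos_inv mD DH pos_count
  pos_decay delta0 delta_alpha.
Qed.

Lemma pos_conv_functional x : theta_conv (fun r => (pos_mean r)%:C) (- x) =
  (expR x)%:C * theta_conv (fun r => (pos_mean r)%:C) x + pos_mass%:C * ((expR x)%:C - 1).
Proof.
have [M [HM E]] := theta_conv_functional Gam_fin T_trans mpos pos0 posB pos_inv mD pos_count
  pos_decay delta0 delta_alpha.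
have [M' [HM' [_ ME]]] := positive_hyp_int Gam_fin T_trans mpos pos0 posB pos_inv mD DH pos_count
  pos_decay delta0 delta_alpha.
have MM : M = M' by have := etrans (esym HM) HM'; case.
by rewrite /pos_mass -ME -MM; exact: E.
Qed.

End part.

Let re z : R := Re z.
Let ren z : R := - Re z.
Let im z : R := Im z.
Let imn z : R := - Im z.

Let re_le z : re z <= normc z. Proof. exact: le_trans (ler_norm _) (le_Re_normc z). Qed.
Let ren_le z : ren z <= normc z.
Proof. by rewrite /ren -ReN -[leRHS]normcN; exact: re_le. Qed.
Let im_le z : im z <= normc z. Proof. exact: le_trans (ler_norm _) (le_Im_normc z). Qed.
Let imn_le z : imn z <= normc z.
Proof. by rewrite /imn -ImN -[leRHS]normcN; exact: im_le. Qed.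

Let mre : measurable_fun setT (fun p => re (f p)). Proof. by case: mf. Qed.
Let mren : measurable_fun setT (fun p => ren (f p)). Proof. exact: measurable_funN. Qed.
Let mim : measurable_fun setT (fun p => im (f p)). Proof. by case: mf. Qed.
Let mimn : measurable_fun setT (fun p => imn (f p)). Proof. exact: measurable_funN. Qed.

Let maxB (a : R) : Num.max a 0 - Num.max (- a) 0 = a.
Proof.
have [a0|a0] := leP a 0; first by rewrite (max_idPl _) ?oppr_ge0// sub0r opprK.
by rewrite max_r ?subr0// oppr_le0 ltW.
Qed.

Let reE p : pos_part re p - pos_part ren p = Re (f p). Proof. exact: maxB. Qed.
Let imE p : pos_part im p - pos_part imn p = Im (f p). Proof. exact: maxB. Qed.

Lemma cusp_meanE r : cusp_mean r =
  (pos_mean re r)%:C - (pos_mean ren r)%:C + 'i * ((pos_mean im r)%:C - (pos_mean imn r)%:C).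
Proof.
rewrite !pos_meanE// -!rmorphB/= -!sumrB /cusp_mean; apply: complex_eq.
  rewrite Re_sum ReD ReM/= mul0r mul1r !subr0 addr0; apply: eq_bigr => t _.
  rewrite /= mul0r subr0 -mulrBr; congr (_ * _).
  rewrite -(@RintegralB _ _ R leb _ _ _ (measurable_itv _) (integrable_pos_line mre re_le _ _)
    (integrable_pos_line mren ren_le _ _)).
  by apply: eq_Rintegral => x _; rewrite reE.
rewrite Im_sum ImD ImM/= mul0r mul1r !add0r; apply: eq_bigr => t _.
rewrite /= mul0r addr0 -mulrBr; congr (_ * _).
rewrite -(@RintegralB _ _ R leb _ _ _ (measurable_itv _) (integrable_pos_line mim im_le _ _)
  (integrable_pos_line mimn imn_le _ _)).
by apply: eq_Rintegral => x _; rewrite imE.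
Qed.

Lemma cmeasurable_cusp_mean : cmeasurable setT cusp_mean.
Proof.
rewrite (_ : cusp_mean = fun r => (pos_mean re r)%:C - (pos_mean ren r)%:C +
    'i * ((pos_mean im r)%:C - (pos_mean imn r)%:C)); last by apply/funext => r; rewrite cusp_meanE.
have mB (a b : R -> R) : measurable_fun setT a -> measurable_fun setT b ->
    cmeasurable setT (fun r : R => (a r)%:C - (b r)%:C :> C).
  move=> ma mb; rewrite (_ : (fun r => _) = fun r => (a r - b r)%:C).
    by apply: cmeasurable_real; exact: measurable_funB.
  by apply/funext => r; rewrite rmorphB.
apply: cmeasurableD; first by apply: mB; apply: measurable_pos_mean.
apply: cmeasurableM; first exact: cmeasurable_cst.
by apply: mB; apply: measurable_pos_mean.
Qed.

Lemma integrable_cusp_mean :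
  leb.-integrable setT (EFin \o (fun r => expR ((1 + delta - 1) * r) * normc (cusp_mean r))).
Proof.
pose G r := expR (delta * r) * pos_mean re r + expR (delta * r) * pos_mean ren r +
  (expR (delta * r) * pos_mean im r + expR (delta * r) * pos_mean imn r).
have iG : leb.-integrable setT (EFin \o G).
  apply: (@integrableD _ _ R leb setT measurableT
    (fun r => (expR (delta * r) * pos_mean re r + expR (delta * r) * pos_mean ren r)%:E)
    (fun r => (expR (delta * r) * pos_mean im r + expR (delta * r) * pos_mean imn r)%:E)).
    apply: (@integrableD _ _ R leb setT measurableT (fun r => (expR (delta * r) * pos_mean re r)%:E)
      (fun r => (expR (delta * r) * pos_mean ren r)%:E)); exact: integrable_pos_mean.
  apply: (@integrableD _ _ R leb setT measurableT (fun r => (expR (delta * r) * pos_mean im r)%:E)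
    (fun r => (expR (delta * r) * pos_mean imn r)%:E)); exact: integrable_pos_mean.
apply: (le_integrable measurableT _ _ iG).
  apply/measurable_EFinP; apply: measurable_funM.
    by apply: measurableT_comp => //; exact: measurable_funM.
  exact: (cmeasurable_normc cmeasurable_cusp_mean).
move=> r _ /=; rewrite lee_fin ger0_norm ?mulr_ge0 ?expR_ge0 ?normc_ge0//.
have p0 := pos_mean_ge0; rewrite ger0_norm ?addr_ge0 ?mulr_ge0 ?expR_ge0//.
rewrite (addrC 1) addrK /G -!mulrDr ler_wpM2l ?expR_ge0// cusp_meanE.
have nB (a b : R) : 0 <= a -> 0 <= b -> normc (a%:C - b%:C) <= a + b.
  by move=> a0 b0; apply: le_trans (le_normcB _ _) _; rewrite !normc_real !ger0_norm.
apply: le_trans (le_normcD _ _) _; apply: lerD; first exact: nB.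
by rewrite Normc.normcM normc_i mul1r nB.
Qed.

(** The functional equation is linear in the mean and the mass taken together, so the equations for
    the four positive parts combine. *)
Lemma cusp_conv_functional x : theta_conv cusp_mean (- x) =
  (expR x)%:C * theta_conv cusp_mean x +
  cintegral (area R) D (fun p => f p * ((p.2 ^+ 2)^-1)%:C) * ((expR x)%:C - 1).
Proof.
have L y : theta_conv cusp_mean y =
    theta_conv (fun r => (pos_mean re r)%:C) y - theta_conv (fun r => (pos_mean ren r)%:C) y +
    'i * (theta_conv (fun r => (pos_mean im r)%:C) y - theta_conv (fun r => (pos_mean imn r)%:C) y).
  have I1 := cintegrable_pos_conv mre re_le y; have I2 := cintegrable_pos_conv mren ren_le y.
  have I3 := cintegrable_pos_conv mim im_le y; have I4 := cintegrable_pos_conv mimn imn_le y.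
  have I12 := cintegrableB measurableT I1 I2; have I34 := cintegrableB measurableT I3 I4.
  have E1 := cintegralB measurableT I1 I2; have E2 := cintegralB measurableT I3 I4.
  have E3 := cintegralZ measurableT 'i I34.
  have E4 := cintegralD measurableT I12 (cintegrableZ measurableT 'i I34).
  apply: etrans (etrans E4 _); first by apply: eq_cintegral => r _; rewrite cusp_meanE mulrDr mulrCA !mulrBr.
  congr (_ + _); first exact: E1.
  by apply: etrans E3 _; congr (_ * _); exact: E2.
have E : cintegral (area R) D (fun p => f p * ((p.2 ^+ 2)^-1)%:C) =
    (pos_mass re)%:C - (pos_mass ren)%:C + 'i * ((pos_mass im)%:C - (pos_mass imn)%:C).
  have cE (a b c d : R) : a%:C - b%:C + 'i * (c%:C - d%:C) = (a - b) +i* (c - d).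
    by rewrite -!rmorphB/=; apply: complex_eq; rewrite /=; ring.
  rewrite cE; apply: complex_eq => /=.
    rewrite /pos_mass -(@RintegralB _ _ R (area R) _ _ _ mD (integrable_pos_mass mre re_le) (integrable_pos_mass mren ren_le)).
    by apply: eq_Rintegral => p _; rewrite -mulrBl reE ReMr.
  rewrite /pos_mass -(@RintegralB _ _ R (area R) _ _ _ mD (integrable_pos_mass mim im_le) (integrable_pos_mass mimn imn_le)).
  by apply: eq_Rintegral => p _; rewrite -mulrBl imE ImMr.
have F1 := pos_conv_functional mre re_le x; have F2 := pos_conv_functional mren ren_le x.
have F3 := pos_conv_functional mim im_le x; have F4 := pos_conv_functional mimn imn_le x.
move: (cintegral _ _ _) E => M E; move: (L x) (L (- x)); rewrite F1 F2 F3 F4 E => -> ->.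
have aux (e m1 m2 m3 m4 a b c d i : C) : e * a + m1 * (e - 1) - (e * b + m2 * (e - 1)) +
    i * (e * c + m3 * (e - 1) - (e * d + m4 * (e - 1))) =
    e * (a - b + i * (c - d)) + (m1 - m2 + i * (m3 - m4)) * (e - 1) by ring.
exact: aux.
Qed.

End CuspMean.

(** * Damping *)

Section ComplexDifferentiation.
Context (R : realType).
Local Notation C := R[i].
Implicit Types (f g : C -> C) (s : C).

Lemma cderivM f g s : (exists d, cderiv f s d) -> (exists d, cderiv g s d) ->
  exists d, cderiv (fun s => f s * g s) s d.
Proof.
move=> [d1 /cderiv_derivable df] [d2 /cderiv_derivable dg]; apply: derivable_cderiv.
exact: (derivableM df dg).
Qed.

Lemma cderivX f n s : (exists d, cderiv f s d) -> exists d, cderiv (fun s => f s ^+ n) s d.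
Proof.
move=> df; elim: n => [|n IH].
  by exists 0 => e e0; exists 1 => // h _; rewrite !expr0 subrr mul0r subr0 Normc.normc0 mulr_ge0 ?normc_ge0// ltW.
rewrite (_ : (fun s => _) = fun s => f s * f s ^+ n); first exact: cderivM.
by apply/funext => z; rewrite exprS.
Qed.

Lemma cderivV f s : f s != 0 -> (exists d, cderiv f s d) -> exists d, cderiv (fun s => (f s)^-1) s d.
Proof.
move=> fs [d /cderiv_derivable df]; apply: derivable_cderiv.
exact: (@derivableV C C^o (f : C^o -> C^o) s 1 fs df).
Qed.

Lemma cderiv_affine (a b : C) s : exists d, cderiv (fun s => a * s + b) s d.
Proof.
exists a => e e0; exists 1 => // h _.
rewrite (_ : _ - _ = 0) ?Normc.normc0 ?mulr_ge0 ?normc_ge0 ?ltW//; ring.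
Qed.

Lemma cderivB f g s : (exists d, cderiv f s d) -> (exists d, cderiv g s d) ->
  exists d, cderiv (fun s => f s - g s) s d.
Proof.
move=> [d1 /cderiv_derivable df] [d2 /cderiv_derivable dg]; apply: derivable_cderiv.
exact: (derivableB df dg).
Qed.

Lemma cderiv_reflect f s : (exists d, cderiv f (1 - s) d) -> exists d, cderiv (fun s => f (1 - s)) s d.
Proof.
move=> [d fd]; exists (- d) => e e0; have [r r0 rP] := fd _ e0; exists r => // h hr.
have := rP (- h); rewrite normcN => /(_ hr).
by rewrite mulNr opprK mulrN opprK opprD addrA.
Qed.

End ComplexDifferentiation.

Section Damping.
Context (R : realType).
Local Notation C := R[i].
Local Notation Re := (@complex.Re R).
Local Notation Im := (@complex.Im R).
Local Notation normc := (@Normc.normc R).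
Variables (delta : R).
Hypothesis (delta0 : 0 < delta).

Let kappa n : R := delta + n.+1%:R.

(* Equal to 1 at 0 and 1, invariant under [s |-> 1 - s], decaying like [(Im s)^-2]
   on the strip, and tending to 1 as [n] grows. *)
Definition damp (n : nat) (s : C) : C :=
  (kappa n * (kappa n + 1))%:C / ((s + (kappa n)%:C) * ((kappa n)%:C + 1 - s)).

Let n1 n : 1 <= n.+1%:R :> R. Proof. by rewrite ler1n. Qed.

Let normc_ge (z : C) (a : R) : 0 <= a -> a <= Re z -> (a ^+ 2 + Im z ^+ 2) <= normc z ^+ 2.
Proof. by move=> a0 az; rewrite normc_sqr lerD2r ler_pXn2r ?nnegrE// (le_trans a0). Qed.

(** Both factors have real part at least n + 1 and imaginary part plus or minus Im s; this is where
    the summand delta in [kappa] is used. *)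
Let den_ge n s : - delta <= Re s <= 1 + delta ->
  n.+1%:R ^+ 2 + Im s ^+ 2 <= normc ((s + (kappa n)%:C) * ((kappa n)%:C + 1 - s)).
Proof.
move=> /andP[s1 s2]; rewrite Normc.normcM.
have a0 : 0 <= n.+1%:R :> R by [].
have h1 : n.+1%:R ^+ 2 + Im s ^+ 2 <= normc (s + (kappa n)%:C) ^+ 2.
  rewrite (_ : Im s = Im (s + (kappa n)%:C)); last by rewrite ImD/= addr0.
  by apply: normc_ge => //; rewrite ReD/= /kappa; lra.
have h2 : n.+1%:R ^+ 2 + Im s ^+ 2 <= normc ((kappa n)%:C + 1 - s) ^+ 2.
  rewrite -(sqrrN (Im s)) (_ : - Im s = Im ((kappa n)%:C + 1 - s)); last by rewrite !ImD ImN/= !add0r.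
  by apply: normc_ge => //; rewrite !ReD ReN/= /kappa; lra.
have N0 : 0 <= n.+1%:R ^+ 2 + Im s ^+ 2 by rewrite addr_ge0 ?sqr_ge0.
rewrite -(@ler_pXn2r _ 2)// ?nnegrE ?mulr_ge0 ?normc_ge0// exprMn [leLHS]expr2.
exact: ler_pM.
Qed.

Let den_neq0 n s : - delta <= Re s <= 1 + delta ->
  (s + (kappa n)%:C) * ((kappa n)%:C + 1 - s) != 0.
Proof.
move=> /(den_ge n) h; apply/eqP => e; move: h; rewrite e Normc.normc0 leNgt => /negP; apply.
by rewrite ltr_wpDr ?sqr_ge0// exprn_gt0.
Qed.

Let kappa0 n : 0 < kappa n. Proof. by rewrite addr_gt0. Qed.

Let kappaE n : (kappa n * (kappa n + 1))%:C = (kappa n)%:C * ((kappa n)%:C + 1) :> C.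
Proof. by apply: complex_eq => /=; ring. Qed.

Lemma damp0 n : damp n 0 = 1.
Proof.
have dn := den_neq0 n (s := 0); rewrite /= oppr_le0 ltW//= addr_ge0 ?ltW//= in dn.
rewrite /damp (_ : (kappa n * (kappa n + 1))%:C = (0 + (kappa n)%:C) * ((kappa n)%:C + 1 - 0)).
  by rewrite divff// dn.
by rewrite add0r subr0 kappaE.
Qed.

Lemma damp_reflect n s : damp n (1 - s) = damp n s.
Proof. by rewrite /damp; congr (_ / _); ring. Qed.

Lemma cderiv_damp n s : - delta <= Re s <= 1 + delta -> exists d, cderiv (damp n) s d.
Proof.
move=> sD; apply: cderivM.
  have [d E] := cderiv_affine 0 (kappa n * (kappa n + 1))%:C s; exists d.
  by rewrite (_ : (fun s => _) = fun s => 0 * s + (kappa n * (kappa n + 1))%:C)//; apply/funext => z; rewrite mul0r add0r.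
apply: (cderivV (f := fun s => (s + (kappa n)%:C) * ((kappa n)%:C + 1 - s)) (den_neq0 n sD)).
apply: cderivM.
  by have := cderiv_affine 1 (kappa n)%:C s; rewrite (_ : (fun s => 1 * _ + _) = fun s => s + (kappa n)%:C)//; apply/funext => z; rewrite mul1r.
have := cderiv_affine (-1) ((kappa n)%:C + 1) s.
rewrite (_ : (fun s => -1 * _ + _) = fun s => (kappa n)%:C + 1 - s)//.
by apply/funext => z; rewrite mulN1r addrC.
Qed.

Let normc_damp n s : normc (damp n s) =
  kappa n * (kappa n + 1) / normc ((s + (kappa n)%:C) * ((kappa n)%:C + 1 - s)).
Proof. by rewrite /damp Normc.normcM Normc.normcV normc_real ger0_norm// mulr_ge0 ?addr_ge0 ?ltW. Qed.

(** The bound does not depend on n: kappa <= (delta + 1) (n + 1) and kappa + 1 <= (delta + 2) (n +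
    1), while the denominator is at least (n + 1) ^ 2. *)
Lemma damp_le n s : - delta <= Re s <= 1 + delta -> normc (damp n s) <= (delta + 1) * (delta + 2).
Proof.
move=> sD; have h := den_ge n sD; have m1 := n1 n; rewrite normc_damp ler_pdivrMr; last first.
  by rewrite (lt_le_trans _ h)// ltr_wpDr ?sqr_ge0// exprn_gt0.
apply: (@le_trans _ _ ((delta + 1) * (delta + 2) * n.+1%:R ^+ 2)); last first.
  apply: ler_wpM2l; first by rewrite mulr_ge0 ?addr_ge0 ?ltW.
  by apply: le_trans h; rewrite lerDl sqr_ge0.
have dm : delta <= delta * n.+1%:R by rewrite ler_peMr// ltW.
rewrite expr2 mulrACA; apply: ler_pM.
- exact: ltW.
- by rewrite addr_ge0// ltW.
- by rewrite /kappa; lra.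
- by rewrite /kappa; lra.
Qed.

Lemma damp_decay n s : - delta <= Re s <= 1 + delta ->
  normc (damp n s) <= kappa n * (kappa n + 1) * cauchy_ker (Im s).
Proof.
move=> sD; have h := den_ge n sD; rewrite normc_damp.
apply: ler_wpM2l; first by rewrite mulr_ge0 ?addr_ge0 ?ltW.
have N0 : 0 < 1 + Im s ^+ 2 by rewrite ltr_wpDr ?sqr_ge0.
have hh : 1 + Im s ^+ 2 <= n.+1%:R ^+ 2 + Im s ^+ 2 by rewrite lerD2r expr_ge1.
rewrite /cauchy_ker lef_pV2 ?posrE//; first exact: le_trans h.
by rewrite (lt_le_trans N0)//; exact: le_trans h.
Qed.

Lemma cvg_damp s : - delta <= Re s <= 1 + delta ->
  Re (damp n s) @[n --> \oo] --> (1 : R) /\ Im (damp n s) @[n --> \oo] --> (0 : R).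
Proof.
move=> sD; pose c := normc (s * (s - 1)).
have E n : normc (damp n s - 1) <= c * n.+1%:R^-1.
  have dn := den_neq0 n sD; have h := den_ge n sD.
  (* The numerator kappa (kappa + 1) exceeds the denominator by s (s - 1), which does not depend on
     n. *)
  have -> : damp n s - 1 = s * (s - 1) / ((s + (kappa n)%:C) * ((kappa n)%:C + 1 - s)).
    apply: (mulIf dn); rewrite mulrBl !divfK// kappaE; ring.
  rewrite Normc.normcM Normc.normcV ler_wpM2l ?normc_ge0//.
  have p : 0 < n.+1%:R ^+ 2 + Im s ^+ 2 by rewrite ltr_wpDr ?sqr_ge0// exprn_gt0.
  rewrite lef_pV2 ?posrE//; last by exact: lt_le_trans h.
  apply: le_trans h; rewrite -[leLHS]addr0 lerD ?sqr_ge0// expr2 ler_peMr//.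
have c0 : (c * n.+1%:R^-1) @[n --> \oo] --> (0 : R).
  by rewrite -[X in _ --> X](mulr0 c); apply: cvgM; [exact: cvg_cst|exact: cvg_harmonic].
split; apply/cvgrPdist_le => e e0; have /cvgrPdist_le/(_ _ e0) := c0; apply: filterS => n.
- rewrite sub0r normrN => /(le_trans (ler_norm _)); apply: le_trans; apply: le_trans (E n).
  by rewrite distrC; have := le_Re_normc (damp n s - 1); rewrite ReD ReN.
- rewrite sub0r normrN => /(le_trans (ler_norm _)); apply: le_trans; apply: le_trans (E n).
  by rewrite sub0r normrN; have := le_Im_normc (damp n s - 1); rewrite ImD ImN/= oppr0 addr0.
Qed.

Lemma cvg_dampX N s : - delta <= Re s <= 1 + delta ->
  Re (damp n s ^+ N) @[n --> \oo] --> (1 : R) /\ Im (damp n s ^+ N) @[n --> \oo] --> (0 : R).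
Proof.
move=> /cvg_damp[h1 h2]; elim: N => [|N [IH1 IH2]].
  by split; under eq_fun do rewrite expr0; exact: cvg_cst.
have H1 : Re (damp n s) * Re (damp n s ^+ N) - Im (damp n s) * Im (damp n s ^+ N)
    @[n --> \oo] --> (1 * 1 - 0 * 0 : R) by apply: cvgB; exact: cvgM.
have H2 : Re (damp n s) * Im (damp n s ^+ N) + Im (damp n s) * Re (damp n s ^+ N)
    @[n --> \oo] --> (1 * 0 + 0 * 1 : R) by apply: cvgD; exact: cvgM.
rewrite !mulr1 !mulr0 subr0 in H1; rewrite mulr0 mul0r addr0 in H2.
split; first by under eq_fun do rewrite exprS ReM; exact: H1.
by under eq_fun do rewrite exprS ImM; exact: H2.
Qed.

End Damping.

(** * Removal of the damping factor *)

Section DampedLimit.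
Context (R : realType).
Local Notation C := R[i].
Local Notation Re := (@complex.Re R).
Local Notation Im := (@complex.Im R).
Local Notation normc := (@Normc.normc R).
Local Notation leb := (@lebesgue_measure R).

(** A factor 1 / (1 + v ^ 2) makes the integrand integrable in both variables, so that Fubini
    provides measurability in v; the factor is divided out afterwards. *)
Lemma cmeasurable_mellin (c : R) (q : R -> C) : cmeasurable setT q ->
  leb.-integrable setT (EFin \o (fun x => expR (c * x) * normc (q x))) ->
  cmeasurable setT (fun v => cintegral leb setT (fun x => expc ((c +i* v) * x%:C) * q x)).
Proof.
move=> mq iq.
pose k (z : R * R) : C := (cauchy_ker z.1)%:C * (expc ((c +i* z.1) * z.2%:C) * q z.2).
have mck : measurable_fun setT (@cauchy_ker R).
  by apply/measurable_EFinP; exact: measurable_int (@integrable_cauchy_ker R).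
have mk : cmeasurable setT k.
  apply: cmeasurableM.
    by apply: cmeasurable_real; exact: (measurableT_comp mck measurable_fst).
  apply: cmeasurableM; last exact: (@cmeasurable_snd _ _ _ _ R _ mq).
  apply: cmeasurable_expc; apply: cmeasurableM.
    by split => /=; [exact: measurable_cst|exact: measurable_fst].
  by apply: cmeasurable_real; exact: measurable_snd.
have ik : cintegrable (leb \x leb)%E setT k.
  apply: (@cintegrable_le R _ _ (leb \x leb)%E setT measurableT _
    (fun z => cauchy_ker z.1 * (expR (c * z.2) * normc (q z.2))) mk).
    exact: (@integrable_prodM _ _ _ _ R leb leb _ _ (@integrable_cauchy_ker R) iq).
  move=> z _; rewrite /k (Normc.normcM (_%:C)) normc_real (Normc.normcM (expc _)) normc_expc ReMr.
  by rewrite ger0_norm// invr_ge0 addr_ge0 ?sqr_ge0.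
have [/cintegrable_measurable I _] := cfubini ik.
have iv v : cintegrable leb setT (fun x => expc ((c +i* v) * x%:C) * q x).
  apply: (@cintegrable_le R _ _ leb setT measurableT _ (fun x => expR (c * x) * normc (q x))); [|exact: iq|].
    apply: cmeasurableM; last exact: mq.
    apply: cmeasurable_expc; apply: cmeasurableM; first exact: cmeasurable_cst.
    by apply: cmeasurable_real; exact: measurable_id.
  by move=> x _; rewrite Normc.normcM normc_expc ReMr.
have E v : cintegral leb setT (fun x => expc ((c +i* v) * x%:C) * q x) =
    (1 + v ^+ 2)%:C * cintegral leb setT (fun x => k (v, x)).
  have := @cintegralZ R _ _ leb setT measurableT (cauchy_ker v)%:C _ (iv v).
  rewrite -/(cintegral _ _ _) => h; rewrite [X in _ * X]h mulrA -rmorphM/= /cauchy_ker mulfV ?mul1r//.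
  by rewrite gt_eqF// ltr_wpDr ?sqr_ge0.
rewrite (_ : (fun v => _) = fun v => (1 + v ^+ 2)%:C * cintegral leb setT (fun x => k (v, x))); last first.
  by apply/funext => v; exact: E.
apply: cmeasurableM; last exact: I.
by apply: cmeasurable_real; apply: measurable_funD => //; exact: measurable_funX.
Qed.

Variables (eps delta : R) (H : C -> C).
Hypotheses (delta0 : 0 < delta) (delta_eps : delta < eps).
Hypothesis H_hol : holomorphic_on (vertical_strip (- eps) (1 + eps)) H.
Hypotheses (H0 : H 0 = 0) (H1 : H 1 = 1).
Hypothesis H_growth : exists K A : R, forall s, vertical_strip (- eps) (1 + eps) s ->
  normc (H s) <= K * (1 + normc s) `^ A.

Let strip s : - delta <= Re s <= 1 + delta -> vertical_strip (- eps) (1 + eps) s.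
Proof. 
rewrite /vertical_strip/= => /andP[h1 h2].
by rewrite (lt_le_trans _ h1) ?ltrN2// (le_lt_trans h2)// ltrD2l. Qed.

Let strip_reflect s : - delta <= Re s <= 1 + delta -> - delta <= Re (1 - s) <= 1 + delta.
Proof. by move=> /andP[h1 h2]; rewrite ReD ReN/=; apply/andP; split; lra. Qed.

Let dH s : - delta <= Re s <= 1 + delta -> exists d, cderiv H s d.
Proof. by move=> /strip/H_hol; exact: derivable_cderiv. Qed.

Let odd_part s := H s - H (1 - s).

Let dodd s : - delta <= Re s <= 1 + delta -> exists d, cderiv odd_part s d.
Proof.
move=> sD; apply: cderivB; first exact: dH.
by apply: cderiv_reflect; apply: dH; exact: strip_reflect.
Qed.

(** On the strip Re s is bounded, so 1 + |s| <= (3 + delta) (1 + Im s ^ 2), and the exponent of the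
    growth hypothesis is rounded up to a natural number. *)
Let odd_growth : exists2 K, 0 <= K & exists N, forall s, - delta <= Re s <= 1 + delta ->
  normc (odd_part s) <= K * (1 + Im s ^+ 2) ^+ N.
Proof.
have [K [A HK]] := H_growth.
pose N := (Num.truncn `|A|).+1.
have AN : A <= N%:R by rewrite (le_trans (ler_norm _))// ltW// truncnS_gt.
have HH s : - delta <= Re s <= 1 + delta ->
    normc (H s) <= `|K| * ((3 + delta) ^+ N * (1 + Im s ^+ 2) ^+ N).
  move=> sD; apply: le_trans (HK _ (strip sD)) _.
  apply: (@le_trans _ _ (`|K| * (1 + normc s) `^ A)).
    by rewrite ler_wpM2r ?powR_ge0// ler_norm.
  have n1 : 1 <= 1 + normc s by rewrite lerDl normc_ge0.
  rewrite ler_wpM2l//; apply: (@le_trans _ _ ((1 + normc s) `^ N%:R)).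
    by apply: ler_powR.
  rewrite powR_mulrn ?(le_trans ler01)// -exprMn ler_pXn2r ?nnegrE//; last 2 first.
  - exact: le_trans n1.
  - by rewrite mulr_ge0 ?addr_ge0 ?sqr_ge0// ltW.
  have rs : `|Re s| <= 1 + delta by move: sD => /andP[h1 h2]; rewrite ler_norml; apply/andP; split; lra.
  have i2 : `|Im s| <= 1 + Im s ^+ 2.
    by rewrite -[Im s ^+ 2]real_normK ?num_real//; have := sqr_ge0 (`|Im s| - 1); rewrite sqrrB1; have := sqr_ge0 `|Im s|; lra.
  have := normc_le_ReIm s; have := sqr_ge0 (Im s); have d1 := delta0.
  have := mulr_ge0 (ltW delta0) (sqr_ge0 (Im s)); lra.
exists (2 * (`|K| * (3 + delta) ^+ N)).
  by rewrite !mulr_ge0// exprn_ge0// addr_ge0// ltW.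
exists N => s sD; apply: le_trans (le_normcB _ _) _.
have h1 := HH _ sD; have := HH _ (strip_reflect sD).
rewrite ImD ImN/= add0r sqrrN => h2; apply: le_trans (lerD h1 h2) _.
by rewrite le_eqVlt; apply/orP; left; apply/eqP; ring.
Qed.

Variables (b : R -> C) (M : C).
Hypothesis mb : cmeasurable setT b.
Hypothesis ib : leb.-integrable setT (EFin \o (fun r => expR ((1 + delta - 1) * r) * normc (b r))).
Hypothesis conv_functional : forall x,
  theta_conv b (- x) = (expR x)%:C * theta_conv b x + M * ((expR x)%:C - 1).

Let line v : C := (1 + delta) +i* v.
Let D1 : 1 <= 1 + delta. Proof. by rewrite lerDl ltW. Qed.

Let line_strip v : - delta <= Re (line v) <= 1 + delta.
Proof. by rewrite /=; have := delta0; move=> h; apply/andP; split; lra. Qed.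

Let X v := cintegral leb setT (fun x => expc (line v * x%:C) * theta_conv b x).

Let damped N n s := odd_part s * damp delta n s ^+ N.

Let damped_int N n : (exists K, forall s, - delta <= Re s <= 1 + delta ->
    normc (damped N n s) <= K * cauchy_ker (Im s)) ->
  cintegral leb setT (fun v => damped N n (line v) * X v) = (2 * pi)%:C * M.
Proof.
move=> [K bK]; have [mq iq] := theta_conv_integrable D1 mb ib.
have A0 : - delta < 0 by rewrite oppr_lt0.
have B0 : 0 < 1 + delta by rewrite addr_gt0.
apply: (mellin_functional A0 B0 _ bK _ _ _ mq iq conv_functional).
- move=> s sD; apply: cderivM; first exact: dodd.
  by apply: cderivX; exact: cderiv_damp.
- by rewrite addrCA addNr addr0.
- move=> s; rewrite /damped damp_reflect// -mulNr; congr (_ * _).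
  by rewrite /odd_part subKr opprB.
- by rewrite /damped damp0// expr1n mulr1 /odd_part subr0 H0 H1 sub0r.
Qed.

(** The odd part is multiplied by the power N + 1 of the damping factor: N powers absorb its growth,
    and the last one leaves the decay demanded by [mellin_functional]. When the damping is removed,
    the growth is absorbed instead by the decay of xi to order N + 1, which provides a dominating
    function independent of n. *)
Lemma line_identity :
  cintegral leb setT (fun v => (H (line v) - H (1 - line v)) * (2 * xi (2 * line v)) *
    cintegral leb setT (fun r => b r * expc ((line v - 1) * r%:C))) = (2 * pi)%:C * M.
Proof.
have [K K0 [N KN]] := odd_growth.
have [Kx Kxi] := xi_decay N.+1 D1.
have mck : measurable_fun setT (@cauchy_ker R).
  by apply/measurable_EFinP; exact: measurable_int (@integrable_cauchy_ker R).
have ck0 v : 0 < cauchy_ker v :> R by rewrite /cauchy_ker invr_gt0 ltr_wpDr ?sqr_ge0.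
have ckE v : (1 + v ^+ 2) * cauchy_ker v = 1 :> R.
  by rewrite /cauchy_ker mulfV// gt_eqF// ltr_wpDr ?sqr_ge0.
have dampK n : exists K, forall s, - delta <= Re s <= 1 + delta ->
    normc (damped N.+1 n s) <= K * cauchy_ker (Im s).
  exists (K * (((delta + n.+1%:R) * (delta + n.+1%:R + 1)) ^+ N.+1)) => s sD.
  rewrite /damped (Normc.normcM (odd_part s)) normcX.
  apply: (@le_trans _ _ (K * (1 + Im s ^+ 2) ^+ N *
      ((delta + n.+1%:R) * (delta + n.+1%:R + 1) * cauchy_ker (Im s)) ^+ N.+1)).
    apply: ler_pM; rewrite ?exprn_ge0 ?normc_ge0//; first exact: KN.
    have e := damp_decay delta0 n sD.
    by apply: lerXn2r => //; rewrite nnegrE ?normc_ge0//; exact: le_trans (normc_ge0 _) e.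
  rewrite exprMn [cauchy_ker _ ^+ N.+1]exprSr mulrACA -!mulrA ler_wpM2l//.
  by rewrite (mulrA (_ ^+ N)) -exprMn ckE expr1n mul1r.
have [mq iq] := theta_conv_integrable D1 mb ib.
have mX : cmeasurable setT X by exact: cmeasurable_mellin.
pose I := \int[leb]_r (expR ((1 + delta - 1) * r) * normc (b r)).
have XE v : X v = 2 * xi (2 * line v) * cintegral leb setT (fun r => b r * expc ((line v - 1) * r%:C)).
  exact: mellin_theta_conv.
have I0 : 0 <= I by apply: Rintegral_ge0 => // r _; rewrite mulr_ge0 ?expR_ge0 ?normc_ge0.
have A_le v : normc (cintegral leb setT (fun r => b r * expc ((line v - 1) * r%:C))) <= 2 * I.
  apply: (@normc_cintegral_le R _ _ leb setT measurableT _ _ _ ib).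
    apply: cmeasurableM => //; apply: cmeasurable_expc; apply: cmeasurableM; first exact: cmeasurable_cst.
    by apply: cmeasurable_real; exact: measurable_id.
  by move=> r _; rewrite Normc.normcM normc_expc ReMr ReD ReN/= mulrC.
have Kx0 : 0 <= Kx.
  have := le_trans (normc_ge0 _) (Kxi 0); rewrite pmulr_lge0//; exact: exprn_gt0.
pose G v := odd_part (line v) * X v.
have modd : cmeasurable setT (fun v => odd_part (line v)).
  apply: (cmeasurable_line (A := - delta) (B := 1 + delta) dodd).
  exact: (line_strip 0).
have mdamp n : cmeasurable setT (fun v => damped N.+1 n (line v)).
  apply: (cmeasurable_line (f := damped N.+1 n) (A := - delta) (B := 1 + delta)); last exact: (line_strip 0).
  move=> s sD; apply: cderivM; first exact: dodd.
  by apply: cderivX; exact: cderiv_damp.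
pose Cd := (delta + 1) * (delta + 2).
have Cd0 : 0 <= Cd by rewrite mulr_ge0 ?addr_ge0 ?ltW.
have lim (u : C -> R) : (u = Re \/ u = Im) -> forall v,
    u (damped N.+1 n (line v) * X v) @[n --> \oo] --> u (G v).
  move=> uE v; have [h1 h2] := cvg_dampX N.+1 (line_strip v).
  have E n : damped N.+1 n (line v) * X v = G v * damp delta n (line v) ^+ N.+1 by rewrite mulrAC.
  under eq_fun do rewrite E.
  case: uE => ->.
    under eq_fun do rewrite ReM.
    have L : Re (G v) * Re (damp delta n (line v) ^+ N.+1) - Im (G v) * Im (damp delta n (line v) ^+ N.+1)
        @[n --> \oo] --> Re (G v) * 1 - Im (G v) * 0.
      by apply: cvgB; apply: cvgM => //; exact: cvg_cst.
    by rewrite mulr1 mulr0 subr0 in L; exact: L.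
  under eq_fun do rewrite ImM.
  have L : Re (G v) * Im (damp delta n (line v) ^+ N.+1) + Im (G v) * Re (damp delta n (line v) ^+ N.+1)
      @[n --> \oo] --> Re (G v) * 0 + Im (G v) * 1.
    by apply: cvgD; apply: cvgM => //; exact: cvg_cst.
  by rewrite mulr1 mulr0 add0r in L; exact: L.
have Gb n v : setT v -> normc (damped N.+1 n (line v) * X v) <=
    K * Cd ^+ N.+1 * (Kx * (2 * I)) * cauchy_ker v.
  move=> _; rewrite (Normc.normcM (damped N.+1 n (line v))) XE.
  rewrite (Normc.normcM (odd_part (line v))) (Normc.normcM (2 * xi _)) normcX.
  have e1 := KN _ (line_strip v); have e2 := damp_le delta0 n (line_strip v).
  have e2' : normc (damp delta n (line v)) ^+ N.+1 <= Cd ^+ N.+1.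
    by apply: lerXn2r; rewrite ?nnegrE ?normc_ge0.
  have e3 := Kxi v; have e4 := A_le v.
  apply: (@le_trans _ _ (K * (1 + v ^+ 2) ^+ N * Cd ^+ N.+1 * (Kx * cauchy_ker v ^+ N.+1 * (2 * I)))).
    apply: ler_pM; rewrite ?mulr_ge0 ?exprn_ge0 ?normc_ge0//.
      by apply: ler_pM; rewrite ?exprn_ge0 ?normc_ge0.
    by apply: ler_pM; rewrite ?normc_ge0.
  rewrite le_eqVlt; apply/orP; left; apply/eqP.
  transitivity (K * Cd ^+ N.+1 * (Kx * (2 * I)) * cauchy_ker v * ((1 + v ^+ 2) * cauchy_ker v) ^+ N).
    have aux (k c cd x i p q : R) : k * p * cd * (x * (q * c) * i) = k * cd * (x * i) * c * (p * q) by ring.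
    by rewrite [((1 + _) * _) ^+ N]exprMn [cauchy_ker v ^+ N.+1]exprSr; exact: aux.
  by rewrite ckE expr1n mulr1.
have [L1 L2] := @cintegral_dominated _ _ _ leb setT measurableT
  (fun n v => damped N.+1 n (line v) * X v) G
  (fun v => K * Cd ^+ N.+1 * (Kx * (2 * I)) * cauchy_ker v)
  (fun n => cmeasurableM (mdamp n) mX) (cmeasurableM modd mX)
  (fun v _ => lim Re (or_introl erefl) v) (fun v _ => lim Im (or_intror erefl) v)
  (integrable_mull measurableT _ (@integrable_cauchy_ker R)) Gb.
have EG : cintegral leb setT G = (2 * pi)%:C * M.
  apply: complex_eq.
    rewrite -(cvg_lim (@Rhausdorff R) L1); apply: (cvg_lim (@Rhausdorff R)).
    by apply: cvg_near_cst; apply: nearW => n; rewrite damped_int.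
  rewrite -(cvg_lim (@Rhausdorff R) L2); apply: (cvg_lim (@Rhausdorff R)).
  by apply: cvg_near_cst; apply: nearW => n; rewrite damped_int.
rewrite -EG; apply: eq_cintegral => v _.
by rewrite /G XE [RHS]mulrA.
Qed.

End DampedLimit.

(** * Reduction to a Borel invariant function *)

Section Regularization.
Context (R : realType).
Local Notation C := R[i].
Local Notation normc := (@Normc.normc R).
Variables (Gam : groupClosed SL2Z) (F : C -> C).
Implicit Types (p : R * R) (g h t : SL2Z) (N : set (R * R)).

Definition regular_part N p : C :=
  if p \in @half_plane R `\` N then F (of_coords p) else 0.

Lemma regular_partE N p : 0 < p.2 -> ~ N p -> regular_part N p = F (of_coords p).
Proof. by move=> p0 Np; rewrite /regular_part mem_set. Qed.

Lemma regular_part0 N p : N p -> regular_part N p = 0.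
Proof. by move=> Np; rewrite /regular_part memNset// => -[]. Qed.

Lemma cmeasurable_regular_part : lebesgue_measurable_on_H F ->
  exists A, (area R).-negligible A /\ forall N, measurable N -> @half_plane R `&` A `<=` N ->
    cmeasurable setT (regular_part N).
Proof.
move=> mF.
have itvE (u : C -> R) (q : rat) :
    @of_coords R @^-1` (upper_half_plane `&` [set z | `]ratr q, +oo[%classic (u (F z))]) =
    @half_plane R `&` [set p | ratr q < u (F (of_coords p))].
  by apply/seteqP; split=> p /= [p0]; rewrite in_itv/= andbT.
have [A1 [n1 A1P]] := @completed_measurable_restrict R (fun p => complex.Re (F (of_coords p)))
  (fun q => ltac:(by rewrite -(itvE (@complex.Re R)); case: (mF _ (measurable_itv `]ratr q, +oo[)))).
have [A2 [n2 A2P]] := @completed_measurable_restrict R (fun p => complex.Im (F (of_coords p)))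
  (fun q => ltac:(by rewrite -(itvE (@complex.Im R)); case: (mF _ (measurable_itv `]ratr q, +oo[)))).
exists (A1 `|` A2); split; first exact: negligibleU.
move=> N mN AN; split.
- have := A1P N mN (fun p hp => AN p (conj hp.1 (or_introl hp.2))).
  by rewrite (_ : (fun p => _) = fun p => complex.Re (regular_part N p))//; apply/funext => p; rewrite /regular_part; case: ifP.
- have := A2P N mN (fun p hp => AN p (conj hp.1 (or_intror hp.2))).
  by rewrite (_ : (fun p => _) = fun p => complex.Im (regular_part N p))//; apply/funext => p; rewrite /regular_part; case: ifP.
Qed.

Lemma regular_part_inv N : invariant_on_H Gam F ->
  (forall g p, 0 < p.2 -> N (mob g p) <-> N p) ->
  forall g p, g \in Gam -> 0 < p.2 -> regular_part N (mob g p) = regular_part N p.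
Proof.
move=> F_inv N_inv g p gG p0; have q0 := mob_gt0 g p0.
have [Np|Np] := pselect (N p); first by rewrite !regular_part0// N_inv.
by rewrite !regular_partE ?N_inv// of_coords_mob F_inv.
Qed.

(** The exceptional set consists of the points whose orbit misses D and of the points of D that an
    element of Gam other than 1 and -1 maps into D. Off an invariant null set containing it, some g
    in Gam brings p into D, and any other such matrix of {1, -1} Gam differs from g by a sign. *)
Lemma orbit_count (D : set C) : fundamental_domain Gam D ->
  exists A, (area R).-negligible A /\
  forall N, (forall g p, 0 < p.2 -> N (mob g p) <-> N p) -> @half_plane R `&` A `<=` N ->
  forall p, 0 < p.2 -> ~ N p ->
  (\esum_(g in [set g | pm_mem Gam g]) (\1_(@of_coords R @^-1` D) (mob g p) : R)%:E = 2%:E)%E.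
Proof.
move=> [DH mD Dex Dtriv].
pose E h : set (R * R) := if (h \in Gam) && (h != 1%g) && (h != sl2_opp 1%g)
  then @of_coords R @^-1` (D `&` mobius h @^-1` D) else set0.
have nE : (area R).-negligible (\bigcup_h E h).
  apply: negligible_countable_union => h; rewrite /E; case: ifP => [/andP[/andP[hG h1] h2]|_].
    exact: Dtriv.
  exact: negligible_set0.
exists ((~` [set p | upper_half_plane (of_coords p) ->
   exists2 g, g \in Gam & D (mobius g (of_coords p))]) `|` \bigcup_h E h).
split; first exact: negligibleU.
move=> N N_inv AN p p0 Np; set D' := @of_coords R @^-1` D.
have [g gG Dg] : exists2 g, g \in Gam & D' (mob g p).
  apply: contrapT => ng; apply: Np; apply: AN; split => //; left => /=.
  by move/(_ p0) => [g gG Dg]; apply: ng; exists g => //; rewrite /D'/= of_coords_mob.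
have trivial_stab h : h \in Gam -> D' (mob h (mob g p)) -> h = 1%g \/ h = sl2_opp 1%g.
  move=> hG Dh; have [->|h1] := eqVneq h 1%g; first by left.
  have [->|h2] := eqVneq h (sl2_opp 1%g); first by right.
  exfalso; apply: Np; rewrite -(N_inv g)//; apply: AN; split; first exact: mob_gt0.
  right; exists h => //; rewrite /E hG h1 h2/=; split => //.
  by rewrite /D'/= of_coords_mob in Dh.
have onlyg k : pm_mem Gam k -> D' (mob k p) -> k = g \/ k = sl2_opp g.
  move=> kG Dk; have kE : k = (k * g^-1 * g)%g by rewrite mulgVK.
  have Dkg : D' (mob (k * g^-1)%g (mob g p)) by rewrite -mob_mul// mulgVK.
  have kgG : pm_mem Gam (k * g^-1)%g by apply: pm_memM => //; rewrite /pm_mem gpredV gG.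
  case/orP: kgG => kgG.
    by case: (trivial_stab _ kgG Dkg) => e; rewrite kE e ?mul1g ?sl2_oppM ?mul1g; [left|right].
  rewrite -(mob_opp (k * g^-1)%g) in Dkg; rewrite kE -[X in (X * g)%g]sl2_oppK.
  by case: (trivial_stab _ kgG Dkg) => ->; [right|left]; rewrite !sl2_oppM mul1g ?sl2_oppK.
transitivity (\esum_(k in [set` [:: g; sl2_opp g]]) (1%:E : \bar R))%E.
  rewrite esum_mkcond [RHS]esum_mkcond; apply: eq_esum => k _.
  have gP : pm_mem Gam g by rewrite /pm_mem gG.
  have oP : pm_mem Gam (sl2_opp g) by rewrite /pm_mem sl2_oppK gG orbT.
  case: (boolP (k \in [set` [:: g; sl2_opp g]])) => [/set_mem/=|kn].
    rewrite !inE => /orP[/eqP->|/eqP->]; rewrite mem_set//.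
      by rewrite indicE mem_set.
    by rewrite indicE mem_set// /D'/= mob_opp.
  case: ifP => // /set_mem/= kP; rewrite indicE memNset// => Dk; move/negP: kn; apply.
  by apply/mem_set => /=; case: (onlyg k kP Dk) => ->; rewrite !inE eqxx ?orbT.
rewrite (esum_fset (finite_seq _))// -fsbig_seq.
  by rewrite sumEFin !big_cons big_nil addr0.
by rewrite /= inE eq_sym sl2_opp_neq.
Qed.

(** By Tonelli almost every horizontal section of a null set is null. Constant terms are integrals
    along horizontal segments, which a null set of the plane may well contain; hence the exceptional
    set of heights. *)
Lemma null_sections N : measurable N -> area R N = 0%E ->
  exists Z : set R, [/\ measurable Z, (@lebesgue_measure R) Z = 0%E &
    forall y, ~ Z y -> measurable [set x | N (x, y)] /\ (@lebesgue_measure R) [set x | N (x, y)] = 0%E].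
Proof.
move=> mN N0; pose f p : \bar R := (\1_N p)%:E.
have mf : measurable_fun setT f by apply/measurable_EFinP; exact: measurable_indic.
have f0 p : (0 <= f p)%E by rewrite lee_fin indicE.
have mG := measurable_tonelli_snd mf f0.
have I0 : (\int[@lebesgue_measure R]_y `|\int[@lebesgue_measure R]_x f (x, y)| = 0)%E.
  transitivity (\int[@lebesgue_measure R]_y \int[@lebesgue_measure R]_x f (x, y))%E.
    by apply: eq_integral => y _; rewrite gee0_abs// integral_ge0.
  by rewrite -tonelli_snd// /f integral_indic// setIT.
have mNy y : measurable [set x | N (x, y)].
  rewrite (_ : [set x | _] = (fun x => (x, y)) @^-1` N)// -[X in measurable X]setTI.
  have mp : measurable_fun setT (fun x : R => (x, y)) by exact: measurable_fun_pair.
  exact: mp.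
move/(ae_eq_integral_abs (@lebesgue_measure R) measurableT mG): I0 => [Z [mZ Z0 ZP]].
exists Z; split => // y Zy; split => //.
apply: contrapT => n0; apply: Zy; apply: ZP => /= /(_ Logic.I) h; apply: n0.
rewrite -h/= -[in LHS](setIT [set x | N (x, y)]) -integral_indic//; last exact: mNy.
Qed.

End Regularization.

(** * Mellin transforms of the constant terms of the original function *)

Section CuspTransforms.
Context (R : realType).
Local Notation leb := (@lebesgue_measure R).
Local Notation C := R[i].
Local Notation normc := (@Normc.normc R).
Variables (Gam : groupClosed SL2Z) (Gam_fin : finite_index Gam).
Variables (F : C -> C) (N : set (R * R)) (B K alpha delta : R).
Let f := regular_part F N.
Hypotheses (mN : measurable N) (N0 : area R N = 0%E).
Hypothesis N_inv : forall g (p : R * R), 0 < p.2 -> N (mob g p) <-> N p.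
Hypotheses (mf : cmeasurable setT f) (fB : forall p, normc (f p) <= B).
Hypothesis f_inv : forall g p, g \in Gam -> 0 < p.2 -> f (mob g p) = f p.
Hypothesis f_decay : forall t p, 1 <= p.2 -> normc (f (mob t p)) <= K * expR (- (alpha * ln p.2)).
Hypotheses (delta0 : 0 < delta) (delta_alpha : delta < alpha).

Lemma eq_cintegral_off_null d (S : measurableType d) (mu : {measure set S -> \bar R})
  (D Z : set S) (h k : S -> C) : measurable Z -> mu Z = 0%E ->
  (forall x, D x -> ~ Z x -> h x = k x) -> cintegral mu D h = cintegral mu D k.
Proof.
move=> mZ Z0 hk; apply: complex_eq => /=; congr fine;
  by apply: (eq_integral_off_null mZ Z0) => x Dx Zx; rewrite hk.
Qed.

Let w t := cusp_width Gam t.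

Let mean t r : C := ((w t)%:R^-1)%:C * cintegral leb `[0, (w t)%:R] (fun x => f (mob t (x, expR r))).

Let meanE t : mean t = cusp_mean Gam [:: t] f.
Proof. by apply/funext => r; rewrite /cusp_mean big_seq1. Qed.

Let mmean t : cmeasurable setT (mean t).
Proof. by rewrite meanE; exact: (cmeasurable_cusp_mean Gam_fin [:: t] mf fB f_inv). Qed.

Let kernel_cmeasurable (s : C) : cmeasurable setT (fun r : R => expc ((s - 1) * r%:C)).
Proof.
apply: cmeasurable_expc; apply: cmeasurableM; first exact: cmeasurable_cst.
by apply: cmeasurable_real; exact: measurable_id.
Qed.

(** At almost every height the section of [N] is null, so the constant terms of [F] and of its
    regularisation agree there, and the integral over y ignores the remaining heights. The rest is
    the substitution y = exp r. *)
Lemma mellin_fourier t (s : C) : mellin_hat (fourier_coef Gam F t 0) (1 - s) =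
  cintegral leb setT (fun r => mean t r * expc ((s - 1) * r%:C)).
Proof.
have [Z [mZ Z0 ZP]] := null_sections mN N0.
rewrite -(cintegral_expR (cmeasurableM (mmean t) (kernel_cmeasurable s))) /mellin_hat.
apply: (@eq_cintegral_off_null _ _ leb _ Z _ _ mZ Z0) => y; rewrite /= in_itv/= andbT => y0 /ZP[mNy Ny0].
congr (_ * _ * _); last by rewrite /cpow opprB.
rewrite /fourier_coef /mean lnK ?posrE//; congr (_ * _).
apply: (@eq_cintegral_off_null _ _ leb _ [set x | N (x, y)] _ _ mNy Ny0) => x _ Nxy.
rewrite mulr0 mul0r oppr0 expc0 mulr1 /f regular_partE ?mob_gt0//; last by rewrite N_inv.
by rewrite of_coords_mob.
Qed.

Lemma sum_mellin_fourier (T : seq SL2Z) v :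
  \sum_(t <- T) mellin_hat (fourier_coef Gam F t 0) (1 - ((1 + delta) +i* v)) =
  cintegral leb setT (fun r => cusp_mean Gam T f r * expc (((1 + delta) +i* v - 1) * r%:C)).
Proof.
set s := (1 + delta) +i* v.
have i1 t : cintegrable leb setT (fun r => mean t r * expc ((s - 1) * r%:C)).
  have ib := integrable_cusp_mean Gam_fin [:: t] mf fB f_inv f_decay delta0 delta_alpha.
  rewrite -meanE in ib.
  apply: (@cintegrable_le R _ _ leb setT measurableT _ _ _ ib).
    by apply: cmeasurableM; [exact: mmean|exact: kernel_cmeasurable].
  by move=> r _; rewrite Normc.normcM normc_expc ReMr ReD ReN/= mulrC.
have E U : cintegrable leb setT (fun r => cusp_mean Gam U f r * expc ((s - 1) * r%:C)) /\
    \sum_(t <- U) mellin_hat (fourier_coef Gam F t 0) (1 - s) =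
    cintegral leb setT (fun r => cusp_mean Gam U f r * expc ((s - 1) * r%:C)).
  elim: U => [|t U [IH1 IH2]].
    have E0 : (fun r : R => cusp_mean Gam [::] f r * expc ((s - 1) * r%:C)) = fun=> 0.
      by apply/funext => r; rewrite /cusp_mean big_nil mul0r.
    rewrite E0 big_nil; split.
      by split; exact: (@integrable0 _ _ _ leb setT).
    by apply: complex_eq; rewrite /= Rintegral_cst//= mul0r.
  have EU : (fun r : R => cusp_mean Gam (t :: U) f r * expc ((s - 1) * r%:C)) =
      fun r => mean t r * expc ((s - 1) * r%:C) + cusp_mean Gam U f r * expc ((s - 1) * r%:C).
    by apply/funext => r; rewrite /cusp_mean big_cons mulrDl.
  rewrite EU big_cons IH2 mellin_fourier; split; first exact: cintegrableD.
  by rewrite (cintegralD measurableT (i1 t) IH1).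
by have [] := E T.
Qed.

End CuspTransforms.

Theorem theorem5p5 (R : realType) (Gam : groupClosed SL2Z)
  (Gam_fin : finite_index Gam)
  (F : R[i] -> R[i])
  (F_inv : invariant_on_H Gam F)
  (F_meas : lebesgue_measurable_on_H F)
  (F_bnd : exists M : R, forall z, upper_half_plane z -> Normc.normc (F z) <= M)
  (alpha : R) (alpha_gt0 : 0 < alpha)
  (F_decay : exists K : R, forall tau : SL2Z, {ae area R, forall p, 1 <= p.2 ->
     Normc.normc (F (mobius tau (of_coords p))) <= K * p.2 `^ (- alpha)})
  (eps : R) (eps_gt0 : 0 < eps)
  (H : R[i] -> R[i])
  (H_hol : holomorphic_on (vertical_strip (- eps) (1 + eps)) H)
  (H0 : H 0 = 0) (H1 : H 1 = 1)
  (H_growth : exists K A : R, forall s, vertical_strip (- eps) (1 + eps) s ->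
     Normc.normc (H s) <= K * (1 + Normc.normc s) `^ A)
  (D : set R[i]) (D_dom : fundamental_domain Gam D)
  (T : seq SL2Z) (T_trans : coset_transversal Gam T)
  (delta : R) (delta_gt0 : 0 < delta) (delta_lt : delta < Num.min alpha eps) :
  hyperbolic_integral D F =
  vline_integral (1 + delta) (fun s =>
    (H s - H (1 - s)) * (2 * xi (2 * s)) *
    \sum_(tau <- T) mellin_hat (fourier_coef Gam F tau 0) (1 - s))
  / ((2 * pi)%:C * 'i).
Proof.
have [delta_alpha delta_eps] : delta < alpha /\ delta < eps.
  by move: delta_lt; rewrite lt_min => /andP.
have [M FM] := F_bnd; have [K FK] := F_decay.
have [DH0 mD _ _] := D_dom.
have DH : @of_coords R @^-1` D `<=` @half_plane R by move=> p /DH0.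
have [A1 [nA1 A1P]] := cmeasurable_regular_part F_meas.
have [A2 [nA2 A2P]] := orbit_count D_dom.
pose A3 := \bigcup_t (~` [set p : R * R | 1 <= p.2 ->
  Normc.normc (F (mobius t (of_coords p))) <= K * p.2 `^ (- alpha)]).
have nA3 : (area R).-negligible A3 by apply: negligible_countable_union => t; exact: FK.
(* A single invariant null set covers the failures of Borel measurability, of the orbit count and of
   the decay under every matrix. *)
have [N [mN N0 NH N_inv AN]] := negligible_invariant
  (negligibleU (negligibleU nA1 nA2) nA3).
pose f := regular_part F N.
have mf : cmeasurable setT f by apply: A1P => // p [p0 Ap]; apply: AN; split => //; left; left.
have fB p : Normc.normc (f p) <= Num.max M 0.
  rewrite /f /regular_part; case: ifPn => [/set_mem[p0 _]|_].
    by rewrite le_max FM.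
  by rewrite Normc.normc0 le_max lexx orbT.
have f_inv := regular_part_inv F_inv N_inv.
have countD p : 0 < p.2 -> f p != 0 ->
    (\esum_(g in [set g | pm_mem Gam g]) (\1_(@of_coords R @^-1` D) (mob g p) : R)%:E = 2%:E)%E.
  move=> p0 fp; apply: (A2P N) => //.
    by move=> q [q0 Aq]; apply: AN; split => //; left; right.
  by move=> Np; move: fp; rewrite /f regular_part0 ?eqxx.
have f_decay t (p : R * R) : 1 <= p.2 -> Normc.normc (f (mob t p)) <= `|K| * expR (- (alpha * ln p.2)).
  move=> p1; have p0 : 0 < p.2 by exact: lt_le_trans p1.
  have [Np|Np] := pselect (N p).
    by rewrite /f regular_part0 ?N_inv// Normc.normc0 mulr_ge0 ?expR_ge0.
  rewrite /f regular_partE ?mob_gt0 ?N_inv// of_coords_mob.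
  apply: (@le_trans _ _ (K * p.2 `^ (- alpha))); last first.
    by rewrite /powR gt_eqF// mulNr ler_wpM2r ?expR_ge0// ler_norm.
  apply: contrapT => h; apply: Np; apply: AN; split => //; right; exists t => //= hh.
  exact: h (hh p1).
have HM : hyperbolic_integral D F =
    cintegral (area R) (@of_coords R @^-1` D) (fun p => f p * ((p.2 ^+ 2)^-1)%:C).
  apply: (@eq_cintegral_off_null R _ _ (area R) _ N _ _ mN N0) => p Dp Np.
  by rewrite /f regular_partE//; exact: DH.
have LI := line_identity delta_gt0 delta_eps H_hol H0 H1 H_growth
  (cmeasurable_cusp_mean Gam_fin T mf fB f_inv)
  (integrable_cusp_mean Gam_fin T mf fB f_inv f_decay delta_gt0 delta_alpha)
  (cusp_conv_functional Gam_fin T_trans mf fB f_inv mD DH countD f_decay delta_gt0 delta_alpha).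
have VE : vline_integral (1 + delta) (fun s => (H s - H (1 - s)) * (2 * xi (2 * s)) *
    \sum_(tau <- T) mellin_hat (fourier_coef Gam F tau 0) (1 - s)) =
    'i * ((2 * pi)%:C * hyperbolic_integral D F).
  rewrite HM -LI /vline_integral; congr (_ * _); apply: eq_cintegral => v _.
  by rewrite (sum_mellin_fourier Gam_fin mN N0 N_inv mf fB f_inv f_decay delta_gt0 delta_alpha).
have nz : (2 * pi)%:C * 'i != 0 :> R[i].
  rewrite mulf_neq0//; first by rewrite (inj_eq (@complexI R)) mulf_neq0 ?pnatr_eq0 ?gt_eqF ?pi_gt0.
  by apply/eqP => /(congr1 (@complex.Im R)) /= /eqP; rewrite oner_eq0.
by rewrite VE mulrA ['i * _]mulrC mulrAC mulfV// mul1r.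
Qed.
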